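(* Let $q$ be an odd prime power, $A=\mathbb{F}_q[T]$, $F=\mathbb{F}_q(T)$, and let $\psi: A\to F\{\tau\}$ be a Drinfeld module of rank $2$ over $F$ with $\operatorname{End}_{F^{\mathrm{alg}}}(\psi)=A$. Let $\mathcal{P}(\psi)$ be the set of primes of $A$ of good reduction for $\psi$. For every function $f:(0,\infty)\to(0,\infty)$ with $\lim_{x\to\infty}f(x)=\infty$, we have, as $x\to\infty$ through positive integers, $$\#\left\{\mathfrak{p}=pA\in\mathcal{P}(\psi):\ \deg p=x,\ |\Delta_{\mathfrak{p}}|>\frac{|a_{\mathfrak{p}}^2-4\mu_{\mathfrak{p}}p|}{q^{f(\deg p)}}\right\}\ \sim\ \pi_F(x),$$ where $\pi_F(x)=\#\{\mathfrak{p}=pA \text{ prime of } A:\ \deg p=x\}$. Moreover, the Dirichlet density of the set $$\left\{\mathfrak{p}=pA\in\mathcal{P}(\psi):\ |\Delta_{\mathfrak{p}}|>\frac{|a_{\mathfrak{p}}^2-4\mu_{\mathfrak{p}}p|}{q^{f(\deg p)}}\right\}$$ exists and equals $1$.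
   Context: $F^{\mathrm{alg}}$ is a fixed algebraic closure of $F$. A prime of $A$ is a nonzero prime ideal $\mathfrak{p}=pA$ of $A$, with $p$ always denoting the monic generator, and $\mathbb{F}_{\mathfrak{p}}=A/\mathfrak{p}$. An $A$-field is a field $L$ with a ring homomorphism $\gamma:A\to L$ (the natural inclusion if $L\supseteq F$; the natural map $A\to A/\mathfrak{p}\hookrightarrow L$ if $L$ is a finite extension of $\mathbb{F}_{\mathfrak{p}}$). $L\{\tau\}$ is the ring of noncommutative polynomials in $\tau$ with $\tau c=c^q\tau$ for $c\in L$. A Drinfeld module of rank $r\ge 1$ over $L$ is an $\mathbb{F}_q$-algebra homomorphism $\psi:A\to L\{\tau\}$, $a\mapsto\psi_a$, with $\psi_T=\gamma(T)+\sum_{i=1}^r g_i\tau^i$, $g_i\in L$, $g_r\ne0$. For $L'\supseteq L$, $\operatorname{End}_{L'}(\psi)=\{u\in L'\{\tau\}: u\psi_a=\psi_a u\ \forall a\in A\}$; it contains $\psi(A)\cong A$, and $\operatorname{End}_{F^{\mathrm{alg}}}(\psi)=A$ means that it equals $\psi(A)$. For $\psi$ of rank $2$ over $F$ with $\psi_T=T+g_1\tau+g_2\tau^2$, a prime $\mathfrak{p}$ is of good reduction if $\operatorname{ord}_{\mathfrak{p}}(g_1)\ge0$ and $\operatorname{ord}_{\mathfrak{p}}(g_2)=0$; then the reduction $\psi\otimes\mathbb{F}_{\mathfrak{p}}:A\to\mathbb{F}_{\mathfrak{p}}\{\tau\}$ is the rank $2$ Drinfeld module obtained by reducing the coefficients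 of $\psi_T$ modulo $\mathfrak{p}$. All but finitely many primes are of good reduction. Let $\pi_{\mathfrak{p}}=\tau^{\deg p}$. It is known that $\mathcal{E}_{\psi,\mathfrak{p}}=\operatorname{End}_{\mathbb{F}_{\mathfrak{p}}}(\psi\otimes\mathbb{F}_{\mathfrak{p}})$ is an $A$-order (free of rank $2$ over $A\cong(\psi\otimes\mathbb{F}_{\mathfrak{p}})(A)$) in the imaginary quadratic extension $F(\pi_{\mathfrak{p}})$ of $F$ (imaginary: only one place lies over $\infty=1/T$), and that the minimal polynomial of $\pi_{\mathfrak{p}}$ over $A$ is $X^2+a_{\mathfrak{p}}X+\mu_{\mathfrak{p}}p\in A[X]$ with $\mu_{\mathfrak{p}}\in\mathbb{F}_q^\times$ and $\deg a_{\mathfrak{p}}\le\frac{\deg p}{2}$; this defines $a_{\mathfrak{p}}$ and $\mu_{\mathfrak{p}}$. For an $A$-basis $\alpha_1,\alpha_2$ of $\mathcal{E}_{\psi,\mathfrak{p}}$, $\Delta_{\mathfrak{p}}=\det(\operatorname{Tr}_{F(\pi_{\mathfrak{p}})/F}(\alpha_i\alpha_j))_{1\le i,j\le2}\in A$, well defined up to multiplication by a square in $\mathbb{F}_q^\times$. The absolute value is $|a|=q^{\deg a}$ for $a\in A$. $h_1(x)\sim h_2(x)$ means $h_1(x)/h_2(x)\to1$ as $x\to\infty$. The Dirichlet density of a set $S$ of primes of $A$ is $\lim_{s\to1^+}\frac{\sum_{\mathfrak{p}\in S}q^{-s\deg p}}{-\log(1-q^{1-s})}$, if the limit exists. *)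

(* Defs.v *)
From HB Require Import structures.
From mathcomp Require Import all_boot all_order all_algebra all_solvable.
From mathcomp Require Import all_field finmap.
From mathcomp Require Import all_classical all_reals all_analysis.

Set Implicit Arguments.
Unset Strict Implicit.
Unset Printing Implicit Defensive.

Import Order.TTheory GRing.Theory Num.Theory.
Import numFieldNormedType.Exports.

Local Open Scope classical_set_scope.
Local Open Scope ring_scope.

(* An A-field is a field L with a ring morphism gamma : A -> L, A = {poly Fq}.
   [twisted gamma] is the ring L{tau}: its elements are the left polynomials
   \sum_i c_i tau^i, stored as {poly L} for the additive structure, size and
   coefficients, but with the multiplication determined by
   tau * c = c ^+ #|Fq| * tau. *)
Definition twisted (Fq : finFieldType) (L : fieldType)
  (gamma : {rmorphism {poly Fq} -> L}) : Type := {poly L}.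

(* g |-> tau * g. *)
Definition twist_tau (Fq : finFieldType) (L : fieldType) (g : {poly L}) :
  {poly L} := map_poly (fun c => c ^+ #|Fq|) g * 'X.

Definition twist_mul (Fq : finFieldType) (L : fieldType) (f g : {poly L}) :
  {poly L} := \sum_(i < size f) f`_i *: iter i (@twist_tau Fq L) g.

Section TwistedRing.
Variables (Fq : finFieldType) (L : fieldType).
Variable gamma : {rmorphism {poly Fq} -> L}.
Local Notation q := #|Fq|.
Local Notation tau := (@twist_tau Fq L).
Local Notation tmul := (@twist_mul Fq L).

Lemma frobqD (x y : L) : (x + y) ^+ q = x ^+ q + y ^+ q.
Proof.
have [p _ pF] := finPcharP Fq.
have pL : p \in [pchar L] by apply: (rmorph_pchar gamma); rewrite pchar_poly.
apply: exprDn_pchar; rewrite (eq_pnat _ (pcharf_eq pL)).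
have /and3P[pg _ _] := fin_ring_pchar_abelem pF.
by have := pg; rewrite /pgroup cardsT.
Qed.

Let q_gt0 : (0 < q)%N. Proof. by apply/card_gt0P; exists 0. Qed.

Let frobq0 : (0 : L) ^+ q = 0. Proof. by rewrite expr0n eqn0Ngt q_gt0. Qed.

Lemma coef_twist_tau g i : (tau g)`_i.+1 = g`_i ^+ q.
Proof. by rewrite /twist_tau coefMX coef_map_id0. Qed.

Lemma coef_twist_tau0 g : (tau g)`_0 = 0.
Proof. by rewrite /twist_tau coefMX. Qed.

Lemma twist_tauD g h : tau (g + h) = tau g + tau h.
Proof.
apply/polyP => -[|i]; rewrite coefD ?coef_twist_tau0 ?addr0 //.
by rewrite !coef_twist_tau coefD frobqD.
Qed.

Lemma twist_tauZ c g : tau (c *: g) = c ^+ q *: tau g.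
Proof.
apply/polyP => -[|i]; rewrite coefZ ?coef_twist_tau0 ?mulr0 //.
by rewrite !coef_twist_tau coefZ exprMn.
Qed.

Lemma twist_tau0 : tau 0 = 0.
Proof.
apply/polyP => -[|i]; rewrite coef0 ?coef_twist_tau0 //.
by rewrite coef_twist_tau coef0.
Qed.

Lemma iter_tauD i g h : iter i tau (g + h) = iter i tau g + iter i tau h.
Proof. by elim: i => //= i ->; rewrite twist_tauD. Qed.

Lemma iter_tauZ i c g : iter i tau (c *: g) = c ^+ (q ^ i) *: iter i tau g.
Proof. by elim: i => //= i ->; rewrite twist_tauZ -exprM expnSr. Qed.

Lemma twist_mul_wide n (f g : {poly L}) : (size f <= n)%N ->
  tmul f g = \sum_(i < n) f`_i *: iter i tau g.
Proof.
move=> fn; rewrite /twist_mul -!(big_mkord xpredT (fun i => f`_i *: iter i tau g)).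
rewrite [RHS](@big_cat_nat _ _ _ (size f)) //= [X in _ = _ + X]big_nat_cond.
rewrite [X in _ = _ + X]big1 ?addr0 // => i /andP[/andP[si _] _].
by rewrite nth_default // scale0r.
Qed.

Lemma twist_mulDl : left_distributive tmul +%R.
Proof.
move=> f g h; pose n := maxn (size f) (size g).
rewrite (@twist_mul_wide n (f + g)) ?size_polyD //.
rewrite (@twist_mul_wide n f) ?leq_maxl // (@twist_mul_wide n g) ?leq_maxr //.
by rewrite -big_split; apply: eq_bigr => i _; rewrite /= coefD scalerDl.
Qed.

Lemma twist_mulDr : right_distributive tmul +%R.
Proof.
move=> f g h; rewrite /twist_mul -big_split; apply: eq_bigr => i _.
by rewrite iter_tauD scalerDr.
Qed.

Lemma twist_mulZl c f g : tmul (c *: f) g = c *: tmul f g.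
Proof.
rewrite (@twist_mul_wide (size f)) ?size_scale_leq // scaler_sumr.
by apply: eq_bigr => i _; rewrite coefZ scalerA.
Qed.

Lemma twist_mul0l g : tmul 0 g = 0.
Proof. by rewrite /twist_mul size_poly0 big_ord0. Qed.

Lemma twist_mulXl i g : tmul 'X^i g = iter i tau g.
Proof.
rewrite /twist_mul size_polyXn big_ord_recr /= coefXn eqxx scale1r.
by rewrite big1 ?add0r // => j _; rewrite coefXn ltn_eqF // scale0r.
Qed.

Lemma twist_tauXn i : tau 'X^i = 'X^(i.+1).
Proof.
apply/polyP => -[|j]; rewrite ?coef_twist_tau0 ?coef_twist_tau !coefXn //.
by rewrite eqSS; case: eqP; rewrite ?expr1n ?frobq0.
Qed.

Lemma twist_tau_mul g h : tmul (tau g) h = tau (tmul g h).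
Proof.
rewrite (@twist_mul_wide (size g).+1); last first.
  apply/leq_sizeP => -[//|j]; rewrite ltnS => gj.
  by rewrite coef_twist_tau nth_default ?frobq0.
rewrite /twist_mul big_ord_recl coef_twist_tau0 scale0r add0r.
rewrite (big_morph _ twist_tauD twist_tau0); apply: eq_bigr => i _.
by rewrite lift0 coef_twist_tau twist_tauZ.
Qed.

Lemma twist_mulA : associative tmul.
Proof.
move=> f g h; rewrite [tmul f g]/twist_mul.
rewrite (big_morph (fun x => tmul x h) (fun x y => twist_mulDl x y h) (twist_mul0l h)).
rewrite [LHS]/twist_mul; apply: eq_bigr => i _; rewrite twist_mulZl; congr (_ *: _).
by elim: (nat_of_ord i) => //= j ->; rewrite twist_tau_mul.
Qed.

Lemma twist_mul1l : left_id 1 tmul.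
Proof. by move=> f; rewrite -[1]/('X^0) twist_mulXl. Qed.

Lemma twist_mul1r : right_id 1 tmul.
Proof.
move=> f; rewrite -[RHS]coefK poly_def; apply: eq_bigr => i _.
congr (_ *: _); elim: (nat_of_ord i) => [|j]; first by rewrite expr0.
by rewrite iterS => ->; rewrite twist_tauXn.
Qed.

HB.instance Definition _ := GRing.Zmodule.copy (twisted gamma) {poly L}.

Let twisted_oner_neq0 : (1 : {poly L}) != (0 : {poly L}).
Proof. exact: oner_neq0. Qed.

HB.instance Definition _ := GRing.Zmodule_isNzRing.Build (twisted gamma)
  twist_mulA twist_mul1l twist_mul1r twist_mulDl twist_mulDr twisted_oner_neq0.

Definition twist_scale (a : Fq) (f : twisted gamma) : twisted gamma :=
  gamma a%:P *: (f : {poly L}).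

Let twist_scaleA a b f :
  twist_scale a (twist_scale b f) = twist_scale (a * b) f.
Proof. by rewrite /twist_scale scalerA polyCM rmorphM. Qed.

Let twist_scale1 : left_id 1 twist_scale.
Proof. by move=> f; rewrite /twist_scale polyC1 rmorph1 scale1r. Qed.

Let twist_scaleDr : right_distributive twist_scale +%R.
Proof. by move=> a f g; apply: scalerDr. Qed.

Let twist_scaleDl f : {morph twist_scale^~ f : a b / a + b}.
Proof. by move=> a b; rewrite /twist_scale polyCD rmorphD scalerDl. Qed.

HB.instance Definition _ := GRing.Zmodule_isLmodule.Build Fq (twisted gamma)
  twist_scaleA twist_scale1 twist_scaleDr twist_scaleDl.

Let twist_scaleAl (a : Fq) (f g : twisted gamma) : a *: (f * g) = a *: f * g.
Proof. exact/esym/twist_mulZl. Qed.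

HB.instance Definition _ := GRing.Lmodule_isLalgebra.Build Fq (twisted gamma)
  twist_scaleAl.

Let twist_scaleAr (a : Fq) (f g : twisted gamma) : a *: (f * g) = f * (a *: g).
Proof.
have ga i : gamma a%:P ^+ (q ^ i) = gamma a%:P.
  elim: i => [|i IH]; first by rewrite expr1.
  by rewrite expnSr exprM IH -rmorphXn -polyC_exp expf_card.
rewrite /GRing.scale /= /twist_scale /GRing.mul /= /twist_mul scaler_sumr.
by apply: eq_bigr => i _; rewrite iter_tauZ ga !scalerA mulrC.
Qed.

HB.instance Definition _ := GRing.Lalgebra_isAlgebra.Build Fq (twisted gamma)
  twist_scaleAr.

End TwistedRing.

Definition deg (Fq : finFieldType) (a : {poly Fq}) : nat := (size a).-1.

Section Drinfeld.
Variables (Fq : finFieldType) (L : fieldType).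
Variable gamma : {rmorphism {poly Fq} -> L}.

Definition tau : twisted gamma := 'X : {poly L}.

Definition is_drinfeld (r : nat)
    (psi : {lrmorphism {poly Fq} -> twisted gamma}) : Prop :=
  [/\ (0 < r)%N, size (psi 'X : {poly L}) = r.+1
    & (psi 'X : {poly L})`_0 = gamma 'X].

Definition endo_ring (psi : {poly Fq} -> twisted gamma) : set (twisted gamma) :=
  [set u | forall a, u * psi a = psi a * u].

Definition base_change (L' : fieldType) (iota : {rmorphism L -> L'})
    (psi : {poly Fq} -> twisted gamma) :
    {poly Fq} -> twisted (iota \o gamma) :=
  fun a => map_poly iota (psi a : {poly L}).

(* alpha is an A-basis of M, where A acts on L{tau} through psi. *)
Definition is_A_basis (n : nat) (psi : {poly Fq} -> twisted gamma)
    (M : set (twisted gamma)) (alpha : 'I_n -> twisted gamma) : Prop :=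
  (forall i, M (alpha i)) /\
  (forall u, M u ->
     exists! c : 'I_n -> {poly Fq}, u = \sum_i psi (c i) * alpha i).

(* P is the minimal polynomial over A of u, where u commutes with psi(A) and
   is integral over it. *)
Definition is_minpoly (psi : {poly Fq} -> twisted gamma) (u : twisted gamma)
    (P : {poly {poly Fq}}) : Prop :=
  [/\ P \is monic, (map_poly psi P).[u] = 0
    & forall Q, Q != 0 -> (map_poly psi Q).[u] = 0 -> (size P <= size Q)%N].

End Drinfeld.

Section Reduction.
Variable Fq : finFieldType.
Local Notation F := {fraction {poly Fq}}.

(* Numerator and denominator of x in lowest terms. *)
Definition fnum (x : F) : {poly Fq} :=
  let r := frac (repr x) in r.1 %/ gcdp r.1 r.2.
Definition fden (x : F) : {poly Fq} :=
  let r := frac (repr x) in r.2 %/ gcdp r.1 r.2.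

Definition poly_ord (p a : {poly Fq}) : nat :=
  (\max_(k < size a | (p ^+ k %| a)%R) k)%N.

(* Only meaningful for x != 0 (ord 0 = +oo, whereas ord p 0 = 0 here). *)
Definition ord (p : {poly Fq}) (x : F) : int :=
  (poly_ord p (fnum x))%:Z - (poly_ord p (fden x))%:Z.

Variable psi : {lrmorphism {poly Fq} -> twisted (@tofrac {poly Fq})}.
Local Notation g i := ((psi 'X : {poly F})`_i).

(* For psi of rank 2. *)
Definition good_reduction (p : {poly Fq}) : Prop :=
  (g 1 = 0 \/ 0 <= ord p (g 1)) /\ (g 2 <> 0 /\ ord p (g 2) = 0).

(* A prime of A is given by its monic generator, i.e. a monic irreducible
   polynomial. *)
Variable p : {poly Fq}.
Hypothesis p_prime : monic_irreducible_poly p.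
Local Notation Fp := {poly %/ p with p_prime}.

Definition gammap : {rmorphism {poly Fq} -> Fp} := in_qpoly p.

(* The residue class of x, when p does not divide its denominator. *)
Definition residue (x : F) : Fp := gammap (fnum x) / gammap (fden x).

(* The F_q-algebra morphism with T |-> (psi_T with coefficients reduced). *)
Definition reduction : {poly Fq} -> twisted gammap :=
  horner_alg (map_poly residue (psi 'X : {poly F}) : twisted gammap).

Definition frob : twisted gammap := tau gammap ^+ deg p.

Definition frob_endo : set (twisted gammap) := endo_ring reduction.

Definition frob_poly (a : {poly Fq}) (mu : Fq) : {poly {poly Fq}} :=
  'X^2 + a *: 'X + (mu *: p)%:P.

(* The pair (a_p, mu_p). For good reduction and rank 2 it exists by the theory
   of the characteristic polynomial of Frobenius, and it is unique because 1
   and pi_p are independent over A. *)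
Definition frob_coefs : {poly Fq} * Fq :=
  xget (0, 0) [set c | c.2 != 0 /\ is_minpoly reduction frob (frob_poly c.1 c.2)].
Definition frob_a : {poly Fq} := frob_coefs.1.
Definition frob_mu : Fq := frob_coefs.2.

(* F(pi_p), presented as F[X] modulo the minimal polynomial of pi_p. *)
Definition frob_minpolyF : {poly F} :=
  map_poly (@tofrac {poly Fq}) (frob_poly frob_a frob_mu).
Definition frob_field := {poly %/ frob_minpolyF}.

(* The embedding of the endomorphism ring into F(pi_p), as a graph: u is sent
   to x = Q(pi_p) / c whenever c u = Q(pi_p), with c in A nonzero and Q in
   A[X]. *)
Definition endo_embed (u : twisted gammap) (x : frob_field) : Prop :=
  exists (c : {poly Fq}) (Q : {poly {poly Fq}}),
    [/\ c != 0, reduction c * u = (map_poly reduction Q).[frob]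
      & tofrac c *: x = in_qpoly frob_minpolyF (map_poly (@tofrac {poly Fq}) Q)].

Definition field_trace (x : frob_field) : F :=
  let B := vbasis {: frob_field} in \tr (passmx.mxof B B (linfun (x \*o idfun))).

Definition is_disc (Delta : {poly Fq}) : Prop :=
  exists (alpha : 'I_2 -> twisted gammap) (x : 'I_2 -> frob_field),
    [/\ is_A_basis reduction frob_endo alpha,
        forall i, endo_embed (alpha i) (x i)
      & tofrac Delta = \det (\matrix_(i, j) field_trace (x i * x j))].

(* Only determined up to the square of a unit of Fq, hence the choice; its
   degree does not depend on it. *)
Definition frob_disc : {poly Fq} := xget 0 [set Delta | is_disc Delta].

End Reduction.

Section Statistics.
Variables (Fq : finFieldType) (R : realType).
Local Notation q := (#|Fq|%:R : R).

Definition absA (a : {poly Fq}) : R := if a == 0 then 0 else q ^+ deg a.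

Definition primes_A : set {poly Fq} := [set p | monic_irreducible_poly p].

(* Number of elements of degree x in S, a set of polynomials; the set counted
   is finite because Fq is. *)
Definition count_deg (S : set {poly Fq}) (x : nat) : nat :=
  #|` fset_set (S `&` [set p | deg p = x])|%fset.

Definition pi_F (x : nat) : nat := count_deg primes_A x.

Definition has_dirichlet_density (S : set {poly Fq}) (d : R) : Prop :=
  ((\esum_(p in S) (q `^ (- s * (deg p)%:R))%:E)
     * ((- ln (1 - q `^ (1 - s)))^-1)%:E)%E @[s --> (1 : R)^'+] --> d%:E.

Definition large_disc_primes
    (psi : {lrmorphism {poly Fq} -> twisted (@tofrac {poly Fq})})
    (f : R -> R) : set {poly Fq} :=
  [set p | exists p_prime : monic_irreducible_poly p,
     good_reduction psi p /\
     absA (frob_disc psi p_prime) >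
       absA (frob_a psi p_prime ^+ 2 - (4%:R * frob_mu psi p_prime) *: p)
         / q `^ f (deg p)%:R].

End Statistics.

Arguments primes_A Fq : clear implicits.
Arguments pi_F Fq x : clear implicits.

(* Main.v *)
(* Let [p] be a prime of degree [n] at which the reduction is good.  As an
   [A]-motive, the reduction has Frobenius the 2x2 matrix
   [P = Phi^(q^(n-1)) ... Phi^q Phi] over [F_p[T]], so [a_p^2 - 4 mu_p p] is the
   discriminant of the characteristic polynomial of [P], and it equals
   [b^2 Delta_p] up to a unit, where [b] is the largest monic polynomial such
   that [P] is scalar modulo [b].  Hence [p] is counted unless [deg b] is large,
   and one has to bound the number of [x] of degree [n] over [F_q] for which
   [P] is scalar modulo some monic [m] of large degree.

   For a fixed [m], [P] is scalar modulo [m] exactly when all solutions of the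
   Frobenius system [Y^(q) = L(t) Y] attached to conjugation by [Phi] modulo [m]
   are fixed by the [n]-th power of Frobenius.  Stepanov's method shows that
   this happens for about [q^n / r(m)] values of [x] when [n] is large with
   respect to [deg m], where [r(m)] is the number of specialised solutions; it
   gives an upper bound, and also a lower bound for suitable [n].  For [m] of
   degree comparable to [n], the scalar [x] are zeros of a nonvanishing
   determinant: its vanishing would yield an endomorphism of [psi] outside
   [psi(A)].  Comparing this last bound with the lower bound gives that
   [sum 1 / r(m)] over the [m] of degree [d] is exponentially small in [d], and
   then the upper bound gives that the exceptional primes have density [0].

   The lower bound needs the solutions to be defined over a field where an
   extension of Frobenius acts on the algebraic relations between them: they are
   built as power series at [t = infinity], followed by a tower of
   Artin-Schreier extensions. *)
Require Import Defs.
From HB Require Import structures.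
From mathcomp Require Import all_boot all_order all_algebra all_fingroup.
From mathcomp Require Import all_solvable all_field generic_quotient.
From mathcomp Require Import boolp classical_sets zify ring.

Set Implicit Arguments.
Unset Strict Implicit.
Unset Printing Implicit Defensive.

Import GRing.Theory.
Local Open Scope ring_scope.

(** * The [q]-th power map on a field containing [Fq] *)

Section FrobeniusPower.
Variables (Fq : finFieldType) (K : fieldType) (i : {rmorphism Fq -> K}).
Local Notation q := #|Fq|.

(** No information on the Galois image of [psi] is used: the size of [r(m)] for a single [m] stays
    unknown, and the hypothesis on endomorphisms enters only through the nonvanishing of a
    determinant. Only the average of [1/r(m)] is bounded, and the exponents leave a narrow window
    for that. The determinant bounds the pairs of an [m] of degree [d] and an [x] of degree [n] by
    about [q^(3(n/2 - d))], which is less than [q^n] only for [n < 6d]. The lower bound from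
    Stepanov's method needs [r^4] below about [q^n], whereas [r] is a priori only at most [q^(4d)].
    With [n] about [4.9 d] it covers the [m] with [r <= q^(1.1 d)]; the others contribute at most
    [q^d q^(-1.1 d)], as there are only [q^d] of them. The passage to all large [n] is free of this
    constraint: the upper bound has total error about [q^(5d)], acceptable for [d] up to [0.18 n],
    and beyond that the determinant suffices alone. Conjugation by [Phi], rather than [Phi] itself,
    is what makes being scalar equivalent to being fixed by Frobenius. *)

Definition frq (j : {rmorphism Fq -> K}) (x : K) : K := x ^+ q.
Local Notation fr := (frq i).

Lemma q_gt1 : (1 < q)%N. Proof. exact: card_finNzRing_gt1. Qed.

Lemma q_gt0 : (0 < q)%N. Proof. exact: ltnW q_gt1. Qed.

Lemma q_char_power : exists p e, [/\ prime p, (0 < e)%N, q = (p ^ e)%N & p \in [pchar K]].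
Proof.
have [p p_pr pF] := finPcharP Fq.
have /and3P[pg _ _] := fin_ring_pchar_abelem pF.
have /p_natP[e qe] : p.-nat q by have := pg; rewrite /pgroup cardsT.
exists p, e; split => //; last exact: (rmorph_pchar i).
by case: e qe q_gt1 => [->|].
Qed.

Lemma frq_is_zmod_morphism : zmod_morphism fr.
Proof.
have [p [e [p_pr e0 qe pK]]] := q_char_power.
have qn : [pchar K].-nat q by rewrite qe (eq_pnat _ (pcharf_eq pK)) pnatX pnat_id.
by move=> x y; rewrite /frq -[in RHS](subrK y x) [in RHS]exprDn_pchar // addrK.
Qed.

Lemma frq_is_monoid_morphism : monoid_morphism fr.
Proof. by split=> [|x y]; rewrite /frq ?expr1n ?exprMn. Qed.

HB.instance Definition _ := GRing.isZmodMorphism.Build K K fr frq_is_zmod_morphism.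
HB.instance Definition _ := GRing.isMonoidMorphism.Build K K fr frq_is_monoid_morphism.

Lemma frq_inj : injective fr. Proof. exact: fmorph_inj. Qed.

Lemma iter_frq n x : iter n fr x = x ^+ (q ^ n).
Proof. by elim: n => [|n /= ->]; rewrite ?expr1 // /frq -exprM expnSr. Qed.

Lemma frq_base (a : Fq) : fr (i a) = i a.
Proof. by rewrite /frq -rmorphXn expf_card. Qed.

(** [X^q - X] has at most [q] roots, and the image of [Fq] already supplies them. *)
Lemma frq_fixed x : fr x = x -> exists a, x = i a.
Proof.
move=> fx; pose P : {poly K} := 'X^q - 'X.
have szP : size P = q.+1.
  by rewrite size_polyDl ?size_polyXn // size_polyN size_polyX ltnS q_gt1.
have P0 : P != 0 by rewrite -size_poly_eq0 szP.
pose s := [seq i a | a <- enum Fq].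
have us : uniq s by rewrite map_inj_uniq ?enum_uniq //; apply: fmorph_inj.
case xs: (x \in s); first by case/mapP: xs => a _ ->; exists a.
have := @max_poly_roots _ P (x :: s) P0.
rewrite /= xs us szP size_map -cardE ltnn => h; exfalso.
suff: false by []. apply: h => //; apply/andP; split.
  by rewrite /root !hornerE -[x ^+ q]/(fr x) fx subrr.
apply/allP => y /mapP[a _ ->].
by rewrite /root !hornerE -[_ ^+ q]/(fr (i a)) frq_base subrr.
Qed.

Lemma map_frq_fixed m n (A : 'M[K]_(m, n)) :
  map_mx fr A = A -> exists B, A = map_mx i B.
Proof.
move=> fA; have /choice[f fP] : forall ij : 'I_m * 'I_n, exists a, A ij.1 ij.2 = i a.
  by move=> [r s]; apply: frq_fixed; have /matrixP/(_ r s) := fA; rewrite mxE.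
exists (\matrix_(r, s) f (r, s)); apply/matrixP => r s.
by rewrite !mxE -(fP (r, s)).
Qed.

Lemma map_frq_base m n (B : 'M[Fq]_(m, n)) : map_mx fr (map_mx i B) = map_mx i B.
Proof. by apply/matrixP => r s; rewrite !mxE frq_base. Qed.
End FrobeniusPower.

(** * Lang's theorem for invertible matrices *)

Section Lang.
Variables (Fq : finFieldType) (K : closedFieldType) (i : {rmorphism Fq -> K}).
Local Notation q := #|Fq|.
Local Notation fr := (frq i).

Lemma closed_root (P : {poly K}) : (1 < size P)%N -> exists x, root P x.
Proof. by move=> sP; apply/closed_rootP; case: (size P) sP => [|[]]. Qed.

Lemma additive_root (a : K) c : exists x, fr x = a * x + c.
Proof.
have sr : (size (a%:P * 'X + c%:P)%R < q.+1)%N.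
  rewrite mul_polyC (leq_ltn_trans (size_polyD _ _)) // gtn_max ltnS.
  rewrite (leq_trans (size_scale_leq _ _)) ?size_polyX ?(q_gt1 Fq) //=.
  by rewrite (leq_ltn_trans (size_polyC_leq1 _)) // ltnS q_gt0.
have [|x] := @closed_root ('X^q - (a%:P * 'X + c%:P)).
  by rewrite size_polyDl size_polyXn ?ltnS ?(q_gt0 Fq) // size_polyN.
by rewrite /root !hornerE subr_eq0 => /eqP xE; exists x.
Qed.

Lemma eigen_root (a : K) : a != 0 -> exists2 x, x != 0 & fr x = a * x.
Proof.
move=> a0; have q1 : (0 < q.-1)%N by rewrite -ltnS (ltn_predK (q_gt1 Fq)) (q_gt1 Fq).
have [|x] := @closed_root ('X^(q.-1) - a%:P).
  rewrite size_polyDl ?size_polyXn ?ltnS // size_polyN.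
  by rewrite (leq_trans (size_polyC_leq1 _)).
rewrite /root !hornerE subr_eq0 => /eqP xE; exists x.
  by apply: contraNneq a0 => x0; rewrite -xE x0 expr0n; case: (q.-1) q1.
by rewrite -xE mulrC -exprS prednK ?(q_gt0 Fq).
Qed.

Lemma q_root (a : K) : exists x, fr x = a.
Proof. by have [x] := additive_root 0 a; rewrite mul0r add0r => xE; exists x. Qed.

(** The map [th] is semilinear and injective, so the iterates of a nonzero vector span a stable
    subspace on which it acts by a companion matrix. In a fixed vector all coordinates can be
    eliminated but the last, which leaves one polynomial equation in one unknown. *)
Lemma semilinear_fixed n (B : 'M[K]_n.+1) : B \in unitmx ->
  exists2 y : 'cV_n.+1, y != 0 & map_mx fr y = B *m y.
Proof.
move=> uB; pose th (v : 'cV[K]_n.+1) := invmx B *m map_mx fr v.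
have thD u v : th (u + v) = th u + th v by rewrite /th map_mxD mulmxDr.
have thZ c v : th (c *: v) = fr c *: th v by rewrite /th map_mxZ scalemxAr.
have th_inj v : th v = 0 -> v = 0.
  move=> /(congr1 (mulmx B)); rewrite mulKVmx // mulmx0 => /matrixP v0.
  by apply/matrixP => r s; apply: (fmorph_inj fr); have := v0 r s; rewrite !mxE rmorph0.
pose v0 : 'cV[K]_n.+1 := delta_mx 0 0.
have v0_neq0 : v0 != 0.
  by apply/negP => /eqP/matrixP/(_ 0 0)/eqP; rewrite !mxE eqxx oner_eq0.
pose v j := iter j th v0.
have v_neq0 j : v j != 0.
  by elim: j => //= j IH; apply: contra IH => /eqP/th_inj->.
pose M m := \matrix_(j < m) (v j)^T.
have exM : exists m, ~~ row_free (M m).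
  by exists n.+2; rewrite /row_free neq_ltn ltnS rank_leq_col.
case: (ex_minnP exM) => -[|m nfM minM].
  by rewrite /row_free -leqn0 rank_leq_row.
have fM : row_free (M m) by apply: contraT => /minM; rewrite ltnn.
have [a aE] : exists a : 'I_m -> K, v m = \sum_j a j *: v j.
  have : ((v m)^T <= M m)%MS.
    apply: contraT => nsub; case/negP: nfM; apply/inj_row_free => c.
    rewrite (mulmx_sum_row c) big_ord_recr /= rowK => c0.
    have ME : \sum_(j < m) c 0 (widen_ord (leqnSn m) j) *: row (widen_ord (leqnSn m) j) (M m.+1)
        = (\row_(j < m) c 0 (widen_ord (leqnSn m) j)) *m M m.
      by rewrite mulmx_sum_row; apply: eq_bigr => j _; rewrite !rowK mxE.
    have cm : c 0 ord_max = 0.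
      apply: contraNeq nsub => cm; rewrite -(scalerK cm (v m)^T) scalemx_sub //.
      by move: c0; rewrite ME addrC => /(canRL (addrK _)); rewrite sub0r => ->; rewrite eqmx_opp submxMl.
    move: c0; rewrite cm scale0r addr0 ME => /eqP; rewrite mulmx_free_eq0 // => /eqP/rowP cz.
    apply/rowP => j; rewrite mxE; case: (unliftP ord_max j) => [k ->|-> //].
    by have := cz k; rewrite !mxE => <-; congr (c 0 _); apply: val_inj; rewrite /= /bump leqNgt ltn_ord.
  case/submxP => D DE; exists (D 0).
  apply: trmx_inj; rewrite DE mulmx_sum_row linear_sum; apply: eq_bigr => j _.
  by rewrite linearZ rowK.
have [m' mE] : exists m', m = m'.+1.
  exists m.-1; rewrite prednK // lt0n; apply: contraNneq (v_neq0 m) => m0.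
  by rewrite aE big1 // => -[j lj]; exfalso; move: lj; rewrite m0.
subst m; pose a' j := if insub j is Some j' then a j' else 0.
have a'E (j : 'I_m'.+1) : a' j = a j by rewrite /a' valK.
(* For [y = sum x_j v_j] the equation [th y = y] reads [x_0 = a_0 x^q] and
   [x_(j+1) = x_j^q + a_(j+1) x^q], where [x] is the last coordinate. [g j] is [x_j] as a polynomial
   in [x], and what remains to be solved is [g m' = x]. *)
pose g := fix g j : {poly K} :=
  if j is j'.+1 then (g j') ^+ q + a' j *: 'X^q else a' 0%N *: 'X^q.
have q2 := q_gt1 Fq.
(* Divisibility by [X^2] turns [g(x) = x] with [x] nonzero into [x h(x) = 1], solvable as soon as
   [h] is nonzero. By [g0] below, [h = 0] would make all the [a_j] vanish, and with them [v m]. *)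
have gX j : exists h, g j = 'X^2 * h.
  elim: j => [|j [h gE]] /=.
    by exists (a' 0%N *: 'X^(q - 2)); rewrite -scalerAr -exprD subnKC.
  exists ('X^(2 * q - 2) * h ^+ q + a' j.+1 *: 'X^(q - 2)).
  rewrite gE mulrDr exprMn -scalerAr -exprM mulrA -!exprD !subnKC //.
  by rewrite leq_pmulr // q_gt0.
have Xq0 : ('X^q == 0 :> {poly K}) = false by apply/negbTE/monic_neq0/monicXn.
have g0 j : g j = 0 -> forall l, (l <= j)%N -> a' l = 0.
  elim: j => [|j IH] /=.
    move=> /eqP; rewrite scaler_eq0 Xq0 orbF => /eqP a0 l.
    by rewrite leqn0 => /eqP->.
  have [gj0|gjn0] := eqVneq (g j) 0.
    rewrite gj0 expr0n eqn0Ngt q_gt0 add0r => /eqP.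
    rewrite scaler_eq0 Xq0 orbF => /eqP a0 l.
    by rewrite leq_eqVlt => /predU1P[->//|]; apply: IH.
  move/eqP; rewrite addr_eq0 => /eqP/(congr1 (fun P : {poly K} => size P)).
  have [h gE] := gX j.
  have sg : (2 < size (g j))%N.
    have h0 : h != 0 by apply: contraNneq gjn0 => h0; rewrite gE h0 mulr0.
    by rewrite gE mulrC size_mulXn // -[2%N]addn0 ltn_add2l size_poly_gt0.
  rewrite size_polyN => sE; exfalso; move: (size_scale_leq (a' j.+1) ('X^q : {poly K})).
  rewrite -sE size_polyXn -ltnS -(@prednK (size _)) ?size_poly_gt0 ?expf_neq0 //.
  rewrite ltnS size_exp ltnS -[leqRHS]mul1n leq_pmul2r ?q_gt0 // leqNgt.
  by rewrite -ltnS prednK ?sg // (leq_trans _ sg).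
have [h gE] := gX m'.
have h0 : h != 0.
  apply: contraTneq (v_neq0 m'.+1) => h0; rewrite negbK aE big1 // => j _.
  have gm0 : g m' = 0 by rewrite gE h0 mulr0.
  by rewrite -a'E (g0 _ gm0) ?scale0r // -ltnS.
have [|x] := @closed_root ('X * h - 1).
  rewrite size_polyDl ?size_polyN ?size_poly1 mulrC size_mulX // ?ltnS ?size_poly_gt0 //.
rewrite /root !hornerE subr_eq0 => /eqP hx.
have x0 : x != 0 by apply: contraTneq (oner_neq0 K) => x0; rewrite negbK -hx x0 mul0r.
have gx : (g m').[x] = x by rewrite gE !hornerE expr2 -mulrA hx mulr1.
pose y : 'cV[K]_n.+1 := \sum_(j < m'.+1) (g j).[x] *: v j.
have thy : th y = y.
  have th_sum (s : seq 'I_m'.+1) : th (\sum_(j <- s) (g j).[x] *: v j) =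
      \sum_(j <- s) fr (g j).[x] *: v j.+1.
    elim: s => [|j s IH]; last by rewrite !big_cons thD thZ IH.
    by rewrite !big_nil /th map_mx0 mulmx0.
  rewrite /y th_sum big_ord_recr /= gx -[th (v m')]/(v m'.+1) aE scaler_sumr.
  rewrite [RHS]big_ord_recl [X in _ + X]big_ord_recl addrCA /=; congr (_ + _).
    by rewrite !hornerE -(a'E ord0) scalerA mulrC.
  rewrite -big_split; apply: eq_bigr => j _ /=; rewrite -a'E !hornerE.
  by rewrite lift0 scalerDl scalerA [fr x * _]mulrC.
exists y; last by rewrite -{2}thy /th mulKVmx.
apply: contraNneq x0 => y0.
have : (\row_j (g (j : 'I_m'.+1)).[x]) *m M m'.+1 = 0.
  rewrite mulmx_sum_row -[RHS](trmx0 _) -y0 /y linear_sum; apply: eq_bigr => j _.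
  by rewrite !rowK mxE linearZ.
move/eqP; rewrite mulmx_free_eq0 // => /eqP/rowP/(_ ord_max).
by rewrite !mxE /= gx => ->.
Qed.

(** A fixed vector completed to a basis [G] makes the system block upper triangular. The lower block
    is solved by induction, the corner by a root of [x^q = a x], and the remaining row by additive
    equations. *)
Theorem lang n (B : 'M[K]_n) : B \in unitmx ->
  exists2 Y : 'M[K]_n, Y \in unitmx & map_mx fr Y = B *m Y.
Proof.
elim: n B => [|n IH] B uB.
  by exists 1%:M; rewrite ?unitmx1 //; apply/matrixP => -[].
have [y y0 yE] := semilinear_fixed uB.
have [G uG [c c0 GE]] : exists2 G : 'M[K]_(1 + n), G \in unitmx &
    exists2 c, c != 0 & y = c *: col 0 G.
  exists (row_ebase y^T)^T; first by rewrite unitmx_tr row_ebase_unit.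
  exists (col_ebase y^T 0 0).
    apply: contraNneq y0 => c0; apply/eqP/trmx_inj.
    rewrite -(mulmx_ebase y^T) [col_ebase _]mx11_scalar c0.
    by rewrite -scalemx1 scale0r !mul0mx trmx0.
  apply: trmx_inj; rewrite linearZ /= tr_col trmxK -{1}(mulmx_ebase y^T).
  rewrite {1}[col_ebase _]mx11_scalar mul_scalar_mx -scalemxAl rowE; congr (_ *: (_ *m _)).
  have -> : \rank y^T = 1%N.
    by apply/eqP; rewrite rank_rV -trmx0 (inj_eq trmx_inj) y0.
  by apply/matrixP => r s; rewrite !mxE ord1 eqxx /= andbT eq_sym.
pose B' : 'M[K]_(1 + n) := invmx (map_mx fr G) *m B *m G.
have uB' : B' \in unitmx by rewrite !unitmx_mul unitmx_inv map_unitmx uG uB.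
have dlE : dlsubmx B' = 0.
  have Gc : map_mx fr G *m (B' *m delta_mx 0 (0 : 'I_1)) = B *m col 0 G.
    by rewrite /B' !mulmxA mulmxV ?mul1mx -?mulmxA ?colE // map_unitmx.
  have BG : B *m col 0 G = (c^-1 * fr c) *: map_mx fr (col 0 G).
    move: yE; rewrite GE map_mxZ -scalemxAr => /(congr1 ( *:%R c^-1)).
    by rewrite !scalerA mulVf // scale1r.
  have : B' *m delta_mx 0 (0 : 'I_1) = (c^-1 * fr c) *: delta_mx 0 0.
    have uG' : map_mx fr G \in unitmx by rewrite map_unitmx.
    apply: (can_inj (mulKmx uG')); rewrite Gc BG -scalemxAr; congr (_ *: _).
    by rewrite map_col colE.
  rewrite -colE => /colP E; apply/matrixP => r s; rewrite ord1 !mxE.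
  rewrite (_ : lshift n 0 = 0); last exact: val_inj.
  by have := E (rshift 1 r); rewrite !mxE /= mulr0.
have B'E : B' = block_mx (ulsubmx B') (ursubmx B') 0 (drsubmx B') by rewrite -dlE submxK.
set a := ulsubmx B' in B'E; set b := ursubmx B' in B'E; set D := drsubmx B' in B'E.
have detB' : \det B' = a 0 0 * \det D by rewrite B'E det_ublock {1}[a]mx11_scalar det_scalar1.
have [a0 uD] : a 0 0 != 0 /\ D \in unitmx.
  by move: uB'; rewrite !unitmxE !unitfE detB' mulf_eq0 negb_or => /andP.
have [Y uY YE] := IH D uD.
have [x x0 xE] := eigen_root a0.
have [X XE] : exists X : 'rV[K]_n, map_mx fr X = a 0 0 *: X + b *m Y.
  have /choice[X XE] : forall j, exists z, fr z = a 0 0 * z + (b *m Y) 0 j.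
    by move=> j; apply: additive_root.
  by exists (\row_j X j); apply/rowP => j; have := XE j; rewrite !mxE.
have dY : \det (block_mx x%:M X 0 Y) = x * \det Y by rewrite det_ublock det_scalar1.
have frY : map_mx fr (block_mx x%:M X 0 Y) = B' *m block_mx x%:M X 0 Y.
  rewrite map_block_mx map_mx0 YE XE map_scalar_mx /= xE B'E mulmx_block.
  rewrite !mul0mx !mulmx0 !addr0 !add0r; congr block_mx.
    by rewrite [a in RHS]mx11_scalar -scalar_mxM.
  by rewrite {2}[a]mx11_scalar mul_scalar_mx.
exists (G *m block_mx x%:M X 0 Y).
  by rewrite unitmx_mul uG unitmxE unitfE [\det _]dY mulf_neq0 // -unitfE -unitmxE.
by rewrite map_mxM frY /B' !mulmxA mulmxV ?mul1mx // map_unitmx.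
Qed.
End Lang.

(** * Frobenius systems [Y^(q) = L(t) Y] and weights of functions on their solutions *)

Section FrobeniusSystem.
Variables (Fq : finFieldType) (k : fieldType) (ik : {rmorphism Fq -> k}) (N : nat).
Variables (L : 'M[{poly Fq}]_N) (h : nat).
Hypothesis Lh : forall a b, (size (L a b) <= h.+1)%N.
Local Notation q := #|Fq|.

Definition evL (K : fieldType) (g : {rmorphism k -> K}) (x : K) : 'M[K]_N :=
  map_mx (fun P => (map_poly (g \o ik) P).[x]) L.
Definition sol (K : fieldType) (g : {rmorphism k -> K}) (x : K) (Y : 'M[K]_N) :=
  map_mx (frq (g \o ik)) Y = evL g x *m Y.

(** The system rewrites [q]-th powers of entries linearly, so monomials with all exponents below [q]
    are enough. *)
Definition Mon := {ffun 'I_N * 'I_N -> 'I_q}.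
Definition rc := {ffun Mon -> {poly k}}.
Definition mdeg (e : Mon) : nat := \sum_ij e ij.
Definition mon (K : fieldType) (Y : 'M[K]_N) (e : 'I_N * 'I_N -> nat) : K :=
  \prod_ij Y ij.1 ij.2 ^+ e ij.
Definition ev (K : fieldType) (g : {rmorphism k -> K}) (x : K) (Y : 'M[K]_N) (f : rc) : K :=
  \sum_e (map_poly g (f e)).[x] * mon Y (fun ij => e ij).
(** In this grading [t] has weight 1 and each entry of [Y] has weight [h]. Zero coefficients are
    exempted because their size says nothing about the monomial. *)
Definition wt (a : nat) (f : rc) :=
  forall e, f e != 0 -> (size (f e) + h * mdeg e <= a.+1)%N.

Definition fam := forall K : fieldType, {rmorphism k -> K} -> K -> 'M[K]_N -> K.
(** One representative has to serve for all solutions over all fields: the generic solution and its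
    specialisations are compared through it. *)
Definition rep (a : nat) (F : fam) := exists2 f, wt a f &
  forall (K : fieldType) (g : {rmorphism k -> K}) x Y, sol g x Y -> ev g x Y f = F K g x Y.

Lemma rep_ext a (F F' : fam) :
  (forall K g x Y, sol g x Y -> F K g x Y = F' K g x Y) -> rep a F -> rep a F'.
Proof. by move=> FF' [f wf fF]; exists f => // K g x Y s; rewrite fF // FF'. Qed.

Lemma rep_le a b F : (a <= b)%N -> rep a F -> rep b F.
Proof.
move=> ab [f wf fF]; exists f => // e fe0.
by rewrite (leq_trans (wf e fe0)).
Qed.

Lemma rep_ev a f : wt a f -> rep a (fun K g x Y => ev g x Y f).
Proof. by exists f. Qed.

Lemma ev0 (K : fieldType) (g : {rmorphism k -> K}) x Y : ev g x Y 0 = 0.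
Proof. by rewrite /ev big1 // => e _; rewrite ffunE rmorph0 horner0 mul0r. Qed.

Lemma evD (K : fieldType) (g : {rmorphism k -> K}) x Y f f' :
  ev g x Y (f + f') = ev g x Y f + ev g x Y f'.
Proof.
by rewrite /ev -big_split; apply: eq_bigr => e _; rewrite ffunE rmorphD hornerD mulrDl.
Qed.

Definition polymul (P : {poly k}) (f : rc) : rc := [ffun e => P * f e].

Lemma ev_polymul (K : fieldType) (g : {rmorphism k -> K}) x Y P f :
  ev g x Y (polymul P f) = (map_poly g P).[x] * ev g x Y f.
Proof.
by rewrite /ev mulr_sumr; apply: eq_bigr => e _; rewrite ffunE rmorphM hornerM mulrA.
Qed.

Lemma wt_polymul a n (P : {poly k}) f : (size P <= n.+1)%N -> wt a f -> wt (a + n) (polymul P f).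
Proof.
move=> sP wf e; rewrite ffunE mulf_eq0 negb_or => /andP[P0 fe0].
have H : forall sp sf m, (0 < sp -> 0 < sf -> sp <= n.+1 -> sf + m <= a.+1 ->
  (sp + sf).-1 + m <= (a + n).+1)%N by lia.
by rewrite size_mul //; apply: H; rewrite ?size_poly_gt0 //; apply: wf.
Qed.

Lemma rep0 a : rep a (fun _ _ _ _ => 0).
Proof. by exists 0 => [e|K g x Y _]; rewrite ?ffunE ?eqxx ?ev0. Qed.

Lemma rep_add a F F' : rep a F -> rep a F' -> rep a (fun K g x Y => F K g x Y + F' K g x Y).
Proof.
move=> [f wf fF] [f' wf' fF']; exists (f + f') => [e|K g x Y s]; last by rewrite evD fF ?fF'.
rewrite ffunE => n0; apply: leq_trans (_ : maxn (size (f e)) (size (f' e)) + h * mdeg e <= _)%N.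
  by rewrite leq_add2r size_polyD.
have [fe0|fe0] := eqVneq (f e) 0.
  by rewrite fe0 size_poly0 max0n; apply: wf'; move: n0; rewrite fe0 add0r.
have [fe0'|fe0'] := eqVneq (f' e) 0; first by rewrite fe0' size_poly0 maxn0; apply: wf.
by have := wf e fe0; have := wf' e fe0'; lia.
Qed.

Lemma rep_sum a (I : Type) (r : seq I) (P : pred I) (F : I -> fam) :
  (forall i, P i -> rep a (F i)) -> rep a (fun K g x Y => \sum_(i <- r | P i) F i K g x Y).
Proof.
move=> rF; elim: r => [|i r IH].
  by apply: rep_ext (rep0 a) => K g x Y _; rewrite big_nil.
have [Pi|nPi] := boolP (P i).
  by apply: rep_ext (rep_add (rF i Pi) IH) => K g x Y _; rewrite big_cons Pi.
by apply: rep_ext IH => K g x Y _; rewrite big_cons (negPf nPi).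
Qed.

Lemma rep_polymul a n (P : {poly k}) F : (size P <= n.+1)%N -> rep a F ->
  rep (a + n) (fun K g x Y => (map_poly g P).[x] * F K g x Y).
Proof.
move=> sP [f wf fF]; exists (polymul P f); first exact: wt_polymul.
by move=> K g x Y s; rewrite ev_polymul fF.
Qed.

Lemma monM (K : fieldType) (Y : 'M[K]_N) e e' :
  mon Y e * mon Y e' = mon Y (fun ij => e ij + e' ij)%N.
Proof. by rewrite /mon -big_split; apply: eq_bigr => ij _; rewrite exprD. Qed.

Lemma mon1 (K : fieldType) (Y : 'M[K]_N) ij n :
  mon Y (fun ij' => (ij' == ij) * n)%N = Y ij.1 ij.2 ^+ n.
Proof.
rewrite /mon (bigD1 ij) //= eqxx mul1n big1 ?mulr1 // => ij' /negPf->.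
by rewrite mul0n expr0.
Qed.

Lemma mon_ext (K : fieldType) (Y : 'M[K]_N) e e' : e =1 e' -> mon Y e = mon Y e'.
Proof. by move=> ee'; apply: eq_bigr => ij _; rewrite ee'. Qed.

Lemma sol_entry (K : fieldType) (g : {rmorphism k -> K}) x Y : sol g x Y -> forall a b,
  Y a b ^+ q = \sum_c (map_poly g (map_poly ik (L a c))).[x] * Y c b.
Proof.
move=> s a b; have /matrixP/(_ a b) := s; rewrite mxE [RHS]mxE /frq => ->.
by apply: eq_bigr => c _; rewrite mxE -map_poly_comp.
Qed.

(** Replacing [Y_ab^q] by [sum_c L_ac Y_cb] turns weight [q h] into at most [2 h], which is no
    increase since [q >= 2]. The degree in [Y] drops by [q - 1] each time, so the rewriting ends. *)
Lemma rep_mon (al : 'I_N * 'I_N -> nat) :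
  rep (h * \sum_ij al ij) (fun K g x Y => mon Y al).
Proof.
have [s] := ubnP (\sum_ij al ij); elim: s al => // s IH al; rewrite ltnS => als.
have [/forallP alq|/forallPn[ij]] := boolP [forall ij, al ij < q]%N.
  pose e0 : Mon := [ffun ij => Ordinal (alq ij)].
  exists [ffun e => (e == e0)%:R] => [e|K g x Y _].
    rewrite ffunE; have [->|_] := eqVneq e e0; last by rewrite eqxx.
    move=> _; rewrite size_poly1 add1n ltnS leq_mul2l; apply/orP; right.
    by apply/eq_leq/eq_bigr => ij _; rewrite ffunE.
  rewrite /ev (bigD1 e0) //= ffunE eqxx rmorph1 hornerC mul1r.
  rewrite big1 ?addr0 => [|e /negPf ee]; last by rewrite ffunE ee rmorph0 horner0 mul0r.
  by apply: mon_ext => ij; rewrite ffunE.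
rewrite -leqNgt => qal; pose al' ij' := (al ij' - (ij' == ij) * q)%N.
have alE ij' : al ij' = (al' ij' + (ij' == ij) * q)%N.
  by rewrite /al'; have [->|_] := eqVneq ij' ij; lia.
have sal : (\sum_ij al ij = \sum_ij al' ij + q)%N.
  rewrite (eq_bigr _ (fun ij _ => alE ij)) big_split /=; congr (_ + _)%N.
  by rewrite (bigD1 ij) //= eqxx mul1n big1 ?addn0 // => ij' /negPf->.
pose de (l : 'I_N) ij' := (al' ij' + (ij' == (l, ij.2)) * 1)%N.
have sde l : (\sum_ij de l ij = (\sum_ij al' ij).+1)%N.
  rewrite big_split /= -[RHS]addn1; congr (_ + _)%N.
  by rewrite (bigD1 (l, ij.2)) //= eqxx mul1n big1 ?addn0 // => ij' /negPf->.
have q2 := q_gt1 Fq.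
apply: (@rep_ext _ (fun K g x Y =>
   \sum_l (map_poly g (map_poly ik (L ij.1 l))).[x] * mon Y (de l))).
  move=> K g x Y s'; rewrite (mon_ext _ alE) -monM mon1 (sol_entry s') mulr_sumr.
  by apply: eq_bigr => l _; rewrite -monM mon1 expr1 /= mulrCA.
apply: rep_sum => l _; apply: rep_le (rep_polymul (n := h) _ (IH (de l) _)).
- by rewrite sde sal addnC -mulnS leq_mul2l; apply/orP; right; lia.
- by rewrite size_map_poly Lh.
- by rewrite sde; apply: leq_trans als; rewrite sal; lia.
Qed.

Lemma rep_mul a b F F' : rep a F -> rep b F' ->
  rep (a + b) (fun K g x Y => F K g x Y * F' K g x Y).
Proof.
move=> [f wf fF] [f' wf' fF'].
apply: (@rep_ext _ (fun K g x Y => \sum_e \sum_e'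
   (map_poly g (f e * f' e')).[x] * mon Y (fun ij => e ij + e' ij)%N)).
  move=> K g x Y s; rewrite -fF // -fF' // /ev mulr_suml; apply: eq_bigr => e _.
  rewrite mulr_sumr; apply: eq_bigr => e' _.
  by rewrite rmorphM hornerM -monM mulrACA.
apply: rep_sum => e _; apply: rep_sum => e' _.
have [fe0|fe0] := eqVneq (f e) 0.
  by apply: rep_ext (rep0 _) => K g x Y _; rewrite fe0 mul0r rmorph0 horner0 mul0r.
have [fe0'|fe0'] := eqVneq (f' e') 0.
  by apply: rep_ext (rep0 _) => K g x Y _; rewrite fe0' mulr0 rmorph0 horner0 mul0r.
apply: rep_le (rep_polymul (n := (size (f e)).-1 + (size (f' e')).-1) _ (rep_mon _)).
  rewrite big_split /= -/(mdeg e) -/(mdeg e') mulnDr.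
  have H : forall s s' m m', (0 < s -> 0 < s' -> s + m <= a.+1 -> s' + m' <= b.+1 ->
    m + m' + (s.-1 + s'.-1) <= a + b)%N by lia.
  by apply: H; rewrite ?size_poly_gt0 //; [apply: wf|apply: wf'].
by rewrite size_mul //; move: fe0 fe0'; rewrite -!size_poly_gt0; case: (size _) => // u; case: (size _) => // v; lia.
Qed.

Lemma rep_poly (P : {poly k}) n : (size P <= n.+1)%N -> rep n (fun K g x Y => (map_poly g P).[x]).
Proof.
move=> sP; have r1 := rep_mon (fun=> 0%N).
apply: rep_ext (rep_le _ (rep_polymul sP r1)) => [K g x Y _|].
  by rewrite /mon big1 ?mulr1.
by rewrite big1 // muln0.
Qed.

Lemma rep_const (c : k) : rep 0 (fun K g x Y => g c).
Proof.
apply: rep_ext (rep_poly (P := c%:P) _) => [K g x Y _|]; last exact: size_polyC_leq1.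
by rewrite map_polyC hornerC.
Qed.

Lemma rep_Y i l : rep h (fun K g x Y => Y i l).
Proof.
apply: rep_ext (rep_le _ (rep_mon (fun ij' => (ij' == (i, l)) * 1)%N)) => [K g x Y _|].
  by rewrite mon1 expr1.
rewrite (bigD1 (i, l)) //= eqxx big1 => [|ij' /negPf->//]; lia.
Qed.

Lemma rep_exp a n F : rep a F -> rep (n * a) (fun K g x Y => F K g x Y ^+ n).
Proof.
move=> rF; elim: n => [|n IH].
  by apply: rep_ext (rep_const 1) => K g x Y _; rewrite rmorph1.
by rewrite mulSn; apply: rep_ext (rep_mul rF IH) => K g x Y _; rewrite exprS.
Qed.

Lemma rep_scale a (c : k) F : rep a F -> rep a (fun K g x Y => g c * F K g x Y).
Proof. by move=> rF; have := rep_mul (rep_const c) rF. Qed.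

Lemma rep_lin (A : 'M[k]_N) i l : rep h (fun K g x Y => (map_mx g A *m Y) i l).
Proof.
apply: (@rep_ext _ (fun K g x Y => \sum_c g (A i c) * Y c l)).
  by move=> K g x Y _; rewrite mxE; apply: eq_bigr => c _; rewrite mxE.
by apply: rep_sum => c _; apply: rep_scale; apply: rep_Y.
Qed.

Lemma sol_mulr (K : fieldType) (g : {rmorphism k -> K}) x Y (ga : 'M[Fq]_N) :
  sol g x Y -> sol g x (Y *m map_mx (g \o ik) ga).
Proof. by move=> s; rewrite /sol map_mxM s map_frq_base mulmxA. Qed.

Definition subst (ga : 'M[Fq]_N) (F : fam) : fam :=
  fun K g x Y => F K g x (Y *m map_mx (g \o ik) ga).

Lemma rep_Ymul (ga : 'M[Fq]_N) i l : rep h (fun K g x Y => (Y *m map_mx (g \o ik) ga) i l).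
Proof.
apply: (@rep_ext _ (fun K g x Y => \sum_c g (ik (ga c l)) * Y i c)).
  by move=> K g x Y _; rewrite mxE; apply: eq_bigr => c _; rewrite mxE mulrC.
by apply: rep_sum => c _; apply: rep_scale; apply: rep_Y.
Qed.

Lemma rep_subst a (ga : 'M[Fq]_N) F : rep a F -> rep a (subst ga F).
Proof.
move=> [f wf fF].
apply: (@rep_ext _ (fun K g x Y => \sum_(e | f e != 0) (map_poly g (f e)).[x] *
   \prod_ij (Y *m map_mx (g \o ik) ga) ij.1 ij.2 ^+ e ij)).
  move=> K g x Y s; rewrite /subst -(fF _ _ _ _ (sol_mulr ga s)) /ev.
  rewrite [RHS](bigID (fun e => f e != 0)) /=.
  rewrite [X in _ = _ + X]big1 ?addr0 // => e; rewrite negbK => /eqP->.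
  by rewrite rmorph0 horner0 mul0r.
apply: rep_sum => e fe0.
have := wf e fe0; rewrite -size_poly_gt0 in fe0 => wfe.
have rp : forall s : seq ('I_N * 'I_N), rep (h * \sum_(ij <- s) e ij) (fun K g x Y =>
    \prod_(ij <- s) (Y *m map_mx (g \o ik) ga) ij.1 ij.2 ^+ e ij).
  elim=> [|ij s IH].
    by apply: rep_ext (rep_le _ (rep_const 1)) => [K g x Y _|]; rewrite !big_nil ?rmorph1.
  have := rep_mul (rep_exp (e ij) (rep_Ymul ga ij.1 ij.2)) IH.
  rewrite big_cons mulnDr [(h * e ij)%N]mulnC.
  by apply: rep_ext => K g x Y _; rewrite big_cons.
apply: rep_le (rep_polymul (n := (size (f e)).-1) _ (rp _)); last by lia.
by rewrite -/(mdeg e); lia.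
Qed.
End FrobeniusSystem.

(** * Degrees and divisors of determinants of polynomial matrices *)

Lemma size_det_leq (R : comNzRingType) r (M : 'M[{poly R}]_r) D :
  (forall i j, (size (M i j) <= D.+1)%N) -> (size (\det M) <= (r * D).+1)%N.
Proof.
move=> sM; apply: leq_trans (size_sum _ _ _) _; apply/bigmax_leqP => s _.
have sp : forall l : seq 'I_r, (size (\prod_(i <- l) M i (s i))%R <= (size l * D).+1)%N.
  elim=> [|i l IH]; first by rewrite big_nil size_poly1.
  rewrite big_cons; apply: leq_trans (size_polyMleq _ _) _.
  by have := sM i (s i); move: IH; rewrite /= mulSn; set x := size _; set y := size _; lia.
apply: leq_trans (size_polyMleq _ _) _.
have -> : (-1) ^+ s = ((-1) ^+ s)%:P :> {poly R} by rewrite rmorphXn rmorphN1.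
have := sp (index_enum 'I_r); rewrite /index_enum -enumT size_enum_ord.
have := size_polyC_leq1 ((-1) ^+ s : R); set x := size _; set y := size _; lia.
Qed.

Lemma prod_XsubC_exp_dvdp (k : fieldType) (T : seq k) (e : k -> nat) (P : {poly k}) :
  uniq T -> (forall x, x \in T -> ('X - x%:P) ^+ e x %| P) ->
  \prod_(x <- T) ('X - x%:P) ^+ e x %| P.
Proof.
elim: T => [|x T IH] /=; first by rewrite big_nil dvd1p.
case/andP=> xT uT eP; rewrite big_cons Gauss_dvdp; last first.
  apply: coprimep_expl; rewrite coprimep_sym.
  elim: T xT {IH uT eP} => [|y T IH]; first by rewrite big_nil coprime1p.
  rewrite inE negb_or => /andP[xy xT]; rewrite big_cons coprimepMl IH // andbT.
  by apply: coprimep_expl; rewrite coprimep_XsubC root_XsubC.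
rewrite eP ?mem_head // IH // => y yT; apply: eP; by rewrite inE yT orbT.
Qed.

Lemma size_prod_XsubC_exp (k : fieldType) (T : seq k) (e : k -> nat) :
  size (\prod_(x <- T) ('X - x%:P) ^+ e x) = (\sum_(x <- T) e x).+1.
Proof.
elim: T => [|x T IH]; first by rewrite !big_nil size_poly1.
rewrite !big_cons size_monicM ?IH ?size_exp_XsubC ?addSn ?addnS //.
  by apply/monic_exp/monicXsubC.
by rewrite -size_poly_eq0 IH.
Qed.

(** After conjugation by [V], each row belonging to the eigenvalue [0] vanishes at [x] and gives a
    factor [X - x]. The dimension [s] is kept apart from [r] because it will be the cardinality of a
    fibre. *)
Lemma unit_conj_diag_dvdp (k : fieldType) r s (M : 'M[{poly k}]_r) (V : 'M[k]_(r, s))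
    (d : 'I_s -> k) x : s = r -> row_free V ->
  map_mx (horner_eval x) M *m V = V *m diag_mx (\row_j d j) ->
  ('X - x%:P) ^+ #|[set j | d j == 0]| %| \det M.
Proof.
move=> sr; subst s; rewrite row_free_unit => Vu MV.
pose M' := map_mx polyC (invmx V) *m M *m map_mx polyC V.
have dM : \det M' = \det M.
  rewrite !det_mulmx mulrAC -det_mulmx -map_mxM mulVmx // map_mx1 det1 mul1r //.
have M'x i j : (M' i j).[x] = d i *+ (i == j).
  have -> : (M' i j).[x] = (map_mx (horner_eval x) M') i j by rewrite [RHS]mxE.
  rewrite !map_mxM -!map_mx_comp.
  have cc (A : 'M[k]_r) : map_mx (horner_eval x \o @polyC k) A = A.
    by apply/matrixP => a b; rewrite mxE /= /horner_eval hornerC.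
  rewrite !cc -mulmxA MV mulmxA mulVmx // mul1mx.
  by rewrite mxE mxE.
pose D := fun i : 'I_r => if d i == 0 then 'X - x%:P else 1.
pose M'' := \matrix_(i, j) (M' i j %/ D i).
have DM : M' = diag_mx (\row_i D i) *m M''.
  apply/matrixP => i j; rewrite mul_diag_mx [RHS]mxE [(\row__ _) _ _]mxE [M'' _ _]mxE mulrC divpK // /D.
  by case: eqP => di; rewrite ?dvd1p // dvdp_XsubCl rootE M'x di mul0rn.
rewrite -dM DM det_mulmx det_diag dvdp_mulr //.
under eq_bigr do rewrite mxE.
rewrite (bigID (fun i => d i == 0)) /= [X in _ * X]big1 ?mulr1; last first.
  by move=> i /negPf di; rewrite /D di.
rewrite (eq_bigr (fun=> 'X - x%:P)); last by move=> i di; rewrite /D di.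
by rewrite prodr_const cardsE.
Qed.

Lemma unit_conj_diag_trace (k : fieldType) r s (A : 'M[k]_r) (V : 'M[k]_(r, s)) (d : 'I_s -> k) :
  s = r -> row_free V -> A *m V = V *m diag_mx (\row_j d j) -> \tr A = \sum_j d j.
Proof.
move=> sr; subst s; rewrite row_free_unit => Vu AV.
have -> : A = V *m diag_mx (\row_j d j) *m invmx V by rewrite -AV mulmxK.
rewrite mxtrace_mulC mulmxA mulVmx // mul1mx mxtrace_diag.
by apply: eq_bigr => j _; rewrite mxE.
Qed.

(** * Finite algebras over [k[t]], their norms and their fibres *)

Section Curve.
Variables (k Om : fieldType) (jk : {rmorphism k -> Om}) (t : Om).

Definition pv : {poly k} -> Om := horner_eval t \o map_poly jk.
HB.instance Definition _ := GRing.RMorphism.on pv.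

Lemma pvC c : pv c%:P = jk c.
Proof. by rewrite /pv /= map_polyC /horner_eval hornerC. Qed.

Lemma pvX : pv 'X = t.
Proof. by rewrite /pv /= map_polyX /horner_eval hornerX. Qed.

Hypothesis t_tr : forall P, pv P = 0 -> P = 0.

Definition spn n (m : 'I_n -> Om) (x : Om) :=
  exists P : 'I_n -> {poly k}, x = \sum_i pv (P i) * m i.
Definition indep n (m : 'I_n -> Om) :=
  forall P : 'I_n -> {poly k}, \sum_i pv (P i) * m i = 0 -> forall i, P i = 0.

Lemma spn0 n (m : 'I_n -> Om) : spn m 0.
Proof. by exists (fun=> 0); rewrite big1 // => i _; rewrite rmorph0 mul0r. Qed.

Lemma spnD n (m : 'I_n -> Om) x y : spn m x -> spn m y -> spn m (x + y).
Proof.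
move=> [P ->] [P' ->]; exists (fun i => P i + P' i).
by rewrite -big_split; apply: eq_bigr => i _; rewrite rmorphD mulrDl.
Qed.

Lemma spnZ n (m : 'I_n -> Om) P x : spn m x -> spn m (pv P * x).
Proof.
move=> [P' ->]; exists (fun i => P * P' i).
by rewrite mulr_sumr; apply: eq_bigr => i _; rewrite rmorphM mulrA.
Qed.

Lemma spn_self n (m : 'I_n -> Om) i : spn m (m i).
Proof.
exists (fun j => (j == i)%:R); rewrite (bigD1 i) //= eqxx rmorph1 mul1r big1 ?addr0 //.
by move=> j /negPf->; rewrite rmorph0 mul0r.
Qed.

Lemma spn_sum n (m : 'I_n -> Om) (I : Type) (s : seq I) (Q : pred I) (x : I -> Om) :
  (forall i, Q i -> spn m (x i)) -> spn m (\sum_(i <- s | Q i) x i).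
Proof. by move=> mx; apply: big_ind => //; [exact: spn0|exact: spnD]. Qed.

Lemma spn_trans n n' (m : 'I_n -> Om) (m' : 'I_n' -> Om) x :
  (forall i, spn m' (m i)) -> spn m x -> spn m' x.
Proof. by move=> mm' [P ->]; apply: spn_sum => i _; apply: spnZ. Qed.

Definition eqspn n n' (m : 'I_n -> Om) (m' : 'I_n' -> Om) :=
  (forall i, spn m' (m i)) /\ (forall i, spn m (m' i)).

Lemma eqspn_trans n n' n'' (m : 'I_n -> Om) (m' : 'I_n' -> Om) (m'' : 'I_n'' -> Om) :
  eqspn m m' -> eqspn m' m'' -> eqspn m m''.
Proof.
by move=> [a b] [c d]; split=> i; [apply: spn_trans (a i)|apply: spn_trans (d i)].
Qed.

(** Euclid's algorithm on the coefficients of a relation. If [P i0] divides the others,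
    torsion-freeness expresses [m i0] by the rest; otherwise replacing [m i0] by [m i0 + Q m i1]
    produces a relation with a smaller nonzero coefficient. *)
Lemma drop_dependent d n (m : 'I_n.+1 -> Om) (P : 'I_n.+1 -> {poly k}) i0 :
  \sum_i pv (P i) * m i = 0 -> P i0 != 0 -> (size (P i0) <= d)%N ->
  exists m' : 'I_n -> Om, eqspn m m'.
Proof.
elim: d m P i0 => [|d IH] m P i0 rel P0 sd.
  by move: P0; rewrite -size_poly_eq0 -leqn0 sd.
have [/forallP dv|/forallPn[i1 ndv]] := boolP [forall i, P i0 %| P i].
  exists (fun i => m (lift i0 i)).
  have e0 : m i0 = \sum_i pv (- (P (lift i0 i) %/ P i0)) * m (lift i0 i).
    have nz : pv (P i0) != 0 by apply: contra_neq P0 => /t_tr.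
    apply: (mulfI nz); move: rel; rewrite (bigD1_ord i0) //= => /eqP.
    rewrite addr_eq0 => /eqP->; rewrite mulr_sumr -sumrN; apply: eq_bigr => i _.
    by rewrite rmorphN mulrA mulrN mulNr -rmorphM mulrC [P i0 * _]mulrC divpK // mulrC.
  split=> [i|i]; last exact: spn_self.
  case: (unliftP i0 i) => [j ->|->]; last by rewrite e0; eexists.
  exact: (spn_self (fun i => m (lift i0 i))).
have i10 : i1 != i0 by apply: contraNneq ndv => ->.
pose Q := P i1 %/ P i0.
pose m' i := if i == i0 then m i0 + pv Q * m i1 else m i.
pose P' i := if i == i1 then P i1 %% P i0 else P i.
have [m'' mm''] : exists m'' : 'I_n -> Om, eqspn m' m''; first apply: (IH m' P' i1).
- rewrite -[RHS]rel (bigD1 i0) //= [RHS](bigD1 i0) //= (bigD1 i1) //= [in RHS](bigD1 i1) //=.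
  rewrite /P' /m' eqxx (negPf i10) eq_sym (negPf i10) eqxx !addrA; congr (_ + _).
    rewrite {2}(divp_eq (P i1) (P i0)) -/Q rmorphD rmorphM mulrDr mulrDl.
    by rewrite [pv Q * pv _]mulrC !mulrA addrA.
  by apply: eq_bigr => i /andP[/negPf-> /negPf->].
- by rewrite /P' eqxx; apply: contraNneq ndv => /eqP; rewrite /dvdp => ->.
- by rewrite /P' eqxx -ltnS (leq_trans _ sd) // ltn_modp.
exists m''; apply: eqspn_trans mm''; split=> i.
  have [->|ni] := eqVneq i i0; last first.
    by have := spn_self m' i; rewrite {2}/m' (negPf ni).
  have -> : m i0 = m' i0 + pv (- Q) * m' i1.
    by rewrite /m' eqxx (negPf i10) rmorphN mulNr addrK.
  by apply: spnD; [|apply: spnZ]; apply: spn_self.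
rewrite /m'; case: eqP => _; last exact: spn_self.
by apply: spnD; [|apply: spnZ]; apply: spn_self.
Qed.

Lemma free_basis n (m : 'I_n -> Om) : exists r (b : 'I_r -> Om), indep b /\ eqspn m b.
Proof.
elim: n m => [|n IH] m.
  by exists 0%N, m; split=> [P _ []//|]; split=> -[].
have [?|ni] := pselect (indep m).
  by exists n.+1, m; split=> //; split=> i; apply: spn_self.
have [P] : exists P : 'I_n.+1 -> {poly k}, ~ (\sum_i pv (P i) * m i = 0 -> forall i, P i = 0).
  exact/existsNP.
move=> /not_implyP[rel /existsNP[i /eqP Pi]].
have [m' mm'] := drop_dependent rel Pi (leqnn _).
have [r [b [ib m'b]]] := IH m'.
by exists r, b; split=> //; apply: eqspn_trans m'b.
Qed.

(** [W a] stands for the functions of weight at most [a], and [m] for generators over [k[t]]. The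
    union [inR] of the [W a] is a ring, finite and torsion-free over [k[t]], hence free with a basis
    [b]. *)
Variables (W : nat -> Om -> Prop).
Hypothesis W_C : forall c, W 0 (jk c).
Hypothesis W_t : W 1 t.
Hypothesis W_D : forall a x y, W a x -> W a y -> W a (x + y).
Hypothesis W_M : forall a b x y, W a x -> W b y -> W (a + b) (x * y).
Hypothesis W_le : forall a b x, (a <= b)%N -> W a x -> W b x.
Variables (n w : nat) (m : 'I_n -> Om).
Hypothesis W_m : forall e, W w (m e).
Hypothesis W_span : forall a x, W a x ->
  exists2 P : 'I_n -> {poly k}, (forall e, (size (P e) <= a.+1)%N) & x = \sum_e pv (P e) * m e.

Definition inR x := exists a, W a x.

Lemma inRD x y : inR x -> inR y -> inR (x + y).
Proof.
move=> [a Wx] [b Wy]; exists (maxn a b).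
by apply: W_D; [apply: W_le Wx; exact: leq_maxl|apply: W_le Wy; exact: leq_maxr].
Qed.
Lemma inRM x y : inR x -> inR y -> inR (x * y).
Proof. by move=> [a Wx] [b Wy]; exists (a + b)%N; apply: W_M. Qed.
Lemma inRC c : inR (jk c). Proof. by exists 0%N. Qed.
Lemma inR0 : inR 0. Proof. by rewrite -(rmorph0 jk); apply: inRC. Qed.
Lemma inR1 : inR 1. Proof. by rewrite -(rmorph1 jk); apply: inRC. Qed.
Lemma inRN x : inR x -> inR (- x).
Proof. by move=> Rx; rewrite -mulN1r -(rmorphN1 jk); apply: inRM => //; apply: inRC. Qed.
Lemma inRB x y : inR x -> inR y -> inR (x - y).
Proof. by move=> Rx Ry; apply: inRD => //; apply: inRN. Qed.
Lemma inRt : inR t. Proof. by exists 1%N. Qed.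
Lemma inRX x e : inR x -> inR (x ^+ e).
Proof. by move=> Rx; elim: e => [|e IH]; [exact: inR1|rewrite exprS; apply: inRM]. Qed.
Lemma inR_sum (I : Type) (s : seq I) (Q : pred I) (x : I -> Om) :
  (forall i, Q i -> inR (x i)) -> inR (\sum_(i <- s | Q i) x i).
Proof. by move=> mx; apply: big_ind => //; [exact: inR0|exact: inRD]. Qed.

Lemma W_sum a (I : Type) (s : seq I) (Q : pred I) (x : I -> Om) :
  (forall i, Q i -> W a (x i)) -> W a (\sum_(i <- s | Q i) x i).
Proof.
move=> mx; apply: big_ind => //; last exact: W_D.
by apply: (@W_le 0) => //; rewrite -(rmorph0 jk).
Qed.

Lemma W_tX e : W e (t ^+ e).
Proof.
elim: e => [|e IH]; first by rewrite expr0 -(rmorph1 jk).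
by rewrite exprS -add1n; apply: W_M.
Qed.

Lemma W_pv a (P : {poly k}) : (size P <= a.+1)%N -> W a (pv P).
Proof.
move=> sP; rewrite -[P]coefK poly_def rmorph_sum; apply: W_sum => i _.
rewrite -mul_polyC (rmorphM pv) (rmorphXn pv) /= pvC pvX; apply: (@W_le (0 + i)).
  by have := ltn_ord i; lia.
by apply: W_M => //; apply: W_tX.
Qed.

Lemma inRpv P : inR (pv P).
Proof. by exists (size P); apply: W_pv. Qed.

Lemma W_exp a x e : W a x -> W (e * a) (x ^+ e).
Proof.
move=> Wx; elim: e => [|e IH]; first by rewrite expr0 -(rmorph1 jk).
by rewrite exprS mulSn; apply: W_M.
Qed.

Variables (r : nat) (b : 'I_r -> Om).
Hypothesis b_indep : indep b.
Hypothesis b_span : eqspn m b.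

Lemma spn_b x : inR x -> spn b x.
Proof.
by move=> [a /W_span[P _ xP]]; apply: spn_trans b_span.1 _; exists P.
Qed.

Lemma inRb i : inR (b i).
Proof.
have [P ->] := b_span.2 i; apply: inR_sum => e _; apply: inRM; first exact: inRpv.
by exists w.
Qed.

Definition Mat_spec x (M : 'M[{poly k}]_r) := forall i, x * b i = \sum_j pv (M i j) * b j.
Definition Mat x : 'M[{poly k}]_r := xget 0 [set M | Mat_spec x M]%classic.
Definition Nm x := \det (Mat x).

Lemma MatP x : inR x -> Mat_spec x (Mat x).
Proof.
move=> Rx; rewrite /Mat; case: xgetP => [M _ //|H]; exfalso.
have /choice[P xP] : forall i, exists P : 'I_r -> {poly k}, x * b i = \sum_j pv (P j) * b j.
  by move=> i; apply: spn_b; apply: inRM => //; apply: inRb.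
by apply: (H (\matrix_(i, j) P i j)) => i; rewrite xP; apply: eq_bigr => j _; rewrite mxE.
Qed.

Lemma pv_inj_sum (P P' : 'I_r -> {poly k}) :
  \sum_i pv (P i) * b i = \sum_i pv (P' i) * b i -> P =1 P'.
Proof.
move=> e i; apply/eqP; rewrite -subr_eq0; apply/eqP; move: i; apply: b_indep.
under eq_bigr do rewrite rmorphB mulrBl.
by rewrite sumrB e subrr.
Qed.

Lemma Mat_uniq x M : inR x -> Mat_spec x M -> Mat x = M.
Proof.
move=> Rx Ms; apply/matrixP => i j; move: j; apply: pv_inj_sum.
by rewrite -(MatP Rx) Ms.
Qed.

Lemma Mat_pv P : Mat (pv P) = P%:M.
Proof.
apply: Mat_uniq (inRpv P) _ => i; rewrite (bigD1 i) //= mxE eqxx mulr1n big1 ?addr0 //.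
by move=> j /negPf ji; rewrite mxE eq_sym ji rmorph0 mul0r.
Qed.

Lemma MatM x y : inR x -> inR y -> Mat (x * y) = Mat y *m Mat x.
Proof.
move=> Rx Ry; apply: Mat_uniq (inRM Rx Ry) _ => i.
rewrite -mulrA (MatP Ry) mulr_sumr.
transitivity (\sum_j \sum_l pv (Mat y i j) * (pv (Mat x j l) * b l)).
  by apply: eq_bigr => j _; rewrite mulrCA (MatP Rx) mulr_sumr.
rewrite exchange_big; apply: eq_bigr => l _ /=; rewrite mxE rmorph_sum mulr_suml.
by apply: eq_bigr => j _; rewrite rmorphM mulrA.
Qed.

Lemma MatD x y : inR x -> inR y -> Mat (x + y) = Mat x + Mat y.
Proof.
move=> Rx Ry; apply: Mat_uniq (inRD Rx Ry) _ => i.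
rewrite mulrDl (MatP Rx) (MatP Ry) -big_split; apply: eq_bigr => j _ /=.
by rewrite mxE rmorphD mulrDl.
Qed.

Lemma NmM x y : inR x -> inR y -> Nm (x * y) = Nm x * Nm y.
Proof. by move=> Rx Ry; rewrite /Nm MatM // det_mulmx mulrC. Qed.

Lemma Nm_pv P : Nm (pv P) = P ^+ r.
Proof. by rewrite /Nm Mat_pv det_scalar. Qed.

Lemma NmX x e : inR x -> Nm (x ^+ e) = Nm x ^+ e.
Proof.
move=> Rx; elim: e => [|e IH]; last by rewrite !exprS NmM ?IH //; apply: inRX.
by rewrite !expr0 -[in LHS](rmorph1 pv) Nm_pv expr1n.
Qed.

Lemma Nm_neq0 x : inR x -> x != 0 -> Nm x != 0.
Proof.
move=> Rx x0; apply/det0P => -[v v0 vM].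
have e : x * (\sum_i pv (v 0 i) * b i) = 0.
  transitivity (\sum_j pv ((v *m Mat x) 0 j) * b j); last first.
    by rewrite vM big1 // => j _; rewrite mxE rmorph0 mul0r.
  rewrite mulr_sumr; transitivity (\sum_i \sum_j pv (v 0 i) * (pv (Mat x i j) * b j)).
    by apply: eq_bigr => i _; rewrite mulrCA (MatP Rx) mulr_sumr.
  rewrite exchange_big; apply: eq_bigr => j _ /=; rewrite mxE rmorph_sum mulr_suml.
  by apply: eq_bigr => i _; rewrite rmorphM mulrA.
move/eqP: e; rewrite mulf_eq0 (negPf x0) /= => /eqP/b_indep v0'.
by case/negP: v0; apply/eqP/rowP => i; rewrite v0' mxE.
Qed.

(** Bounding the entries of [Mat x] directly loses a constant that depends on the basis. The norm
    being multiplicative, the bound is applied to [x^J] instead: the constant is in effect divided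
    by [J]. *)
Lemma Nm_size a x : W a x -> (size (Nm x) <= (r * a).+1)%N.
Proof.
move=> Wx; have Rx : inR x by exists a.
have [a0 Wb] : exists a0, forall i, W a0 (b i).
  have /choice[f Wf] := inRb; exists (\sum_i f i)%N => i; apply: W_le (Wf i).
  by rewrite (bigD1 i) //= leq_addr.
have /choice[P mP] := b_span.1.
pose D := (\sum_e \sum_j size (P e j))%N.
have sD e j : (size (P e j) <= D)%N.
  by rewrite /D (bigD1 e) //= (bigD1 j) //= -addnA leq_addr.
have bound J : (size (Nm x ^+ J) <= (r * (J * a + (a0 + D))).+1)%N.
  rewrite -NmX //; apply: size_det_leq => i j.
  have [Q sQ xQ] := W_span (W_M (W_exp J Wx) (Wb i)).
  have -> : Mat (x ^+ J) i j = \sum_e Q e * P e j.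
    move: j; apply: pv_inj_sum; rewrite -(MatP (inRX J Rx)) xQ.
    under eq_bigr do rewrite mP mulr_sumr.
    rewrite exchange_big; apply: eq_bigr => j _ /=; rewrite rmorph_sum mulr_suml.
    by apply: eq_bigr => e _; rewrite rmorphM mulrA.
  apply: leq_trans (size_sum _ _ _) _; apply/bigmax_leqP => e _.
  apply: leq_trans (size_polyMleq _ _) _.
  by have := sQ e; have := sD e j; set A := size _; set B := size _; lia.
have [->|n0] := eqVneq (Nm x) 0; first by rewrite size_poly0.
rewrite leqNgt; apply/negP => gt.
(* With this [J], one degree too many per factor adds up to more than the constant allows. *)
have [J defJ] : {J | J = (r * (a0 + D)).+1} by eexists.
have := bound J.
have s0 : (0 < size (Nm x))%N by rewrite size_poly_gt0.
have -> : size (Nm x ^+ J) = (J * (size (Nm x)).-1).+1.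
  have := size_exp (Nm x) J; rewrite mulnC => <-; rewrite prednK // size_poly_gt0.
  by rewrite expf_neq0.
have : (J * (r * a).+1 <= J * (size (Nm x)).-1)%N by rewrite leq_mul2l; lia.
rewrite mulnDr [(r * (J * a))%N]mulnCA mulnS.
set A := (J * (r * a))%N; lia.
Qed.

Section IndependentMonomials.
(** The matrix expressing [m] in the basis [b] has a left inverse over [k[t]], so it keeps full rank
    at [0], and a nonzero minor picks the members. Members of the family itself are wanted because
    their weight is known, unlike that of the [b i]. *)
Lemma indep_monomials : exists2 f : 'I_r -> 'I_n, injective f & indep (fun i => m (f i)).
Proof.
have /choice[P mP] := b_span.1; have /choice[P' bP'] := b_span.2.
pose A := \matrix_(e < n, i < r) P e i; pose A' := \matrix_(i < r, e < n) P' i e.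
have AA : A' *m A = 1%:M.
  apply/matrixP => i j; rewrite [RHS]mxE; move: j.
  apply: (@pv_inj_sum (fun j => (A' *m A) i j)).
  transitivity (b i); last first.
    rewrite (bigD1 i) //= eqxx rmorph1 mul1r big1 ?addr0 // => j /negPf ji.
    by rewrite eq_sym ji rmorph0 mul0r.
  rewrite bP'; under [RHS]eq_bigr do rewrite mP mulr_sumr.
  rewrite exchange_big; apply: eq_bigr => j _ /=; rewrite mxE rmorph_sum mulr_suml.
  by apply: eq_bigr => e _; rewrite !mxE rmorphM mulrA.
pose A0 := map_mx (horner_eval 0) A.
have fA : row_full A0.
  apply/row_fullP; exists (map_mx (horner_eval 0) A').
  by rewrite -map_mxM AA map_mx1.
pose f := fullrankfun fA; exists f; first exact: fullrankfun_inj.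
have := fullrowsub_unit fA; rewrite -/f unitmxE unitfE => du.
have dn : \det (rowsub f A) != 0.
  apply: contra_neq du => d0; rewrite -map_mxsub det_map_mx d0 rmorph0 //.
move=> Q rel i.
have : (\row_i Q i) *m rowsub f A = 0.
  apply/rowP => j; rewrite [RHS]mxE; move: j; apply: b_indep.
  rewrite -[RHS]rel; under [RHS]eq_bigr do rewrite mP mulr_sumr.
  rewrite [RHS]exchange_big; apply: eq_bigr => j _ /=; rewrite mxE rmorph_sum mulr_suml.
  by apply: eq_bigr => e _; rewrite !mxE rmorphM mulrA.
move/(congr1 (mulmx^~ (\adj (rowsub f A)))); rewrite mul0mx -mulmxA mul_mx_adj.
rewrite mul_mx_scalar => /rowP/(_ i); rewrite !mxE => /eqP.
by rewrite mulf_eq0 (negPf dn) => /eqP.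
Qed.
End IndependentMonomials.

(** [S x] is the fibre over [x], its points labelled by a finite type, and [val x g] is evaluation
    at the point [g]. [val_div] and [val_interp] together say that reduction modulo [t - x] is the
    algebra of all functions on the fibre. *)
Variables (G : finType) (good : k -> Prop) (S : k -> {set G}) (val : k -> G -> Om -> k).
Hypothesis val_D : forall x g y z, good x -> g \in S x -> inR y -> inR z ->
  val x g (y + z) = val x g y + val x g z.
Hypothesis val_M : forall x g y z, good x -> g \in S x -> inR y -> inR z ->
  val x g (y * z) = val x g y * val x g z.
Hypothesis val_C : forall x g c, good x -> g \in S x -> val x g (jk c) = c.
Hypothesis val_t : forall x g, good x -> g \in S x -> val x g t = x.
Hypothesis val_div : forall x y, good x -> inR y ->
  (forall g, g \in S x -> val x g y = 0) -> exists2 y', inR y' & y = (t - jk x) * y'.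
Hypothesis val_interp : forall x (v : G -> k), good x ->
  exists2 y, inR y & forall g, g \in S x -> val x g y = v g.

Lemma val_sum x g (I : Type) (s : seq I) (Q : pred I) (y : I -> Om) :
  good x -> g \in S x -> (forall i, Q i -> inR (y i)) ->
  val x g (\sum_(i <- s | Q i) y i) = \sum_(i <- s | Q i) val x g (y i).
Proof.
move=> gx gS Ry; elim: s => [|i s IH]; first by rewrite !big_nil -(rmorph0 jk) val_C.
rewrite !big_cons; case: ifP => // Qi; rewrite val_D ?IH //; first exact: Ry.
exact: inR_sum.
Qed.

Lemma val_X x g y e : good x -> g \in S x -> inR y -> val x g (y ^+ e) = val x g y ^+ e.
Proof.
move=> gx gS Ry; elim: e => [|e IH]; first by rewrite !expr0 -(rmorph1 jk) val_C.
by rewrite !exprS val_M ?IH //; apply: inRX.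
Qed.

Lemma val_pv x g P : good x -> g \in S x -> val x g (pv P) = P.[x].
Proof.
move=> gx gS; rewrite horner_coef -[in LHS](coefK P) poly_def rmorph_sum.
have -> : \sum_(i < size P) pv (P`_i *: 'X^i) = \sum_(i < size P) jk P`_i * t ^+ i.
  by apply: eq_bigr => i _; rewrite -mul_polyC (rmorphM pv) (rmorphXn pv) /= pvC pvX.
rewrite val_sum //; last by move=> i _; apply: inRM; [apply: inRC|apply/inRX/inRt].
apply: eq_bigr => i _; rewrite val_M ?val_C ?val_X ?val_t //;
  by [apply: inRt|apply: inRC|apply/inRX/inRt].
Qed.

Definition Vm x : 'M[k]_(r, #|S x|) := \matrix_(i, j) val x (enum_val j) (b i).

Lemma val_lin x g (P : 'I_r -> {poly k}) : good x -> g \in S x ->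
  val x g (\sum_i pv (P i) * b i) = \sum_i (P i).[x] * val x g (b i).
Proof.
move=> gx gS; rewrite val_sum //; last first.
  by move=> i _; apply: inRM; [exact: inRpv|exact: inRb].
by apply: eq_bigr => i _; rewrite val_M ?val_pv //; [exact: inRpv|exact: inRb].
Qed.

Lemma Vm_free x : good x -> row_free (Vm x).
Proof.
move=> gx; apply/inj_row_free => v vV; apply/rowP => i; rewrite mxE.
have [|g gS|y' Ry' e] := @val_div x (\sum_i pv (v 0 i)%:P * b i) gx.
- by apply: inR_sum => j _; apply: inRM; [exact: inRpv|exact: inRb].
- rewrite val_lin //; have /rowP/(_ (enum_rank_in gS g)) := vV; rewrite mxE [RHS]mxE => E.
  rewrite -[RHS]E; by apply: eq_bigr => j _; rewrite hornerC mxE enum_rankK_in.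
have [Q yQ] := spn_b Ry'.
have /(_ i) : (fun i => (v 0 i)%:P) =1 (fun i => ('X - x%:P) * Q i).
  apply: pv_inj_sum; rewrite e yQ mulr_sumr; apply: eq_bigr => j _.
  by rewrite (rmorphM pv) (rmorphB pv) /= pvX pvC mulrA.
by move/(congr1 (horner_eval x)); rewrite /horner_eval hornerC hornerM hornerXsubC subrr mul0r.
Qed.

(** The ring modulo [t - x] has dimension [r] and is the algebra of functions on the fibre:
    [Vm_free] gives injectivity of evaluation, interpolation gives surjectivity. *)
Lemma card_S x : good x -> #|S x| = r.
Proof.
move=> gx; have : row_full (Vm x).
  apply/row_fullP.
  suff /choice[B BV] : forall j : 'I_#|S x|, exists v : 'rV_r, v *m Vm x = delta_mx 0 j.
    exists (\matrix_j B j); apply/row_matrixP => j.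
    by rewrite row_mul rowK BV rowE mulmx1.
  move=> j; have [y Ry yv] := @val_interp x (fun g => (g == enum_val j)%:R) gx.
  have [P yP] := spn_b Ry; exists (\row_i (P i).[x]); apply/rowP => l.
  rewrite [RHS]mxE eqxx /= -(inj_eq enum_val_inj) -yv ?enum_valP // yP val_lin ?enum_valP //.
  by rewrite mxE; apply: eq_bigr => i _; rewrite !mxE.
rewrite /row_full => /eqP <-; have := Vm_free gx; rewrite /row_free => /eqP //.
Qed.

Lemma Mat_val x y : good x -> inR y ->
  map_mx (horner_eval x) (Mat y) *m Vm x = Vm x *m diag_mx (\row_j val x (enum_val j) y).
Proof.
move=> gx Ry; apply/matrixP => i j; rewrite mxE mul_mx_diag !mxE mulrC.
have gS := enum_valP j.
rewrite -val_M //; last exact: inRb.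
by rewrite (MatP Ry) val_lin //; apply: eq_bigr => l _; rewrite !mxE.
Qed.

Definition zer x y := #|[set g in S x | val x g y == 0]|.

Lemma zer_dvd x y : good x -> inR y -> ('X - x%:P) ^+ zer x y %| Nm y.
Proof.
move=> gx Ry.
have := unit_conj_diag_dvdp (card_S gx) (Vm_free gx) (Mat_val gx Ry).
suff -> : zer x y = #|[set j : 'I_#|S x| | val x (enum_val j) y == 0]| by [].
rewrite /zer -[RHS](card_imset _ (@enum_val_inj _ (mem (S x)))); apply: eq_card => g.
rewrite inE; apply/andP/imsetP => [[gS vg]|[j]].
  by exists (enum_rank_in gS g); rewrite ?inE enum_rankK_in.
by rewrite inE => vj ->; split=> //; apply: enum_valP.
Qed.

Lemma sum_zer (T : seq k) a y : uniq T -> (forall x, x \in T -> good x) -> W a y -> y != 0 ->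
  (\sum_(x <- T) zer x y <= r * a)%N.
Proof.
move=> uT gT Wy y0; have Ry : inR y by exists a.
rewrite -ltnS; apply: leq_trans (Nm_size Wy); rewrite -size_prod_XsubC_exp.
apply: dvdp_leq; first exact: Nm_neq0.
by apply: prod_XsubC_exp_dvdp => // x xT; apply: zer_dvd => //; apply: gT.
Qed.

Hypothesis k_inf : forall P : {poly k}, P != 0 -> exists c, P.[c] != 0.

(** The norm of [u0 + c (t - x)] is the characteristic polynomial of [- Mat u0] at [c (t - x)]. If
    [(X - x)^r] divided it for every [c], it would divide each term [a_i (X - x)^i], as [k] is
    infinite. For [i = r - 1] this makes the trace of [Mat u0] vanish at [x], but that trace is the
    sum of the values of [u0] on the fibre, namely 1. *)
Lemma uniformizing_shift x g0 u0 : good x -> g0 \in S x -> inR u0 ->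
  (forall g, g \in S x -> val x g u0 = (g == g0)%:R) ->
  exists c, ~~ (('X - x%:P) ^+ r %| Nm (u0 + jk c * (t - jk x))).
Proof.
move=> gx g0S Ru0 vu0.
have r0 : (0 < r)%N by rewrite -(card_S gx); apply/card_gt0P; exists g0.
have Rtx : inR (t - jk x) by apply: inRB; [exact: inRt|exact: inRC].
pose u c := u0 + jk c * (t - jk x).
have Ru c : inR (u c) by apply: inRD => //; apply: inRM => //; apply: inRC.
apply: contrapT => dv0; have dv c : ('X - x%:P) ^+ r %| Nm (u c).
  by apply: contraT => ndv; case: dv0; exists c.
pose a := char_poly (- Mat u0).
have Nu c : Nm (u c) = \sum_(i < r.+1) c ^+ i *: (a`_i * ('X - x%:P) ^+ i).
  have -> : Nm (u c) = a.[c%:P * ('X - x%:P)].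
    rewrite /Nm MatD //; last by apply: inRM => //; apply: inRC.
    have -> : jk c * (t - jk x) = pv (c%:P * ('X - x%:P)).
      by rewrite (rmorphM pv) (rmorphB pv) /= pvX !pvC.
    rewrite Mat_pv /a /char_poly -[_.[_]]/(horner_eval _ _) -det_map_mx; congr (\det _).
    apply/matrixP => i j; rewrite !mxE /= /horner_eval hornerD hornerN hornerMn hornerX hornerC.
    by rewrite opprK addrC.
  rewrite (@horner_coef_wide _ r.+1); last by rewrite size_char_poly.
  by apply: eq_bigr => i _; rewrite exprMn -polyC_exp mulrCA mul_polyC.
pose D := ('X - x%:P) ^+ r.
pose rho i := (a`_i * ('X - x%:P) ^+ i) %% D.
have rho0 i : (i < r.+1)%N -> rho i = 0.
  move=> ir; apply/polyP => l; rewrite coef0.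
  pose P := \poly_(i < r.+1) (rho i)`_l.
  have P0 : P = 0.
    apply/eqP; apply: contraT => /k_inf[c]; rewrite horner_poly.
    have := dv c; rewrite Nu /dvdp -/D => /eqP.
    have -> : (\sum_(i < r.+1) c ^+ i *: (a`_i * ('X - x%:P) ^+ i)) %% D =
              \sum_(i < r.+1) c ^+ i *: rho i.
      rewrite (big_morph (fun p => p %% D) (fun p q => modpD D p q) (mod0p D)).
      by apply: eq_bigr => i' _; rewrite modpZl.
    move=> /(congr1 (coefp l)) /=; rewrite coef0 coef_sum => e.
    case/eqP; rewrite -[RHS]e; apply: eq_bigr => i' _; by rewrite coefZ mulrC.
  have /(congr1 (coefp i)) := P0; rewrite /= coef0 coef_poly ir //.
have : ('X - x%:P) ^+ r %| a`_r.-1 * ('X - x%:P) ^+ r.-1.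
  by apply/eqP; apply: rho0; rewrite prednK.
rewrite -{1}(prednK r0) exprS dvdp_mul2r ?expf_neq0 ?polyXsubC_eq0 //.
rewrite dvdp_XsubCl rootE char_poly_trace // (raddfN (@mxtrace _ r)) opprK.
have := unit_conj_diag_trace (card_S gx) (Vm_free gx) (Mat_val gx Ru0).
rewrite -[(\tr _).[x]]/(horner_eval x _) -trace_map_mx => ->.
rewrite (bigD1 (enum_rank_in g0S g0)) //= enum_rankK_in // vu0 // eqxx big1 ?addr0 ?oner_eq0 //.
move=> j jn; rewrite vu0 ?enum_valP //.
case: eqP => // e; case/eqP: jn; apply: enum_val_inj; by rewrite enum_rankK_in.
Qed.

(** [u] vanishes at all points of the fibre except [g0], so [u y] is divisible by [t - x] whenever
    [y] vanishes at [g0]. The last clause limits the order of vanishing of [u] over [x], as seen by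
    its norm, to less than [r]. *)
Lemma uniformizing x g0 : good x -> g0 \in S x -> exists u, [/\ inR u,
  forall y, inR y -> val x g0 y = 0 -> exists2 y', inR y' & u * y = (t - jk x) * y'
  & ~~ (('X - x%:P) ^+ r %| Nm u)].
Proof.
move=> gx g0S; have [u0 Ru0 vu0] := @val_interp x (fun g => (g == g0)%:R) gx.
have [c nc] := uniformizing_shift gx g0S Ru0 vu0.
have Rtx : inR (t - jk x) by apply: inRB; [exact: inRt|exact: inRC].
exists (u0 + jk c * (t - jk x)).
have Ru : inR (u0 + jk c * (t - jk x)) by apply: inRD => //; apply: inRM => //; apply: inRC.
split=> // y Ry vy; apply: val_div => // [|g gS]; first exact: inRM.
rewrite val_M // val_D //; last by apply: inRM => //; apply: inRC.
rewrite vu0 // val_M ?val_C //; last exact: inRC.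
have -> : val x g (t - jk x) = 0.
  have := @val_pv x g ('X - x%:P) gx gS.
  by rewrite hornerXsubC subrr (rmorphB pv) /= pvX pvC.
by rewrite mulr0 addr0; case: eqP => [->|_]; rewrite ?vy ?mulr0 ?mul0r.
Qed.

Hypothesis good_cofinite : exists2 P : {poly k}, P != 0 & forall x, P.[x] != 0 -> good x.
Variable Q : nat.
Hypothesis Q_add : forall x y : Om, (x + y) ^+ Q = x ^+ Q + y ^+ Q.
Hypothesis r0 : (0 < r)%N.

(** The core of Stepanov's method: a power [z^Q] is constant up to order [Q] at a point. With [v_i]
    the value of [z_i] at a point where [z_i0] does not vanish, [F = sum v_i^Q y_i = sum y_i (v_i -
    z_i)^Q] has weight at most [a], is nonzero by independence of the [y_i], and vanishes to order
    [Q] there. The assumption [r a < Q] forbids this. *)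
Lemma power_independent (I : finType) a (y z : I -> Om) : (r * a < Q)%N ->
  (forall i, W a (y i)) -> (forall c, \sum_i jk (c i) * y i = 0 -> forall i, c i = 0) ->
  (forall i, inR (z i)) -> \sum_i y i * z i ^+ Q = 0 -> forall i, z i = 0.
Proof.
move=> raQ Wy iy Rz rel i0; apply/eqP; apply: contraT => z0.
have [B B0 Bgood] := good_cofinite.
have [x] : exists x, (B * Nm (z i0)).[x] != 0 by apply: k_inf; rewrite mulf_neq0 ?Nm_neq0.
rewrite hornerM mulf_eq0 negb_or => /andP[/Bgood gx Nx].
have [g0 g0S] : exists g0, g0 \in S x by apply/card_gt0P; rewrite card_S.
have [u [Ru uP Nu]] := uniformizing gx g0S.
have Ry i : inR (y i) by exists a.
have Q0 : (0 < Q)%N by lia.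
have Q_sub (p s : Om) : (p - s) ^+ Q = p ^+ Q - s ^+ Q.
  by apply/eqP; rewrite eq_sym subr_eq -Q_add subrK.
have Q0E : (0 : Om) ^+ Q = 0 by rewrite expr0n; case: Q Q0.
have Q_sum (f : I -> Om) : (\sum_i f i) ^+ Q = \sum_i f i ^+ Q.
  exact: (big_morph (fun s => s ^+ Q) Q_add Q0E).
pose v i := val x g0 (z i).
have v0 : v i0 != 0.
  apply: contra Nx => v0; rewrite -rootE -dvdp_XsubCl.
  have := zer_dvd gx (Rz i0); apply: dvdp_trans.
  rewrite -{1}['X - _]expr1 dvdp_exp2l //; apply/card_gt0P; exists g0.
  by rewrite inE g0S.
pose F := \sum_i jk (v i ^+ Q) * y i.
have WF : W a F.
  by apply: W_sum => i _; rewrite -[a]add0n; apply: W_M.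
have RF : inR F by exists a.
have F0 : F != 0.
  apply/eqP => /iy/(_ i0) /eqP; rewrite expf_eq0 (negPf v0) andbF //.
have FE : F = \sum_i y i * (jk (v i) - z i) ^+ Q.
  transitivity (F - \sum_i y i * z i ^+ Q); first by rewrite rel subr0.
  rewrite /F -sumrB; apply: eq_bigr => i _.
  by rewrite Q_sub mulrBr rmorphXn [jk _ ^+ _ * _]mulrC.
have /choice[z' z'P] : forall i, exists z', inR z' /\ u * (jk (v i) - z i) = (t - jk x) * z'.
  move=> i; have [|z' Rz' e] := uP _ (inRB (inRC (v i)) (Rz i)); last by exists z'.
  have vzi : val x g0 (jk (v i) - z i) + val x g0 (z i) = val x g0 (jk (v i)).
    rewrite -val_D ?subrK //; apply: inRB => //; exact: inRC.
  by apply/eqP; rewrite -(inj_eq (addIr (val x g0 (z i)))) vzi val_C // add0r.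
pose F' := \sum_i y i * z' i ^+ Q.
have RF' : inR F' by apply: inR_sum => i _; apply: inRM => //; apply: inRX; exact: (z'P i).1.
(* Orders at [x] are compared through norms. On the left [Nm u] contributes at most [r - 1] per
   factor and [Nm F] at most [r a]; on the right there is at least [r Q]. *)
have uF : u ^+ Q * F = pv ('X - x%:P) ^+ Q * F'.
  rewrite FE !mulr_sumr; apply: eq_bigr => i _.
  rewrite mulrCA -exprMn (z'P i).2 exprMn mulrCA (rmorphB pv) /= pvX pvC //.
have u0 : u != 0.
  apply: contraNneq Nu => ->; rewrite -(rmorph0 pv) Nm_pv expr0n.
  by move: r0; case: r => //= ? _; rewrite dvdp0.
have tx0 : pv ('X - x%:P) != 0.
  by apply/eqP => /t_tr/eqP; rewrite polyXsubC_eq0.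
have F'0 : F' != 0.
  apply/eqP => F'0; move/eqP: uF; rewrite F'0 mulr0 mulf_eq0 (negPf F0) orbF.
  by rewrite expf_eq0 (negPf u0) andbF.
have := congr1 (fun y => mup x (Nm y)) uF.
rewrite /= !NmM //; try by [apply: inRX|apply/inRX/inRpv].
rewrite !NmX //; last exact: inRpv.
rewrite Nm_pv -!exprM !mupM ?expf_neq0 ?Nm_neq0 ?polyXsubC_eq0 //.
rewrite mup_XsubCX eqxx.
have mX (p : {poly k}) e : p != 0 -> mup x (p ^+ e) = (e * mup x p)%N.
  move=> p0; elim: e => [|e IH]; last by rewrite exprS mupM ?expf_neq0 // IH mulSn.
  by rewrite expr0 mupNroot // rootC oner_eq0.
rewrite mX ?Nm_neq0 //; move: Nu; rewrite -mup_ltn ?Nm_neq0 //.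
have : (mup x (Nm F) <= r * a)%N.
  rewrite -ltnS; apply: leq_trans (Nm_size WF).
  have := mup_geq x (mup x (Nm F)) (Nm_neq0 RF F0); rewrite leqnn => /esym dF.
  by have := dvdp_leq (Nm_neq0 RF F0) dF; rewrite size_exp_XsubC.
set A := mup x (Nm u); set B' := mup x (Nm F); set C' := mup x _ => Ba Ar e.
have H : (Q * A + Q <= r * Q)%N by rewrite addnC -mulnS mulnC leq_mul2r Ar orbT.
clear -raQ Ba e H; lia.
Qed.
End Curve.

(** * Linear algebra and inequalities for Stepanov's method *)

Lemma left_kernel (k : fieldType) m n (A : 'M[k]_(m, n)) : (n < m)%N ->
  exists2 v : 'rV_m, v != 0 & v *m A = 0.
Proof.
move=> nm; have : kermx A != 0.
  rewrite kermx_eq0 /row_free neq_ltn; apply/orP; left.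
  exact: leq_ltn_trans (rank_leq_col A) nm.
by case/rowV0Pn => v /sub_kermxP vA v0; exists v.
Qed.

Lemma char_expD (k : fieldType) p j : p \in [pchar k] ->
  {morph (fun x : k => x ^+ (p ^ j)) : x y / x + y}.
Proof.
move=> pk x y; apply: exprDn_pchar; rewrite (eq_pnat _ (pcharf_eq pk)).
by rewrite pnatX pnat_id ?(pcharf_prime pk).
Qed.

Lemma char_exp_sum (k : fieldType) p j (I : finType) (f : I -> k) : p \in [pchar k] ->
  (\sum_i f i) ^+ (p ^ j) = \sum_i f i ^+ (p ^ j).
Proof.
move=> pk; apply: (big_morph (fun x : k => x ^+ (p ^ j)) (char_expD j pk)).
by rewrite expr0n expn_eq0 eqn0Ngt prime_gt0 ?(pcharf_prime pk).
Qed.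

Lemma closed_power_root (k : closedFieldType) n (d : k) : (0 < n)%N -> exists c, c ^+ n = d.
Proof.
move=> n0; have [|c] := @closed_root k ('X^n - d%:P).
  by rewrite size_XnsubC.
by rewrite rootE !hornerE subr_eq0 => /eqP<-; exists c.
Qed.

Lemma map_exp_mulmx (k : fieldType) p n m1 m2 m3 (A : 'M[k]_(m1, m2)) (B : 'M_(m2, m3)) :
  p \in [pchar k] -> map_mx (fun c => c ^+ (p ^ n)) (A *m B) =
  map_mx (fun c => c ^+ (p ^ n)) A *m map_mx (fun c => c ^+ (p ^ n)) B.
Proof.
move=> pk; apply/matrixP => a c; rewrite !mxE (char_exp_sum n _ pk); apply: eq_bigr => l _.
by rewrite exprMn !mxE.
Qed.

Lemma horner_map_exp (k : fieldType) p n (P : {poly k}) (x : k) : p \in [pchar k] ->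
  (map_poly (fun c => c ^+ (p ^ n)) P).[x ^+ (p ^ n)] = P.[x] ^+ (p ^ n).
Proof.
move=> pk; rewrite (@horner_coef_wide _ (size P)) ?size_poly // horner_coef.
rewrite (char_exp_sum n _ pk); apply: eq_bigr => i _.
rewrite coef_map_id0; first by rewrite exprMn -!exprM mulnC.
by rewrite expr0n expn_eq0 eqn0Ngt prime_gt0 ?(pcharf_prime pk).
Qed.

Lemma power_roots_size (k : fieldType) Q (T : seq k) : (1 < Q)%N -> uniq T ->
  (forall x, x \in T -> x ^+ Q = x) -> (size T <= Q)%N.
Proof.
move=> Q1 uT TQ; rewrite -ltnS.
have sP : size ('X^Q - 'X : {poly k}) = Q.+1.
  by rewrite size_polyDl ?size_polyXn // size_polyN size_polyX ltnS.
rewrite -sP; apply: max_poly_roots => //; first by rewrite -size_poly_eq0 sP.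
by apply/allP => x /TQ xQ; rewrite rootE !hornerE xQ subrr.
Qed.

Lemma prime_power_between p m : (1 < p)%N -> (0 < m)%N -> exists j, (m < p ^ j <= p * m)%N.
Proof.
move=> p1 m0; exists (trunc_log p m).+1.
by rewrite trunc_log_ltn //= expnS leq_mul2l trunc_logP ?orbT.
Qed.

(** The dimension count behind the upper bound, for [a = 2 (w + 1)] and [B = w + be], with [P = p^i]
    and [be] just above [2 P / r]. *)
Lemma arith_upper1 P r w be : (0 < P)%N -> (0 < r)%N -> (2 * P < r * be)%N -> (be <= 2 * P + 1)%N ->
  (P * (2 * w.+1) + (w + be) + 1 < r * ((2 * w.+1 - w).+1 * (w + be - w).+1))%N.
Proof.
move=> P0 r0 h1 h2; rewrite addKn.
have -> : (2 * w.+1 - w).+1 = w.+3 by lia.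
have -> : (r * (w.+3 * be.+1) = w.+3 * (r * be) + w.+3 * r)%N by lia.
have h3 : (w.+3 * (2 * P).+1 <= w.+3 * (r * be))%N by rewrite leq_mul2l h1 orbT.
have h4 : (w.+3 <= w.+3 * r)%N by rewrite leq_pmulr.
by move: h3 h4 h2 P0; clear; move: (r * be)%N (w.+3 * r)%N => x y; lia.
Qed.

(** With the larger value [a - w = 8 r (w + 1)] the bound for one Frobenius class exceeds [P u],
    which is the number [p^n] of points, by a factor of at most [1 + 1/(4 r)]. Here [u] is [p^j],
    and [d] is [B - w]. *)
Lemma arith_lower1 w r a P u p d : (0 < r)%N -> (0 < p)%N -> (0 < u)%N ->
  a = (w + 8 * r * w.+1)%N -> (d * (r * (8 * r * w.+1).+1 - 1) <= P * a + w + 1)%N ->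
  (u <= 9 * p * r ^ 2 * w.+1)%N -> (144 * p * r ^ 4 * w.+1 ^ 2 <= P * u)%N ->
  (4 * r * (r * (a + u * (w + d))) <= (4 * r + 1) * (P * u))%N.
Proof.
set W := w.+1 => r0 p0 u0 aE dD Q'l big.
pose al := (8 * r * W)%N; pose Q := (P * u)%N.
have a9 : (a <= 9 * r * W)%N.
  have : (1 * W <= r * W)%N by rewrite leq_mul2r r0 orbT.
  by rewrite aE mul1n -!mulnA; move: (r * W)%N => x; rewrite /W; clear; lia.
have rj : (r * d * al <= P * a + w + 1)%N.
  apply: leq_trans dD; rewrite [X in (X <= _)%N]mulnAC mulnC leq_mul2l.
  apply/orP; right; rewrite -/al mulnS; move: (r * al)%N r0 => x; clear; lia.
have e1 : (u * (r * d * al) <= Q * a + u * W)%N.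
  apply: leq_trans (_ : u * (P * a + w + 1) <= _)%N; first by rewrite leq_mul2l rj orbT.
  by rewrite /Q /W; clear; lia.
have e2 : (8 * r * W * (u * (r * d)) <= Q * (w + 8 * r * W) + u * W)%N.
  by move: e1; rewrite aE /al; clear; lia.
pose Z := (9 * p * r ^ 3 * W ^ 2)%N.
have e3 : (u * r * W <= Z)%N.
  have -> : (Z = (9 * p * r ^ 2 * W) * (r * W))%N by rewrite /Z; clear; lia.
  by rewrite -mulnA leq_mul2r Q'l orbT.
have e4 : (r * a <= Z)%N.
  apply: leq_trans (_ : r * (9 * r * W) <= _)%N; first by rewrite leq_mul2l a9 orbT.
  have -> : (Z = r * (9 * r * W) * (p * r * W))%N by rewrite /Z; clear; lia.
  by rewrite leq_pmulr // !muln_gt0 r0 p0.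
have e5 : (144 * p * r ^ 4 * W ^ 2 = 16 * r * Z)%N by rewrite /Z; clear; lia.
rewrite e5 -/Q in big.
have e6 : (2 * W * (4 * r * (u * (r * d))) <= 2 * W * (4 * r * Q) + W * Q + u * W)%N.
  by move: e2; rewrite /W; clear; lia.
have e7 : (8 * r * (u * (r * d)) <= 8 * r * Q + Q + u)%N.
  by rewrite -(leq_pmul2l (ltn0Sn w)) -/W; move: e6; clear; lia.
rewrite -(leq_pmul2l (ltn0Sn 1)) -/Q.
have -> : (2 * (4 * r * (r * (a + u * (w + d)))) =
  8 * r * (r * a) + 8 * r * (u * r * w) + 8 * r * (u * (r * d)))%N by clear; lia.
have e9 : (8 * r * (u * r * w) + 8 * r * (u * r) = 8 * r * (u * r * W))%N.
  by rewrite /W; clear; lia.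
have e10 : (8 * r * (r * a) <= 8 * r * Z)%N by rewrite leq_mul2l e4 orbT.
have e11 : (8 * r * (u * r * W) <= 8 * r * Z)%N by rewrite leq_mul2l e3 orbT.
have e12 : (u <= 8 * r * (u * r))%N by rewrite mulnCA leq_pmulr // !muln_gt0 r0.
have e14 : (16 * r * Z = 2 * (8 * r * Z))%N by clear; lia.
rewrite e14 in big.
move: e7 e9 e10 e11 e12 big; clear.
move: (8 * r * (u * (r * d)))%N (8 * r * (u * r * w))%N (8 * r * (u * r))%N
    (8 * r * (u * r * W))%N (8 * r * (r * a))%N (8 * r * Z)%N => u1 u2 u3 u4 u5 u7.
by rewrite mulnDl mul1n mulnA; lia.
Qed.

(** From a total of [r S] pairs, [r - 1] classes of at most [X] pairs are removed. The exceptional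
    points cost at most [v / 4] and the excess of [X] over [v] costs less than [v / 4], so that at
    least [v / 2] remains. *)
Lemma arith_lower2 r X v S bad F : (0 < r)%N -> (4 * r * X <= (4 * r + 1) * v)%N ->
  (v <= S + bad)%N -> (4 * r * bad <= v)%N -> (r * S <= r * F + (r - 1) * X)%N ->
  (v <= 2 * r * F)%N.
Proof.
move=> r0 X4 sT bT e.
have h1 : (4 * r * ((r - 1) * X) <= (r - 1) * ((4 * r + 1) * v))%N.
  by rewrite mulnCA leq_mul2l X4 orbT.
have h2 : (4 * r * (r * S) <= 4 * r * (r * F + (r - 1) * X))%N by rewrite leq_mul2l e orbT.
have h3 : (4 * r * r * v <= 4 * r * r * (S + bad))%N by rewrite leq_mul2l sT orbT.
have h4 : (r * (4 * r * bad) <= r * v)%N by rewrite leq_mul2l bT orbT.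
rewrite -(@leq_pmul2l (2 * r)) ?muln_gt0 ?r0 //.
clear X4 sT bT e; case: r r0 h1 h2 h3 h4 => // s _; rewrite subn1 /= => h1 h2 h3 h4.
lia.
Qed.

(** * Specialisations of a generic solution, and the count of Frobenius classes *)

Section Fibres.
Variables (Fq : finFieldType) (k : closedFieldType) (ik : {rmorphism Fq -> k}) (N : nat).
Variables (L : 'M[{poly Fq}]_N) (h : nat).
Hypothesis Lh : forall a b, (size (L a b) <= h.+1)%N.
Variables (Om : fieldType) (jk : {rmorphism k -> Om}) (t : Om).
Hypothesis t_tr : forall P, pv jk t P = 0 -> P = 0.
Variable Yg : 'M[Om]_N.
Hypothesis Yg_sol : sol ik L jk t Yg.
Hypothesis Yg_unit : Yg \in unitmx.
Local Notation q := #|Fq|.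
Local Notation rc := (rc Fq k N).
Local Notation rep := (rep ik L h).
Local Notation fam := (fam k N).
Local Notation eid := (@idfun k : {rmorphism k -> k}).

Definition gen (f : rc) := ev jk t Yg f.
Definition WW a y := exists2 f, wt h a f & gen f = y.
(** The largest weight of a reduced monomial. *)
Definition wm := (h * (q.-1 * (N * N)))%N.
Definition eM (i : 'I_#|{: Mon Fq N}|) : Mon Fq N := enum_val i.
Definition mm (i : 'I_#|{: Mon Fq N}|) : Om := mon Yg (fun ij => eM i ij).
Definition goodp (x : k) : Prop := evL ik L eid x \in unitmx.
Definition Yx (x : k) : 'M[k]_N :=
  xget 0 [set Y | Y \in unitmx /\ sol ik L eid x Y]%classic.
Definition fpt (x : k) (g : 'M[Fq]_N) : 'M[k]_N := Yx x *m map_mx ik g.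
Definition eva x g (f : rc) : k := ev eid x (fpt x g) f.
(** The specialisations of the generic solution over [x]: solutions [Yx x g] at which every
    algebraic relation satisfied by [(t, Yg)] still holds. A solution is recorded by its matrix [g]
    over [Fq]. *)
Definition SS x : {set 'M[Fq]_N} := [set g | `[< forall f, gen f = 0 -> eva x g f = 0 >]].
(** The choice of a representative of [y] is harmless on [SS x], by [vvE]. *)
Definition vv x g (y : Om) : k := eva x g (xget 0 [set f | gen f = y]%classic).

Lemma rep_WW a F : rep a F -> WW a (F Om jk t Yg).
Proof. by move=> [f wf fF]; exists f => //; apply: fF. Qed.

Lemma WW_C c : WW 0 (jk c). Proof. exact: (rep_WW (rep_const ik Lh c)). Qed.

Lemma WW_t : WW 1 t.
Proof.
have := rep_WW (@rep_poly _ _ ik _ L h Lh 'X 1 _); rewrite map_polyX hornerX; apply.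
by rewrite size_polyX.
Qed.

Lemma WW_D a x y : WW a x -> WW a y -> WW a (x + y).
Proof. by move=> [f wf <-] [g wg <-]; apply: rep_WW (rep_add (rep_ev ik L wf) (rep_ev ik L wg)). Qed.

Lemma WW_M a b x y : WW a x -> WW b y -> WW (a + b) (x * y).
Proof. by move=> [f wf <-] [g wg <-]; apply: rep_WW (rep_mul Lh (rep_ev ik L wf) (rep_ev ik L wg)). Qed.

Lemma WW_le a b x : (a <= b)%N -> WW a x -> WW b x.
Proof.
by move=> ab [f wf <-]; exists f => // e fe0; apply: leq_trans (wf e fe0) _.
Qed.

Lemma mdeg_le (e : Mon Fq N) : (mdeg e <= q.-1 * (N * N))%N.
Proof.
have H ij : (e ij <= q.-1)%N.
  by have := ltn_ord (e ij); case: (e ij) => /= n _; case: #|Fq| (q_gt0 Fq) => // n' _; rewrite ltnS.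
apply: leq_trans (_ : \sum_(ij : 'I_N * 'I_N) q.-1 <= _)%N; first exact: leq_sum.
by rewrite sum_nat_const card_prod card_ord mulnC.
Qed.

Lemma WW_m i : WW wm (mm i).
Proof.
apply: (@WW_le (h * mdeg (eM i))); last first.
  exact: (rep_WW (rep_mon ik Lh (fun ij => nat_of_ord (eM i ij)))).
by rewrite leq_mul2l mdeg_le orbT.
Qed.

Lemma WW_span a x : WW a x -> exists2 P : 'I_#|{: Mon Fq N}| -> {poly k},
  (forall e, (size (P e) <= a.+1)%N) & x = \sum_e pv jk t (P e) * mm e.
Proof.
move=> [f wf <-]; exists (fun i => f (eM i)) => [i|].
  have [->|/wf] := eqVneq (f (eM i)) 0; first by rewrite size_poly0.
  by apply: leq_trans; apply: leq_addr.
rewrite /gen /ev (reindex (@enum_val _ (mem {: Mon Fq N}))) //=.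
by apply: onW_bij; apply: enum_val_bij.
Qed.

Lemma map_idfun_poly (P : {poly k}) : map_poly eid P = P.
Proof. by apply: map_poly_id. Qed.

Lemma YxP x : goodp x -> Yx x \in unitmx /\ sol ik L eid x (Yx x).
Proof.
move=> gx; rewrite /Yx; case: xgetP => // H; exfalso.
have [Y Yu Ys] := lang ik gx.
by apply: (H Y); split=> //; rewrite /sol -Ys.
Qed.

Lemma fpt_sol x g : goodp x -> sol ik L eid x (fpt x g).
Proof.
by move=> gx; have := @sol_mulr _ _ ik _ L _ eid x _ g (YxP gx).2.
Qed.

(** The quotient of two solutions is fixed by Frobenius, hence has entries in [Fq]. *)
Lemma fpt_onto x Y : goodp x -> sol ik L eid x Y -> exists g, Y = fpt x g.
Proof.
move=> gx sY; have [Yu sx] := YxP gx; pose Z := invmx (Yx x) *m Y.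
have fZ : map_mx (frq ik) Z = Z.
  have e1 : map_mx (frq ik) Y = map_mx (frq ik) (Yx x) *m map_mx (frq ik) Z.
    by rewrite -map_mxM mulKVmx.
  have sx' : map_mx (frq ik) (Yx x) = evL ik L eid x *m Yx x by [].
  have sY' : map_mx (frq ik) Y = evL ik L eid x *m Y by [].
  rewrite sx' sY' -{1}(mulKVmx Yu Y) -/Z -!mulmxA in e1.
  have := congr1 (mulmx (invmx (evL ik L eid x))) e1; rewrite !mulKmx //.
  by move/(congr1 (mulmx (invmx (Yx x)))); rewrite !mulKmx.
have [g Zg] := map_frq_fixed fZ.
by exists g; rewrite /fpt -Zg mulKVmx.
Qed.

Lemma eva_rep a F x : goodp x -> rep a F ->
  exists2 f, wt h a f & gen f = F Om jk t Yg /\ forall g, eva x g f = F k eid x (fpt x g).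
Proof. by move=> gx [f wf fF]; exists f => //; split=> [|g']; apply: fF => //; apply: fpt_sol. Qed.

(** On [Fq] the function [1 - z^(q-1)] is the indicator of [0]. When [A] is inverse to [Yx x], the
    entries of [A Y] at the solution labelled [g'] are those of [g'], so the product tells whether
    [g' = g]. *)
Lemma indicator (A : 'M[k]_N) : exists a, forall g : 'M[Fq]_N,
  rep a (fun K i x Y => \prod_(ij : 'I_N * 'I_N)
     (1 - ((map_mx i A *m Y) ij.1 ij.2 - i (ik (g ij.1 ij.2))) ^+ q.-1)).
Proof.
pose a := (\sum_(ij : 'I_N * 'I_N) q.-1 * h)%N.
exists a => g.
have H : forall s : seq ('I_N * 'I_N), rep (\sum_(ij <- s) q.-1 * h)
   (fun K i x Y => \prod_(ij <- s)
     (1 - ((map_mx i A *m Y) ij.1 ij.2 - i (ik (g ij.1 ij.2))) ^+ q.-1)).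
  elim=> [|ij s IH].
    by apply: rep_ext (rep_le _ (rep_const ik Lh 1)) => [K i x Y _|//]; rewrite big_nil rmorph1.
  rewrite big_cons.
  apply: (@rep_ext _ _ ik _ L h _ (fun K i x Y => (i 1 + i (-1) *
     ((map_mx i A *m Y) ij.1 ij.2 + i (- ik (g ij.1 ij.2))) ^+ q.-1) *
     \prod_(ij <- s) (1 - ((map_mx i A *m Y) ij.1 ij.2 - i (ik (g ij.1 ij.2))) ^+ q.-1))).
    by move=> K i x Y _; rewrite big_cons !rmorphN rmorph1 mulN1r.
  apply: rep_mul => //; apply: rep_add.
    by apply: rep_le (rep_const ik Lh 1).
  apply: rep_scale => //; apply: rep_exp => //; apply: rep_add; first exact: rep_lin.
  by apply: rep_le (rep_const ik Lh _).
exact: H.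
Qed.

Lemma unit_indicator (a b : Fq) : 1 - (ik a - ik b) ^+ q.-1 = (a == b)%:R :> k.
Proof.
rewrite -rmorphB -rmorphXn; have [->|ab] := eqVneq a b.
  by rewrite subrr expr0n -[(q.-1 == 0)%N]negbK -lt0n -ltnS prednK ?q_gt0 ?q_gt1 // rmorph0 subr0.
have ab0 : a - b != 0 by rewrite subr_eq0.
have -> : (a - b) ^+ q.-1 = 1.
  by apply: (mulfI ab0); rewrite -exprS prednK ?q_gt0 // expf_card mulr1.
by rewrite rmorph1 subrr.
Qed.

Lemma fibre_indicator x : goodp x -> exists2 U : 'M[Fq]_N -> rc,
  (forall g g', eva x g' (U g) = (g' == g)%:R) & exists a, forall g, wt h a (U g).
Proof.
move=> gx; have [a ra] := indicator (invmx (Yx x)).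
have /choice[U UP] : forall g, exists f, wt h a f /\ forall g', eva x g' f = (g' == g)%:R.
  move=> g; have [f wf [_ fE]] := eva_rep gx (ra g); exists f; split=> // g'.
  rewrite fE /fpt.
  have -> : map_mx eid (invmx (Yx x)) = invmx (Yx x) by apply/matrixP => i j; rewrite mxE.
  rewrite mulKmx ?(YxP gx).1 //.
  under eq_bigr do rewrite mxE unit_indicator.
  have [->|gg] := eqVneq g' g; first by rewrite big1 // => ij _; rewrite eqxx.
  have [i [j /negPf gij]] : exists i j, g' i j != g i j.
    apply: contrapT => H; case/eqP: gg; apply/matrixP => i j; apply/eqP.
    by apply: contraT => nij; case: H; exists i, j.
  by rewrite (bigD1 (i, j)) //= gij mul0r.
by exists U => [g g'|]; [apply: (UP g).2|exists a => g; apply: (UP g).1].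
Qed.

Lemma eva_coef x g f : eva x g f = \sum_e (f e).[x] * mon (fpt x g) (fun ij => e ij).
Proof. by apply: eq_bigr => e _; rewrite map_idfun_poly. Qed.

Lemma card_Mon : #|{: Mon Fq N}| = #|{: 'M[Fq]_N}|.
Proof. by rewrite card_ffun card_mx card_ord card_prod card_ord. Qed.

(** There are as many reduced monomials as matrices over [Fq]. By the indicators evaluation at all
    solutions over [x] is surjective, hence injective. *)
Lemma vanish_fibre x f : goodp x -> (forall g, eva x g f = 0) -> forall e, (f e).[x] = 0.
Proof.
move=> gx f0; have [U UP _] := fibre_indicator gx.
pose A : 'M[k]_(#|{: Mon Fq N}|, #|{: 'M[Fq]_N}|) :=
  \matrix_(i, j) mon (fpt x (enum_val j)) (fun ij => eM i ij).
have AE g (f' : rc) (v : 'rV_#|{: Mon Fq N}|) :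
    v = \row_i (f' (eM i)).[x] -> (v *m A) 0 g = eva x (enum_val g) f'.
  move=> ->; rewrite mxE eva_coef (reindex (@enum_val _ (mem {: Mon Fq N}))) /=.
    by apply: eq_bigr => i _; rewrite !mxE.
  by apply: onW_bij; apply: enum_val_bij.
have fullA : row_full A.
  apply/row_fullP; exists (\matrix_j \row_i (U (enum_val j) (eM i)).[x]).
  apply/matrixP => i j; rewrite [RHS]mxE.
  have := AE j (U (enum_val i)) _ erefl; rewrite UP (inj_eq enum_val_inj) eq_sym => <-.
  by rewrite !mxE; apply: eq_bigr => l _; rewrite !mxE.
have freeA : row_free A.
  have /eqP fA : \rank A == #|{: 'M[Fq]_N}| := fullA.
  by apply/eqP; rewrite [LHS]fA -card_Mon.
move=> e; pose v := \row_i (f (eM i)).[x] : 'rV[k]_#|{: Mon Fq N}|.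
have v0 : v *m A = 0 by apply/rowP => g; rewrite (AE _ f) // f0 mxE.
have /rowP/(_ (enum_rank e)) : v = 0.
  by apply: (row_free_inj freeA); rewrite v0 mul0mx.
by rewrite /v !mxE /eM enum_rankK.
Qed.

Lemma vanish_fibre_div x a (f : rc) : goodp x -> wt h a f -> (forall g, eva x g f = 0) ->
  exists2 f' : rc, wt h a f' & forall (K : fieldType) (i : {rmorphism k -> K}) y Y,
    ev i y Y f = (y - i x) * ev i y Y f'.
Proof.
move=> gx wf f0; have fx := vanish_fibre gx f0.
pose f' : rc := [ffun e => f e %/ ('X - x%:P)].
have fE e : f e = ('X - x%:P) * f' e.
  by rewrite ffunE mulrC divpK // dvdp_XsubCl rootE fx.
exists f' => [e f'e|K i y Y].
  have fe0 : f e != 0 by rewrite fE mulf_neq0 ?polyXsubC_eq0.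
  apply: leq_trans (wf e fe0); rewrite leq_add2r fE size_mul ?polyXsubC_eq0 //.
  by rewrite size_XsubC /= leqnSn.
rewrite /ev mulr_sumr; apply: eq_bigr => e _.
by rewrite fE rmorphM rmorphB /= map_polyX map_polyC hornerM hornerXsubC mulrA.
Qed.

Lemma SSP x g : reflect (forall f, gen f = 0 -> eva x g f = 0) (g \in SS x).
Proof. by rewrite inE; apply: asboolP. Qed.

Lemma ev_sub (K : fieldType) (i : {rmorphism k -> K}) y Y (f f' : rc) :
  ev i y Y (f - f') = ev i y Y f - ev i y Y f'.
Proof. by have := evD i y Y (f - f') f'; rewrite subrK => ->; rewrite addrK. Qed.

Lemma vvE x g f : g \in SS x -> vv x g (gen f) = eva x g f.
Proof.
move=> /SSP gS; rewrite /vv; case: xgetP => [f' _ /= e|/(_ f) []//].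
apply/eqP; rewrite -subr_eq0 /eva -ev_sub; apply/eqP; apply: gS.
by rewrite /gen ev_sub -!/(gen _) e subrr.
Qed.

Lemma vv_rep x g a F : goodp x -> g \in SS x -> rep a F ->
  vv x g (F Om jk t Yg) = F k eid x (fpt x g).
Proof. by move=> gx gS rF; have [f _ [<- fE]] := eva_rep gx rF; rewrite vvE. Qed.

Local Notation inRW := (inR WW).

Lemma vv_D x g y z : goodp x -> g \in SS x -> inRW y -> inRW z ->
  vv x g (y + z) = vv x g y + vv x g z.
Proof.
move=> gx gS [a [f wf <-]] [b [f' wf' <-]].
by rewrite -evD -!/(gen _) !vvE // /eva evD.
Qed.

Lemma vv_M x g y z : goodp x -> g \in SS x -> inRW y -> inRW z ->
  vv x g (y * z) = vv x g y * vv x g z.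
Proof.
move=> gx gS [a [f wf <-]] [b [f' wf' <-]].
by rewrite (vv_rep gx gS (rep_mul Lh (rep_ev ik L wf) (rep_ev ik L wf'))) !vvE.
Qed.

Lemma vv_C x g c : goodp x -> g \in SS x -> vv x g (jk c) = c.
Proof. by move=> gx gS; rewrite (vv_rep gx gS (rep_const ik Lh c)). Qed.

Lemma vv_t x g : goodp x -> g \in SS x -> vv x g t = x.
Proof.
move=> gx gS; have := @rep_poly _ _ ik _ L h Lh 'X 1 _.
rewrite size_polyX => /(_ isT) /(vv_rep gx gS); rewrite !map_polyX !hornerX; exact.
Qed.

Lemma vv_interp x (v : 'M[Fq]_N -> k) : goodp x ->
  exists2 y, inRW y & forall g, g \in SS x -> vv x g y = v g.
Proof.
move=> gx; have [U UP [a Ua]] := fibre_indicator gx.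
have r1 : rep a (fun K i x Y => \sum_g i (v g) * ev i x Y (U g)).
  by apply: rep_sum => g _; apply: rep_scale => //; apply: rep_ev.
exists (\sum_g jk (v g) * gen (U g)); first by exists a; apply: (rep_WW r1).
move=> g gS; rewrite (vv_rep gx gS r1) (bigD1 g) //= -[ev _ _ _ _]/(eva x g _) UP eqxx mulr1.
rewrite big1 ?addr0 // => g' /negPf gg'.
by rewrite -[ev _ _ _ _]/(eva x g _) UP eq_sym gg' mulr0.
Qed.

(** Each solution outside [SS x] is excluded by some relation [fk g]. Adding multiples of [U g fk g]
    changes [f] by relations only and makes it vanish at all solutions over [x]; then [X - x]
    divides its coefficients. *)
Lemma vv_div x y : goodp x -> inRW y -> (forall g, g \in SS x -> vv x g y = 0) ->
  exists2 y', inRW y' & y = (t - jk x) * y'.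
Proof.
move=> gx [b [f wf <-]] f0; have [U UP [a Ua]] := fibre_indicator gx.
have /choice[fk fkP] : forall g, exists f', gen f' = 0 /\ (g \notin SS x -> eva x g f' != 0).
  move=> g; have [gS|gS] := boolP (g \in SS x).
    by exists 0; rewrite /gen ev0.
  apply: contrapT => H; case/SSP: gS => f' f'0; apply/eqP; apply: contraT => nf'.
  by case: H; exists f'.
have [c wfk] : exists c, forall g, wt h c (fk g).
  exists (\max_g \max_e (size (fk g e) + h * mdeg e))%N => g e _.
  apply: leqW; apply: leq_trans (@leq_bigmax _ (fun g => \max_e (size (fk g e) + h * mdeg e))%N g).
  exact: (@leq_bigmax _ (fun e => size (fk g e) + h * mdeg e)%N e).
pose cf g := if g \in SS x then 0 else - (eva x g f / eva x g (fk g)).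
have r1 : rep (b + (a + c)) (fun K i x Y => ev i x Y f +
    \sum_g i (cf g) * (ev i x Y (U g) * ev i x Y (fk g))).
  apply: rep_add; first by apply: rep_le (rep_ev ik L wf); apply: leq_addr.
  apply: rep_sum => g _; apply: rep_scale => //.
  apply: rep_le (rep_mul Lh (rep_ev ik L (Ua g)) (rep_ev ik L (wfk g))); exact: leq_addl.
have [f1 wf1 [gf1 f1E]] := eva_rep gx r1.
have gff : gen f1 = gen f.
  rewrite gf1 big1 ?addr0 // => g _.
  by rewrite [ev jk t Yg (fk g)](fkP g).1 !mulr0.
have [|f2 wf2 f2E] := vanish_fibre_div gx wf1.
  move=> g; rewrite f1E (bigD1 g) //= -![ev _ _ _ _]/(eva x _ _) UP eqxx mul1r.
  rewrite big1 ?addr0 => [|g' /negPf gg']; last first.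
    by rewrite -![ev _ _ _ _]/(eva x _ _) UP eq_sym gg' mul0r mulr0.
  rewrite /cf; case: ifP => gS; first by rewrite mul0r addr0 -vvE // f0.
  by rewrite mulNr divfK ?subrr //; apply: (fkP g).2; rewrite gS.
by exists (gen f2); [exists (b + (a + c))%N; exists f2|rewrite -gff /gen f2E].
Qed.

Lemma genL_unit : evL ik L jk t \in unitmx.
Proof.
have : map_mx (frq (jk \o ik)) Yg \in unitmx by rewrite map_unitmx.
by rewrite Yg_sol unitmx_mul => /andP[].
Qed.

Definition detL : {poly k} := \det (map_mx (map_poly ik) L).

Lemma detL_ev (K : fieldType) (i : {rmorphism k -> K}) y :
  (map_poly i detL).[y] = \det (evL ik L i y).
Proof.
rewrite -[_.[y]]/(horner_eval y _) -!det_map_mx -map_mx_comp; congr (\det _).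
by apply/matrixP => a b; rewrite !mxE /= /horner_eval -map_poly_comp.
Qed.

Lemma goodpP x : goodp x <-> detL.[x] != 0.
Proof. by rewrite /goodp unitmxE unitfE -detL_ev map_idfun_poly. Qed.

Lemma goodp_cofinite : exists2 P : {poly k}, P != 0 & forall x, P.[x] != 0 -> goodp x.
Proof.
exists detL; last by move=> x /goodpP.
have := genL_unit; rewrite unitmxE unitfE -detL_ev.
by apply: contra_neq => ->; rewrite rmorph0 horner0.
Qed.

Lemma closed_nonzero (P : {poly k}) : P != 0 -> exists c, P.[c] != 0.
Proof. by move/closed_nonrootP => [c nr]; exists c. Qed.

Variables (r : nat) (b : 'I_r -> Om).
Hypothesis b_indep : indep jk t b.
Hypothesis b_span : eqspn jk t mm b.

Lemma fcardS x : goodp x -> #|SS x| = r.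
Proof.
exact: (card_S WW_C WW_t WW_D WW_M WW_le WW_m WW_span b_indep b_span
  vv_D vv_M vv_C vv_t vv_div vv_interp).
Qed.

Lemma fsum_zer (T : seq k) a y : uniq T -> (forall x, x \in T -> goodp x) -> WW a y -> y != 0 ->
  (\sum_(x <- T) zer SS vv x y <= r * a)%N.
Proof.
exact: (sum_zer WW_C WW_t WW_D WW_M WW_le WW_m WW_span b_indep b_span
  vv_D vv_M vv_C vv_t vv_div vv_interp).
Qed.

Lemma frank_gt0 : (0 < r)%N.
Proof.
rewrite lt0n; apply/eqP => r0; have [P] := spn_b WW_span b_span (inR1 WW_C).
by rewrite big1 => [/eqP|]; [rewrite oner_eq0|case=> i ir; exfalso; move: (ir); rewrite r0].
Qed.

Lemma many_good n : exists T : seq k, [/\ uniq T, size T = n & forall x, x \in T -> goodp x].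
Proof.
elim: n => [|n [T [uT sT gT]]]; first by exists [::].
have [B B0 Bg] := goodp_cofinite.
have [|x] := @closed_nonzero (B * \prod_(y <- T) ('X - y%:P)).
  by rewrite mulf_neq0 // prodf_seq_neq0; apply/allP => y _; rewrite /= polyXsubC_eq0.
rewrite hornerM mulf_eq0 negb_or => /andP[/Bg gx xT].
have nxT : x \notin T by move: xT; rewrite -rootE root_prod_XsubC.
exists (x :: T); split=> /=; rewrite ?nxT ?uT ?sT // => y.
by rewrite inE => /orP[/eqP->|/gT].
Qed.

Lemma rep_tmon l (e : Mon Fq N) :
  rep (l + wm) (fun K i x Y => x ^+ l * mon Y (fun ij => e ij)).
Proof.
have r1 := rep_mon ik Lh (fun ij => nat_of_ord (e ij)).
have := rep_polymul (P := 'X^l) (n := l) _ r1; rewrite size_polyXn leqnn => /(_ isT) r2.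
apply: rep_ext (rep_le _ r2) => [K i x Y _|]; first by rewrite map_polyXn hornerXn.
by rewrite addnC leq_add2l leq_mul2l mdeg_le orbT.
Qed.

(** At a counted pair [x] is fixed and the big Frobenius power of [Y] is [Y ga], so
    [y(Y)^(p^i) z(Y ga)] is the [p^i]-th power of [y(Y) z(Y)^(p^j)]. A dimension count gives a
    nontrivial combination [FG] of the former that vanishes identically. Taking [p^(i+j)]-th roots
    of its coefficients gives [Fp], which vanishes at all the pairs, has small weight and is nonzero
    by [power_independent]. *)
Lemma stepanov (ga : 'M[Fq]_N) a B p i j (T : seq k) :
  p \in [pchar k] -> uniq T -> (forall x, x \in T -> goodp x /\ x ^+ (p ^ (i + j)) = x) ->
  (wm <= a)%N -> (wm <= B)%N -> (r * a < p ^ j)%N ->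
  (p ^ i * a + B + 1 < r * ((a - wm).+1 * (B - wm).+1))%N ->
  (\sum_(x <- T) #|[set g in SS x | map_mx (fun c => c ^+ (p ^ (i + j))) (fpt x g) ==
      fpt x g *m map_mx ik ga]| <= r * (a + p ^ j * B))%N.
Proof.
move=> pk uT gT wa wB raQ big.
have pO : p \in [pchar Om] by rewrite (fmorph_pchar jk).
have p0 : (0 < p)%N by rewrite prime_gt0 // (pcharf_prime pk).
have [f _ find] := indep_monomials b_indep b_span.
(* Independent monomials times powers of [t] below [d]: a family of [r d] functions, independent
   over [k], of weight at most [d - 1 + wm]. *)
pose ym d (il : 'I_r * 'I_d) (K : fieldType) (x : K) (Y : 'M[K]_N) : K :=
  x ^+ il.2 * mon Y (fun ij => eM (f il.1) ij).
have ymind d (c : 'I_r * 'I_d -> k) :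
    \sum_il jk (c il) * ym d il Om t Yg = 0 -> forall il, c il = 0.
  move=> rel [i1 l]; pose P i1 := \poly_(l < d) (if insub l is Some l then c (i1, l) else 0).
  have Pc i2 (l2 : 'I_d) : (P i2)`_l2 = c (i2, l2).
    by rewrite coef_poly ltn_ord valK.
  rewrite -Pc (_ : P i1 = 0) ?coef0 //; move: i1 {l}; apply: find.
  rewrite -[RHS]rel (eq_bigr (fun i2 => \sum_l jk (c (i2, l)) * ym d (i2, l) Om t Yg)).
    by rewrite pair_big; apply: eq_bigr => -[].
  move=> i2 _; rewrite /P poly_def rmorph_sum mulr_suml; apply: eq_bigr => l _.
  rewrite valK -mul_polyC (rmorphM (pv jk t)) (rmorphXn (pv jk t)) /= pvX pvC.
  by rewrite -mulrA.
have yrep (d s : nat) (il : 'I_r * 'I_d) : (d <= s.+1)%N -> (wm <= s)%N -> d = (s - wm).+1 ->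
    rep s (fun K i x Y => ym d il K x Y).
  move=> _ ws ds; apply: rep_le (rep_tmon il.2 (eM (f il.1))).
  by have := ltn_ord il.2; move: (nat_of_ord il.2) => v vd; clear -vd ds ws; lia.
pose da := (a - wm).+1; pose dB := (B - wm).+1.
have ya il : rep a (fun K i x Y => ym da il K x Y) by apply: yrep => //; rewrite /da; lia.
have yB il : rep B (fun K i x Y => ym dB il K x Y) by apply: yrep => //; rewrite /dB; lia.
pose I := ('I_r * 'I_da)%type; pose J := ('I_r * 'I_dB)%type.
pose E (u : I * J) : fam := fun K i0 x Y =>
  ym da u.1 K x Y ^+ (p ^ i) * ym dB u.2 K x (Y *m map_mx (i0 \o ik) ga).
have Erep u : rep (p ^ i * a + B) (E u).
  apply: rep_mul => //; first by apply: rep_exp => //; apply: ya.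
  exact: (rep_subst Lh ga (yB u.2)).
(* Vanishing on whole fibres over more points than its weight makes [FG] vanish identically. This
   imposes [r (p^i a + B + 1)] linear conditions on [r^2 (a - wm + 1) (B - wm + 1)] coefficients. *)
have [T0 [uT0 sT0 gT0]] := many_good (p ^ i * a + B + 1).
pose pr (u : 'I_(p ^ i * a + B + 1) * 'I_r) :=
  vv (nth 0 T0 u.1) (nth 0 (enum (SS (nth 0 T0 u.1))) u.2).
pose M : 'M[k]_(#|{: I * J}|, #|{: 'I_(p ^ i * a + B + 1) * 'I_r}|) :=
  \matrix_(u, v) pr (enum_val v) (E (enum_val u) Om jk t Yg).
have [|v v0 vM] := @left_kernel _ _ _ M.
  rewrite !card_prod !card_ord mulnC.
  have -> : (r * da * (r * dB) = r * (r * (da * dB)))%N by rewrite -!mulnA; congr (_ * _)%N; rewrite mulnCA.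
  by rewrite ltn_pmul2l ?frank_gt0.
pose d u := v 0 (enum_rank u).
pose FG : fam := fun K i0 x Y => \sum_u i0 (d u) * E u K i0 x Y.
have repFG : rep (p ^ i * a + B) FG.
  by apply: rep_sum => u _; apply: rep_scale => //; apply: Erep.
have inE' u : inRW (E u Om jk t Yg) by exists (p ^ i * a + B)%N; apply: rep_WW.
have FG0 : FG Om jk t Yg = 0.
  apply/eqP; apply: contraT => n0; have := fsum_zer uT0 gT0 (rep_WW repFG) n0.
  rewrite (eq_big_seq (fun=> r)); last first.
    move=> x xT0; have gx := gT0 x xT0; rewrite -[RHS](fcardS gx) /zer; apply: eq_card => g.
    rewrite inE; case gS: (g \in SS x) => //=.
    have xi : (index x T0 < p ^ i * a + B + 1)%N by rewrite -sT0 index_mem.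
    have gi : (index g (enum (SS x)) < r)%N.
      by rewrite -[X in (_ < X)%N](fcardS gx) cardE index_mem mem_enum.
    have /rowP/(_ (enum_rank (Ordinal xi, Ordinal gi))) := vM; rewrite mxE [RHS]mxE => e.
    rewrite -[X in _ == X]e (vv_rep gx gS repFG) /FG (reindex (@enum_val _ (mem {: I * J}))) /=.
      apply/eqP/eq_bigr => u _; rewrite mxE /d enum_valK /pr enum_rankK /= nth_index //.
      by rewrite nth_index ?mem_enum // (vv_rep gx gS (Erep _)).
    by apply: onW_bij; apply: enum_val_bij.
  rewrite big_const_seq count_predT iter_addn_0 sT0 leq_pmul2l ?frank_gt0 //.
  by rewrite addn1 ltnn.
have Q0 : (0 < p ^ (i + j))%N by rewrite expn_gt0 p0.
have /choice[c cd] := fun u => closed_power_root (d u) Q0.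
pose Fp : fam := fun K i0 x Y => \sum_y ym da y K x Y *
  (\sum_z i0 (c (y, z)) * ym dB z K x Y) ^+ (p ^ j).
have repI y : rep B (fun K i0 x Y => \sum_z i0 (c (y, z)) * ym dB z K x Y).
  by apply: rep_sum => z _; apply: rep_scale => //; apply: yB.
have repFp : rep (a + p ^ j * B) Fp.
  by apply: rep_sum => y _; apply: rep_mul => //; apply: rep_exp.
have Fp0 : Fp Om jk t Yg != 0.
  apply/eqP => e.
  have := power_independent t_tr WW_C WW_t WW_D WW_M WW_le WW_m WW_span b_indep b_span
    vv_D vv_M vv_C vv_t vv_div vv_interp (@closed_nonzero) goodp_cofinite (char_expD j pO) frank_gt0
    raQ (fun y => rep_WW (ya y)) (ymind da) _ e.
  have RI y : inRW (\sum_z jk (c (y, z)) * ym dB z Om t Yg).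
    by exists B; exact: (rep_WW (repI y)).
  move=> /(_ RI) z0; case/negP: v0; apply/eqP/rowP => u; rewrite [RHS]mxE.
  have := cd (enum_val u); rewrite /d enum_valK => <-.
  case: (enum_val u) => y z; have /ymind/(_ z)-> := z0 y.
  by rewrite expr0n eqn0Ngt Q0.
have := fsum_zer uT (fun x xT => (gT x xT).1) (rep_WW repFp) Fp0.
apply: leq_trans; rewrite big_seq [X in (_ <= X)%N]big_seq; apply: leq_sum => x xT.
have [gx xQ] := gT x xT; rewrite /zer; apply/subset_leq_card/fintype.subsetP => g; rewrite !inE.
move=> /andP[/asboolP gS /eqP zQ]; have gS' : g \in SS x by apply/SSP.
have -> /= : `[< forall f, gen f = 0 -> eva x g f = 0 >] by apply/asboolP.
rewrite (vv_rep gx gS' repFp); have := vv_rep gx gS' repFG; rewrite FG0.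
have := vv_C 0 gx gS'; rewrite rmorph0 => -> e0.
suff : Fp k eid x (fpt x g) ^+ (p ^ i) == 0 by rewrite expf_eq0 expn_gt0 p0.
rewrite e0 /Fp (char_exp_sum i _ pk) /FG; apply/eqP.
transitivity (\sum_y \sum_z d (y, z) * E (y, z) k eid x (fpt x g)); last first.
  by rewrite pair_big; apply: eq_bigr => -[].
apply: eq_bigr => y _; rewrite exprMn -exprM -expnD addnC (char_exp_sum _ _ pk) mulr_sumr.
apply: eq_bigr => z _; rewrite [(_ * ym dB z k x _) ^+ _]exprMn /= cd /E /= mulrCA; congr (_ * (_ * _)).
rewrite /ym exprMn -exprM mulnC exprM xQ; congr (_ * _).
rewrite -[map_mx _ ga]/(map_mx ik ga) -zQ /mon -prodrXl; apply: eq_bigr => ij _.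
by rewrite [(map_mx _ _) _ _]mxE -!exprM mulnC.
Qed.

Definition fixedp Q (x : k) := map_mx (fun c => c ^+ Q) (Yx x) == Yx x.

(** If the fundamental solution at [x] is fixed, so are all [r] points of the fibre, and each of
    them is counted by [stepanov] with [ga = 1]. The parameters are [a = 2 W], [p^j] just above
    [r a], and [B - wm] just above [2 p^i / r]. *)
Lemma fixed_upper p n (T : seq k) : p \in [pchar k] -> (0 < n)%N ->
  (forall a : Fq, a ^+ (p ^ n) = a) -> uniq T ->
  (forall x, x \in T -> [/\ goodp x, x ^+ (p ^ n) = x & fixedp (p ^ n) x]) ->
  (r * size T <= 2 * p ^ n + 4 * p * r ^ 2 * wm.+1 ^ 2)%N.
Proof.
move=> pk n0 Fqn uT HT; have r0 := frank_gt0.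
have p1 : (1 < p)%N by rewrite prime_gt1 // (pcharf_prime pk).
have Q1 : (1 < p ^ n)%N by rewrite -(expn0 p) ltn_exp2l.
have sT : (size T <= p ^ n)%N by apply: power_roots_size => // x /HT[].
set W := wm.+1; have rW0 : (0 < 2 * r * W)%N by rewrite !muln_gt0 r0.
have [j /andP[jl ju]] := prime_power_between p1 rW0.
(* For [n <= j] even the trivial bound [p^n] lies within the error term. *)
have [nj|jn] := leqP n j.
  have : (p ^ n <= p * (2 * r * W))%N by apply: leq_trans ju; rewrite leq_exp2l.
  have : (r * size T <= r * p ^ n)%N by rewrite leq_mul2l sT orbT.
  have -> : (4 * p * r ^ 2 * W ^ 2 = 2 * W * (r * (p * (2 * r * W))))%N by lia.
  move=> h1 h2; apply: leq_trans h1 _; apply: leq_trans (leq_addl _ _).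
  apply: leq_trans (_ : r * (p * (2 * r * W)) <= _)%N; first by rewrite leq_mul2l h2 orbT.
  by rewrite leq_pmull.
pose i := (n - j)%N; have nE : n = (i + j)%N by rewrite /i; lia.
pose P := (p ^ i)%N; have P0 : (0 < P)%N by rewrite expn_gt0 (ltnW p1).
pose be := (2 * P %/ r).+1.
have be1 : (r * be <= 2 * P + r)%N.
  by rewrite /be mulnS mulnC; have := leq_trunc_div (2 * P) r; lia.
have be2 : (2 * P < r * be)%N.
  by rewrite /be mulnC; have := ltn_ceil (2 * P) r0; lia.
have be3 : (be <= 2 * P + 1)%N by rewrite /be; have := leq_div (2 * P) r; lia.
have st := @stepanov 1%:M (2 * W) (wm + be) p i j T pk uT.
have {st} : (\sum_(x <- T) #|[set g in SS x | map_mx (fun c => c ^+ (p ^ (i + j))) (fpt x g) ==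
      fpt x g *m map_mx ik 1%:M]| <= r * (2 * W + p ^ j * (wm + be)))%N.
  apply: st.
  - by move=> x /HT[]; rewrite -nE.
  - by rewrite /W; clear; lia.
  - exact: leq_addr.
  - by move: jl; rewrite mulnA [(r * 2)%N]mulnC.
  - by rewrite -/P; apply: arith_upper1.
rewrite (eq_big_seq (fun=> r)); last first.
  move=> x /HT[gx _ /eqP fx]; rewrite -[RHS](fcardS gx); apply: eq_card => g.
  rewrite inE; case: (g \in SS x) => //=; apply/eqP.
  rewrite map_mx1 mulmx1 -nE /fpt (map_exp_mulmx n _ _ pk) fx; congr (_ *m _).
  by apply/matrixP => a c; rewrite !mxE -rmorphXn Fqn.
rewrite big_const_seq count_predT iter_addn_0 leq_pmul2l // => sB.
have e1 : (r * (p ^ j * be) <= 2 * p ^ n + p ^ j * r)%N.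
  have -> : (2 * p ^ n + p ^ j * r = p ^ j * (2 * P + r))%N.
    by rewrite nE expnD -/P; lia.
  by rewrite mulnCA leq_mul2l be1 orbT.
have e2 : (p ^ j * (r * W) <= p * (2 * r * W) * (r * W))%N by rewrite leq_mul2r ju orbT.
have e3 : (r * size T <= r * (2 * W + p ^ j * (wm + be)))%N by rewrite leq_mul2l sB orbT.
have e4 : (1 * (2 * r * W) <= p * (r * W) * (2 * r * W))%N.
  by rewrite leq_mul2r; apply/orP; right; rewrite !muln_gt0 r0 (ltnW p1).
move: e1 e2 e3 e4; rewrite /W; clear; move: (p ^ j)%N (p ^ n)%N => A D.
by rewrite !mulnDr; nia.
Qed.

Lemma fpt_mul x g g' : fpt x g *m map_mx ik g' = fpt x (g *m g').
Proof. by rewrite /fpt map_mxM mulmxA. Qed.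

Lemma rep_det : exists a, rep a (fun K i x Y => \det Y).
Proof.
exists (\sum_(i : 'I_N) h)%N; apply: rep_sum => s _.
apply: (@rep_ext _ _ ik _ L h _ (fun K i x Y => i ((-1) ^+ s) * \prod_i0 Y i0 (s i0))).
  by move=> K i x Y _; rewrite rmorphXn rmorphN1.
apply: rep_scale => //.
have H : forall l : seq 'I_N, rep (\sum_(i <- l) h) (fun K i x Y => \prod_(i0 <- l) Y i0 (s i0)).
  elim=> [|i0 l IH].
    by apply: rep_ext (rep_le _ (rep_const ik Lh 1)) => [K i x Y _|//]; rewrite big_nil rmorph1.
  rewrite big_cons; apply: rep_ext (rep_mul Lh (rep_Y ik Lh i0 (s i0)) IH) => K i x Y _.
  by rewrite big_cons.
exact: H.
Qed.

(** Determinants in the system give [(det Yg)^(q-1) = det L(t)], and this relation specialises to a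
    nonzero value at a good [x]. *)
Lemma SS_unit x g : goodp x -> g \in SS x -> g \in unitmx.
Proof.
move=> gx gS; have [a ra] := rep_det.
have dE : (\det Yg) ^+ q.-1 = pv jk t detL.
  have dY0 : \det Yg != 0 by rewrite -unitfE -unitmxE.
  apply: (mulfI dY0); rewrite -exprS prednK ?q_gt0 // mulrC.
  rewrite [pv _ _ _]detL_ev -det_mulmx -Yg_sol det_map_mx //.
have Rd : inRW (\det Yg) by exists a; apply: (rep_WW ra).
have := vv_rep gx gS ra => vd.
have : vv x g ((\det Yg) ^+ q.-1) != 0.
  rewrite dE (val_pv WW_C WW_t WW_D WW_M WW_le vv_D vv_M vv_C vv_t) //.
  exact/goodpP.
rewrite (val_X WW_C WW_M vv_M vv_C) // vd => dn.
have : fpt x g \in unitmx.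
  rewrite unitmxE unitfE; apply: contraNneq dn => ->.
  by rewrite expr0n -[(q.-1 == 0)%N]negbK -lt0n -ltnS prednK ?q_gt0 ?q_gt1.
by rewrite unitmx_mul map_unitmx => /andP[].
Qed.

Definition gens (ga : 'M[Fq]_N) (f : rc) := ev jk t (Yg *m map_mx (jk \o ik) ga) f.

Lemma gens_rc ga a (f : rc) : wt h a f -> exists2 f', wt h a f' & gen f' = gens ga f /\
  forall x g, goodp x -> eva x g f' = eva x (g *m ga) f.
Proof.
move=> wf; have [f' wf' fE] := rep_subst Lh ga (rep_ev ik L wf).
exists f' => //; split=> [|x g gx]; first exact: fE.
rewrite /eva fE; last exact: fpt_sol.
exact: (congr1 (fun Y => ev eid x Y f) (fpt_mul x g ga)).
Qed.

Lemma rc_wt (f : rc) : exists a, wt h a f.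
Proof.
exists (\max_e (size (f e) + h * mdeg e))%N => e _; apply: leqW.
exact: (@leq_bigmax _ (fun e => size (f e) + h * mdeg e)%N e).
Qed.

(** Compatibility at one point of one fibre forces it everywhere. For a relation [f1], the function
    [(U (g0 ga) + c (t - x)) f1] vanishes at all solutions over [x], since [f1] vanishes at [g0 ga];
    division by [t - x] gives a relation [f2] with [u gens f1 = (t - x) gens f2]. Iterating,
    [u^n gens f] is divisible by [(t - x)^n] for all [n]. As [(X - x)^r] does not divide the norm of
    [u], this is impossible unless [gens ga f = 0]. *)
Lemma kernel_stable x g0 ga : goodp x -> g0 \in SS x -> g0 *m ga \in SS x ->
  forall f, gen f = 0 -> gens ga f = 0.
Proof.
move=> gx g0S g1S f f0; apply/eqP; apply: contraT => y0.
have gaU : ga \in unitmx by have := SS_unit gx g1S; rewrite unitmx_mul => /andP[].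
have Rgens f1 : inRW (gens ga f1).
  by have [a w1] := rc_wt f1; have [f2 w2 [<- _]] := gens_rc ga w1; exists a, f2.
have [U UP [aU wU]] := fibre_indicator gx; pose u0 := gens ga (U (g0 *m ga)).
have vu0 g : g \in SS x -> vv x g u0 = (g == g0)%:R.
  move=> gS; have [f2 w2 [e2 e2']] := gens_rc ga (wU (g0 *m ga)).
  by rewrite /u0 -e2 vvE // e2' // UP (can_eq (mulmxK gaU)).
have [c nc] := uniformizing_shift WW_C WW_t WW_D WW_M WW_le WW_m WW_span b_indep b_span
    vv_D vv_M vv_C vv_t vv_div vv_interp (@closed_nonzero) gx g0S (Rgens _) vu0.
set u := u0 + _ in nc.
have sg : sol ik L jk t (Yg *m map_mx (jk \o ik) ga) by apply: sol_mulr.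
have step f1 : gen f1 = 0 -> exists2 f2, gen f2 = 0 & u * gens ga f1 = (t - jk x) * gens ga f2.
  move=> f10; have [a w1] := rc_wt f1.
  have rX : rep 1 (fun K i y Y => y - i x).
    have := @rep_poly _ _ ik _ L h Lh ('X - x%:P) 1 _; rewrite size_XsubC => /(_ isT).
    by apply: rep_ext => K i y Y _; rewrite rmorphB /= map_polyX map_polyC hornerXsubC.
  have r1 : rep ((aU + 1) + a) (fun K i y Y =>
      (ev i y Y (U (g0 *m ga)) + i c * (y - i x)) * ev i y Y f1).
    apply: rep_mul; [by []| |exact: rep_ev]; apply: rep_add.
      by apply: rep_le (rep_ev ik L (wU _)); apply: leq_addr.
    by apply: rep_le (rep_scale Lh c rX); apply: leq_addl.
  have [f3 w3 f3E] := r1.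
  have [|f2 _ f2E] := vanish_fibre_div gx w3.
    move=> g; rewrite /eva f3E; last exact: fpt_sol.
    rewrite /= subrr mulr0 addr0 -![ev _ _ _ _]/(eva x g _) UP.
    case: eqP => [->|_]; last by rewrite mul0r.
    by move/SSP: g1S => ->; rewrite ?mulr0.
  have tx0 : t - jk x != 0.
    apply/eqP => e; have := t_tr (P := 'X - x%:P).
    rewrite (rmorphB (pv jk t)) /= pvX pvC => /(_ e) /eqP.
    by rewrite polyXsubC_eq0.
  exists f2; last by rewrite /gens -f2E f3E.
  apply: (mulfI tx0); rewrite mulr0 /gen -f2E f3E //.
  by rewrite [ev jk t Yg f1]f10 mulr0.
have iter n : exists2 f2, gen f2 = 0 & u ^+ n * gens ga f = (t - jk x) ^+ n * gens ga f2.
  elim: n => [|n [f2 f20 e2]]; first by exists f; rewrite // !expr0 !mul1r.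
  have [f3 f30 e3] := step _ f20; exists f3 => //.
  by rewrite exprS -mulrA e2 mulrCA e3 mulrA -exprSr.
have Ru : inRW u.
  apply: (inRD WW_D WW_le); first exact: Rgens.
  apply: (inRM WW_M); first exact: (inRC WW_C).
  by apply: (inRB WW_C WW_D WW_M WW_le); [exact: (inRt WW_t)|exact: (inRC WW_C)].
pose Nr := Nm jk t b.
have NM y z : inRW y -> inRW z -> Nr (y * z) = Nr y * Nr z.
  exact: (NmM WW_C WW_t WW_D WW_M WW_le WW_m WW_span b_indep b_span).
have N0 y : inRW y -> y != 0 -> Nr y != 0.
  exact: (Nm_neq0 WW_C WW_t WW_D WW_M WW_le WW_m WW_span b_indep b_span).
have NX y n : inRW y -> Nr (y ^+ n) = Nr y ^+ n.
  exact: (NmX WW_C WW_t WW_D WW_M WW_le WW_m WW_span b_indep b_span).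
have Np P : Nr (pv jk t P) = P ^+ r.
  exact: (Nm_pv WW_C WW_t WW_D WW_M WW_le WW_m WW_span b_indep b_span).
have txE : t - jk x = pv jk t ('X - x%:P) by rewrite (rmorphB (pv jk t)) /= pvX pvC.
have Rtx : inRW (t - jk x) by rewrite txE; apply: (inRpv WW_C WW_t WW_D WW_M WW_le).
have RX y n : inRW y -> inRW (y ^+ n) by apply: (inRX WW_C WW_M).
have u1 : u != 0.
  have := Np 0; rewrite rmorph0 expr0n eqn0Ngt frank_gt0 => N00.
  by apply: contraNneq nc => ->; rewrite -[Nm _ _ _ _]/(Nr 0) N00 dvdp0.
pose m0 := mup x (Nr (gens ga f)).
have [f2 _ e2] := iter m0.+1.
have y2 : gens ga f2 != 0.
  apply/eqP => y2; move/eqP: e2; rewrite y2 mulr0 mulf_eq0 (negPf y0) orbF.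
  by rewrite expf_eq0 (negPf u1) andbF.
have := congr1 (fun y => mup x (Nr y)) e2.
rewrite /= !NM ?NX //; try exact: RX.
rewrite {1}txE Np -exprM !mupM ?expf_neq0 ?N0 ?polyXsubC_eq0 //.
rewrite mup_XsubCX eqxx -/m0.
have mX (p : {poly k}) e : p != 0 -> mup x (p ^+ e) = (e * mup x p)%N.
  move=> p0; elim: e => [|e IH]; last by rewrite exprS mupM ?expf_neq0 // IH mulSn.
  by rewrite expr0 mupNroot // rootC oner_eq0.
rewrite mX ?N0 //; move: nc; rewrite -mup_ltn ?N0 //.
set A := mup x _; move=> Ar e.
have H : (m0.+1 * A + m0.+1 <= r * m0.+1)%N by rewrite addnC -mulnS mulnC leq_mul2r Ar orbT.
by clear -e H; lia.
Qed.

(** The translations that preserve the ideal of relations; they play the role of a Galois group. *)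
Definition Stab : {set 'M[Fq]_N} := [set ga | `[< forall f, gen f = 0 -> gens ga f = 0 >]].

Lemma card_Stab : (#|Stab| <= r)%N.
Proof.
have [T [_ sT gT]] := many_good 1; case: T sT gT => // x T _ gT; have gx := gT x (mem_head _ _).
have [g0 g0S] : exists g0, g0 \in SS x by apply/card_gt0P; rewrite fcardS // frank_gt0.
have gU := SS_unit gx g0S.
rewrite -(fcardS gx) -(card_imset _ (can_inj (mulKmx gU))); apply: subset_leq_card.
apply/fintype.subsetP => _ /imsetP[ga + ->]; rewrite inE => /asboolP gaS.
apply/SSP => f f0; have [a wf] := rc_wt f; have [f' _ [f'g f'e]] := gens_rc ga wf.
by rewrite -f'e //; move/SSP: g0S; apply; rewrite f'g gaS.
Qed.

Definition coefX Q (f : rc) : rc := [ffun e => map_poly (fun c => c ^+ Q) (f e)].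

Section Lower.
Variables (p n : nat).
Hypothesis pk : p \in [pchar k].
Hypothesis n0 : (0 < n)%N.
Hypothesis Fqn : forall a : Fq, a ^+ (p ^ n) = a.
(** Satisfied when the [Q]-th power on [k] extends to an endomorphism of [Om] fixing [t] and
    [Yg]. *)
Hypothesis stable : forall f, gen (coefX (p ^ n) f) = 0 -> gen f = 0.
Local Notation Q := (p ^ n)%N.
Local Notation FQ := (map_mx (fun c : k => c ^+ Q)).

Let p0 : (0 < p)%N. Proof. by rewrite prime_gt0 // (pcharf_prime pk). Qed.
Let Q0 : (0 < Q)%N. Proof. by rewrite expn_gt0 p0. Qed.
Let ikQ a : ik a ^+ Q = ik a. Proof. by rewrite -rmorphXn Fqn. Qed.

Let FQ_mul m1 m2 m3 (A : 'M[k]_(m1, m2)) (B : 'M_(m2, m3)) : FQ (A *m B) = FQ A *m FQ B.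
Proof. exact: map_exp_mulmx. Qed.

Lemma FQ_base m1 m2 (A : 'M[Fq]_(m1, m2)) : FQ (map_mx ik A) = map_mx ik A.
Proof. by apply/matrixP => a c; rewrite !mxE ikQ. Qed.

(** Frobenius permutes the solutions over a fixed [x], and by [stable] it maps [SS x] into itself.
    The quotient of two points of [SS x] is in [Stab] by [kernel_stable]. *)
Lemma frobenius_class x g : goodp x -> x ^+ Q = x -> g \in SS x ->
  exists2 ga, ga \in Stab & FQ (fpt x g) == fpt x g *m map_mx ik ga.
Proof.
move=> gx xQ gS.
have evQ : FQ (evL ik L eid x) = evL ik L eid x.
  apply/matrixP => a c; rewrite !mxE -(horner_map_exp n _ _ pk) xQ; congr _.[_].
  apply/polyP => l; rewrite coef_map_id0 ?coef_map /= ?ikQ //.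
  by rewrite expr0n eqn0Ngt Q0.
have sQ : sol ik L eid x (FQ (fpt x g)).
  have e : map_mx (frq ik) (fpt x g) = evL ik L eid x *m fpt x g := fpt_sol g gx.
  rewrite /sol -[in RHS]evQ -FQ_mul -e.
  by apply/matrixP => a c; rewrite !mxE /frq -!exprM mulnC.
have [g' g'E] := fpt_onto gx sQ.
have gU := SS_unit gx gS.
have g'S : g' \in SS x.
  apply/SSP => f f0.
  (* As [k] is closed, every relation is the [Q]-twist of some [f']; by [stable] that is a relation
     too, and its value at [g], raised to the power [Q], is the value of [f] at [g']. *)
  have /choice[c cQ] := fun d => closed_power_root (k := k) d Q0.
  pose f' : rc := [ffun e => \poly_(l < size (f e)) c (f e)`_l].
  have f'Q : coefX Q f' = f.
    apply/ffunP => e; rewrite !ffunE; apply/polyP => l.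
    rewrite coef_map_id0; last by rewrite expr0n eqn0Ngt Q0.
    rewrite coef_poly; case: ltnP => ls; first exact: cQ.
    by rewrite expr0n eqn0Ngt Q0 nth_default.
  have : eva x g f' = 0 by move/SSP: gS; apply; apply: stable; rewrite f'Q.
  move/(congr1 (fun c => c ^+ Q)); rewrite expr0n eqn0Ngt Q0 mulr0n eva_coef (char_exp_sum n _ pk) => <-.
  rewrite eva_coef -g'E -{1}f'Q; apply: eq_bigr => e _.
  rewrite exprMn -(horner_map_exp n _ _ pk) xQ [in LHS]ffunE; congr (_ * _).
  by rewrite /mon -prodrXl; apply: eq_bigr => ij _; rewrite mxE -!exprM mulnC.
exists (invmx g *m g'); last by rewrite fpt_mul mulKVmx // g'E.
rewrite inE; apply/asboolP; apply: (kernel_stable gx gS); by rewrite mulKVmx.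
Qed.

(** The pairs are distributed among at most [r] classes, one for each element of [Stab], and
    [stepanov] bounds every class by [X], which is close to [Q]. There are nearly [r Q] pairs, so
    the class of [1] has at least about [Q / 2] of them, and these lie over fixed [x]. *)
Lemma fixed_lower bad (T : seq k) : uniq T ->
  (forall x, x \in T -> goodp x /\ x ^+ Q = x) ->
  (Q <= size T + bad)%N -> (4 * r * bad <= Q)%N -> (144 * p * r ^ 4 * wm.+1 ^ 2 <= Q)%N ->
  (Q <= 2 * r * size [seq x <- T | fixedp Q x])%N.
Proof.
move=> uT HT sT bT big; have r0 := frank_gt0.
have p1 : (1 < p)%N by rewrite prime_gt1 // (pcharf_prime pk).
set W := wm.+1 in big; pose al := (8 * r * W)%N; pose a := (wm + al)%N.
have ra0 : (0 < r * a)%N by rewrite muln_gt0 r0 /a /al addn_gt0 !muln_gt0 r0 orbT.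
have [j /andP[jl ju]] := prime_power_between p1 ra0.
have a9 : (a <= 9 * r * W)%N by rewrite /a /al /W; nia.
have Q'l : (p ^ j <= 9 * p * r ^ 2 * W)%N.
  apply: leq_trans ju _; have -> : (9 * p * r ^ 2 * W = p * (r * (9 * r * W)))%N by lia.
  by rewrite !leq_mul2l a9 !orbT.
have jn : (j <= n)%N.
  rewrite -(leq_exp2l _ _ p1); apply: leq_trans Q'l _; apply: leq_trans big.
  have -> : (144 * p * r ^ 4 * W ^ 2 = (9 * p * r ^ 2 * W) * (16 * r ^ 2 * W))%N by lia.
  by rewrite leq_pmulr // !muln_gt0 ?expn_gt0 ?r0.
pose i := (n - j)%N; have nE : n = (i + j)%N by rewrite /i; lia.
pose P := (p ^ i)%N; have P0 : (0 < P)%N by rewrite expn_gt0 p0.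
have QE : (Q = P * p ^ j)%N by rewrite /P -expnD -nE.
pose D := (r * al.+1 - 1)%N.
have al0 : (0 < al)%N by rewrite !muln_gt0 r0.
have D0 : (0 < D)%N.
  rewrite /D subn_gt0; apply: (@leq_trans (1 * al.+1)); first by rewrite mul1n ltnS.
  by rewrite leq_mul2r r0 orbT.
pose dB := ((P * a + wm + 1) %/ D).+1; pose B := (wm + dB.-1)%N.
have dB1 : (P * a + wm + 1 < dB * D)%N by rewrite /dB ltn_ceil.
have dB2 : (dB.-1 * D <= P * a + wm + 1)%N by rewrite /dB /= leq_trunc_div.
pose X := (r * (a + p ^ j * B))%N.
pose cnt ga := (\sum_(x <- T) #|[set g in SS x | FQ (fpt x g) == fpt x g *m map_mx ik ga]|)%N.
have cntX ga : (cnt ga <= X)%N.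
  rewrite /cnt nE; apply: stepanov => //; rewrite -?nE //.
  - by rewrite /a leq_addr.
  - by rewrite /B leq_addr.
  - rewrite -/P; have -> : (a - wm = al)%N by rewrite /a addKn.
    have -> : ((B - wm).+1 = dB)%N by rewrite /B addKn.
    have rD : (r * al.+1 = D + 1)%N by rewrite /D subnK // muln_gt0 r0.
    have -> : (r * (al.+1 * dB) = dB * D + dB)%N by rewrite mulnA rD mulnDl mul1n mulnC.
    have -> : (P * a + B + 1 = P * a + wm + dB)%N by rewrite /B -!addnA addn1.
    by rewrite ltn_add2r; apply: leq_ltn_trans dB1; rewrite leq_addr.
have X4 : (4 * r * X <= (4 * r + 1) * Q)%N.
  rewrite QE; apply: (@arith_lower1 wm r a P (p ^ j) p dB.-1) => //; rewrite -?QE //.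
  by rewrite expn_gt0 p0.
have tot : (r * size T <= \sum_(ga in Stab) cnt ga)%N.
  rewrite /cnt exchange_big /= -[X in (X <= _)%N]/(r * _)%N.
  have -> : (r * size T = \sum_(x <- T) r)%N.
    by rewrite big_const_seq count_predT iter_addn_0.
  rewrite big_seq [X in (_ <= X)%N]big_seq; apply: leq_sum => x /HT[gx xQ].
  rewrite -(fcardS gx) -sum1_card.
  apply: leq_trans (_ : \sum_(g in SS x) \sum_(ga in Stab)
     (FQ (fpt x g) == fpt x g *m map_mx ik ga) <= _)%N.
    apply: leq_sum => g gS; have [ga gaS e] := frobenius_class gx xQ gS.
    by rewrite (bigD1 ga) //= e.
  rewrite exchange_big; apply: leq_sum => ga _ /=.
  rewrite -sum1dep_card big_mkcondr /=; apply: leq_sum => g _; by case: eqP.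
have fix1 : (cnt 1%:M <= r * size [seq x <- T | fixedp Q x])%N.
  have -> : (r * size [seq x <- T | fixedp Q x] = \sum_(x <- T | fixedp Q x) r)%N.
    by rewrite -big_filter big_const_seq count_predT iter_addn_0.
  rewrite /cnt [X in (_ <= X)%N]big_mkcond big_seq [X in (_ <= X)%N]big_seq.
  apply: leq_sum => x /HT[gx xQ].
  case: ifP => fx.
    rewrite -(fcardS gx); apply: subset_leq_card.
    by apply/fintype.subsetP => g; rewrite inE => /andP[].
  rewrite leqn0; apply/eqP/eq_card0 => g; rewrite inE [RHS]inE.
  apply/negP => /andP[gS /eqP e]; case/negP: fx.
  have gU : map_mx ik g \in unitmx by rewrite map_unitmx (SS_unit gx gS).
  apply/eqP/(can_inj (mulmxK gU)); move: e.
  by rewrite map_mx1 mulmx1 /fpt FQ_mul FQ_base.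
have St1 : 1%:M \in Stab.
  rewrite inE; apply/asboolP => f f0; rewrite /gens map_mx1 mulmx1; exact: f0.
have : (r * size T <= r * size [seq x <- T | fixedp Q x] + (r - 1) * X)%N.
  apply: leq_trans tot _; rewrite (bigD1 1%:M) //=; apply: leq_add => //.
  apply: leq_trans (_ : \sum_(ga in Stab :\ 1%:M) X <= _)%N.
    rewrite [X in (_ <= X)%N](eq_bigl (fun ga => (ga \in Stab) && (ga != 1%:M))).
      by apply: leq_sum => ga _; apply: cntX.
    by move=> ga; rewrite finset.in_setD1 andbC.
  rewrite sum_nat_const leq_mul2r; apply/orP; right.
  have := cardsD1 1%:M Stab; rewrite St1 /=; have := card_Stab; rewrite leq_subRL // => + e; by rewrite e.
by move=> e; apply: arith_lower2 r0 X4 sT bT e.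
Qed.
End Lower.
End Fibres.

(** * Companion matrices *)

Definition comp_mx (R : comNzRingType) d' (m : {poly R}) : 'M[R]_d'.+1 :=
  \matrix_(i, j) if (i < d')%N then (j == i.+1 :> nat)%:R else - m`_j.

Lemma map_comp_mx (R R' : comNzRingType) (f : {rmorphism R -> R'}) d' (m : {poly R}) :
  map_mx f (comp_mx d' m) = comp_mx d' (map_poly f m).
Proof.
apply/matrixP => i j; rewrite !mxE; case: ifP => _; first by rewrite rmorph_nat.
by rewrite rmorphN coef_map.
Qed.

Lemma ord2_ind (P : 'I_2 -> Prop) : P 0 -> P 1 -> forall i, P i.
Proof.
move=> P0 P1 [[|[|//]] i2].
  by rewrite (_ : Ordinal i2 = 0) //; apply/val_inj.
by rewrite (_ : Ordinal i2 = 1) //; apply/val_inj.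
Qed.

Section Companion.
Variables (F : fieldType) (d' : nat) (m : {poly F}).
Hypothesis m_monic : m \is monic.
Hypothesis m_size : size m = d'.+2.
Local Notation C := (comp_mx d' m).

(** The rows of [C] are shifted unit vectors, so that residues modulo [m] are row vectors of
    coefficients and [C] acts on the right as multiplication by the variable. *)
Lemma comp_mx_pow (i : 'I_d'.+1) : delta_mx 0 0 *m C ^+ i = delta_mx 0 i :> 'rV_d'.+1.
Proof.
case: i => i; elim: i => [|i IH] id.
  by rewrite expr0 mulmx1; congr delta_mx; apply: val_inj.
rewrite exprSr -[_ * C]/(_ *m C) mulmxA (IH (ltnW id)) -rowE; apply/rowP => j.
by rewrite !mxE /= -ltnS id /=.
Qed.

Lemma comp_mx_row0 (p : {poly F}) : (size p <= d'.+1)%N ->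
  delta_mx 0 0 *m horner_mx C p = poly_rV p :> 'rV_d'.+1.
Proof.
move=> sp; rewrite -[in LHS](coefK p) poly_def rmorph_sum mulmx_sumr.
have -> : \sum_(i < size p) (delta_mx 0 0 : 'rV_d'.+1) *m horner_mx C (p`_i *: 'X^i) =
    \sum_(i < size p) p`_i *: delta_mx 0 (widen_ord sp i).
  apply: eq_bigr => i _; rewrite linearZ rmorphXn /= horner_mx_X -scalemxAr.
  by rewrite -(comp_mx_pow (widen_ord sp i)).
apply/rowP => j; rewrite summxE mxE.
have [js|sj] := ltnP j (size p).
  rewrite (bigD1 (Ordinal js)) //= big1 => [|i ij]; rewrite !mxE /=.
    by rewrite addr0 (_ : j == _) ?mulr1 //; apply/eqP/val_inj.
  rewrite (_ : j == _ = false) ?mulr0 //; apply: contraNF ij => /eqP e.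
  by apply/eqP/val_inj; rewrite /= e.
rewrite nth_default // big1 // => i _; rewrite !mxE /= (_ : j == _ = false) ?mulr0 //.
by apply/negbTE; apply: contraTneq sj => ->; rewrite -ltnNge /=.
Qed.

Lemma comp_mx_root : horner_mx C m = 0.
Proof.
have e0 : (delta_mx 0 0 : 'rV_d'.+1) *m horner_mx C m = 0.
  have mE : m = 'X^(d'.+1) + (m - 'X^(d'.+1)) by rewrite addrC subrK.
  rewrite [X in horner_mx _ X]mE rmorphD mulmxDr [X in _ + X]comp_mx_row0; last first.
    apply/leq_sizeP => j dj; rewrite coefB coefXn.
    case: eqP => [->|/eqP jd]; last by rewrite nth_default ?subr0 // m_size ltn_neqAle eq_sym jd.
    by move/monicP: m_monic; rewrite /lead_coef m_size => ->; rewrite subrr.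
  rewrite rmorphXn /= horner_mx_X exprSr -[_ * _]/(_ *m _) mulmxA.
  rewrite -[d' in C ^+ d']/(nat_of_ord (ord_max : 'I_d'.+1)) comp_mx_pow -rowE.
  apply/rowP => j; rewrite !mxE /= ltnn coefB coefXn.
  by rewrite ltn_eqF ?subr0 ?addNr //; apply: ltn_ord.
apply/row_matrixP => i; rewrite row0 rowE -comp_mx_pow -mulmxA.
have -> : C ^+ i *m horner_mx C m = horner_mx C m *m C ^+ i.
  rewrite -[C in C ^+ i](horner_mx_X C) -rmorphXn; exact: comm_horner_mx2.
by rewrite mulmxA e0 mul0mx.
Qed.

Lemma comp_mx_eq0 (p : {poly F}) : (horner_mx C p == 0) = (m %| p).
Proof.
have [q -> ] : exists q, p = q * m + p %% m by exists (p %/ m); rewrite -divp_eq.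
rewrite dvdp_addr ?dvdp_mull // rmorphD rmorphM /= comp_mx_root mulr0 add0r.
have sr : (size (p %% m)%R <= d'.+1)%N.
  by rewrite -ltnS -m_size ltn_modp -size_poly_eq0 m_size.
apply/eqP/idP => [e|/modp_eq0P]; last first.
  by rewrite modp_small ?m_size ?ltnS // => ->; rewrite rmorph0.
have := comp_mx_row0 sr; rewrite e mulmx0 => /(congr1 (@rVpoly _ _)).
by rewrite poly_rV_K // linear0 => <-; apply: dvdp0.
Qed.
End Companion.

(** * Two-sided multiplication on 2x2 matrices modulo [m], as a matrix over the base *)

Section AdMatrix.
Variables (R : comNzRingType) (d' : nat) (C : 'M[R]_d'.+1).
Local Notation H := (horner_mx C).
Definition adI := ('I_2 * 'I_2 * 'I_d'.+1)%type.
Local Notation N := #|{: adI}|.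

(** The index [(i, j, l)] stands for the coefficient of [T^l] in the entry [(i, j)]. Residues are
    row vectors on which [C] acts from the right, whence the order [l' l]. *)
Definition adm (A B : 'M[{poly R}]_2) : 'M[R]_N :=
  \matrix_(u, v) let: (i, j, l) := (enum_val u : adI) in let: (a, b, l') := (enum_val v : adI) in
    H (A i a * B b j) l' l.

Lemma admE A B i j l a b l' :
  adm A B (enum_rank (i, j, l)) (enum_rank (a, b, l')) = H (A i a * B b j) l' l.
Proof. by rewrite mxE !enum_rankK. Qed.

Lemma ad_ind (P : 'I_N -> Prop) : (forall i j l, P (enum_rank (i, j, l))) -> forall u, P u.
Proof. by move=> H u; rewrite -(enum_valK u); case: (enum_val u) => [[]]. Qed.

Lemma adm_mul A B A' B' : adm A B *m adm A' B' = adm (A *m A') (B' *m B).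
Proof.
apply/matrixP => u v; elim/ad_ind: u => i j l; elim/ad_ind: v => c e l''.
rewrite admE mxE (reindex (@enum_rank adI)) /=; last exact/onW_bij/enum_rank_bij.
transitivity (\sum_(ab : 'I_2 * 'I_2) H ((A' ab.1 c * B' e ab.2) * (A i ab.1 * B ab.2 j)) l'' l).
  transitivity (\sum_ab \sum_l' adm A B (enum_rank (i, j, l)) (enum_rank (ab, l')) *
     adm A' B' (enum_rank (ab, l')) (enum_rank (c, e, l''))).
    by rewrite pair_big; apply: eq_bigr => -[].
  apply: eq_bigr => -[a b] _; rewrite rmorphM mxE; apply: eq_bigr => l' _.
  by rewrite !admE mulrC.
rewrite -summxE -rmorph_sum; congr (H _ _ _).
rewrite !mxE mulr_suml -(pair_bigA _ (fun a b => A' a c * B' e b * (A i a * B b j))) /=.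
apply: eq_bigr => a _; rewrite mulr_sumr; apply: eq_bigr => b _.
by ring.
Qed.

Lemma adm_scalar (c : R) (A B : 'M[{poly R}]_2) : adm (c%:P *: A) B = c *: adm A B.
Proof.
apply/matrixP => u v; elim/ad_ind: u => i j l; elim/ad_ind: v => a b l'.
by rewrite admE [RHS]mxE admE [(_ *: A) _ _]mxE -mulrA mul_polyC linearZ /= mxE.
Qed.

Lemma adm1 : adm 1%:M 1%:M = 1%:M.
Proof.
apply/matrixP => u v; elim/ad_ind: u => i j l; elim/ad_ind: v => a b l'.
rewrite admE !mxE (inj_eq enum_rank_inj) !xpair_eqE.
rewrite -natrM mulnb -[_%:R]/(GRing.natmul 1 _) rmorph_nat.
rewrite [b == j]eq_sym; case: eqP => _; case: eqP => _ //=; rewrite ?mulr0n ?mxE //.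
by rewrite eq_sym.
Qed.
End AdMatrix.

Lemma map_adm (R R' : comNzRingType) (f : {rmorphism R -> R'}) d' (C : 'M[R]_d'.+1) A B :
  map_mx f (adm C A B) = adm (map_mx f C) (map_mx (map_poly f) A) (map_mx (map_poly f) B).
Proof.
apply/matrixP => u v; elim/ad_ind: u => i j l; elim/ad_ind: v => a b l'.
by rewrite mxE !admE ![(map_mx _ _) _ _]mxE -rmorphM -map_horner_mx mxE.
Qed.

Lemma adm_scalar2 (R : comNzRingType) d' (C : 'M[R]_d'.+1) (c : R) (A B : 'M[{poly R}]_2) :
  adm C A (c%:P *: B) = c *: adm C A B.
Proof.
apply/matrixP => u v; elim/ad_ind: u => i j l; elim/ad_ind: v => a b l'.
by rewrite admE [RHS]mxE admE [(_ *: B) _ _]mxE mulrCA mul_polyC linearZ /= mxE.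
Qed.

Lemma adm_congr (R : comNzRingType) d' (C : 'M[R]_d'.+1) (A B A' B' : 'M[{poly R}]_2) :
  (forall i j, horner_mx C (A i j) = horner_mx C (A' i j)) ->
  (forall i j, horner_mx C (B i j) = horner_mx C (B' i j)) -> adm C A B = adm C A' B'.
Proof.
move=> hA hB; apply/matrixP => u v; elim/ad_ind: u => i j l; elim/ad_ind: v => a b l'.
by rewrite !admE !rmorphM /= hA hB.
Qed.

Section AdCentral.
Variables (R : fieldType) (d' : nat) (C : 'M[R]_d'.+1).
Local Notation H := (horner_mx C).

(* [adm A B] is the matrix of [U |-> A U B]; for [B] inverse to [A] up to the scalar [c],
   it is [c] exactly when [A] is central. *)
Lemma adm_central (P S : 'M[{poly R}]_2) c : c != 0 ->
  (forall i j, H ((P *m S) i j) = (c *+ (i == j))%:M) ->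
  (forall i j, H ((S *m P) i j) = (c *+ (i == j))%:M) ->
  adm C P S = c%:M <-> [/\ H (P 0 1) = 0, H (P 1 0) = 0 & H (P 0 0) = H (P 1 1)].
Proof.
move=> c0 PS SP; split.
  move=> /matrixP e.
  have e1 i a b j : H (P i a * S b j) = (c *+ ((i == a) && (j == b)))%:M.
    apply/matrixP => l' l; have := e (enum_rank (i, j, l)) (enum_rank (a, b, l')).
    rewrite admE => ->; rewrite !mxE (inj_eq enum_rank_inj) !xpair_eqE -mulrnA mulnb.
    by rewrite [l' == l]eq_sym.
  have e2 i a b a' : (c *+ (i == a)) *: H (P b a') = (c *+ (b == a')) *: H (P i a).
    transitivity (\sum_j H (P i a * S b j * P j a')).
      transitivity (\sum_j H (P i a * S b j) * H (P j a')); last first.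
        by apply: eq_bigr => j _; rewrite -rmorphM.
      rewrite (bigD1 b) //= e1 eqxx andbT -[_%:M * _]/(_ *m _) mul_scalar_mx.
      rewrite big1 ?addr0 // => j /negPf jb; rewrite e1 jb andbF mulr0n raddf0 mul0r //.
    have -> : \sum_j H (P i a * S b j * P j a') = H (P i a) * H ((S *m P) b a').
      rewrite [(S *m P) b a']mxE rmorph_sum mulr_sumr; apply: eq_bigr => j _.
      by rewrite -mulrA rmorphM.
    by rewrite SP -[_ * _%:M]/(_ *m _) mul_mx_scalar.
  split; last first.
  - by have := e2 1 1 0 0; rewrite !eqxx !mulr1n => /(scalerI c0).
  - have := e2 0 0 1 0; rewrite eqxx mulr1n mulr0n scale0r => /eqP.
    by rewrite scaler_eq0 (negPf c0) => /eqP.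
  - have := e2 0 0 0 1; rewrite eqxx mulr1n mulr0n scale0r => /eqP.
    by rewrite scaler_eq0 (negPf c0) => /eqP.
move=> [P01 P10 P00].
have Pd i a : H (P i a) = if i == a then H (P 0 0) else 0.
  by elim/ord2_ind: i; elim/ord2_ind: a.
apply/matrixP => u v; elim/ad_ind: u => i j l; elim/ad_ind: v => a b l'.
rewrite admE mxE (inj_eq enum_rank_inj) !xpair_eqE rmorphM /= Pd.
case: eqP => [ia|_] /=; last by rewrite mul0r mxE.
have : H ((P *m S) b j) = H (P 0 0) * H (S b j).
  rewrite mxE rmorph_sum (bigD1 b) //= rmorphM /= Pd eqxx big1 ?addr0 // => x xb.
  by rewrite rmorphM /= Pd eq_sym (negPf xb) mul0r.
rewrite PS => <-; rewrite mxE -mulrnA mulnb eq_sym; congr (c *+ _); congr (nat_of_bool (_ && _)).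
by rewrite eq_sym.
Qed.
End AdCentral.

(** * Explicit 2x2 matrices, and degrees in the inner variable *)

Section Mx2.
Variable R : comNzRingType.
Implicit Types a b c d : R.
Definition mx2 a b c d : 'M[R]_2 :=
  \matrix_(i, j) if i == 0 then if j == 0 then a else b else if j == 0 then c else d.

Lemma mx2P (A B : 'M[R]_2) : A 0 0 = B 0 0 -> A 0 1 = B 0 1 -> A 1 0 = B 1 0 -> A 1 1 = B 1 1 ->
  A = B.
Proof.
by move=> h1 h2 h3 h4; apply/matrixP => i j; elim/ord2_ind: i; elim/ord2_ind: j.
Qed.

Lemma mx2E (A : 'M[R]_2) : A = mx2 (A 0 0) (A 0 1) (A 1 0) (A 1 1).
Proof. by apply: mx2P; rewrite mxE. Qed.

Lemma mulmx2E (A B : 'M[R]_2) i j : (A *m B) i j = A i 0 * B 0 j + A i 1 * B 1 j.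
Proof.
rewrite mxE big_ord_recl big_ord1; congr (_ * _ + _ * _); congr (_ _ _); exact: val_inj.
Qed.

Lemma mulmx2 a b c d a' b' c' d' : mx2 a b c d *m mx2 a' b' c' d' =
  mx2 (a * a' + b * c') (a * b' + b * d') (c * a' + d * c') (c * b' + d * d').
Proof. by apply: mx2P; rewrite mulmx2E !mxE. Qed.

Lemma scale_mx2 x a b c d : x *: mx2 a b c d = mx2 (x * a) (x * b) (x * c) (x * d).
Proof. by apply: mx2P; rewrite !mxE. Qed.

Lemma scalar_mx2 a : a%:M = mx2 a 0 0 a.
Proof. by apply: mx2P; rewrite !mxE. Qed.
End Mx2.

Lemma map_mx2 (R R' : comNzRingType) (f : R -> R') a b c d :
  map_mx f (mx2 a b c d) = mx2 (f a) (f b) (f c) (f d).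
Proof. by apply: mx2P; rewrite !mxE. Qed.

Section HeightBound.
Variable F : fieldType.
(** The outer variable is [T] and the inner one [t]; only the degree in [t] is bounded. *)
Definition hsz B (P : {poly {poly F}}) := forall i, (size (P`_i)%R <= B.+1)%N.

Lemma hsz_le B B' P : (B <= B')%N -> hsz B P -> hsz B' P.
Proof. by move=> BB hP i; apply: leq_trans (hP i) _. Qed.

Lemma hszD B P P' : hsz B P -> hsz B P' -> hsz B (P + P').
Proof.
by move=> hP hP' i; rewrite coefD (leq_trans (size_polyD _ _)) // geq_max hP hP'.
Qed.

Lemma hsz_sum B (I : Type) (r : seq I) (Q : pred I) (P : I -> {poly {poly F}}) :
  (forall i, Q i -> hsz B (P i)) -> hsz B (\sum_(i <- r | Q i) P i).
Proof.
by move=> hP; apply: big_ind => //; [move=> i; rewrite coef0 size_poly0|exact: hszD].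
Qed.

Lemma hszM B B' P P' : hsz B P -> hsz B' P' -> hsz (B + B') (P * P').
Proof.
move=> hP hP' i; rewrite coefM; apply: leq_trans (size_sum _ _ _) _.
apply/bigmax_leqP => j _; apply: leq_trans (size_polyMleq _ _) _.
by have := hP j; have := hP' (i - j)%N; move: (size _) (size _) => x y; lia.
Qed.

Lemma hszN B P : hsz B P -> hsz B (- P).
Proof. by move=> hP i; rewrite coefN size_polyN. Qed.

Lemma hszC (c : {poly F}) : hsz (size c).-1 c%:P.
Proof.
by move=> i; rewrite coefC; case: eqP => _; rewrite ?size_poly0 // leqSpred.
Qed.

Lemma hszX i : hsz 0 'X^i.
Proof. by move=> j; rewrite coefXn; case: eqP => _; rewrite ?size_poly1 ?size_poly0. Qed.

Lemma horner_mx_size B d' (C : 'M[F]_d'.+1) P i j : hsz B P ->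
  (size (horner_mx (map_mx polyC C) P i j) <= B.+1)%N.
Proof.
move=> hP; rewrite -[P]coefK poly_def rmorph_sum summxE.
apply: leq_trans (size_sum _ _ _) _; apply/bigmax_leqP => l _.
rewrite /= linearZ rmorphXn /= horner_mx_X -rmorphXn mxE mxE mulrC mul_polyC.
exact: leq_trans (size_scale_leq _ _) (hP l).
Qed.
End HeightBound.

(** * The conjugation system of a Drinfeld module modulo [m] *)

Section System.
Variables (Fq : finFieldType) (k : closedFieldType) (ik : {rmorphism Fq -> k}).
Variables (G0 G1 G2 : {poly Fq}).
Variables (d' : nat) (m : {poly Fq}).
Hypothesis G0_neq0 : G0 != 0.
Hypothesis G2_neq0 : G2 != 0.
Hypothesis m_monic : m \is monic.
Hypothesis m_size : size m = d'.+2.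
Local Notation q := #|Fq|.
Local Notation C0 := (comp_mx d' m).
Local Notation N := #|{: adI d'}|.
Local Notation Tt := ('X - ('X)%:P : {poly {poly Fq}}).

(* [(m(T) - m(t)) / (T - t)], with [T] the polynomial variable and [t] the one of the coefficients. *)
Definition ddiff : {poly {poly Fq}} :=
  \sum_(i < size m) (m`_i)%:P%:P * \sum_(j < i) 'X^(i.-1 - j) * ('X%:P) ^+ j.

Lemma ddiffE : Tt * ddiff = map_poly polyC m - m%:P.
Proof.
have -> : map_poly polyC m = \sum_(i < size m) (m`_i)%:P%:P * 'X^i :> {poly {poly Fq}}.
  by rewrite /map_poly poly_def; apply: eq_bigr => i _; rewrite mul_polyC.
have -> : m%:P = \sum_(i < size m) (m`_i)%:P%:P * ('X%:P) ^+ i :> {poly {poly Fq}}.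
  rewrite -{1}(coefK m) poly_def rmorph_sum; apply: eq_bigr => i _.
  by rewrite -mul_polyC rmorphM rmorphXn.
rewrite /ddiff mulr_sumr -sumrB; apply: eq_bigr => i _.
by rewrite mulrCA -subrXX mulrBr.
Qed.

Lemma hsz_ddiff : hsz d'.+1 ddiff.
Proof.
apply: hsz_sum => i _; rewrite -[d'.+1]add0n; apply: hszM.
  by apply: hsz_le (hszC _); have := size_polyC_leq1 m`_i; case: (size _) => [|[]].
apply: hsz_sum => j _; rewrite -[d'.+1]add0n; apply: hszM; first exact: hszX.
rewrite -polyC_exp; apply: hsz_le (hszC _); rewrite size_polyXn /=.
apply: leq_trans (ltnW (ltn_ord j)) _; rewrite -ltnS -m_size; exact: ltn_ord.
Qed.

(** For [psi_T = t + (G1/G0) tau + (G2/G0) tau^2] this is [G2] times the matrix of [tau] on the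
    motive in the basis [1, tau], with [T] acting on the motive and [t] its value in the coefficient
    field. *)
Definition PhiG : 'M[{poly {poly Fq}}]_2 := mx2 0 G2%:P (Tt * G0%:P) (- G1%:P).
(** The adjugate of [PhiG] times [ddiff]: modulo [m(T)] it is inverse to [PhiG] up to the factor
    [DD], which is free of [T]. *)
Definition PsiG : 'M[{poly {poly Fq}}]_2 :=
  ddiff *: mx2 (- G1%:P) (- G2%:P) (- (Tt * G0%:P)) 0.
Definition DD := G0 * G2 * m.
(** Conjugation by [PhiG] is [DD^-1 adm PhiG PsiG]. For solutions multiplied by [DD] the matrix
    gains a factor [DD^(q-1)] and becomes polynomial in [t]. *)
Definition LL : 'M[{poly Fq}]_N := DD ^+ (q - 2) *: adm (map_mx polyC C0) PhiG PsiG.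

Lemma PhiPsi : PhiG *m PsiG = ((m%:P - map_poly polyC m) * (G0 * G2)%:P)%:M.
Proof.
rewrite /PsiG -scalemxAr mulmx2 scalar_mx2 scale_mx2 -[m%:P - _]opprB -ddiffE polyCM.
by congr mx2; ring.
Qed.

Lemma PsiPhi : PsiG *m PhiG = ((m%:P - map_poly polyC m) * (G0 * G2)%:P)%:M.
Proof.
rewrite /PsiG -scalemxAl mulmx2 scalar_mx2 scale_mx2 -[m%:P - _]opprB -ddiffE polyCM.
by congr mx2; ring.
Qed.

Definition gsz := (size G0 + size G1 + size G2)%N.
Definition hh := (q * (2 * gsz + d' + 3))%N.

Lemma LL_size u v : (size (LL u v) <= hh.+1)%N.
Proof.
have g0s : (size G0 <= gsz)%N by rewrite /gsz -addnA leq_addr.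
have g1s : (size G1 <= gsz)%N by rewrite /gsz addnAC leq_addl.
have g2s : (size G2 <= gsz)%N by rewrite /gsz leq_addl.
have hT : hsz 1 Tt.
  apply: hszD; first by have := @hszX Fq 1; rewrite expr1; apply: hsz_le.
  by apply/hszN/(hsz_le _ (hszC _)); rewrite size_polyX.
have hG (G : {poly Fq}) : (size G <= gsz)%N -> hsz gsz.+1 G%:P.
  by move=> sG; apply: hsz_le (hszC _); apply: leq_trans (leq_pred _) (leqW sG).
have hTG : hsz gsz.+1 (Tt * G0%:P).
  apply: hsz_le (hszM hT (hszC _)); rewrite add1n ltnS (leq_trans (leq_pred _)) //.
have h0 B : hsz B (0 : {poly {poly Fq}}) by move=> i; rewrite coef0 size_poly0.
have hG1 := hG G1 g1s; have hG2 := hG G2 g2s.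
have hPhi i j : hsz gsz.+1 (PhiG i j).
  elim/ord2_ind: i; elim/ord2_ind: j; rewrite mxE /=; [exact: h0|exact: hG2|exact: hTG|exact/hszN/hG1].
have hPsi i j : hsz (d'.+1 + gsz.+1) (PsiG i j).
  rewrite mxE; apply: hszM hsz_ddiff _.
  elim/ord2_ind: i; elim/ord2_ind: j; rewrite mxE /=;
    [exact/hszN/hG1|exact/hszN/hG2|exact/hszN/hTG|exact: h0].
have s02 : (size (G0 * G2)%R <= gsz)%N.
  apply: leq_trans (size_polyMleq _ _) _; apply: leq_trans (leq_pred _) _.
  by rewrite /gsz addnAC leq_addr.
have sD : (size DD <= gsz + d'.+2)%N.
  rewrite /DD; apply: leq_trans (size_polyMleq _ _) _; rewrite m_size.
  by apply: leq_trans (leq_pred _) _; rewrite leq_add2r.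
elim/ad_ind: u => i j l; elim/ad_ind: v => a b l'.
rewrite mxE admE; apply: leq_trans (size_polyMleq _ _) _.
have := horner_mx_size (comp_mx d' m) l' l (hszM (hPhi i a) (hPsi b j)).
have : (size (DD ^+ (q - 2)) <= ((q - 2) * (gsz + d'.+1)).+1)%N.
  apply: leq_trans (size_poly_exp_leq _ _) _; rewrite ltnS mulnC leq_mul2l; apply/orP; right.
  by rewrite -subn1 leq_subLR add1n -addnS.
rewrite /hh; have q2 := q_gt1 Fq.
have -> : (q * (2 * gsz + d' + 3) = (q - 2) * (2 * gsz + d' + 3) + 2 * (2 * gsz + d' + 3))%N.
  by rewrite -mulnDl subnK.
have : ((q - 2) * (gsz + d'.+1) <= (q - 2) * (2 * gsz + d' + 3))%N by rewrite leq_mul2l; lia.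
by move: (size _) (size _) ((q - 2) * _)%N ((q - 2) * _)%N => x y z t; lia.
Qed.

Section Evaluation.
Variables (K : fieldType) (g : {rmorphism k -> K}) (x : K).
Definition evA : {poly Fq} -> K := horner_eval x \o map_poly (g \o ik).
HB.instance Definition _ := GRing.RMorphism.on evA.
Local Notation CK := (map_mx (g \o ik) C0).
Local Notation mK := (map_poly (g \o ik) m).

Lemma evAC c : evA c%:P = g (ik c).
Proof. by rewrite /evA /= map_polyC /horner_eval hornerC. Qed.

Lemma evAX : evA 'X = x.
Proof. by rewrite /evA /= map_polyX /horner_eval hornerX. Qed.

Definition PhiK := mx2 0 (evA G2)%:P (('X - x%:P) * (evA G0)%:P) (- (evA G1)%:P).
Definition PsiK := map_poly evA ddiff *:
  mx2 (- (evA G1)%:P) (- (evA G2)%:P) (- (('X - x%:P) * (evA G0)%:P)) 0.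

Lemma map_PhiG : map_mx (map_poly evA) PhiG = PhiK.
Proof.
rewrite map_mx2 rmorph0 rmorphN rmorphM rmorphB /= map_polyX !map_polyC /=.
by rewrite evAX.
Qed.

Lemma map_PsiG : map_mx (map_poly evA) PsiG = PsiK.
Proof.
rewrite map_mxZ map_mx2 rmorph0 !rmorphN rmorphM rmorphB /= map_polyX !map_polyC /=.
by rewrite evAX.
Qed.

Lemma LL_ev : evL ik LL g x = evA DD ^+ (q - 2) *: adm CK PhiK PsiK.
Proof.
have -> : evL ik LL g x = map_mx evA LL by apply/matrixP => u v; rewrite !mxE.
rewrite map_mxZ rmorphXn map_adm map_PhiG map_PsiG -map_mx_comp; congr (_ *: adm _ _ _).
by apply/matrixP => u v; rewrite !mxE /= evAC.
Qed.

Lemma CK_comp : CK = comp_mx d' mK.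
Proof. exact: map_comp_mx. Qed.

Lemma horner_CK_m : horner_mx CK mK = 0.
Proof. by rewrite CK_comp comp_mx_root ?size_map_poly ?map_monic. Qed.

Lemma horner_CK_eq0 p : (horner_mx CK p == 0) = (mK %| p).
Proof. by rewrite CK_comp comp_mx_eq0 ?size_map_poly ?map_monic. Qed.

Lemma PhiPsiK : PhiK *m PsiK = (((evA m)%:P - mK) * (evA G0 * evA G2)%:P)%:M.
Proof.
rewrite -map_PhiG -map_PsiG -map_mxM PhiPsi map_scalar_mx rmorphM rmorphB /= !map_polyC /=.
rewrite -rmorphM -map_poly_comp; congr ((_ * _)%:M); congr (_ - _).
by apply: eq_map_poly => c; rewrite /= evAC.
Qed.

Lemma PsiPhiK : PsiK *m PhiK = (((evA m)%:P - mK) * (evA G0 * evA G2)%:P)%:M.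
Proof.
rewrite -map_PhiG -map_PsiG -map_mxM PsiPhi map_scalar_mx rmorphM rmorphB /= !map_polyC /=.
rewrite -rmorphM -map_poly_comp; congr ((_ * _)%:M); congr (_ - _).
by apply: eq_map_poly => c; rewrite /= evAC.
Qed.

Lemma horner_PhiPsiK : horner_mx CK (((evA m)%:P - mK) * (evA G0 * evA G2)%:P) = (evA DD)%:M.
Proof.
rewrite rmorphM rmorphB /= horner_CK_m subr0 !horner_mx_C -[_ * _]/(_ *m _) -scalar_mxM.
by rewrite -rmorphM mulrC -rmorphM.
Qed.
End Evaluation.

(** * Iterating the system at a point of a finite field *)

Section Points.
Local Notation eid := (@idfun k : {rmorphism k -> k}).
Local Notation ee := (evA eid).
Local Notation CK := (map_mx (eid \o ik) C0).
Local Notation mK := (map_poly ik m).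
Hypothesis q_gt2 : (2 < q)%N.

Definition scp x : {poly k} := ((ee x m)%:P - map_poly (eid \o ik) m) * (ee x G0 * ee x G2)%:P.

Fixpoint PP x n : 'M[{poly k}]_2 := if n is n'.+1 then PhiK eid (x ^+ (q ^ n')) *m PP x n' else 1%:M.
Fixpoint QQ x n : 'M[{poly k}]_2 := if n is n'.+1 then QQ x n' *m PsiK eid (x ^+ (q ^ n')) else 1%:M.
Definition scalar_mod (P : {poly k}) (A : 'M[{poly k}]_2) :=
  [/\ P %| A 0 1, P %| A 1 0 & P %| A 0 0 - A 1 1].

Lemma evA_frob n x (P : {poly Fq}) : ee (x ^+ (q ^ n)) P = ee x P ^+ (q ^ n).
Proof.
have [p [e [pp e0 qE pk]]] := q_char_power ik.
rewrite /evA /= /horner_eval qE -expnM -(horner_map_exp (e * n) _ _ pk); congr _.[_].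
apply/polyP => i; rewrite [RHS]coef_map_id0; last by rewrite expr0n expn_eq0 eqn0Ngt prime_gt0.
rewrite !coef_map /=.
rewrite expnM -qE -rmorphXn; congr (ik _).
by elim: n => [|n IH]; rewrite ?expr1 // expnSr exprM -IH expf_card.
Qed.

Lemma evL_ee x : evL ik LL eid x = map_mx (ee x) LL.
Proof. by apply/matrixP => u v; rewrite !mxE. Qed.

Lemma PP_QQ x n : PP x n *m QQ x n = (\prod_(i < n) scp (x ^+ (q ^ i)))%:M.
Proof.
elim: n => [|n IH]; first by rewrite big_ord0 mulmx1.
rewrite /= mulmxA -[_ *m PP x n *m _]mulmxA IH big_ord_recr /= scalar_mxM.
by rewrite scalar_mxC -mulmxA PhiPsiK.
Qed.

Lemma QQ_PP x n : QQ x n *m PP x n = (\prod_(i < n) scp (x ^+ (q ^ i)))%:M.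
Proof.
elim: n => [|n IH]; first by rewrite big_ord0 mulmx1.
rewrite /= mulmxA -[_ *m PsiK _ _ *m _]mulmxA PsiPhiK scalar_mxC -mulmxA IH.
by rewrite -scalar_mxM mulrC big_ord_recr.
Qed.

Definition ccn x n := \prod_(i < n) ee x DD ^+ (q ^ i).

Lemma horner_scp x n : horner_mx CK (\prod_(i < n) scp (x ^+ (q ^ i))) = (ccn x n)%:M.
Proof.
rewrite /ccn; elim: n => [|n IH]; first by rewrite !big_ord0 rmorph1.
rewrite !big_ord_recr rmorphM /= IH horner_PhiPsiK evA_frob.
by rewrite -[_ * _]/(_ *m _) -scalar_mxM.
Qed.

Fixpoint Lp x n : 'M[k]_N := if n is n'.+1 then evL ik LL eid (x ^+ (q ^ n')) *m Lp x n' else 1%:M.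

Lemma Lp_iter x n (Y : 'M[k]_N) : sol ik LL eid x Y -> map_mx (fun c => c ^+ (q ^ n)) Y = Lp x n *m Y.
Proof.
have [p [e [pp e0 qE pk]]] := q_char_power ik.
move=> sY; elim: n => [|n IH].
  by rewrite mul1mx; apply/matrixP => u v; rewrite mxE expr1.
have -> : map_mx (fun c => c ^+ (q ^ n.+1)) Y =
    map_mx (fun c => c ^+ (q ^ n)) (map_mx (frq ik) Y).
  by apply/matrixP => u v; rewrite !mxE /frq -exprM expnS.
have sY' : map_mx (frq ik) Y = evL ik LL eid x *m Y by exact: sY.
rewrite sY' {1}qE -expnM (map_exp_mulmx _ _ _ pk) expnM -qE IH /= mulmxA; congr (_ *m _ *m _).
by apply/matrixP => u v; rewrite !evL_ee mxE [(map_mx _ _) u v]mxE [RHS]mxE evA_frob.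
Qed.

Lemma LpE x n : Lp x n = ccn x n ^+ (q - 2) *: adm CK (PP x n) (QQ x n).
Proof.
elim: n => [|n IH]; first by rewrite /ccn big_ord0 expr1n scale1r adm1.
rewrite /= IH LL_ev -scalemxAl -scalemxAr scalerA adm_mul /ccn big_ord_recr /= evA_frob.
by rewrite exprMn mulrC.
Qed.

Lemma adm_scalar_mx (K : comNzRingType) (C : 'M[K]_d'.+1) (P : {poly K}) c :
  horner_mx C P = c%:M -> adm C P%:M P%:M = (c ^+ 2)%:M.
Proof.
move=> HP.
rewrite (@adm_congr _ _ _ _ _ (c%:P *: 1%:M) (c%:P *: 1%:M)); last first.
- move=> i j; rewrite !mxE; case: eqP => _; rewrite ?mulr1n ?mulr0n ?mulr0 ?mulr1 ?rmorph0 //.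
  by rewrite horner_mx_C.
- move=> i j; rewrite !mxE; case: eqP => _; rewrite ?mulr1n ?mulr0n ?mulr0 ?mulr1 ?rmorph0 //.
  by rewrite horner_mx_C.
by rewrite adm_scalar adm_scalar2 adm1 scalerA scalemx1.
Qed.

Lemma DD_goodp x : ee x DD != 0 -> goodp ik LL x.
Proof.
move=> D0; rewrite /goodp LL_ev unitmxZ ?unitfE ?expf_neq0 //.
have : adm CK (PhiK eid x) (PsiK eid x) *m adm CK (PsiK eid x) (PhiK eid x) \in unitmx.
  rewrite adm_mul PhiPsiK (adm_scalar_mx (c := ee x DD)); last exact: horner_PhiPsiK.
  by rewrite unitmxE det_scalar unitfE !expf_neq0.
by rewrite unitmx_mul => /andP[].
Qed.

(** Iterating the system [n] times multiplies a solution by [ccn^(q-2) adm PP QQ], and a fundamental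
    solution is fixed exactly when this is the identity. Now [ccn] is the norm of [DD(x)], so
    [ccn^(q-1) = 1], and the condition becomes [adm PP QQ = ccn], which [adm_central] interprets. *)
Lemma fixedp_scalar x n : ee x DD != 0 -> x ^+ (q ^ n) = x ->
  fixedp ik LL (q ^ n) x <-> scalar_mod mK (PP x n).
Proof.
move=> D0 xn; have gx := DD_goodp D0; have [Yu Ys] := YxP gx.
have c0 : ccn x n != 0 by apply/prodf_neq0 => i _; rewrite expf_neq0.
have cq : ccn x n ^+ q.-1 = 1.
  apply: (mulfI c0); rewrite -exprS prednK ?q_gt0 // mulr1.
  rewrite -[LHS]/(frq ik _) rmorph_prod /=.
  have e0 : ee x DD ^+ (q ^ n) = ee x DD by rewrite -evA_frob xn.
  have : (\prod_(i < n) frq ik (ee x DD ^+ (q ^ i))) * ee x DD = ccn x n * ee x DD.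
    transitivity (\prod_(i < n.+1) ee x DD ^+ (q ^ i)).
      rewrite big_ord_recl mulrC; congr (_ * _); apply: eq_bigr => i _.
      by rewrite /frq -exprM -expnSr.
    by rewrite big_ord_recr /= e0.
  by move/(mulIf D0).
have -> : fixedp ik LL (q ^ n) x <-> Lp x n = 1%:M.
  rewrite /fixedp (Lp_iter n Ys); split=> [/eqP e|->]; last by rewrite mul1mx.
  by apply: (can_inj (mulmxK Yu)); rewrite e mul1mx.
have -> : Lp x n = 1%:M <-> adm CK (PP x n) (QQ x n) = (ccn x n)%:M.
  have cc : ccn x n ^+ (q - 2) * ccn x n = 1.
    by rewrite -exprSr subn2 prednK // -ltnS prednK ?q_gt0 ?q_gt1.
  have cu : ccn x n ^+ (q - 2) != 0 by rewrite expf_neq0.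
  rewrite LpE; split=> [e|->]; last by rewrite scale_scalar_mx cc.
  by apply: (scalerI cu); rewrite e scale_scalar_mx cc.
rewrite adm_central //; first last.
- by move=> i j; rewrite QQ_PP mxE rmorphMn /= horner_scp raddfMn.
- by move=> i j; rewrite PP_QQ mxE rmorphMn /= horner_scp raddfMn.
have h0 P : horner_mx CK P = 0 <-> mK %| P.
  have e : (horner_mx CK P == 0) = (mK %| P) := horner_CK_eq0 eid P.
  by rewrite -e; split=> /eqP.
have hB P P' : horner_mx CK P = horner_mx CK P' <-> mK %| P - P'.
  rewrite -h0 rmorphB /=; split=> [->|/eqP]; first by rewrite subrr.
  by rewrite subr_eq0 => /eqP.
by split=> -[a b c]; split; by [apply/h0|apply/hB].
Qed.
End Points.
End System.

(** * The algebra generated over [k(t)] by solutions of a linear Frobenius system *)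

Lemma left_kernel_idomain (R : idomainType) n (M : 'M[R]_(n.+1, n)) :
  exists2 v : 'rV_n.+1, v != 0 & v *m M = 0.
Proof.
pose M' : 'M[R]_n.+1 := \matrix_(i, j) if unlift ord_max j is Some j' then M i j' else 0.
have : \det M'^T = 0.
  apply/eqP/det0P; exists (delta_mx 0 ord_max).
    by apply/negP => /eqP/rowP/(_ ord_max)/eqP; rewrite !mxE !eqxx oner_eq0.
  by rewrite -rowE; apply/rowP => i; rewrite !mxE unlift_none.
rewrite det_tr => /eqP/det0P[v v0 vM]; exists v => //; apply/rowP => j.
move/rowP/(_ (lift ord_max j)): vM; rewrite !mxE => e; rewrite -[RHS]e.
by apply: eq_bigr => i _; rewrite mxE liftK.
Qed.

Section RankBound.
Variables (k Om : fieldType) (jk : {rmorphism k -> Om}) (t : Om).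
Hypothesis t_tr : forall P, pv jk t P = 0 -> P = 0.
Variables (I : finType) (om : I -> Om) (q : nat).
Hypothesis q0 : (0 < q)%N.
Variables (e2 : {poly k}) (cf : I -> I -> {poly k}).
Hypothesis e2_neq0 : e2 != 0.
Hypothesis om_frob : forall u, pv jk t e2 * om u ^+ q = \sum_v pv jk t (cf u v) * om v.
Local Notation pt := (pv jk t).

Definition red := {ffun I -> 'I_q}.
Definition omon (e : I -> nat) : Om := \prod_u om u ^+ e u.
Definition rmon (i : 'I_#|{: red}|) : Om := omon (fun u => (enum_val i : red) u).

(* The [k(t)]-span of the reduced monomials. *)
Definition kt (s : Om) := exists2 P : {poly k}, P != 0 & spn jk t rmon (pt P * s).

Lemma kt0 : kt 0.
Proof. by exists 1; rewrite ?oner_eq0 // mulr0; apply: spn0. Qed.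

Lemma ktD s s' : kt s -> kt s' -> kt (s + s').
Proof.
move=> [P P0 Ps] [P' P'0 Ps']; exists (P * P'); first exact: mulf_neq0.
rewrite rmorphM mulrDr; apply: spnD; last by rewrite -mulrA; apply: spnZ.
by rewrite [pt P * _]mulrC -mulrA; apply: spnZ.
Qed.

Lemma ktZ P s : kt s -> kt (pt P * s).
Proof. by move=> [P' P'0 Ps]; exists P' => //; rewrite mulrCA; apply: spnZ. Qed.

Lemma ktZ_inv P s : P != 0 -> kt (pt P * s) -> kt s.
Proof.
move=> P0 [P' P'0 Ps]; exists (P' * P); first exact: mulf_neq0.
by rewrite rmorphM -mulrA.
Qed.

Lemma kt_sum (J : Type) (r : seq J) (Q : pred J) (F : J -> Om) :
  (forall j, Q j -> kt (F j)) -> kt (\sum_(j <- r | Q j) F j).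
Proof. by move=> hF; apply: big_ind => //; [exact: kt0|exact: ktD]. Qed.

Lemma omonM e e' : omon e * omon e' = omon (fun u => e u + e' u)%N.
Proof. by rewrite /omon -big_split; apply: eq_bigr => u _; rewrite exprD. Qed.

Lemma omon1 u n : omon (fun v => (v == u) * n)%N = om u ^+ n.
Proof.
rewrite /omon (bigD1 u) //= eqxx mul1n big1 ?mulr1 // => v /negPf->.
by rewrite mul0n expr0.
Qed.

Lemma omon_ext e e' : e =1 e' -> omon e = omon e'.
Proof. by move=> ee; apply: eq_bigr => u _; rewrite ee. Qed.

Hypothesis q1 : (1 < q)%N.

Lemma kt_omon e : kt (omon e).
Proof.
have [s] := ubnP (\sum_u e u); elim: s e => // s IH e; rewrite ltnS => es.
have [/forallP eq|/forallPn[u]] := boolP [forall u, e u < q]%N.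
  pose e0 : red := [ffun u => Ordinal (eq u)].
  exists 1; rewrite ?oner_eq0 // rmorph1 mul1r.
  have -> : omon e = rmon (enum_rank e0).
    by rewrite /rmon enum_rankK; apply: omon_ext => u; rewrite ffunE.
  exact: spn_self.
rewrite -leqNgt => qe; pose e' v := (e v - (v == u) * q)%N.
have eE v : e v = (e' v + (v == u) * q)%N.
  by rewrite /e'; have [->|_] := eqVneq v u; lia.
have se : (\sum_v e v = \sum_v e' v + q)%N.
  rewrite (eq_bigr _ (fun v _ => eE v)) big_split /=; congr (_ + _)%N.
  by rewrite (bigD1 u) //= eqxx mul1n big1 ?addn0 // => v /negPf->.
apply: (@ktZ_inv e2) => //.
have -> : pt e2 * omon e = \sum_v pt (cf u v) * omon (fun w => e' w + (w == v) * 1)%N.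
  rewrite (omon_ext eE) -omonM omon1 mulrCA om_frob mulr_sumr; apply: eq_bigr => v _.
  by rewrite -omonM omon1 expr1 mulrCA.
apply: kt_sum => v _; apply: ktZ; apply: IH; apply: leq_trans es.
rewrite big_split /= se; have -> : (\sum_w (w == v) * 1 = 1)%N.
  by rewrite (bigD1 v) //= eqxx big1 // => w /negPf->.
by rewrite ltn_add2l.
Qed.

Lemma kt_om u : kt (om u).
Proof. by have := kt_omon (fun v => (v == u) * 1)%N; rewrite omon1 expr1. Qed.

Lemma kt_pt P : kt (pt P).
Proof.
rewrite -[pt P]mulr1; apply: ktZ.
have -> : 1 = omon (fun=> 0%N) by rewrite /omon big1.
exact: kt_omon.
Qed.

Lemma kt1 : kt 1. Proof. by rewrite -(rmorph1 pt); apply: kt_pt. Qed.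

Lemma ktM s s' : kt s -> kt s' -> kt (s * s').
Proof.
move=> [P P0 [A As]] [P' P'0 [A' As']]; apply: (@ktZ_inv (P * P')); first exact: mulf_neq0.
rewrite rmorphM mulrACA As As' mulr_suml; apply: kt_sum => i _.
rewrite mulr_sumr; apply: kt_sum => j _; rewrite mulrACA -rmorphM; apply: ktZ.
by rewrite omonM; apply: kt_omon.
Qed.

Lemma ktN s : kt s -> kt (- s).
Proof. by move=> ks; rewrite -mulN1r -(rmorphN1 pt); apply: ktZ. Qed.

Lemma ktX s n : kt s -> kt (s ^+ n).
Proof. by move=> ks; elim: n => [|n IH]; [exact: kt1|rewrite exprS; apply: ktM]. Qed.

Lemma kt_prod (J : Type) (r : seq J) (Q : pred J) (F : J -> Om) :
  (forall j, Q j -> kt (F j)) -> kt (\prod_(j <- r | Q j) F j).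
Proof. by move=> hF; apply: big_ind => //; [exact: kt1|exact: ktM]. Qed.

Lemma kt_dependent (s : 'I_#|{: red}|.+1 -> Om) : (forall i, kt (s i)) ->
  exists2 v : 'I_#|{: red}|.+1 -> {poly k}, (exists i, v i != 0) & \sum_i pt (v i) * s i = 0.
Proof.
move=> ks; have /choice[P hP] : forall i, exists P : {poly k}, P != 0 /\ spn jk t rmon (pt P * s i).
  by move=> i; have [P P0 Ps] := ks i; exists P.
have /choice[A hA] : forall i, exists A, pt (P i) * s i = \sum_e pt (A e) * rmon e.
  by move=> i; have [A sA] := (hP i).2; exists A.
have [v v0 vM] := left_kernel_idomain (\matrix_(i, e) A i e).
exists (fun i => v 0 i * P i).
  have [i vi] : exists i, v 0 i != 0.
    apply: contrapT => H; case/negP: v0; apply/eqP/rowP => i; rewrite mxE; apply/eqP.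
    by apply: contraT => vi; case: H; exists i.
  by exists i; rewrite mulf_neq0 // (hP i).1.
under eq_bigr do rewrite rmorphM -mulrA hA mulr_sumr.
rewrite exchange_big big1 // => e _.
under eq_bigr do rewrite mulrA -rmorphM.
rewrite -mulr_suml -rmorph_sum; have /rowP/(_ e) := vM; rewrite !mxE.
under eq_bigr do rewrite mxE.
by move=> ->; rewrite rmorph0 mul0r.
Qed.

(** The span is a finite-dimensional algebra, so [s] satisfies a polynomial equation over [k[t]].
    Dividing out powers of [s] leaves a nonzero constant term, from which the inverse is read
    off. *)
Lemma ktV s : kt s -> kt s^-1.
Proof.
move=> ks; have [->|s0] := eqVneq s 0; first by rewrite invr0; apply: kt0.
have [v [i0 vi0] e] := kt_dependent (fun i => ktX i ks).
have H : forall n (w : nat -> {poly k}), \sum_(i < n) pt (w i) * s ^+ i = 0 ->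
    (exists2 i, (i < n)%N & w i != 0) -> kt s^-1.
  elim=> [|n IH] w; first by move=> _ [].
  rewrite big_ord_recl expr0 mulr1 => rel wn.
  have rel' : pt (w 0%N) + s * \sum_(i < n) pt (w i.+1) * s ^+ i = 0.
    rewrite -[RHS]rel; congr (_ + _); rewrite mulr_sumr; apply: eq_bigr => i _.
    by rewrite lift0 exprS mulrCA.
  have [w0|w0] := eqVneq (w 0%N) 0.
    apply: (IH (fun i => w i.+1)).
      by apply: (mulfI s0); rewrite mulr0 -[RHS]rel' w0 rmorph0 add0r.
    by case: wn => -[|i] ilt wi; [rewrite w0 eqxx in wi|exists i].
  apply: (ktZ_inv w0); have -> : pt (w 0%N) * s^-1 = - \sum_(i < n) pt (w i.+1) * s ^+ i.
    by apply: (mulIf s0); rewrite divfK // mulNr mulrC; apply/eqP; rewrite -addr_eq0 rel'.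
  by apply/ktN/kt_sum => i _; apply/ktZ/ktX.
apply: (H _ (fun i => v (inord i))); last by exists i0; rewrite ?ltn_ord // inord_val.
by rewrite -[RHS]e; apply: eq_bigr => i _; rewrite inord_val.
Qed.

Definition ktM_mx m n (A : 'M[Om]_(m, n)) := forall i j, kt (A i j).

Lemma kt_det n (A : 'M[Om]_n) : ktM_mx A -> kt (\det A).
Proof.
move=> hA; apply: kt_sum => s _; apply: ktM; first exact/ktX/ktN/kt1.
by apply: kt_prod => i _; apply: hA.
Qed.

Lemma kt_invmx n (A : 'M[Om]_n) : ktM_mx A -> ktM_mx (invmx A).
Proof.
move=> hA i j; rewrite /invmx; case: ifP => // _; rewrite mxE; apply: ktM; first exact/ktV/kt_det.
rewrite mxE; apply: ktM; first exact/ktX/ktN/kt1.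
by apply: kt_det => a b; rewrite !mxE.
Qed.

Lemma indep_kt_card r (b : 'I_r -> Om) : indep jk t b -> (forall i, kt (b i)) ->
  (r <= q ^ #|I|)%N.
Proof.
move=> ib kb; rewrite -(card_ord q) -card_ffun leqNgt; apply/negP => rq.
have [v [i vi] rel] := kt_dependent (fun i => kb (widen_ord rq i)).
pose P (j : 'I_r) := if insub (j : nat) is Some i then v i else 0.
case/negP: vi; apply/eqP; have := ib P _ (widen_ord rq i).
rewrite /P valK; apply.
rewrite (bigID (fun j : 'I_r => (j < #|{: red}|.+1)%N)) /= [X in _ + X]big1 ?addr0; last first.
  by move=> j /negPf jn; rewrite insubF // rmorph0 mul0r.
rewrite -[RHS]rel; rewrite (big_ord_narrow rq).
by apply: eq_bigr => j _; rewrite /= valK.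
Qed.
End RankBound.

(** * The generic solution attached to a fundamental matrix of the motive modulo [m] *)

Section GenericSolution.
Variables (Fq : finFieldType) (k : closedFieldType) (ik : {rmorphism Fq -> k}).
Variables (G0 G1 G2 : {poly Fq}).
Variables (d' : nat) (m : {poly Fq}).
Hypothesis G0_neq0 : G0 != 0.
Hypothesis G2_neq0 : G2 != 0.
Hypothesis m_monic : m \is monic.
Hypothesis m_size : size m = d'.+2.
Local Notation q := #|Fq|.
Hypothesis q_gt2 : (2 < q)%N.
Variables (Om : fieldType) (jk : {rmorphism k -> Om}) (t : Om).
Hypothesis t_tr : forall P, pv jk t P = 0 -> P = 0.
Local Notation C := (map_mx (jk \o ik) (comp_mx d' m)).
Local Notation H := (horner_mx C).
Local Notation et := (evA ik jk t).
Local Notation fr := (frq (jk \o ik)).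
Variables (wa wb wc wd gi : {poly Om}).
Local Notation W := (mx2 wa wb wc wd).
Local Notation W' := (gi *: mx2 wd (- wb) (- wc) wa).
Hypothesis W_size : forall i j, (size (W i j) <= d'.+1)%N.
Hypothesis gi_inv : H (gi * (wa * wd - wb * wc)) = 1.
Hypothesis W_frob : forall i j,
  (et G2) *: H (map_poly fr (W i j)) = H ((PhiK ik G0 G1 G2 jk t *m W) i j).

(** If [G2 W^(q) = Phi W] modulo [m], then [U -> W U W^-1] solves the conjugation system, the factor
    [G2] cancelling. The factor [DD] corresponds to the normalisation of [LL]. *)
Definition Yg := et (DD G0 G2 m) *: adm C W W'.
Local Notation LLm := (LL G0 G1 G2 d' m).

Lemma et_neq0 P : P != 0 -> et P != 0.
Proof.
move=> P0; rewrite /evA /= map_poly_comp; apply/eqP => e; have := t_tr e.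
by move/eqP; rewrite map_poly_eq0 (negPf P0).
Qed.

Lemma DD_neq0 : DD G0 G2 m != 0.
Proof. by rewrite !mulf_neq0 // monic_neq0. Qed.

Lemma WW' : W *m W' = (gi * (wa * wd - wb * wc))%:M.
Proof. by rewrite -scalemxAr mulmx2 scalar_mx2 scale_mx2; congr mx2; ring. Qed.

Lemma W'W : W' *m W = (gi * (wa * wd - wb * wc))%:M.
Proof. by rewrite -scalemxAl mulmx2 scalar_mx2 scale_mx2; congr mx2; ring. Qed.

Lemma horner_fr P : H (map_poly fr P) = map_mx fr (H P).
Proof.
by rewrite map_horner_mx map_frq_base.
Qed.

Lemma horner_mul_congr (A A' B B' : 'M[{poly Om}]_2) :
  (forall i j, H (A i j) = H (A' i j)) -> (forall i j, H (B i j) = H (B' i j)) ->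
  forall i j, H ((A *m B) i j) = H ((A' *m B') i j).
Proof.
move=> hA hB i j; rewrite !mxE !rmorph_sum; apply: eq_bigr => l _ /=.
by rewrite !rmorphM /= hA hB.
Qed.

Lemma horner_scalar_mul p c (A : 'M[{poly Om}]_2) : H p = c%:M ->
  forall i j, H ((p%:M *m A) i j) = H ((c%:P *: A) i j).
Proof.
move=> hp i j; rewrite mul_scalar_mx ![(_ *: A) i j]mxE !rmorphM /= hp.
by rewrite horner_mx_C.
Qed.

Lemma Yg_sol : sol ik LLm jk t Yg.
Proof.
rewrite /sol LL_ev /Yg map_mxZ map_adm.
have CE : map_mx fr C = C by rewrite map_frq_base.
have etfr P : fr (et P) = et P ^+ q by [].
rewrite CE; set Wf := map_mx (map_poly fr) W; set Wf' := map_mx (map_poly fr) W'.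
set Ph := PhiK ik G0 G1 G2 jk t; set Ps := PsiK ik G0 G1 G2 m jk t.
have D0 := et_neq0 DD_neq0; have e20 := et_neq0 G2_neq0.
have h1 i j : H (((et G2)%:P *: Wf) i j) = H ((Ph *m W) i j).
  by rewrite mxE [Wf i j]mxE mul_polyC linearZ /= W_frob.
have hDD : H (((et m)%:P - map_poly (jk \o ik) m) * (et G0 * et G2)%:P) = (et (DD G0 G2 m))%:M.
  exact: horner_PhiPsiK.
have gi1 : H (gi * (wa * wd - wb * wc)) = 1%:M by [].
have h2 i j : H ((Wf' *m Wf) i j) = H (1%:M i j).
  rewrite -map_mxM W'W map_scalar_mx mxE [1%:M i j]mxE; case: eqP => _; last by rewrite !mulr0n.
  by rewrite !mulr1n /= horner_fr gi1 [RHS]rmorph1; apply: map_mx1.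
(* The equation for the inverse of [W], cleared of denominators: [DD W'^(q) = G2 W' Psi] modulo
   [m]. *)
have h3 i j : H (((et (DD G0 G2 m))%:P *: Wf') i j) = H (((et G2)%:P *: (W' *m Ps)) i j).
  rewrite -(horner_scalar_mul Wf' hDD) -scalar_mxC.
  transitivity (H ((Wf' *m (Ph *m Ps)) i j)); first by rewrite PhiPsiK.
  transitivity (H ((Wf' *m (Ph *m (W *m W') *m Ps)) i j)).
    apply: horner_mul_congr => // a b; apply: horner_mul_congr => // {}a {}b.
    by rewrite WW' scalar_mxC (horner_scalar_mul Ph gi1) polyC1 scale1r.
  have -> : Wf' *m (Ph *m (W *m W') *m Ps) = (Wf' *m (Ph *m W)) *m (W' *m Ps) by rewrite !mulmxA.
  have -> : (et G2)%:P *: (W' *m Ps) = ((et G2)%:P *: 1%:M) *m (W' *m Ps).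
    by rewrite -[RHS]scalemxAl mul1mx.
  apply: horner_mul_congr => // a b.
  transitivity (H ((Wf' *m ((et G2)%:P *: Wf)) a b)); first by apply: horner_mul_congr.
  rewrite -scalemxAr; have sc (A : 'M[{poly Om}]_2) : H (((et G2)%:P *: A) a b) = H (et G2)%:P * H (A a b).
    by rewrite [(_ *: A) a b]mxE rmorphM.
  by rewrite !sc h2.
have e : adm C Wf Wf' = (et (DD G0 G2 m))^-1 *: (adm C Ph Ps *m adm C W W').
  have cu : et G2 * et (DD G0 G2 m) != 0 by rewrite mulf_neq0.
  apply: (scalerI cu); rewrite mulrC -[LHS]scalerA -adm_scalar -adm_scalar2 scalerA.
  rewrite mulrAC divff // mul1r adm_mul -adm_scalar2.
  exact: adm_congr.
rewrite e -!scalemxAl -!scalemxAr !scalerA; congr (_ *: _).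
apply: (mulIf D0); rewrite divfK // -!exprSr -[LHS]/(et (DD G0 G2 m) ^+ q); congr (_ ^+ _).
by rewrite -addn2 subnK // ltnW.
Qed.

Lemma Yg_unit : Yg \in unitmx.
Proof.
rewrite unitmxZ ?unitfE ?et_neq0 ?DD_neq0 //.
have : adm C W W' *m adm C W' W \in unitmx.
  rewrite adm_mul WW' (adm_scalar_mx (c := 1)) ?expr1n ?unitmx1 //.
by rewrite unitmx_mul => /andP[].
Qed.

Definition omc (u : adI d') : Om := (W u.1.1 u.1.2)`_u.2.

Lemma horner_CE (P : {poly {poly Fq}}) :
  H (map_poly et P) = map_mx et (horner_mx (map_mx polyC (comp_mx d' m)) P).
Proof.
rewrite map_horner_mx -map_mx_comp; congr (horner_mx _ _).
by apply/matrixP => i j; rewrite !mxE /= evAC.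
Qed.

Lemma omc_frob : exists cf : adI d' -> adI d' -> {poly k},
  forall u, pv jk t (map_poly ik G2) * omc u ^+ q = \sum_v pv jk t (cf u v) * omc v.
Proof.
have pvE P : pv jk t (map_poly ik P) = et P by rewrite /pv /evA /= -map_poly_comp.
pose cf (u v : adI d') : {poly k} := if v.1.2 == u.1.2 then
   map_poly ik (horner_mx (map_mx polyC (comp_mx d' m)) (PhiG G0 G1 G2 u.1.1 v.1.1) v.2 u.2) else 0.
exists cf => -[[i j] l]; rewrite pvE.
have mK : map_poly (jk \o ik) m \is monic by rewrite map_monic.
have sK : size (map_poly (jk \o ik) m) = d'.+2 by rewrite size_map_poly.
have row0 (P : {poly Om}) : (size P <= d'.+1)%N -> delta_mx 0 0 *m H P = poly_rV P :> 'rV_d'.+1.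
  by move=> sP; rewrite map_comp_mx; apply: comp_mx_row0.
have -> : et G2 * omc (i, j, l) ^+ q = ((delta_mx 0 0 : 'rV_d'.+1) *m (et G2 *: H (map_poly fr (W i j)))) 0 l.
  rewrite -scalemxAr row0; last by rewrite size_map_poly.
  by rewrite mxE mxE coef_map.
have step a : ((delta_mx 0 0 : 'rV_d'.+1) *m (H (PhiK ik G0 G1 G2 jk t i a) * H (W a j))) 0 l =
    \sum_(l' < d'.+1) et (horner_mx (map_mx polyC (comp_mx d' m)) (PhiG G0 G1 G2 i a) l' l) * (W a j)`_l'.
  have -> : H (PhiK ik G0 G1 G2 jk t i a) * H (W a j) = H (W a j) *m H (PhiK ik G0 G1 G2 jk t i a).
    exact: comm_horner_mx2.
  rewrite mulmxA row0 // mxE; apply: eq_bigr => l' _.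
  by rewrite [poly_rV _ _ _]mxE -map_PhiG [(map_mx _ (PhiG _ _ _)) i a]mxE horner_CE
    [(map_mx _ (horner_mx _ _)) _ _]mxE mulrC.
rewrite W_frob mulmx2E rmorphD !rmorphM /= mulmxDr [LHS]mxE !step.
transitivity (\sum_a \sum_b \sum_l' pv jk t (cf (i, j, l) (a, b, l')) * omc (a, b, l')); last first.
  by rewrite pair_bigA pair_bigA; apply: eq_bigr => -[[]].
have sum2 (F : 'I_2 -> Om) : \sum_a F a = F 0 + F 1.
  by rewrite big_ord_recl big_ord1; congr (_ + F _); apply: val_inj.
rewrite sum2.
have one a : \sum_b \sum_l' pv jk t (cf (i, j, l) (a, b, l')) * omc (a, b, l') =
    \sum_(l' < d'.+1) et (horner_mx (map_mx polyC (comp_mx d' m)) (PhiG G0 G1 G2 i a) l' l) * (W a j)`_l'.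
  rewrite (bigD1 j) //= [X in _ + X]big1 ?addr0 => [|b /negPf bj]; last first.
    by rewrite big1 // => l' _; rewrite /cf /= bj rmorph0 mul0r.
  by apply: eq_bigr => l' _; rewrite /cf /= eqxx pvE.
by rewrite !one.
Qed.

(** [Yg] has [(4 d)^2] entries, for [d = d' + 1], but all of them lie in the algebra generated over
    [k(t)] by the [4 d] coefficients of [W]. That algebra is closed under inversion and spanned by
    [q^(4 d)] reduced monomials. *)
Theorem rank_bound r (b : 'I_r -> Om) : indep jk t b -> eqspn jk t (@mm Fq #|{: adI d'}| Om Yg) b ->
  (r <= q ^ (4 * d'.+1))%N.
Proof.
move=> ib [_ bm]; have [cf cfE] := omc_frob.
have G20 : map_poly ik G2 != 0 by rewrite map_poly_eq0.
have q1 := q_gt1 Fq; have q0 := q_gt0 Fq.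
have -> : (4 * d'.+1)%N = #|{: adI d'}| by rewrite !card_prod !card_ord.
pose KT := kt jk t omc q.
have K0 : KT 0 by exact: kt0.
have KD s s' : KT s -> KT s' -> KT (s + s') by exact: ktD.
have KM s s' : KT s -> KT s' -> KT (s * s') by exact: (ktM q0 G20 cfE q1).
have KN s : KT s -> KT (- s) by exact: ktN.
have Kp P : KT (pv jk t P) by exact: (kt_pt q0 G20 cfE q1).
have Kx s n : KT s -> KT (s ^+ n) by exact: (ktX q0 G20 cfE q1).
have KS (J : Type) (l : seq J) (Q : pred J) (F : J -> Om) :
  (forall j, Q j -> KT (F j)) -> KT (\sum_(j <- l | Q j) F j) by exact: kt_sum.
have KP (J : Type) (l : seq J) (Q : pred J) (F : J -> Om) :
  (forall j, Q j -> KT (F j)) -> KT (\prod_(j <- l | Q j) F j) by exact: (kt_prod q0 G20 cfE q1).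
have Kjk c : KT (jk c) by rewrite -(pvC jk t); apply: Kp.
pose KMx n1 n2 (A : 'M[Om]_(n1, n2)) := forall i j, KT (A i j).
have KMM n1 n2 n3 (A : 'M[Om]_(n1, n2)) (B : 'M_(n2, n3)) : KMx _ _ A -> KMx _ _ B -> KMx _ _ (A *m B).
  by move=> hA hB i j; rewrite mxE; apply: KS => l _; apply: KM.
have KC n : KMx _ _ (C ^+ n).
  elim: n => [|n IH]; first by move=> i j; rewrite mxE -(rmorph_nat jk); apply: Kjk.
  by rewrite exprS; apply: KMM => // i j; rewrite mxE; apply: Kjk.
have KH (P : {poly Om}) : (forall l, KT P`_l) -> KMx _ _ (H P).
  move=> hP i j; rewrite -[P]coefK poly_def rmorph_sum summxE; apply: KS => l _.
  by rewrite /= linearZ rmorphXn /= horner_mx_X mxE; apply: KM => //; apply: KC.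
have KW i j : KMx _ _ (H (W i j)).
  apply: KH => l; have [ld|dl] := ltnP l d'.+1.
    by have := kt_om q0 G20 cfE q1 ((i, j), Ordinal ld); apply.
  by rewrite nth_default // (leq_trans (W_size i j)).
have Ka : KMx _ _ (H wa) by have := KW 0 0; rewrite mxE.
have Kb : KMx _ _ (H wb) by have := KW 0 1; rewrite mxE.
have Kc : KMx _ _ (H wc) by have := KW 1 0; rewrite mxE.
have Kd : KMx _ _ (H wd) by have := KW 1 1; rewrite mxE.
have KNm n1 n2 (A : 'M[Om]_(n1, n2)) : KMx _ _ A -> KMx _ _ (- A).
  by move=> hA i j; rewrite mxE; apply: KN.
have Kdet : KMx _ _ (H (wa * wd - wb * wc)).
  rewrite rmorphB !rmorphM /= => i j; rewrite mxE; apply: KD; first exact: KMM.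
  by apply: KNm; apply: KMM.
have Kg : KMx _ _ (H gi).
  have e : H gi *m H (wa * wd - wb * wc) = 1%:M.
    by move: gi_inv; rewrite rmorphM.
  have [_ uD] := mulmx1_unit e.
  have -> : H gi = invmx (H (wa * wd - wb * wc)).
    by rewrite -[RHS]mul1mx -e mulmxK.
  by apply: (kt_invmx q0 G20 cfE q1).
have KW' i j : KMx _ _ (H (W' i j)).
  rewrite mxE rmorphM /=; apply: KMM => //.
  elim/ord2_ind: i; elim/ord2_ind: j; rewrite mxE /= ?rmorphN /=;
    [exact: Kd|exact: KNm|exact: KNm|exact: Ka].
have KY u v : KT (Yg u v).
  rewrite mxE; apply: KM.
    have -> : et (DD G0 G2 m) = pv jk t (map_poly ik (DD G0 G2 m)).
      by rewrite /pv /evA /= -map_poly_comp.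
    exact: Kp.
  elim/ad_ind: u => i j l; elim/ad_ind: v => a c l'.
  by rewrite admE rmorphM /=; apply: KMM.
apply: (indep_kt_card ib) => i; have [P ->] := bm i.
by apply: KS => e _; apply: KM => //; apply: KP => ij _; apply: Kx.
Qed.
End GenericSolution.

(** * Formal power series *)

Record ps (k : fieldType) := Ps { psc : nat -> k }.
Arguments Ps {k} _.

HB.instance Definition _ k := gen_eqMixin (ps k).
HB.instance Definition _ k := gen_choiceMixin (ps k).

Section PowerSeries.
Variable k : fieldType.
Implicit Types f g h : ps k.

Lemma psP f g : (forall i, psc f i = psc g i) -> f = g.
Proof. by case: f g => f [g] /= fg; congr Ps; apply/funext. Qed.

Definition ptr n f : {poly k} := \poly_(i < n.+1) psc f i.

Definition ps_zero : ps k := Ps (fun=> 0).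
Definition ps_add f g := Ps (fun i => psc f i + psc g i).
Definition ps_opp f := Ps (fun i => - psc f i).
Definition ps_one : ps k := Ps (fun i => (i == 0%N)%:R).
(** Products are computed on truncations, so that the ring laws are inherited from polynomials
    through [agree]. *)
Definition ps_mul f g := Ps (fun n => (ptr n f * ptr n g)`_n).

Definition agree n f (P : {poly k}) := forall i, (i <= n)%N -> psc f i = P`_i.

Lemma agree_ptr n f : agree n f (ptr n f).
Proof. by move=> i le_in; rewrite coef_poly ltnS le_in. Qed.

Lemma agreeP f g : (forall n, exists2 P, agree n f P & agree n g P) -> f = g.
Proof. by move=> H; apply: psP => n; have [P ->//] := H n; move=> ->. Qed.

Lemma agreeD n f g P Q : agree n f P -> agree n g Q -> agree n (ps_add f g) (P + Q).
Proof. by move=> fP gQ i le_in; rewrite /= coefD fP // gQ. Qed.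

Lemma agreeM n f g P Q : agree n f P -> agree n g Q -> agree n (ps_mul f g) (P * Q).
Proof.
move=> fP gQ i le_in; rewrite /= !coefM; apply: eq_bigr => j _.
have ji : (j <= i)%N by rewrite -ltnS ltn_ord.
rewrite !coef_poly !ltnS ji leq_subr fP ?gQ //; last exact: leq_trans ji le_in.
by rewrite (leq_trans _ le_in) // leq_subr.
Qed.

Lemma agree1 n : agree n ps_one 1.
Proof. by move=> i _; rewrite coef1. Qed.

Lemma ps_addA : associative ps_add.
Proof. by move=> f g h; apply: psP => i; rewrite /= addrA. Qed.
Lemma ps_addC : commutative ps_add.
Proof. by move=> f g; apply: psP => i; rewrite /= addrC. Qed.
Lemma ps_add0 : left_id ps_zero ps_add.
Proof. by move=> f; apply: psP => i; rewrite /= add0r. Qed.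
Lemma ps_addN : left_inverse ps_zero ps_opp ps_add.
Proof. by move=> f; apply: psP => i; rewrite /= addNr. Qed.

HB.instance Definition _ := GRing.isZmodule.Build (ps k) ps_addA ps_addC ps_add0 ps_addN.

Lemma ps_mulA : associative ps_mul.
Proof.
move=> f g h; apply: agreeP => n; have [a b c] := And3 (@agree_ptr n f) (@agree_ptr n g) (@agree_ptr n h).
exists (ptr n f * ptr n g * ptr n h); last by do ![apply: agreeM => //].
by rewrite -mulrA; do ![apply: agreeM => //].
Qed.
Lemma ps_mulC : commutative ps_mul.
Proof. by move=> f g; apply: psP => n; rewrite /= mulrC. Qed.
Lemma ps_mul1 : left_id ps_one ps_mul.
Proof.
move=> f; apply: agreeP => n; exists (ptr n f); last exact: agree_ptr.
by rewrite -[ptr n f]mul1r; apply: agreeM; [exact: agree1|exact: agree_ptr].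
Qed.
Lemma ps_mulDl : left_distributive ps_mul ps_add.
Proof.
move=> f g h; apply: agreeP => n; have [a b c] := And3 (@agree_ptr n f) (@agree_ptr n g) (@agree_ptr n h).
exists ((ptr n f + ptr n g) * ptr n h); first by apply: agreeM => //; apply: agreeD.
by rewrite mulrDl; apply: agreeD; apply: agreeM.
Qed.
Lemma ps_one_neq0 : ps_one != 0.
Proof. by apply/eqP => /(congr1 (fun f => psc f 0)) /=/eqP; rewrite oner_eq0. Qed.

HB.instance Definition _ := GRing.Zmodule_isComNzRing.Build (ps k)
  ps_mulA ps_mulC ps_mul1 ps_mulDl ps_one_neq0.

Lemma pscD f g i : psc (f + g) i = psc f i + psc g i. Proof. by []. Qed.
Lemma pscN f i : psc (- f) i = - psc f i. Proof. by []. Qed.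
Lemma pscB f g i : psc (f - g) i = psc f i - psc g i. Proof. by []. Qed.
Lemma pscM f g n : psc (f * g) n = \sum_(i < n.+1) psc f i * psc g (n - i).
Proof.
rewrite /= coefM; apply: eq_bigr => i _.
by rewrite !coef_poly ltn_ord ltnS leq_subr.
Qed.

Definition van s f := forall i, (i < s)%N -> psc f i = 0.

Lemma vanD s f g : van s f -> van s g -> van s (f + g).
Proof. by move=> vf vg i si; rewrite pscD vf ?vg ?addr0. Qed.
Lemma vanN s f : van s f -> van s (- f).
Proof. by move=> vf i si; rewrite pscN vf ?oppr0. Qed.
Lemma van_sum s (I : Type) (r : seq I) (Q : pred I) (F : I -> ps k) :
  (forall i, Q i -> van s (F i)) -> van s (\sum_(i <- r | Q i) F i).
Proof. by move=> vF; apply: big_ind => //; exact: vanD. Qed.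
Lemma van_le s s' f : (s <= s')%N -> van s' f -> van s f.
Proof. by move=> ss vf i si; apply: vf; apply: leq_trans ss. Qed.

Lemma vanM s s' f g : van s f -> van s' g -> van (s + s') (f * g).
Proof.
move=> vf vg i si; rewrite pscM big1 // => j _.
have [js|sj] := ltnP j s; first by rewrite vf ?mul0r.
by rewrite vg ?mulr0 //; have := ltn_ord j; lia.
Qed.

Lemma vanMl s f g : van s g -> van s (f * g).
Proof. by move=> vg; rewrite -[s]add0n; apply: vanM => // i. Qed.

Lemma vanX s f n : van s f -> van (n * s) (f ^+ n).
Proof.
move=> vf; elim: n => [|n IH]; first by move=> i.
by rewrite exprS mulSn; apply: vanM.
Qed.

(** Inverses are chosen and not computed: what matters is that power series form an integral domain
    with a fraction field. *)
Definition ps_unit : pred (ps k) := fun f => `[< exists g, g * f = 1 >].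
Definition ps_inv f := if pselect (exists g, g * f = 1) is left P then projT1 (cid P) else f.

Lemma ps_mulV : {in ps_unit, left_inverse 1 ps_inv *%R}.
Proof.
move=> f /asboolP uf; rewrite /ps_inv; case: pselect => // P.
by case: (cid P).
Qed.
Lemma ps_unitP f g : g * f = 1 -> ps_unit f.
Proof. by move=> e; apply/asboolP; exists g. Qed.
Lemma ps_inv_out : {in [predC ps_unit], ps_inv =1 id}.
Proof.
move=> f; rewrite inE /= => /asboolP uf; rewrite /ps_inv; case: pselect => // P.
Qed.

HB.instance Definition _ := GRing.ComNzRing_hasMulInverse.Build (ps k)
  ps_mulV ps_unitP ps_inv_out.

Lemma ps_val f : f != 0 -> exists2 s, van s f & psc f s != 0.
Proof.
move=> f0; have ex : exists s, psc f s != 0.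
  apply: contrapT => H; case/eqP: f0; apply: psP => i; apply/eqP.
  by apply: contraT => fi; case: H; exists i.
exists (ex_minn ex); case: ex_minnP => s // fs smin i si.
by apply/eqP; apply: contraTT si => fi; rewrite -leqNgt smin.
Qed.

Lemma ps_idom : GRing.integral_domain_axiom (ps k).
Proof.
move=> f g fg; have [//|f0] := eqVneq f 0; have [//|g0] /= := eqVneq g 0.
have [s vf fs] := ps_val f0; have [s' vg gs] := ps_val g0.
have := congr1 (fun h => psc h (s + s')) fg; rewrite pscM.
have sl : (s < (s + s').+1)%N by lia.
rewrite (bigD1 (Ordinal sl)) //= big1 ?addr0 => [/eqP|j].
  by rewrite addKn mulf_eq0 (negPf fs) (negPf gs).
rewrite -val_eqE /= => js; have [jl|lj] := ltnP j s; first by rewrite vf ?mul0r.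
rewrite vg ?mulr0 //; have := ltn_ord j; move: js => /eqP; lia.
Qed.

HB.instance Definition _ := GRing.ComUnitRing_isIntegral.Build (ps k) ps_idom.

Definition pcst (c : k) : ps k := Ps (fun i => if i == 0%N then c else 0).
Lemma pcst_is_zmod : zmod_morphism pcst.
Proof. by move=> a b; apply: psP => -[|i] //=; rewrite subr0. Qed.
HB.instance Definition _ := GRing.isZmodMorphism.Build k (ps k) pcst pcst_is_zmod.
Lemma pscZ c f i : psc (pcst c * f) i = c * psc f i.
Proof. by rewrite pscM big_ord_recl subn0 big1 ?addr0 // => j _; rewrite /= mul0r. Qed.
Lemma pcst_is_monoid : monoid_morphism pcst.
Proof.
split; first by apply: psP => -[|i].
by move=> a b; apply: psP => -[|i]; rewrite pscZ //= mulr0.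
Qed.
HB.instance Definition _ := GRing.isMonoidMorphism.Build k (ps k) pcst pcst_is_monoid.

Definition pev f : k := psc f 0.
Lemma pev_is_zmod : zmod_morphism pev. Proof. by []. Qed.
HB.instance Definition _ := GRing.isZmodMorphism.Build (ps k) k pev pev_is_zmod.
Lemma pev_is_monoid : monoid_morphism pev.
Proof. by split=> // f g; rewrite /pev pscM big_ord1. Qed.
HB.instance Definition _ := GRing.isMonoidMorphism.Build (ps k) k pev pev_is_monoid.

Lemma van1 f : pev f = 0 -> van 1 f.
Proof. by move=> f0 [|i]. Qed.

Definition pX : ps k := Ps (fun i => (i == 1%N)%:R).
Lemma pX_neq0 : pX != 0.
Proof. by apply/eqP => /(congr1 (fun f => psc f 1)) /=/eqP; rewrite oner_eq0. Qed.
Lemma pev_pX : pev pX = 0. Proof. by []. Qed.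

Section Map.
Variable phi : {rmorphism k -> k}.
Definition psmap f : ps k := Ps (fun i => phi (psc f i)).
Lemma psmap_is_zmod : zmod_morphism psmap.
Proof. by move=> f g; apply: psP => i; rewrite /= rmorphB. Qed.
HB.instance Definition _ := GRing.isZmodMorphism.Build (ps k) (ps k) psmap psmap_is_zmod.
Lemma psmap_is_monoid : monoid_morphism psmap.
Proof.
split; first by apply: psP => i; rewrite /= rmorph_nat.
move=> f g; apply: psP => n; rewrite pscM (_ : psc _ n = phi (psc (f * g) n)) // pscM rmorph_sum.
by apply: eq_bigr => i _; rewrite rmorphM.
Qed.
HB.instance Definition _ := GRing.isMonoidMorphism.Build (ps k) (ps k) psmap psmap_is_monoid.
Lemma psmap_cst c : psmap (pcst c) = pcst (phi c).
Proof. by apply: psP => -[|i] //=; rewrite rmorph0. Qed.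
Lemma psmap_X : psmap pX = pX.
Proof. by apply: psP => i; rewrite /= rmorph_nat. Qed.
Lemma psmap_eq0 f : psmap f = 0 -> f = 0.
Proof.
by move=> e; apply: psP => i; apply/eqP; rewrite -(fmorph_eq0 phi); apply/eqP/(congr1 (fun g => psc g i) e).
Qed.
End Map.
End PowerSeries.
Arguments pev {k} f : simpl never.
Arguments pcst {k} c : simpl never.
Arguments psmap {k} phi f : simpl never.

(** * A contraction on vectors of power series *)

Section FixedPoint.
Variables (k : fieldType) (n q : nat).
Hypothesis q_gt1 : (1 < q)%N.
Hypothesis qD : forall x y : ps k, (x - y) ^+ q = x ^+ q - y ^+ q.
Variables (A0 : 'M[ps k]_n) (a1 a2 : ps k) (v0 : 'rV[k]_n).
Local Notation pw := (map_mx (fun x => x ^+ q)).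
Hypothesis A0_van : forall i j, pev (A0 i j) = 0.
Hypothesis v0E : v0 = pev a1 *: pw v0 + pev a2 *: pw (pw v0).
Definition psF (v : 'rV[ps k]_n) := v *m A0 + a1 *: pw v + a2 *: pw (pw v).
Definition vanv s (v : 'rV[ps k]_n) := forall j, van s (v 0 j).

Lemma vanvE s u v i j : vanv s (u - v) -> (i < s)%N -> psc (u 0 j) i = psc (v 0 j) i.
Proof.
move=> uv si; have := uv j i si; rewrite !mxE => /eqP.
by rewrite -[psc _ i]/(psc (u 0 j) i - psc (v 0 j) i) subr_eq0 => /eqP.
Qed.

(** The linear part vanishes at the origin, and the other parts are [q]-th powers with [q >= 2].
    Each gains an order of vanishing, the powers only once [s] is positive. *)
Lemma psF_contract s u v : (0 < s)%N -> vanv s (u - v) -> vanv s.+1 (psF u - psF v).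
Proof.
move=> s0 uv j.
have -> : (psF u - psF v) 0 j = ((u - v) *m A0) 0 j + a1 * (u 0 j - v 0 j) ^+ q
    + a2 * ((u 0 j - v 0 j) ^+ q) ^+ q.
  by rewrite !qD mulmxBl !mxE; ring.
have uvj : van s (u 0 j - v 0 j) by have := uv j; rewrite !mxE.
apply: vanD; first apply: vanD.
- rewrite mxE; apply: van_sum => i _; rewrite mulrC -add1n; apply: vanM => //; exact: van1.
- apply: vanMl; apply: van_le (vanX (n := q) uvj); nia.
- apply: vanMl; rewrite -exprM; apply: van_le (vanX (n := q * q) uvj).
  by apply: leq_trans (leq_mul (leq_mul q_gt1 q_gt1) (leqnn s)); lia.
Qed.

Lemma psF_base u : map_mx (@pev k) u = v0 -> map_mx (@pev k) (psF u) = v0.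
Proof.
move=> uv; rewrite /psF !map_mxD map_mxM !map_mxZ.
have pe (w : 'rV[ps k]_n) : map_mx (@pev k) (pw w) = pw (map_mx (@pev k) w).
  by apply/rowP => j; rewrite !mxE rmorphXn.
rewrite !pe uv (_ : map_mx _ A0 = 0) ?mulmx0 ?add0r -?v0E //.
by apply/matrixP => i j; rewrite !mxE; apply: A0_van.
Qed.

Lemma vanv_base u v : map_mx (@pev k) u = v0 -> map_mx (@pev k) v = v0 -> vanv 1 (u - v).
Proof.
move=> /rowP uE /rowP vE j; apply: van1; rewrite !mxE rmorphB /=.
by have := uE j; have := vE j; rewrite !mxE => -> ->; rewrite subrr.
Qed.

Definition psit s : 'rV[ps k]_n := iter s psF (map_mx (@pcst k) v0).

Lemma psit_base s : map_mx (@pev k) (psit s) = v0.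
Proof.
elim: s => [|s IH]; last exact: psF_base.
by rewrite -map_mx_comp; apply/rowP => j; rewrite !mxE.
Qed.

Lemma psit_step s : vanv s.+1 (psit s.+1 - psit s).
Proof.
elim: s => [|s IH]; first by apply: vanv_base; apply: psit_base.
exact: psF_contract.
Qed.

Lemma psit_stable s i j r : (i <= s)%N -> psc (psit (s + r) 0 j) i = psc (psit s 0 j) i.
Proof.
move=> le_is; elim: r => [|r IH]; first by rewrite addn0.
rewrite -IH addnS; apply: (vanvE j (@psit_step (s + r))).
by rewrite ltnS (leq_trans le_is) // leq_addr.
Qed.

(** The coefficient of index [i] is stationary from the [i]-th iterate on. *)
Definition psfix : 'rV[ps k]_n := \row_j Ps (fun i => psc (psit i 0 j) i).

Lemma psfix_near s : vanv s.+1 (psfix - psit s).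
Proof.
move=> j i is1; rewrite !mxE pscB /= -{1}(subnKC (n := s) (m := i)) //.
by rewrite subnKC // -(psit_stable j (s - i) (leqnn i)) subnKC // subrr.
Qed.

Lemma psfix_base : map_mx (@pev k) psfix = v0.
Proof. by apply/rowP => j; rewrite mxE [psfix _ _]mxE /pev /= mxE. Qed.

Lemma vanv_eq u v : (forall s, vanv s (u - v)) -> u = v.
Proof.
move=> H; apply/rowP => j; apply: psP => i; exact: (vanvE j (H i.+1)).
Qed.

Lemma vanvD s u v : vanv s u -> vanv s v -> vanv s (u + v).
Proof. by move=> hu hv j; rewrite mxE; apply: vanD. Qed.

Lemma psfixE : psF psfix = psfix.
Proof.
apply: vanv_eq => s.
have h1 : vanv s.+2 (psF psfix - psit s.+1) by apply: psF_contract => //; exact: psfix_near.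
have h2 := @psfix_near s.+1.
have -> : psF psfix - psfix = (psF psfix - psit s.+1) + - (psfix - psit s.+1).
  by rewrite opprB addrA subrK.
move=> j; apply: (@van_le _ s s.+2); first lia.
by apply: (vanvD h1) => l; rewrite mxE; apply: vanN.
Qed.

Lemma psfix_unique v : psF v = v -> map_mx (@pev k) v = v0 -> v = psfix.
Proof.
move=> vF vb; apply: vanv_eq; elim=> [|s IH]; first by move=> j i.
case: s IH => [|s] IH; first by apply: vanv_base => //; apply: psfix_base.
by rewrite -vF -psfixE; apply: psF_contract.
Qed.

(** The image under [phi] is a fixed point with the same constant term, and uniqueness applies. *)
Lemma psfix_stable (phi : {rmorphism k -> k}) :
  map_mx (psmap phi) A0 = A0 -> psmap phi a1 = a1 -> psmap phi a2 = a2 ->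
  map_mx phi v0 = v0 -> map_mx (psmap phi) psfix = psfix.
Proof.
move=> hA h1 h2 hv; apply: psfix_unique; last first.
  rewrite -[RHS]hv -psfix_base -!map_mx_comp; apply/rowP => j; by rewrite !mxE.
have pe (w : 'rV[ps k]_n) : map_mx (psmap phi) (pw w) = pw (map_mx (psmap phi) w).
  by apply/rowP => j; rewrite !mxE rmorphXn.
rewrite -[in RHS]psfixE /psF !map_mxD map_mxM !map_mxZ !pe hA /=.
by rewrite [psmap phi a1 in RHS]h1 [psmap phi a2 in RHS]h2.
Qed.
End FixedPoint.

(** * Ring morphisms out of quotients and fraction fields *)

Lemma rmorphism_of (A B : nzRingType) (f : A -> B) :
  zmod_morphism f -> monoid_morphism f -> exists g : {rmorphism A -> B}, g =1 f.
Proof.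
move=> fz fm.
pose z := GRing.isZmodMorphism.Build A B f fz; pose m := GRing.isMonoidMorphism.Build A B f fm.
pose F := HB.pack_for (GRing.RMorphism.type A B) f z m.
by exists F.
Qed.

Lemma rmorph_factor (A B L : nzRingType) (pr : {rmorphism A -> L}) (h : {rmorphism A -> B}) :
  (forall x, exists a, x = pr a) -> (forall a, pr a = 0 -> h a = 0) ->
  exists psi : {rmorphism L -> B}, forall a, psi (pr a) = h a.
Proof.
move=> /choice[r rE] ker.
have hE a b : pr a = pr b -> h a = h b.
  by move=> e; apply/eqP; rewrite -subr_eq0 -rmorphB ker // rmorphB e subrr.
have [] := @rmorphism_of L B (h \o r).
- by move=> x y; rewrite /= -rmorphB; apply: hE; rewrite rmorphB -!rE.
- split; first by rewrite /= -(rmorph1 h); apply: hE; rewrite -rE rmorph1.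
  by move=> x y; rewrite /= -rmorphM; apply: hE; rewrite rmorphM -!rE.
by move=> psi psiE; exists psi => a; rewrite psiE; apply: hE; rewrite -rE.
Qed.

Lemma fracE (R : idomainType) (x : {fraction R}) :
  exists a b : R, b != 0 /\ x = tofrac a / tofrac b.
Proof.
elim/quotW: x => r; exists \n_r, \d_r; split; first exact: denom_ratioP.
have d0 : tofrac \d_r != 0 by rewrite tofrac_eq0 denom_ratioP.
apply: (mulIf d0); rewrite divfK //; unlock tofrac.
rewrite -[LHS]FracField.pi_mul; apply/eqmodP; rewrite /= FracField.equivfE.
rewrite /FracField.mulf !numden_Ratio ?mulf_neq0 ?oner_eq0 ?denom_ratioP //.
by rewrite !mulr1 mulrC.
Qed.

Lemma frac_lift (R : idomainType) (K : fieldType) (h : {rmorphism R -> K}) :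
  injective h -> exists psi : {rmorphism {fraction R} -> K}, forall a, psi (tofrac a) = h a.
Proof.
move=> h_inj; have h0 a : a != 0 -> h a != 0 by rewrite -(rmorph0 h) (inj_eq h_inj).
have /choice[num /choice[den nd]] := @fracE R.
have num_den x : tofrac (num x) = x * tofrac (den x).
  by have [d0 xE] := nd x; rewrite [X in X * _]xE divfK // tofrac_eq0.
pose g x := h (num x) / h (den x).
have gE x a b : b != 0 -> x * tofrac b = tofrac a -> g x = h a / h b.
  move=> b0 e; have dx0 := (nd x).1; rewrite /g; apply/eqP; rewrite eqr_div ?h0 //.
  rewrite -!rmorphM; apply/eqP; congr (h _); apply/eqP.
  by rewrite -tofrac_eq !rmorphM /= num_den -e mulrAC.
have [] := @rmorphism_of _ _ g.
- move=> x y; have [dx dy] := ((nd x).1, (nd y).1).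
  rewrite (@gE _ (num x * den y - num y * den x) (den x * den y)) ?mulf_neq0 //; last first.
    by rewrite rmorphB !rmorphM /= !num_den; ring.
  have -> : g x - g y = g x + (- h (num y)) / h (den y) by rewrite mulNr.
  by rewrite addf_div ?h0 // rmorphB !rmorphM /= mulNr.
- split; first by rewrite (@gE _ 1 1) ?oner_eq0 // ?rmorph1 ?divr1 ?mulr1.
  move=> x y; have [dx dy] := ((nd x).1, (nd y).1).
  rewrite (@gE _ (num x * num y) (den x * den y)) ?mulf_neq0 //; last first.
    by rewrite !rmorphM /= !num_den; ring.
  by rewrite !rmorphM mulf_div.
move=> psi psiE; exists psi => a; rewrite psiE (@gE _ a 1) ?oner_eq0 ?rmorph1 ?mulr1 ?divr1 //.
Qed.

Lemma irreducible_factor (K : fieldType) (P : {poly K}) : (1 < size P)%N ->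
  exists2 g, monic_irreducible_poly g & g %| P.
Proof.
have [n] := ubnP (size P); elim: n P => // n IH P sP P1.
have P0 : P != 0 by rewrite -size_poly_gt0 ltnW.
have [irr|nirr] := pselect (irreducible_poly P).
  exists ((lead_coef P)^-1 *: P); last by rewrite dvdpZl ?dvdpp // invr_eq0 lead_coef_eq0.
  have eqP' : (lead_coef P)^-1 *: P %= P by rewrite eqp_scale // invr_eq0 lead_coef_eq0.
  split; last by rewrite monicE lead_coefZ mulVf // lead_coef_eq0.
  split; first by rewrite (eqp_size eqP').
  by move=> Q Q1; rewrite (eqp_dvdr _ eqP') (eqp_rtrans eqP'); apply: irr.2.
have [Q [Q1 QP nQ]] : exists Q : {poly K}, [/\ size Q != 1, Q %| P & ~~ (Q %= P)].
  apply: contrapT => H; apply: nirr; split => // Q Q1 QP; apply: contraT => nQ.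
  by case: H; exists Q.
have Q0 : Q != 0 by apply: contraNneq P0 => Q0; move: QP; rewrite Q0 dvd0p.
have sQ : (size Q < size P)%N.
  by rewrite ltn_neqAle (dvdp_leq P0 QP) andbT; apply: contraNN nQ; rewrite dvdp_size_eqp.
have [||g gI gQ] := IH Q; first by rewrite (leq_trans sQ).
  by rewrite ltn_neqAle eq_sym Q1 size_poly_gt0.
by exists g => //; apply: dvdp_trans QP.
Qed.

Lemma quotient_field (K : fieldType) (g : {poly K}) : monic_irreducible_poly g ->
  exists (L : fieldType) (pr : {rmorphism {poly K} -> L}),
    (forall x, exists P, x = pr P) /\ (forall P, pr P = 0 <-> g %| P).
Proof.
move=> gI; exists {poly %/ g with gI}.
pose pr : {rmorphism {poly K} -> {poly %/ g with gI}} := in_qpoly g.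
have gE : mk_monic g = g by rewrite /mk_monic gI.2 gI.1.1.
exists pr; split.
  move=> x; exists (val x); apply: val_inj; rewrite /= Pdiv.CommonRing.rmodp_small //; exact: size_mk_monic.
move=> P; split => [/(congr1 val) /= | gP].
  by rewrite gE => e; apply/modp_eq0P; rewrite Pdiv.IdomainMonic.modpE ?gI.2.
apply: val_inj; rewrite /= gE.
have := modp_eq0P _ _ gP; rewrite Pdiv.IdomainMonic.modpE ?gI.2 //.
Qed.

(** * Artin-Schreier towers to which endomorphisms extend *)

Section ArtinSchreier.
Variables (Fq : finFieldType).
Local Notation q := #|Fq|.

(** [X^q - X - a] need not be irreducible, so one irreducible factor [g] is adjoined. All roots have
    the form [s + c] with [c] in [Fq]; the image of [g] under [phi] has such a root, and sending [s]
    to it extends [phi]. *)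
Lemma artin_schreier_step (K : fieldType) (i : {rmorphism Fq -> K}) (a : K) :
  exists (L : fieldType) (j : {rmorphism K -> L}) (s : L), s ^+ q - s = j a /\
    forall phi : {rmorphism K -> K}, (forall c, phi (i c) = i c) -> phi a = a ->
    exists2 psi : {rmorphism L -> L}, (forall x, psi (j x) = j (phi x)) &
      exists c, psi s = s + j (i c).
Proof.
pose P : {poly K} := 'X^q - 'X - a%:P.
have q1 := q_gt1 Fq.
have szXX (F : fieldType) : size ('X^q - 'X : {poly F}) = q.+1.
  by rewrite size_polyDl ?size_polyXn // size_polyN size_polyX ltnS.
have szP (F : fieldType) (b : F) : size ('X^q - 'X - b%:P) = q.+1.
  rewrite size_polyDl ?szXX // size_polyN (leq_ltn_trans (size_polyC_leq1 _)) // ltnS; lia.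
have [|g gI gP] := @irreducible_factor K P; first by rewrite szP; lia.
have [L [pr [pr_surj pr_ker]]] := quotient_field gI.
have [j jE] : exists j : {rmorphism K -> L}, forall x, j x = pr x%:P.
  by exists (pr \o polyC).
pose s := pr 'X.
have prE Q : pr Q = (map_poly j Q).[s].
  rewrite -{1}[Q]coefK poly_def rmorph_sum (horner_coef_wide _ (n := size Q)) ?size_map_poly //.
  by apply: eq_bigr => l _; rewrite -mul_polyC rmorphM rmorphXn /= coef_map /= jE.
have jP : map_poly j P = 'X^q - 'X - (j a)%:P.
  by rewrite !rmorphB /= map_polyXn map_polyX map_polyC.
have sE : s ^+ q - s = j a.
  have /pr_ker := gP; rewrite prE jP !hornerE => /eqP.
  by rewrite subr_eq0 => /eqP.
exists L, j, s; split=> // phi phi_c phi_a.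
have mPhi : map_poly phi P = P by rewrite !rmorphB /= map_polyXn map_polyX map_polyC /= phi_a.
pose rs := [seq s + j (i c) | c <- enum Fq].
have urs : uniq rs.
  rewrite map_inj_uniq ?enum_uniq // => c c' /addrI /(fmorph_inj j) /(fmorph_inj i) //.
have prod_rs : map_poly j P %| \prod_(z <- rs) ('X - z%:P).
  rewrite (all_roots_prod_XsubC (p := map_poly j P) (rs := rs)) ?uniq_rootsE //.
  - by rewrite dvdpZl ?dvdpp // lead_coef_eq0 map_poly_eq0 -size_poly_eq0 szP.
  - by rewrite size_map_poly szP size_map -cardE.
  - apply/allP => _ /mapP[c _ ->]; rewrite jP; apply/rootP; rewrite !hornerE -sE.
    have -> : (s + j (i c)) ^+ q = s ^+ q + j (i c).
      have e : frq (j \o i) (s + j (i c)) = frq (j \o i) s + frq (j \o i) (j (i c)) by apply: rmorphD.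
      by rewrite [LHS]e (frq_base (j \o i) c).
    by ring.
have g'dvd : map_poly j (map_poly phi g) %| \prod_(z <- rs) ('X - z%:P).
  by apply: dvdp_trans prod_rs; rewrite dvdp_map -mPhi dvdp_map.
have [c rc] : exists c, root (map_poly j (map_poly phi g)) (s + j (i c)).
  have [m' m'E] := dvdp_prod_XsubC g'dvd.
  case e: (mask m' rs) m'E => [|z zs] m'E.
    by move/eqp_size: m'E; rewrite big_nil size_poly1 !size_map_poly => sg; have := gI.1.1; rewrite sg.
  have : z \in rs by apply: (mem_mask (m := m')); rewrite e mem_head.
  case/mapP => c _ zc; exists c; rewrite -zc (eqp_root m'E) big_cons rootM root_XsubC eqxx //.
pose u := s + j (i c).
have cfu : commr_rmorph (j \o phi) u by move=> x; apply: mulrC.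
have [psi psiE] : exists psi : {rmorphism L -> L}, forall Q, psi (pr Q) = horner_morph cfu Q.
  apply: rmorph_factor => // Q /pr_ker/dvdpP[R ->]; rewrite rmorphM [X in _ * X](_ : _ = 0) ?mulr0 //.
  by rewrite [LHS](_ : _ = (map_poly (j \o phi) g).[u]) // map_poly_comp; apply/rootP.
exists psi; first by move=> x; rewrite !jE psiE /horner_morph map_polyC hornerC /= jE.
by exists c; rewrite psiE /horner_morph map_polyX hornerX.
Qed.

Lemma artin_schreier_tower (K : fieldType) (i : {rmorphism Fq -> K}) n (a : 'I_n -> K) :
  exists (L : fieldType) (j : {rmorphism K -> L}) (s : 'I_n -> L),
    (forall l, s l ^+ q - s l = j (a l)) /\
    forall phi : {rmorphism K -> K}, (forall c, phi (i c) = i c) -> (forall l, phi (a l) = a l) ->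
    exists2 psi : {rmorphism L -> L}, (forall x, psi (j x) = j (phi x)) &
      forall l, exists c, psi (s l) = s l + j (i c).
Proof.
elim: n a => [|n IH] a.
  exists K, idfun, (fun l => 0); split => [[]//|phi _ _]; exists phi => // -[] //.
have [L [j [s [sE ext]]]] := IH (fun l => a (widen_ord (leqnSn n) l)).
have [L' [j' [s' [s'E ext']]]] := artin_schreier_step (j \o i) (j (a ord_max)).
pose S l := if unlift ord_max l is Some l' then j' (s l') else s'.
have lE (l : 'I_n) : lift ord_max l = widen_ord (leqnSn n) l.
  by apply: val_inj; rewrite /= /bump leqNgt ltn_ord.
exists L', (j' \o j), S; split.
  move=> l; rewrite /S; case: unliftP => [l' ->|->] //.
  by rewrite lE -rmorphXn -rmorphB sE.
move=> phi phic phia; have [|psi psij psis] := ext phi phic; first by move=> l; apply: phia.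
have [||psi' psi'j [c psi's]] := ext' psi; [by move=> c; rewrite /= psij phic| by rewrite psij phia|].
exists psi'; first by move=> x; rewrite /= psi'j psij.
move=> l; rewrite /S; case: unliftP => [l' _|_]; last by exists c.
by have [c' e] := psis l'; exists c'; rewrite psi'j e rmorphD.
Qed.

Lemma iter_rmorph (K : nzRingType) (phi : {rmorphism K -> K}) n :
  exists psi : {rmorphism K -> K}, psi =1 iter n phi.
Proof.
elim: n => [|n [psi E]]; first by exists idfun.
by exists (phi \o psi) => x /=; rewrite E.
Qed.

(** An extension moves [s] by a constant [c] that it fixes, so its [p]-th iterate fixes [s]. *)
Lemma artin_schreier_char (K : fieldType) (i : {rmorphism Fq -> K}) n (a : 'I_n -> K) :
  exists (L : fieldType) (j : {rmorphism K -> L}) (s : 'I_n -> L),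
    (forall l, s l ^+ q - s l = j (a l)) /\
    forall p (phi : {rmorphism K -> K}), p \in [pchar K] ->
    (forall c, phi (i c) = i c) -> (forall l, phi (a l) = a l) ->
    exists2 psi : {rmorphism L -> L}, (forall x, psi (j x) = j (iter p phi x)) &
      forall l, psi (s l) = s l.
Proof.
have [L [j [s [sE ext]]]] := artin_schreier_tower i a; exists L, j, s; split=> //.
move=> p phi pK phic phia; have [psi psij psis] := ext phi phic phia.
have [psip psipE] := iter_rmorph psi p; exists psip.
  by move=> x; rewrite psipE; elim: p {pK psip psipE} x => //= p IH x; rewrite IH psij.
move=> l; have [c e] := psis l; rewrite psipE.
have -> : iter p psi (s l) = s l + j (i c) *+ p.
  elim: p {pK psip psipE} => [|p IH]; first by rewrite addr0.
  by rewrite iterS IH rmorphD rmorphMn e psij phic -addrA -mulrS.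
by rewrite -mulr_natr pcharf0 ?mulr0 ?addr0 //; apply: (rmorph_pchar j).
Qed.
End ArtinSchreier.

(** * Roots of additive polynomials over [Fq] *)

Section RootPeriod.
Variables (Fq : finFieldType) (k : closedFieldType) (ik : {rmorphism Fq -> k}).
Local Notation q := #|Fq|.

(** All the [x^(q^i)] are roots of the additive polynomial [Q], so two of them coincide, and
    Frobenius is injective. *)
Lemma root_period (b0 b1 b2 : Fq) : b0 != 0 -> (b1 != 0) || (b2 != 0) ->
  exists (x : k) (f : nat), [/\ x != 0, (0 < f)%N, x ^+ (q ^ f) = x &
    ik b0 * x + ik b1 * x ^+ q + ik b2 * (x ^+ q) ^+ q = 0].
Proof.
move=> b00 b12; have q1 := q_gt1 Fq; have q2 : (q < q * q)%N by nia.
pose P : {poly k} := (ik b0)%:P + ik b1 *: 'X^(q.-1) + ik b2 *: 'X^((q * q).-1).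
have coefP : P`_q.-1 = ik b1 /\ P`_(q * q).-1 = ik b2.
  rewrite /P !coefD !coefC !coefZ !coefXn !eqxx /=.
  have -> : (q.-1 == 0%N) = false by lia.
  have -> : ((q * q).-1 == 0%N) = false by lia.
  have -> : (q.-1 == (q * q).-1) = false by lia.
  have -> : ((q * q).-1 == q.-1) = false by lia.
  by rewrite !mulr0 !mulr1 !add0r addr0.
have [|x] := @closed_root k P.
  rewrite ltnNge; apply/negP => sP; case/orP: b12 => /negP; apply; rewrite -(fmorph_eq0 ik).
    by rewrite -coefP.1 nth_default // (leq_trans sP) //; lia.
  by rewrite -coefP.2 nth_default // (leq_trans sP) //; lia.
rewrite /root /P !hornerE => /eqP Px.
have x0 : x != 0.
  apply: contra_neq b00 => x0; apply/eqP; rewrite -(fmorph_eq0 ik) -Px x0 !expr0n.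
  have -> : (q.-1 == 0%N) = false by lia.
  have -> : ((q * q).-1 == 0%N) = false by lia.
  by rewrite !mulr0 !addr0.
have eqx : ik b0 * x + ik b1 * x ^+ q + ik b2 * (x ^+ q) ^+ q = 0.
  rewrite -[RHS](mul0r x) -Px !mulrDl -!mulrA -!exprSr -exprM !prednK //; lia.
pose Q : {poly k} := ik b0 *: 'X + ik b1 *: 'X^q + ik b2 *: 'X^(q * q).
have rootQ i : root Q (x ^+ (q ^ i)).
  have -> : x ^+ (q ^ i) = iter i (frq ik) x by rewrite iter_frq.
  have fE (y : k) : y ^+ q = frq ik y by [].
  rewrite /root /Q !hornerE !exprM !fE; elim: i => [|i /eqP IH]; first exact/eqP.
  rewrite iterS -(rmorph0 (frq ik)) -IH !rmorphD !rmorphM /=.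
  by rewrite !frq_base.
have Q0 : Q != 0.
  apply: contra_neq b00 => Q0; have := congr1 (fun R : {poly k} => R`_1) Q0.
  rewrite /Q !coefD !coefZ poly.coefX !coefXn coef0 eqxx.
  have -> : (1 == q)%N = false by lia.
  have -> : (1 == q * q)%N = false by lia.
  by rewrite !mulr0 mulr1 !addr0 => /eqP; rewrite fmorph_eq0 => /eqP.
pose s := mkseq (fun i => x ^+ (q ^ i)) (size Q).
have : ~~ uniq s.
  have rs : all (root Q) s by apply/allP => _ /mapP[i _ ->].
  by apply/negP => /(max_poly_roots Q0 rs); rewrite size_mkseq ltnn.
move/(uniqPn 0) => [i [j [ij]]]; rewrite size_mkseq => jQ.
rewrite !nth_mkseq //; last exact: ltn_trans jQ.
move=> e; exists x, (j - i)%N; split=> //; first by rewrite subn_gt0.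
have inj n (y z : k) : y ^+ (q ^ n) = z ^+ (q ^ n) -> y = z.
  rewrite -!(iter_frq ik); elim: n => //= n IH /(frq_inj (i := ik)); exact: IH.
by apply: (inj i); rewrite -exprM -expnD subnK 1?ltnW.
Qed.
End RootPeriod.

(** Turns the fixed-point equation of [psF] back into the twisted equation, [b] being the constant
    by which the latter was divided. *)
Lemma solve_affine (R : comNzRingType) n (v y1 y2 : 'rV[R]_n) (C : 'M_n) (b i g0 c g1 g2 : R) :
  b * i = 1 ->
  v *m (i *: ((b - g0)%:M + c *: C)) + (- (i * g1)) *: y1 + (- (i * g2)) *: y2 = v ->
  g0 *: v - c *: (v *m C) + g1 *: y1 + g2 *: y2 = 0.
Proof.
move=> bi; rewrite -scalemxAr mulmxDr mul_mx_scalar -scalemxAr; move: (v *m C) => u.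
move=> /rowP e; apply/rowP => j; have := e j; rewrite !mxE => ej.
transitivity (b * (v 0 j - (i * ((b - g0) * v 0 j + c * u 0 j) + - (i * g1) * y1 0 j +
  - (i * g2) * y2 0 j))); last by rewrite ej subrr mulr0.
transitivity (b * v 0 j - b * i * ((b - g0) * v 0 j + c * u 0 j - g1 * y1 0 j - g2 * y2 0 j)); last by ring.
by rewrite bi; ring.
Qed.

(** * Solutions as series at [t = infinity] *)

Section LaurentSolution.
Variables (Fq : finFieldType) (k : closedFieldType) (ik : {rmorphism Fq -> k}).
Local Notation q := #|Fq|.
Local Notation K := {fraction (ps k)}.
Local Notation F := (@tofrac (ps k)).

Definition jk0 : {rmorphism k -> K} := F \o @pcst k.
Definition jF0 : {rmorphism Fq -> K} := jk0 \o ik.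
Definition X0 : K := F (pX k).
(** The exponent is [q^2 - 1]. The Newton polygon at infinity of
    [G0 (t - T) w + G1 w^(q) + G2 w^(q^2)] has slopes with denominators [q - 1] or [q^2 - 1], and
    they become integral in terms of [X] when [t = X^-ex]. *)
Definition ex := ((q - 1) * (q + 1))%N.
Definition t0 : K := (X0 ^+ ex)^-1.

Lemma X0_neq0 : X0 != 0. Proof. by rewrite tofrac_eq0 pX_neq0. Qed.

Lemma ex_gt0 : (0 < ex)%N.
Proof. by have := q_gt1 Fq; rewrite /ex muln_gt0; lia. Qed.

Lemma pev_pXn n : pev (pX k ^+ n) = (n == 0%N)%:R.
Proof. by rewrite rmorphXn /= pev_pX expr0n. Qed.

Lemma t0_tr P : pv jk0 t0 P = 0 -> P = 0.
Proof.
move=> e; apply/eqP; rewrite -lead_coef_eq0; apply/eqP.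
have [->|P0] := eqVneq P 0; first by rewrite lead_coef0.
have sP : (0 < size P)%N by rewrite size_poly_gt0.
pose S : ps k := \sum_(i < size P) pcst P`_i * pX k ^+ (ex * ((size P).-1 - i)).
have SE : F S = pv jk0 t0 P * X0 ^+ (ex * (size P).-1).
  rewrite rmorph_sum /pv /= /horner_eval (horner_coef_wide _ (n := size P)) ?size_map_poly //.
  rewrite mulr_suml; apply: eq_bigr => i _; rewrite rmorphM rmorphXn /= coef_map -mulrA; congr (_ * _).
  rewrite /t0 -exprVn -exprM -[_ ^+ (ex * (size P).-1)](@divfK _ (X0 ^+ (ex * i))) ?expf_neq0 ?X0_neq0 //.
  have le_i : (ex * i <= ex * (size P).-1)%N by rewrite leq_mul2l -ltnS prednK // ltn_ord orbT.
  rewrite -(subnK le_i) exprD mulfK ?expf_neq0 ?X0_neq0 // mulrCA -exprMn mulVf ?X0_neq0 //.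
  by rewrite expr1n mulr1 mulnBr.
have S0 : S = 0 by apply/eqP; rewrite -tofrac_eq0 SE e mul0r.
have := congr1 (@pev k) S0; rewrite rmorph0 => <-.
have sl : ((size P).-1 < size P)%N by rewrite prednK.
rewrite rmorph_sum (bigD1 (Ordinal sl)) //= [X in _ + X]big1 ?addr0.
  by rewrite rmorphM /= subnn muln0 expr0 rmorph1 mulr1.
move=> i /eqP ne; have il : (i < (size P).-1)%N.
  rewrite ltn_neqAle -ltnS prednK // ltn_ord andbT; apply/eqP => ei; apply: ne; exact: val_inj.
rewrite rmorphM /= pev_pXn muln_eq0.
have -> : (ex == 0%N) = false by have := ex_gt0; lia.
have -> : ((size P).-1 - i == 0)%N = false by lia.
by rewrite mulr0.
Qed.

(** [P(t)] multiplied by [X^(ex deg P)]: the reversed polynomial, whose constant term is the leading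
    coefficient of [P]. *)
Definition gam (P : {poly Fq}) : ps k :=
  \sum_(i < size P) pcst (ik P`_i) * pX k ^+ (ex * ((size P).-1 - i)).

Lemma pev_gam P : pev (gam P) = ik (lead_coef P).
Proof.
have [->|P0] := eqVneq P 0; first by rewrite /gam size_poly0 big_ord0 lead_coef0 !rmorph0.
have sP : (0 < size P)%N by rewrite size_poly_gt0.
have sl : ((size P).-1 < size P)%N by rewrite prednK.
rewrite rmorph_sum (bigD1 (Ordinal sl)) //= [X in _ + X]big1 ?addr0.
  by rewrite rmorphM /= subnn muln0 expr0 rmorph1 mulr1.
move=> i /eqP ne; have il : (i < (size P).-1)%N.
  rewrite ltn_neqAle -ltnS prednK // ltn_ord andbT; apply/eqP => ei; apply: ne; exact: val_inj.
rewrite rmorphM /= pev_pXn muln_eq0.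
have -> : (ex == 0%N) = false by have := ex_gt0; lia.
have -> : ((size P).-1 - i == 0)%N = false by lia.
by rewrite mulr0.
Qed.

Lemma evA_gam P : evA ik jk0 t0 P = F (gam P) * X0 ^ (- (ex * (size P).-1)%:Z).
Proof.
rewrite rmorph_sum /evA /= /horner_eval (horner_coef_wide _ (n := size P)) ?size_map_poly //.
rewrite mulr_suml; apply: eq_bigr => i _; rewrite rmorphM rmorphXn /= coef_map -mulrA; congr (_ * _).
rewrite /t0 -exprVn -exprM -/X0 -exprz_inv -[X0^-1 ^ _]/(X0^-1 ^+ _).
have le_i : (ex * i <= ex * (size P).-1)%N by rewrite leq_mul2l; have := ltn_ord i; lia.
by rewrite -[in RHS](subnK le_i) exprD mulrA mulnBr -exprMn mulfV ?X0_neq0 // expr1n mul1r.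
Qed.

Lemma psmap_gam (phi : {rmorphism k -> k}) P : (forall c, phi (ik c) = ik c) ->
  psmap phi (gam P) = gam P.
Proof.
move=> hphi; rewrite rmorph_sum; apply: eq_bigr => i _.
by rewrite rmorphM rmorphXn /= psmap_cst psmap_X hphi.
Qed.

Lemma psmap_lift (phi : {rmorphism k -> k}) :
  exists psi : {rmorphism K -> K}, forall a, psi (F a) = F (psmap phi a).
Proof.
have [|psi] := @frac_lift (ps k) K (F \o psmap phi); last by exists psi.
apply: raddf_inj => a /eqP; rewrite /= tofrac_eq0 => /eqP; exact: psmap_eq0.
Qed.

Variables (d' : nat) (m : {poly Fq}).
Hypothesis m_monic : m \is monic.
Hypothesis m_size : size m = d'.+2.
Local Notation mK := (map_poly jF0 m).
Local Notation fr := (frq jF0).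

Lemma mK_monic (L : fieldType) (j : {rmorphism Fq -> L}) : map_poly j m \is monic.
Proof. by rewrite map_monic. Qed.
Lemma mK_size (L : fieldType) (j : {rmorphism Fq -> L}) : size (map_poly j m) = d'.+2.
Proof. by rewrite size_map_poly. Qed.

Lemma comp_mx_row0_eq0 (L : fieldType) (j : {rmorphism Fq -> L}) p :
  (delta_mx 0 0 : 'rV_d'.+1) *m horner_mx (comp_mx d' (map_poly j m)) p = 0 -> map_poly j m %| p.
Proof.
have M := mK_monic j; have S := mK_size j; set mL := map_poly j m in M S *.
rewrite {1}(divp_eq p mL) rmorphD rmorphM /= comp_mx_root // mulr0 add0r.
rewrite comp_mx_row0; last by rewrite -ltnS -S ltn_modp monic_neq0.
move/(congr1 (@rVpoly _ _)); rewrite poly_rV_K ?linear0 => [/eqP //|].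
by rewrite -ltnS -S ltn_modp monic_neq0.
Qed.

Lemma horner_unit_coprime (L : fieldType) (j : {rmorphism Fq -> L}) p :
  horner_mx (comp_mx d' (map_poly j m)) p \in unitmx -> coprimep (map_poly j m) p.
Proof.
have M := mK_monic j; have S := mK_size j; set mL := map_poly j m in M S *; move=> u.
have m0 : mL != 0 by apply: monic_neq0.
rewrite coprimep_def; set g := gcdp mL p.
have /dvdpP[m' mE] : g %| mL := dvdp_gcdl _ _; have /dvdpP[p' pE] : g %| p := dvdp_gcdr _ _.
have /eqP : horner_mx (comp_mx d' mL) (m' * p) = 0.
  by rewrite pE mulrCA -mE rmorphM /= comp_mx_root // mulr0.
rewrite rmorphM /= => /eqP e.
have /eqP : horner_mx (comp_mx d' mL) m' = 0 by rewrite -[LHS](mulmxK u) [X in X *m _]e mul0mx.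
rewrite comp_mx_eq0 // => mm'; have m'0 : m' != 0 by apply: contraNneq m0 => m'0; rewrite mE m'0 mul0r.
have g0 : g != 0 by apply: contraNneq m0 => g0; rewrite mE g0 mulr0.
have := dvdp_leq m'0 mm'; rewrite {1}mE size_mul //.
by move: g0 m'0; rewrite -!size_poly_gt0; move: (size g) (size m') => a b; lia.
Qed.

Section Template.
Variables (g0 g1 g2 : ps k) (al b1 b2 : Fq) (x : k).
Hypothesis g0E : pev g0 = ik al.
Hypothesis al0 : al != 0.
Hypothesis g1E : pev g1 = ik b1.
Hypothesis g2E : pev g2 = ik b2.
Hypothesis x0 : x != 0.
Hypothesis xE : ik al * x + ik b1 * x ^+ q + ik b2 * (x ^+ q) ^+ q = 0.

Let iF : {rmorphism Fq -> ps k} := @pcst k \o ik.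
Let Cp := comp_mx d' (map_poly iF m).
(** The equation is divided by [al], the constant term of [g0], and solved for its linear term; the
    part of the linear term that stays on the right vanishes at [X = 0]. *)
Let A0 := iF al^-1 *: ((iF al - g0)%:M + (g0 * pX k ^+ ex) *: Cp).
Let a1 := - (iF al^-1 * g1).
Let a2 := - (iF al^-1 * g2).
(** At [X = 0] the variable [T] disappears from the equation, so a constant polynomial whose value
    solves the additive equation can start the series. *)
Let v0 : 'rV[k]_d'.+1 := \row_j (if j == 0 then x else 0).
Let v := psfix q A0 a1 a2 v0.
Let w : {poly K} := map_poly F (rVpoly v).

Let q1 := q_gt1 Fq.

Let psqD (y z : ps k) : (y - z) ^+ q = y ^+ q - z ^+ q.
Proof.
have [p [e [p_pr e0 qe pk]]] := q_char_power ik.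
have pP : p \in [pchar (ps k)] by apply: (rmorph_pchar (@pcst k)).
have qn : [pchar (ps k)].-nat q by rewrite qe (eq_pnat _ (pcharf_eq pP)) pnatX pnat_id.
by rewrite -[in RHS](subrK z y) [in RHS]exprDn_pchar // addrK.
Qed.

Let A0_van i j : pev (A0 i j) = 0.
Proof.
rewrite !mxE rmorphM rmorphD /= !rmorphMn rmorphB /= g0E.
have -> : pev (pcst (ik al)) = ik al by [].
rewrite subrr mul0rn add0r rmorphM rmorphM /= pev_pXn.
by rewrite (_ : (ex == 0)%N = false) ?mulr0 ?mul0r ?mulr0 //; have := ex_gt0; lia.
Qed.

Let v0E : v0 = pev a1 *: map_mx (fun y => y ^+ q) v0 +
  pev a2 *: map_mx (fun y => y ^+ q) (map_mx (fun y => y ^+ q) v0).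
Proof.
have c0 (n : nat) : (0 : k) ^+ q = 0 by rewrite expr0n; case: q q1.
have pc (c : k) : pev (pcst c) = c by [].
apply/rowP => j; rewrite !mxE; case: (j == 0); last by rewrite !c0 // !mulr0 addr0.
rewrite !rmorphN !rmorphM /= !pc g1E g2E; apply/eqP; rewrite -subr_eq0 fmorphV; apply/eqP.
have al0' : ik al != 0 by rewrite fmorph_eq0.
apply: (mulfI al0'); rewrite mulr0 -[RHS]xE mulrBr !mulrDr !mulNr !mulrN !mulrA divff // !mul1r.
by ring.
Qed.

Lemma template_size : (size w <= d'.+1)%N.
Proof. by rewrite size_map_inj_poly ?rmorph0 ?size_poly // => a b /eqP; rewrite tofrac_eq => /eqP. Qed.

Lemma template_eq : mK %| (F g0)%:P * (1 - (X0 ^+ ex)%:P * 'X) * w +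
   (F g1)%:P * map_poly fr w + (F g2)%:P * map_poly fr (map_poly fr w).
Proof.
apply: comp_mx_row0_eq0; set C := comp_mx d' mK.
have CE : C = map_mx F Cp by rewrite /C /Cp map_comp_mx -map_poly_comp.
have sw := template_size.
have szf (p : {poly K}) : (size p <= d'.+1)%N -> (size (map_poly fr p) <= d'.+1)%N.
  by rewrite size_map_poly.
have row (p : {poly K}) : (size p <= d'.+1)%N -> delta_mx 0 0 *m horner_mx C p = poly_rV p :> 'rV_d'.+1.
  by move=> sp; apply: comp_mx_row0.
have rowZ c (p : {poly K}) : delta_mx 0 0 *m horner_mx C (c%:P * p) = c *: (delta_mx 0 0 *m horner_mx C p) :> 'rV_d'.+1.
  by rewrite mul_polyC linearZ /= scalemxAr.
have -> : (F g0)%:P * (1 - (X0 ^+ ex)%:P * 'X) * w = (F g0)%:P * w - (F g0 * X0 ^+ ex)%:P * (w * 'X).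
  by rewrite polyCM; ring.
have rowD (p p' : {poly K}) : delta_mx 0 0 *m horner_mx C (p + p') =
    delta_mx 0 0 *m horner_mx C p + delta_mx 0 0 *m horner_mx C p' :> 'rV_d'.+1.
  by rewrite rmorphD mulmxDr.
have rowB (p p' : {poly K}) : delta_mx 0 0 *m horner_mx C (p - p') =
    delta_mx 0 0 *m horner_mx C p - delta_mx 0 0 *m horner_mx C p' :> 'rV_d'.+1.
  by rewrite rmorphB mulmxBr.
have sw1 := szf _ sw; have sw2 := szf _ sw1.
rewrite 2!rowD rowB !rowZ (row _ sw) (row _ sw1) (row _ sw2).
rewrite [horner_mx C (w * 'X)]rmorphM /= horner_mx_X mulmxA row //.
have wv : poly_rV w = map_mx F v by apply/rowP => j; rewrite mxE [RHS]mxE coef_map coef_rVpoly_ord.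
have wv1 : poly_rV (map_poly fr w) = map_mx F (map_mx (fun y => y ^+ q) v).
  by apply/rowP => j; rewrite mxE [RHS]mxE [in RHS]mxE !coef_map coef_rVpoly_ord /= rmorphXn.
have wv2 : poly_rV (map_poly fr (map_poly fr w)) =
    map_mx F (map_mx (fun y => y ^+ q) (map_mx (fun y => y ^+ q) v)).
  by apply/rowP => j; rewrite mxE [RHS]mxE [in RHS]mxE [in RHS]mxE !coef_map coef_rVpoly_ord /= !rmorphXn.
rewrite wv wv1 wv2 CE -rmorphXn -rmorphM -map_mxM -!map_mxZ -!map_mxN -!map_mxD.
rewrite -[RHS](map_mx0 F); congr (map_mx _ _).
have := psfixE q1 psqD A0_van v0E; rewrite -/v /psF.
have ial : iF al * iF al^-1 = 1 by rewrite -rmorphM divff // rmorph1.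
by move=> vE; apply: solve_affine ial vE.
Qed.

(** At [X = 0] the solution is the nonzero constant [x], so the determinant of its matrix is nonzero
    there. *)
Lemma template_coprime : coprimep mK w.
Proof.
apply: horner_unit_coprime; rewrite unitmxE unitfE.
have -> : horner_mx (comp_mx d' mK) w = map_mx F (horner_mx Cp (rVpoly v)).
  by rewrite map_horner_mx /Cp map_comp_mx -map_poly_comp.
rewrite det_map_mx tofrac_eq0; apply: contraTneq isT => e.
have := congr1 (@pev k) e; rewrite rmorph0 -det_map_mx map_horner_mx.
have -> : map_poly (@pev k) (rVpoly v) = x%:P.
  have vb : map_mx (@pev k) v = v0 by apply: psfix_base.
  apply/polyP => j; rewrite coef_map coefC.
  have [jd|dj] := ltnP j d'.+1.
    rewrite (coef_rVpoly_ord v (Ordinal jd)).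
    by have /rowP/(_ (Ordinal jd)) := vb; rewrite !mxE -val_eqE /= => ->.
  rewrite nth_default ?rmorph0; last exact: leq_trans (size_poly _ _) dj.
  by case: j dj.
rewrite horner_mx_C det_scalar => /eqP; rewrite expf_eq0 (negPf x0) andbF //.
Qed.

Lemma template_stable (phi : {rmorphism k -> k}) (psi : {rmorphism K -> K}) :
  (forall a, psi (F a) = F (psmap phi a)) ->
  (forall c, phi (ik c) = ik c) -> phi x = x ->
  psmap phi g0 = g0 -> psmap phi g1 = g1 -> psmap phi g2 = g2 -> map_poly psi w = w.
Proof.
move=> psiE phik phix h0 h1 h2.
have iFE c : psmap phi (iF c) = iF c by rewrite /= psmap_cst phik.
have vE : map_mx (psmap phi) v = v.
  apply: psfix_stable => //.
  - rewrite /A0 map_mxZ map_mxD map_scalar_mx map_mxZ map_comp_mx rmorphB rmorphM rmorphXn /=.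
    have hm : map_poly (psmap phi) (map_poly iF m) = map_poly iF m.
      by rewrite -map_poly_comp; apply: eq_map_poly => c; exact: iFE.
    by rewrite [psmap phi (pcst (ik al))]iFE [psmap phi (pcst _)]iFE h0 psmap_X hm.
  - by rewrite /a1 rmorphN rmorphM /= h1 [psmap phi (pcst _)]iFE.
  - by rewrite /a2 rmorphN rmorphM /= h2 [psmap phi (pcst _)]iFE.
  - by apply/rowP => j; rewrite !mxE; case: ifP; rewrite ?rmorph0 ?phix.
rewrite /w -[in RHS]vE; apply/polyP => j; rewrite !coef_map /= psiE; congr (F _).
have [jd|dj] := ltnP j d'.+1.
  by rewrite !(coef_rVpoly_ord _ (Ordinal jd)) [RHS]mxE.
by rewrite !nth_default ?rmorph0 // (leq_trans (size_poly _ _) dj).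
Qed.
Lemma template : exists u : {poly K}, [/\ (size u <= d'.+1)%N,
  mK %| (F g0)%:P * (1 - (X0 ^+ ex)%:P * 'X) * u +
     (F g1)%:P * map_poly fr u + (F g2)%:P * map_poly fr (map_poly fr u),
  coprimep mK u &
  forall (phi : {rmorphism k -> k}) (psi : {rmorphism K -> K}),
    (forall a, psi (F a) = F (psmap phi a)) -> (forall c, phi (ik c) = ik c) -> phi x = x ->
    psmap phi g0 = g0 -> psmap phi g1 = g1 -> psmap phi g2 = g2 -> map_poly psi u = u].
Proof.
exists w; split; [exact: template_size|exact: template_eq|exact: template_coprime|].
exact: template_stable.
Qed.
End Template.
End LaurentSolution.

(** Reduction of order. If [W0] solves the equation of order two and [S^(q) = S + A], then [W0 S] is
    a second solution as soon as the Casoratian [D = W0 W1 A] satisfies [G2 D^(q) = u G0 D]. Here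
    [W1], [W2], [A1], [D1] are Frobenius twists, and [IW] is inverse to [W1]. *)
Lemma second_solution (R : comNzRingType) (W0 W1 W2 S A A1 G0 G1 G2 u D D1 IW : R) :
  G0 * u * W0 + G1 * W1 + G2 * W2 = 0 -> W1 * IW = 1 -> D = W0 * W1 * A -> D1 = W1 * W2 * A1 ->
  G2 * D1 = u * G0 * D ->
  G2 * (W2 * (S + A + A1)) = - u * G0 * (W0 * S) - G1 * (W1 * (S + A)).
Proof.
move=> e1 e2 eD eD1 e4; apply/eqP; rewrite -subr_eq0; apply/eqP.
transitivity ((G0 * u * W0 + G1 * W1 + G2 * W2) * (S + A) +
  (W1 * IW) * (G2 * W2 * A1 - u * G0 * W0 * A) + (1 - W1 * IW) * (G2 * W2 * A1 - u * G0 * W0 * A)); first by ring.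
rewrite e1 e2 mul0r add0r subrr mul0r addr0 -e2.
transitivity (IW * (G2 * (W1 * W2 * A1) - u * G0 * (W0 * W1 * A))); first by ring.
by rewrite -eD -eD1 e4 subrr mulr0.
Qed.

Lemma residue_ring (L : fieldType) (g : {poly L}) : g \is monic -> (1 < size g)%N ->
  exists (Q : comNzRingType) (pr : {rmorphism {poly L} -> Q}), forall P, pr P = 0 <-> g %| P.
Proof.
move=> M S; exists {poly %/ g}.
pose pr : {rmorphism {poly L} -> {poly %/ g}} := in_qpoly g.
have gE : mk_monic g = g by rewrite /mk_monic M S.
exists pr => P; split => [/(congr1 val) /= | gP].
  by rewrite gE => e; apply/modp_eq0P; rewrite Pdiv.IdomainMonic.modpE ?M.
apply: val_inj; rewrite /= gE.
by have := modp_eq0P _ _ gP; rewrite Pdiv.IdomainMonic.modpE ?M.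
Qed.

(** * A fundamental matrix from one solution and its Casoratian *)

Section Assembly.
Variables (Fq : finFieldType) (k : closedFieldType) (ik : {rmorphism Fq -> k}).
Variables (G0 G1 G2 : {poly Fq}).
Variables (d' : nat) (m : {poly Fq}).
Hypothesis m_monic : m \is monic.
Hypothesis m_size : size m = d'.+2.
Local Notation q := #|Fq|.
Variables (L : fieldType) (jk : {rmorphism k -> L}) (t : L).
Local Notation jF := (jk \o ik).
Local Notation et := (evA ik jk t).
Local Notation fr := (frq (jk \o ik)).
Local Notation mL := (map_poly jF m).
Local Notation sg := (map_poly fr).
Local Notation H := (horner_mx (map_mx jF (comp_mx d' m))).
Variables (w iw a s dl gi : {poly L}).
Hypothesis w_size : (size w <= d'.+1)%N.
Hypothesis w_eq : mL %| (et G0)%:P * (t%:P - 'X) * w + (et G1)%:P * sg w + (et G2)%:P * sg (sg w).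
Hypothesis w_inv : mL %| w * iw - 1.
Hypothesis dl_eq : mL %| (et G2)%:P * sg dl - (t%:P - 'X) * (et G0)%:P * dl.
Hypothesis dlE : mL %| dl - w * sg w * a.
Hypothesis dl_inv : mL %| gi * dl - 1.
Hypothesis sE : sg s = s + a.

Local Notation wb := ((w * s) %% mL).
Local Notation wd := ((sg w * (s + a)) %% mL).
Local Notation W := (mx2 w wb (sg w) wd).

Let M : mL \is monic. Proof. by rewrite map_monic. Qed.
Let SZ : size mL = d'.+2. Proof. by rewrite size_map_poly. Qed.

Variables (Q : comNzRingType) (pr : {rmorphism {poly L} -> Q}).
Hypothesis prP : forall P, pr P = 0 <-> mL %| P.
Let prE P P' : pr P = pr P' <-> mL %| P - P'.
Proof.
rewrite -prP rmorphB; split => [->|/eqP]; first by rewrite subrr.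
by rewrite subr_eq0 => /eqP.
Qed.
Let pr_mod P : pr (P %% mL) = pr P.
Proof. by apply/prE; rewrite {2}(divp_eq P mL) opprD addrCA subrr addr0 dvdpNr dvdp_mull. Qed.
Let sgm : sg mL = mL.
Proof. by rewrite -map_poly_comp; apply: eq_map_poly => c; exact: (frq_base jF). Qed.
Let pr_sg P : mL %| P -> mL %| sg P.
Proof. by move=> mP; rewrite -sgm dvdp_map. Qed.
Let HE P P' : pr P = pr P' -> H P = H P'.
Proof.
move/prE => e; apply/eqP; rewrite -subr_eq0 -rmorphB map_comp_mx comp_mx_eq0 //.
Qed.

Let e1 : pr (et G0)%:P * pr (t%:P - 'X) * pr w + pr (et G1)%:P * pr (sg w) + pr (et G2)%:P * pr (sg (sg w)) = 0.
Proof. by have /prP := w_eq; rewrite 2!(rmorphD pr) !(rmorphM pr). Qed.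
Let e2 : pr (sg w) * pr (sg iw) = 1.
Proof.
have /pr_sg := w_inv; rewrite rmorphB rmorphM rmorph1 => /prP.
by rewrite rmorphB rmorphM rmorph1 => /eqP; rewrite subr_eq0 => /eqP.
Qed.
Let e3 : pr dl = pr w * pr (sg w) * pr a.
Proof. by have /prE := dlE; rewrite !rmorphM. Qed.
Let e3' : pr (sg dl) = pr (sg w) * pr (sg (sg w)) * pr (sg a).
Proof. by have /pr_sg := dlE; rewrite rmorphB !rmorphM => /prE; rewrite !rmorphM. Qed.
Let e4 : pr (et G2)%:P * pr (sg dl) = pr (t%:P - 'X) * pr (et G0)%:P * pr dl.
Proof. by have /prE := dl_eq; rewrite !rmorphM. Qed.

Lemma assembly_size i j : (size (W i j) <= d'.+1)%N.
Proof.
have m0 : mL != 0 by exact: monic_neq0.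
have sm (P : {poly L}) : (size (P %% mL)%R <= d'.+1)%N by rewrite -ltnS -SZ ltn_modp.
by elim/ord2_ind: i; elim/ord2_ind: j; rewrite mxE //= size_map_poly.
Qed.

Lemma assembly_inv : H (gi * (w * wd - wb * sg w)) = 1.
Proof.
rewrite -(rmorph1 H); apply: HE; rewrite rmorphM rmorphB !rmorphM !pr_mod !rmorphM rmorphD rmorph1.
have : pr gi * pr dl = 1.
  by have /prP := dl_inv; rewrite rmorphB rmorphM rmorph1 => /eqP; rewrite subr_eq0 => /eqP.
by rewrite e3 => <-; ring.
Qed.

Lemma assembly_frob i j :
  (et G2) *: H (sg (W i j)) = H ((PhiK ik G0 G1 G2 jk t *m W) i j).
Proof.
rewrite -linearZ /= -mul_polyC; apply: HE; rewrite mulmx2E.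
have sgmod P : sg (P %% mL) = sg P %% mL by rewrite map_modp sgm.
elim/ord2_ind: i; elim/ord2_ind: j; rewrite !mxE /= ?mul0r ?add0r //.
- by rewrite sgmod !rmorphM /= !pr_mod !rmorphM /= sE.
- rewrite rmorphD !rmorphM /= rmorphB rmorphN; have := e1; rewrite rmorphB => e.
  by apply/eqP; rewrite -subr_eq0 -e; apply/eqP; ring.
- have -> : sg wd = (sg (sg w) * (s + a + sg a)) %% mL by rewrite sgmod rmorphM rmorphD /= sE.
  rewrite (rmorphD pr) !(rmorphM pr) !pr_mod !(rmorphM pr) !(rmorphD pr) !(rmorphN pr).
  have := second_solution (pr s) e1 e2 e3 e3' e4; rewrite (rmorphB pr) => ->; ring.
Qed.
End Assembly.
(** Serves to show that a residue determined by invariant data is itself invariant. *)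
Lemma dvdp_small_eq (L : fieldType) (g z a a' : {poly L}) : coprimep g z ->
  g %| z * a - z * a' -> (size a < size g)%N -> (size a' < size g)%N -> a = a'.
Proof.
move=> cz; rewrite -mulrBr Gauss_dvdpr // => ga sa sa'.
apply/eqP; rewrite -subr_eq0; apply: contraLR ga => ne; rewrite gtNdvdp //.
by rewrite (leq_ltn_trans (size_polyD _ _)) // gtn_max size_polyN sa sa'.
Qed.

Lemma period_iter (T : Type) (phi : T -> T) x f n : iter f phi x = x -> (f %| n)%N -> iter n phi x = x.
Proof.
by move=> xf /dvdnP[c ->]; elim: c => // c IH; rewrite mulSn iterD IH.
Qed.

Lemma weight_factor (L : fieldType) (A B C t r rq rqq E g0 g1 g2 Xe : L) (u u1 u2 : {poly L}) :
  A * t * r = E * g0 -> A * r = E * g0 * Xe -> B * rq = E * g1 -> C * rqq = E * g2 ->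
  A%:P * (t%:P - 'X) * (r%:P * u) + B%:P * (rq%:P * u1) + C%:P * (rqq%:P * u2) =
  E%:P * (g0%:P * (1 - Xe%:P * 'X) * u + g1%:P * u1 + g2%:P * u2).
Proof.
move=> c0 c0' c1 c2.
transitivity ((A * t * r)%:P * u - (A * r)%:P * 'X * u + (B * rq)%:P * u1 + (C * rqq)%:P * u2).
  by rewrite !polyCM; ring.
by rewrite c0 c0' c1 c2 !polyCM; ring.
Qed.

Lemma exE (Fq : finFieldType) : (ex Fq)%:Z = (#|Fq|%:Z - 1) * (#|Fq|%:Z + 1).
Proof. by rewrite /ex; have := q_gt1 Fq; lia. Qed.

(** * The Newton polygon at infinity, and existence of the generic solution *)

Section GenericSolutionExists.
Variables (Fq : finFieldType) (k : closedFieldType) (ik : {rmorphism Fq -> k}).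
Variables (G0 G1 G2 : {poly Fq}).
Hypothesis G0_neq0 : G0 != 0.
Hypothesis G2_neq0 : G2 != 0.
Local Notation q := #|Fq|.
Local Notation K := {fraction (ps k)}.
Local Notation F := (@tofrac (ps k)).
Local Notation X := (X0 k).
Local Notation e := (ex Fq).
Local Notation h P := ((size P).-1%:Z).
Local Notation et0 := (evA ik (jk0 k) (t0 Fq k)).
Local Notation fr0 := (frq (jF0 ik)).

(** After the substitution [w = X^rho u], the terms in [w^(q)] and [w^(q^2)] have orders [n1] and
    [n2] relative to the linear one. [A] makes [n1] vanish and [B] makes [n2] vanish; the larger of
    the two keeps both nonnegative. One order must be zero for the equation at [X = 0] to have a
    nonzero solution. *)
Lemma weight_choice : exists (rho : int) (n1 n2 : nat),
  [/\ G1 != 0 -> n1%:Z = e%:Z * (h G0 + 1 - h G1) + (q%:Z - 1) * rho,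
      n2%:Z = e%:Z * (h G0 + 1 - h G2 + rho) & (n2 == 0%N) || (n1 == 0%N) && (G1 != 0)].
Proof.
have q1 := q_gt1 Fq.
have eE := exE Fq.
pose B : int := h G2 - h G0 - 1; pose A : int := (q%:Z + 1) * (h G1 - h G0 - 1).
have nat_of (z : int) : 0 <= z -> exists n : nat, n%:Z = z by case: z => // n _; exists n.
have [G10|G10] := eqVneq G1 0.
  by exists B, 0%N, 0%N; split=> //; rewrite /B; lia.
have [BA|AB] := Order.TotalTheory.leP B A.
  have [n2 n2E] : exists n : nat, n%:Z = e%:Z * (A - B) by apply: nat_of; nia.
  by exists A, 0%N, n2; split=> //; rewrite ?n2E ?eE /A /B ?orbT //; try (move=> _); ring.
have [n1 n1E] : exists n : nat, n%:Z = (q%:Z - 1) * (B - A) by apply: nat_of; nia.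
by exists B, n1, 0%N; split=> //; rewrite ?n1E ?eE /A /B //; try (move=> _); ring.
Qed.

Lemma X_expD a b : X ^ a * X ^ b = X ^ (a + b).
Proof. by rewrite expfzDr // X0_neq0. Qed.

Lemma t0E : t0 Fq k = X ^ (- e%:Z).
Proof. by rewrite -exprz_inv /t0 -exprVn. Qed.

Lemma et0_w (P : {poly Fq}) (rho E : int) (n s : nat) :
  - (e%:Z * h P) + rho * s%:Z = E + n%:Z ->
  et0 P * (X ^ rho) ^+ s = X ^ E * F (pX k ^+ n * gam ik P).
Proof.
move=> eqn; rewrite evA_gam tofracM tofracXn -/X !exprnP exprz_exp -mulrA X_expD.
by rewrite mulrA X_expD mulrC PoszM eqn.
Qed.

Variables (d' : nat) (m : {poly Fq}).
Hypothesis m_monic : m \is monic.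
Hypothesis m_size : size m = d'.+2.
Local Notation mK := (map_poly (jF0 ik) m).

(** The polynomials [H1], [H2] are left free because the construction serves twice: with [G1, G2]
    for a solution of the equation, and with [- G2, 0] for the Casoratian. *)
Lemma weighted_template (rho : int) (H1 H2 : {poly Fq}) (n1 n2 : nat) (b1 b2 : Fq) (x : k) :
  (H1 != 0 -> n1%:Z = e%:Z * (h G0 + 1 - h H1) + (q%:Z - 1) * rho) ->
  (H2 != 0 -> n2%:Z = e%:Z * (h G0 + 1 - h H2 + rho)) ->
  b1 = (n1 == 0%N)%:R * lead_coef H1 -> b2 = (n2 == 0%N)%:R * lead_coef H2 ->
  x != 0 -> ik (lead_coef G0) * x + ik b1 * x ^+ q + ik b2 * (x ^+ q) ^+ q = 0 ->
  exists w : {poly K}, [/\ (size w <= d'.+1)%N,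
    mK %| (et0 G0)%:P * ((t0 Fq k)%:P - 'X) * w + (et0 H1)%:P * map_poly fr0 w +
      (et0 H2)%:P * map_poly fr0 (map_poly fr0 w),
    coprimep mK w &
    forall (phi : {rmorphism k -> k}) (psi : {rmorphism K -> K}),
      (forall a, psi (F a) = F (psmap phi a)) -> (forall c, phi (ik c) = ik c) -> phi x = x ->
      map_poly psi w = w].
Proof.
move=> n1E n2E b1E b2E x0 xE; have q1 := q_gt1 Fq.
have eE := exE Fq.
have pevg n b P : b = (n == 0%N)%:R * lead_coef P -> pev (pX k ^+ n * gam ik P) = ik b.
  by move=> ->; rewrite !rmorphM /= pev_pXn pev_gam rmorph_nat.
have g0E : pev (gam ik G0) = ik (lead_coef G0) by rewrite pev_gam.
have al0 : lead_coef G0 != 0 by rewrite lead_coef_eq0.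
have [u [su ueq cu st]] := template m_monic m_size g0E al0 (pevg _ _ _ b1E) (pevg _ _ _ b2E) x0 xE.
have Xr0 : X ^ rho != 0 by rewrite expfz_neq0 // X0_neq0.
exists (X ^ rho *: u); split.
- exact: leq_trans (size_scale_leq _ _) su.
- pose E : int := - (e%:Z * (h G0 + 1)) + rho.
  have gamz : gam ik 0 = 0 by rewrite /gam size_poly0 big_ord0.
  have c0 : et0 G0 * t0 Fq k * X ^ rho = X ^ E * F (gam ik G0).
    have := @et0_w G0 (rho - e%:Z) E 0 1; rewrite expr0 mul1r expr1 => <-; last by rewrite /E; ring.
    by rewrite t0E -mulrA X_expD addrC.
  have c0' : et0 G0 * X ^ rho = X ^ E * F (gam ik G0) * X ^+ e.
    have := @et0_w G0 rho E e 1; rewrite expr1 => ->; last by rewrite /E; ring.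
    by rewrite rmorphM rmorphXn /= -mulrA [F _ * _]mulrC.
  have c1 : et0 H1 * (X ^ rho) ^+ q = X ^ E * F (pX k ^+ n1 * gam ik H1).
    have [->|H10] := eqVneq H1 0; first by rewrite gamz mulr0 !rmorph0 mul0r mulr0.
    by apply: et0_w; rewrite n1E // /E; ring.
  have c2 : et0 H2 * ((X ^ rho) ^+ q) ^+ q = X ^ E * F (pX k ^+ n2 * gam ik H2).
    have [->|H20] := eqVneq H2 0; first by rewrite gamz mulr0 !rmorph0 mul0r mulr0.
    by rewrite -exprM; apply: et0_w; rewrite n2E // PoszM eE /E eE; ring.
  rewrite !map_polyZ /= /frq -!mul_polyC.
  set u1 := map_poly fr0 u in ueq *; set u2 := map_poly fr0 u1 in ueq *.
  rewrite (weight_factor _ _ _ c0 c0' c1 c2).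
  exact: dvdp_mull.
- by rewrite coprimepZr.
- move=> phi psi psiE phik phix; rewrite map_polyZ /= (st _ _ psiE phik phix);
    rewrite ?rmorphM ?rmorphXn /= ?psmap_X ?psmap_gam //.
  by rewrite fmorphXz /= psiE psmap_X.
Qed.
End GenericSolutionExists.

(** The number [f] is chosen before [m]. It collects what a power of Frobenius needs in order to fix
    the solution: the periods [f1], [f2] of the starting values of the two series, and a factor [p]
    for the Artin-Schreier generators. *)
Theorem generic_solution (Fq : finFieldType) (k : closedFieldType) (ik : {rmorphism Fq -> k})
  (G0 G1 G2 : {poly Fq}) : G0 != 0 -> G2 != 0 ->
  exists2 f : nat, (0 < f)%N & forall d' (m : {poly Fq}), m \is monic -> size m = d'.+2 ->
  exists (L : fieldType) (jk : {rmorphism k -> L}) (t : L) (wa wb wc wd gi : {poly L}),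
  [/\ forall P, pv jk t P = 0 -> P = 0,
      forall i j, (size (mx2 wa wb wc wd i j) <= d'.+1)%N,
      horner_mx (map_mx (jk \o ik) (comp_mx d' m)) (gi * (wa * wd - wb * wc)) = 1,
      forall i j, (evA ik jk t G2) *:
        horner_mx (map_mx (jk \o ik) (comp_mx d' m)) (map_poly (frq (jk \o ik)) (mx2 wa wb wc wd i j)) =
        horner_mx (map_mx (jk \o ik) (comp_mx d' m)) ((PhiK ik G0 G1 G2 jk t *m mx2 wa wb wc wd) i j)
    & forall n, (f %| n)%N -> exists phi : {rmorphism L -> L},
      [/\ forall c, phi (jk c) = jk (c ^+ (#|Fq| ^ n)), phi t = t, map_poly phi gi = gi
        & forall i j, map_poly phi (mx2 wa wb wc wd i j) = mx2 wa wb wc wd i j]].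
Proof.
move=> G00 G20; set q := #|Fq|; pose jF := jF0 ik; pose fr0 := frq jF.
have [rho [n1 [n2 [n1E n2E n12]]]] := weight_choice G1 G00 G20.
pose b1 := (n1 == 0%N)%:R * lead_coef G1; pose b2 := (n2 == 0%N)%:R * lead_coef G2.
have lG0 : lead_coef G0 != 0 by rewrite lead_coef_eq0.
have lG2 : lead_coef G2 != 0 by rewrite lead_coef_eq0.
have b12 : (b1 != 0) || (b2 != 0).
  rewrite /b1 /b2; case/orP: n12 => [/eqP ->|/andP[/eqP -> G10]]; rewrite ?mul1r ?lG2 ?orbT //.
  by rewrite lead_coef_eq0 G10.
have [x [f1 [x0 f10 xf1 xE]]] := root_period ik lG0 b12.
have lNG2 : (- lead_coef G2 != 0) || ((0 : Fq) != 0) by rewrite oppr_eq0 lG2.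
have [y [f2 [y0 f20 yf2 yE]]] := root_period ik lG0 lNG2.
have [p [_ [p_pr _ _ pk]]] := q_char_power ik.
exists (p * (f1 * f2))%N; first by rewrite !muln_gt0 prime_gt0 // f10.
move=> d' m m_monic m_size.
pose mK := map_poly jF m.
have [w [sw w_eq cw w_st]] := weighted_template G00 m_monic m_size n1E (fun=> n2E) (erefl b1) (erefl b2) x0 xE.
have [dl [_ dl_eq0 cdl dl_st]] : exists dl : {poly {fraction ps k}}, [/\ (size dl <= d'.+1)%N,
    mK %| (evA ik (jk0 k) (t0 Fq k) G0)%:P * ((t0 Fq k)%:P - 'X) * dl +
      (evA ik (jk0 k) (t0 Fq k) (- G2))%:P * map_poly fr0 dl +
      (evA ik (jk0 k) (t0 Fq k) 0)%:P * map_poly fr0 (map_poly fr0 dl),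
    coprimep mK dl &
    forall (phi : {rmorphism k -> k}) (psi : {rmorphism {fraction ps k} -> {fraction ps k}}),
      (forall a, psi (tofrac a) = tofrac (psmap phi a)) -> (forall c, phi (ik c) = ik c) -> phi y = y ->
      map_poly psi dl = dl].
  (* The weight [(q + 1) z] balances the two terms of the first-order equation. *)
  pose z : int := (size G2).-1%:Z - (size G0).-1%:Z - 1.
  apply: (@weighted_template _ k ik G0 G00 d' m m_monic m_size ((q%:Z + 1) * z) (- G2) 0 0 0 (- lead_coef G2) 0 y) => //.
  - by move=> _; rewrite size_polyN exE /z /q; ring.
  - by rewrite eqxx.
  - by rewrite mul1r lead_coefN.
  - by rewrite lead_coef0 mulr0.
have dl_eq : mK %| (evA ik (jk0 k) (t0 Fq k) G2)%:P * map_poly fr0 dl -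
    ((t0 Fq k)%:P - 'X) * (evA ik (jk0 k) (t0 Fq k) G0)%:P * dl.
  have := dl_eq0; rewrite -dvdpNr; congr (_ %| _).
  have evN : evA ik (jk0 k) (t0 Fq k) (- G2) = - evA ik (jk0 k) (t0 Fq k) G2 by exact: rmorphN.
  have ev0 : evA ik (jk0 k) (t0 Fq k) 0 = 0 by exact: rmorph0.
  by rewrite evN ev0 polyCN polyC0 mulNr mul0r addr0 opprB [_%:P * (_ - _)]mulrC.
have mKm : mK \is monic by rewrite map_monic.
have mKs : size mK = d'.+2 by rewrite size_map_poly.
have mK0 : mK != 0 by apply: monic_neq0.
have sgm : map_poly fr0 mK = mK.
  by rewrite -map_poly_comp; apply: eq_map_poly => c; exact: (frq_base jF).
have inv z : coprimep mK z -> exists2 iz, mK %| z * iz - 1 & (size iz < size mK)%N.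
  case/Bezout_eq1_coprimepP => -[u v] /= uv; exists (v %% mK); last by rewrite ltn_modp.
  have -> : z * (v %% mK) - 1 = - (z * (v %/ mK) + u) * mK.
    by rewrite -uv [X in u * mK + X * z](divp_eq v mK); ring.
  exact: dvdp_mulIr.
have [iw iwE siw] := inv _ cw; have [gi giE sgi] := inv _ cdl.
have cw1 : coprimep mK (map_poly fr0 w) by rewrite -sgm coprimep_map.
have cww : coprimep mK (w * map_poly fr0 w) by rewrite coprimepMr cw cw1.
have [iww iwwE siww] := inv _ cww.
(* The quotient of the Casoratian by [w w^(q)] modulo [m]; its coefficients are the right-hand sides
   of the Artin-Schreier equations. *)
pose a := (dl * iww) %% mK.
have sa : (size a < size mK)%N by rewrite ltn_modp.
have aE : mK %| dl - w * map_poly fr0 w * a.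
  set z := w * _ in iwwE *.
  have -> : dl - z * a = z * ((dl * iww) %/ mK) * mK - dl * (z * iww - 1).
    have -> : z * a = z * (dl * iww) - z * ((dl * iww) %/ mK) * mK.
      by rewrite [X in z * X - _](divp_eq (dl * iww) mK) /a; ring.
    by ring.
  by rewrite dvdp_sub ?dvdp_mulIr ?dvdp_mull.
have [L [j [s [sE ext]]]] := artin_schreier_char jF (fun l : 'I_d'.+1 => a`_l).
pose jk : {rmorphism k -> L} := j \o jk0 k.
pose S := \poly_(l < d'.+1) (if insub l is Some l' then s l' else 0).
have evj P : evA ik jk (j (t0 Fq k)) P = j (evA ik (jk0 k) (t0 Fq k) P).
  rewrite /evA /= /horner_eval -horner_map -map_poly_comp; congr _.[_].
have frj P : map_poly (frq (jk \o ik)) (map_poly j P) = map_poly j (map_poly fr0 P).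
  by rewrite -!map_poly_comp; apply: eq_map_poly => c /=; rewrite /fr0 /frq rmorphXn.
have mjE : map_poly (jk \o ik) m = map_poly j mK by rewrite -map_poly_comp.
have SE : map_poly (frq (jk \o ik)) S = S + map_poly j a.
  apply/polyP => l; rewrite coef_map coefD coef_map !coef_poly.
  case: ltnP => [ld|dl']; last first.
    have al0 : a`_l = 0 by rewrite nth_default // -ltnS (leq_trans sa) // mKs.
    by rewrite add0r [in RHS]al0; transitivity (0 : L); [exact: raddf0|symmetry; exact: raddf0].
  by rewrite insubT /= -(sE (Ordinal ld)) /frq addrC subrK.
have mLm : map_poly (jk \o ik) m \is monic by rewrite map_monic.
have mLs : (1 < size (map_poly (jk \o ik) m))%N by rewrite size_map_poly m_size.
have [Q [pr prP]] := residue_ring mLm mLs.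
pose wb := (map_poly j w * S) %% map_poly (jk \o ik) m.
pose wd := (map_poly (frq (jk \o ik)) (map_poly j w) * (S + map_poly j a)) %% map_poly (jk \o ik) m.
exists L, jk, (j (t0 Fq k)), (map_poly j w), wb, (map_poly (frq (jk \o ik)) (map_poly j w)), wd, (map_poly j gi); split.
- move=> P e; apply: (@t0_tr Fq k); apply: (fmorph_inj j); rewrite rmorph0 -[RHS]e /pv /= /horner_eval.
  by rewrite -horner_map -map_poly_comp.
- by apply: assembly_size => //; rewrite size_map_poly.
- apply: (@assembly_inv Fq k ik d' m m_monic m_size L jk (map_poly j w) (map_poly j a) S (map_poly j dl) (map_poly j gi) _ _ Q pr prP).
  + by rewrite mjE frj -!rmorphM -rmorphB dvdp_map.
  + by rewrite mjE -rmorphM -(rmorph1 (map_poly j)) -rmorphB dvdp_map mulrC.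
- apply: (@assembly_frob Fq k ik G0 G1 G2 d' m m_monic m_size L jk (j (t0 Fq k)) (map_poly j w) (map_poly j iw) (map_poly j a) S (map_poly j dl) _ _ _ _ _ Q pr prP).
  + have := w_eq; rewrite -(dvdp_map j) mjE !frj !evj !rmorphD !rmorphM rmorphB /=.
    by rewrite !map_polyC map_polyX.
  + by rewrite mjE -rmorphM -(rmorph1 (map_poly j)) -rmorphB dvdp_map.
  + have := dl_eq; rewrite -(dvdp_map j) mjE !frj !evj !rmorphB !rmorphM rmorphB /=.
    by rewrite !map_polyC map_polyX.
  + by rewrite mjE frj -!rmorphM -rmorphB dvdp_map.
  + exact: SE.
- move=> n /dvdnP[n' nE]; pose N := (n' * (f1 * f2))%N.
  (* Here [n = p N]. The extension to the tower starts from the [p]-th iterate, so it acts on [k] as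
     the [n]-th power of Frobenius. *)
  have [phi phiE] := iter_rmorph (frq ik) N.
  have phic c : phi c = c ^+ (q ^ N) by rewrite phiE iter_frq.
  have phiF c : phi (ik c) = ik c.
    by rewrite phiE; apply: (@period_iter _ _ _ 1) => //; apply: frq_base.
  have phix : phi x = x.
    by rewrite phiE; apply: (@period_iter _ _ _ f1); rewrite ?iter_frq // /N mulnCA dvdn_mulr.
  have phiy : phi y = y.
    by rewrite phiE; apply: (@period_iter _ _ _ f2); rewrite ?iter_frq // /N mulnA dvdn_mull.
  have [psi psiE] := psmap_lift phi.
  have psiF c : psi (jF c) = jF c by rewrite /= psiE psmap_cst phiF.
  have psim : map_poly psi mK = mK by rewrite -map_poly_comp; apply: eq_map_poly.
  have psifr P : map_poly psi (map_poly fr0 P) = map_poly fr0 (map_poly psi P).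
    by rewrite -!map_poly_comp; apply: eq_map_poly => c /=; rewrite /fr0 /frq rmorphXn.
  have psiw := w_st _ _ psiE phiF phix; have psidl := dl_st _ _ psiE phiF phiy.
  have uniq (z P : {poly {fraction (ps k)}}) : coprimep mK z -> map_poly psi z = z -> (size P < size mK)%N ->
      mK %| z * P - z * map_poly psi P -> map_poly psi P = P.
    by move=> cz _ sP dz; apply/esym/(dvdp_small_eq cz dz); rewrite // size_map_poly.
  have psigi : map_poly psi gi = gi.
    apply: (uniq dl) => //.
    have := giE; rewrite -(dvdp_map psi) rmorphB rmorphM rmorph1 /= psim psidl => g2.
    by have := dvdp_sub giE g2; rewrite opprB addrA subrK.
  have psia : map_poly psi a = a.
    apply: (uniq (w * map_poly fr0 w)) => //; first by rewrite rmorphM /= psifr psiw.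
    have := aE; rewrite -(dvdp_map psi) rmorphB !rmorphM /= psim psidl psifr psiw => g2.
    by have := dvdp_sub g2 aE; rewrite opprB addrC addrA subrK.
  have pK : p \in [pchar {fraction ps k}] by apply: (rmorph_pchar (jk0 k)).
  have [|Psi PsiE Psis] := ext p psi pK psiF.
    by move=> l; rewrite -coef_map /= psia.
  have itm P : map_poly psi P = P -> map_poly Psi (map_poly j P) = map_poly j P.
    move=> PE; rewrite -map_poly_comp; apply/polyP => l; rewrite !coef_map /= PsiE; congr (j _).
    have cl : psi P`_l = P`_l by rewrite -coef_map /= PE.
    by elim: (p) => //= p' ->.
  have Psim : map_poly Psi (map_poly (jk \o ik) m) = map_poly (jk \o ik) m by rewrite mjE; apply: itm.
  have PsiS : map_poly Psi S = S.
    apply/polyP => l; rewrite coef_map !coef_poly; case: ltnP => ld; last exact: raddf0.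
    by rewrite insubT /= Psis.
  have PsiX : psi (X0 k) = X0 k by rewrite psiE psmap_X.
  exists Psi; split.
  + move=> c; rewrite /= PsiE; congr (j _).
    have -> : iter p psi (jk0 k c) = jk0 k (iter p phi c).
      by elim: (p) => //= p' ->; rewrite psiE psmap_cst.
    congr (jk0 k _); have -> : iter p phi c = iter (p * N) (frq ik) c.
      by elim: (p) => // p' IH; rewrite iterS IH phiE -iterD -mulSn.
    by rewrite iter_frq nE /N mulnCA.
  + rewrite PsiE; congr (j _); elim: (p) => //= p' ->.
    by rewrite /t0 fmorphV rmorphXn /= PsiX.
  + exact: itm.
  + have w1 : map_poly Psi (map_poly (frq (jk \o ik)) (map_poly j w)) = map_poly (frq (jk \o ik)) (map_poly j w).
      by rewrite frj; apply: itm; rewrite psifr psiw.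
    move=> i l; elim/ord2_ind: i; elim/ord2_ind: l; rewrite mxE //=; first exact: itm.
    * by rewrite /wb map_modp rmorphM /= Psim PsiS itm.
    * by rewrite /wd map_modp rmorphM rmorphD /= Psim PsiS w1 itm.
Qed.

(** * Counting the [x] that are scalar modulo a fixed [m] *)

Section ScalarCount.
Variables (Fq : finFieldType) (k : closedFieldType) (ik : {rmorphism Fq -> k}).
Variables (G0 G1 G2 : {poly Fq}).
Hypothesis G0_neq0 : G0 != 0.
Hypothesis G2_neq0 : G2 != 0.
Local Notation q := #|Fq|.
Hypothesis q_gt2 : (2 < q)%N.
Local Notation eid := (@idfun k : {rmorphism k -> k}).

Definition scalp (m : {poly Fq}) n x := `[< scalar_mod (map_poly ik m) (PP ik G0 G1 G2 x n) >].
Definition goodm m x := evA ik eid x (DD G0 G2 m) != 0.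
Definition wbd d' := (wm Fq #|{: adI d'}| (hh G0 G1 G2 d')).+1.

(** [f] is common to all [m], while [r], the rank over [k[t]] of the ring generated by the generic
    solution, depends on [m]. The two bounds are [fixed_upper] and [fixed_lower], translated by
    [fixedp_scalar]. *)
Theorem scalar_count : exists2 f : nat, (0 < f)%N &
  forall d' (m : {poly Fq}), m \is monic -> size m = d'.+2 ->
  exists r : nat, [/\ (0 < r)%N, (r <= q ^ (4 * d'.+1))%N,
    forall n (T : seq k), (0 < n)%N -> uniq T ->
      (forall x, x \in T -> [/\ goodm m x, x ^+ (q ^ n) = x & scalp m n x]) ->
      (r * size T <= 2 * q ^ n + 4 * q * r ^ 2 * wbd d' ^ 2)%N
  & forall n bad (T : seq k), (0 < n)%N -> (f %| n)%N -> uniq T ->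
      (forall x, x \in T -> goodm m x /\ x ^+ (q ^ n) = x) ->
      (q ^ n <= size T + bad)%N -> (4 * r * bad <= q ^ n)%N ->
      (144 * q * r ^ 4 * wbd d' ^ 2 <= q ^ n)%N ->
      (q ^ n <= 2 * r * size [seq x <- T | scalp m n x])%N].
Proof.
have [f f0 sol] := generic_solution ik G1 G0_neq0 G2_neq0; exists f => // d' m m_monic m_size.
have [Om [jk [t [wa [wb [wc [wd [gi [t_tr W_size gi_inv W_frob stab]]]]]]]]] := sol d' m m_monic m_size.
have Ysol := Yg_sol G0_neq0 G2_neq0 m_monic m_size q_gt2 t_tr gi_inv W_frob.
have Yunit := Yg_unit G0_neq0 G2_neq0 m_monic t_tr gi_inv.
have [r [b [b_indep b_span]]] := free_basis t_tr (@mm Fq #|{: adI d'}| Om (Yg ik G0 G2 d' m jk t wa wb wc wd gi)).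
have Lh := LL_size G1 G0_neq0 G2_neq0 m_monic m_size.
have [p [e [p_pr e0 qe pk]]] := q_char_power ik.
have pq : (p <= q)%N by rewrite qe -{1}(expn1 p) leq_exp2l // prime_gt1.
have qn n : (q ^ n = p ^ (e * n))%N by rewrite qe -expnM.
have Fqn n : (0 < n)%N -> forall a : Fq, a ^+ (p ^ (e * n)) = a.
  move=> _ a; rewrite -qn; elim: n => [|n IH]; first by rewrite expr1.
  by rewrite expnSr exprM IH expf_card.
have fsc n x : goodm m x -> x ^+ (q ^ n) = x -> fixedp ik (LL G0 G1 G2 d' m) (q ^ n) x = scalp m n x.
  move=> gx xn; apply/idP/asboolP => h; first exact/(fixedp_scalar G1 m_monic m_size gx xn).
  exact/(fixedp_scalar G1 m_monic m_size gx xn).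
exists r; split.
- by have := frank_gt0 Lh Ysol b_span; apply.
- exact: (rank_bound G2_neq0 m_monic m_size W_size gi_inv W_frob b_indep b_span).
- move=> n T n0 uT hT.
  have := fixed_upper Lh t_tr Ysol Yunit b_indep b_span pk _ (Fqn _ n0) uT.
  rewrite -qn muln_gt0 e0 n0 => /(_ isT) up; apply: leq_trans (up _) _.
    by move=> x /hT[gx xn sx]; split=> //; [apply: DD_goodp gx|rewrite fsc].
  by rewrite leq_add2l !leq_mul.
- move=> n bad T n0 fn uT hT hbad h4 h144.
  have [phi [phik phit phig phiW]] := stab n fn.
  have := fixed_lower Lh t_tr Ysol Yunit b_indep b_span pk _ (Fqn _ n0) _ uT.
  rewrite -qn muln_gt0 e0 n0 => /(_ isT) low.
  have -> : [seq x <- T | scalp m n x] = [seq x <- T | fixedp ik (LL G0 G1 G2 d' m) (q ^ n) x].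
    by apply: eq_in_filter => x /hT[gx xn]; rewrite fsc.
  apply: low hbad h4 _; last by apply: leq_trans h144; rewrite !leq_mul.
    (* For the hypothesis [stable]: [phi] fixes [t] and [Yg] and acts on [k] as the [q^n]-th power,
       so it maps the value of [f] to the value of its twist, injectively. *)
    have YgE u v : phi (Yg ik G0 G2 d' m jk t wa wb wc wd gi u v) = Yg ik G0 G2 d' m jk t wa wb wc wd gi u v.
      have phiik c : phi (jk (ik c)) = jk (ik c).
        rewrite phik; congr (jk _); rewrite -(iter_frq ik).
        by elim: (n) => //= n' ->; rewrite frq_base.
      have phiet P : phi (evA ik jk t P) = evA ik jk t P.
        rewrite /evA /= /horner_eval -horner_map -map_poly_comp phit; congr _.[_].
        by apply: eq_map_poly => c; apply: phiik.
      have wE i j : map_poly phi (mx2 wa wb wc wd i j) = mx2 wa wb wc wd i j by [].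
      have waE := wE 0 0; have wbE := wE 0 1; have wcE := wE 1 0; have wdE := wE 1 1.
      rewrite !mxE /= in waE wbE wcE wdE.
      have : map_mx phi (Yg ik G0 G2 d' m jk t wa wb wc wd gi) = Yg ik G0 G2 d' m jk t wa wb wc wd gi.
        rewrite /Yg map_mxZ map_adm phiet !map_mxZ !map_mx2 !rmorphN /= waE wbE wcE wdE phig.
        congr (_ *: adm _ _ _); apply/matrixP => i j; rewrite !mxE -[(jk \o ik) _]/(jk (ik _)).
        exact: phiik.
      by move=> /matrixP/(_ u v); rewrite mxE.
    move=> g e1; apply: (fmorph_inj phi); rewrite rmorph0 -[RHS]e1 /gen /ev rmorph_sum.
    apply: eq_bigr => E _; rewrite rmorphM; congr (_ * _).
      rewrite /pv /= /horner_eval -horner_map -map_poly_comp phit /coefX ffunE.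
      rewrite -map_poly_comp_id0 ?rmorph0 ?expr0n ?expn_eq0 ?(gtn_eqF (q_gt0 Fq)) //.
      by congr _.[_]; apply: eq_map_poly => c; rewrite /= phik.
    rewrite /mon rmorph_prod; apply: eq_bigr => ij _; by rewrite rmorphXn /= YgE.
  by move=> x /hT[gx xn]; split=> //; apply: DD_goodp gx.
Qed.
End ScalarCount.

(** * The motive: [L{tau}] as a free module of rank two over [L[T]] *)

Lemma mul_row2 (R : comNzRingType) (w : 'rV[R]_2) (A : 'M_2) j :
  (w *m A) 0 j = w 0 0 * A 0 j + w 0 1 * A 1 j.
Proof.
by rewrite mxE big_ord_recl big_ord1; congr (_ + _ * _); congr (_ _ _); exact: val_inj.
Qed.

Section TwistedModule.
Variables (Fq : finFieldType) (L : fieldType) (gamma : {rmorphism {poly Fq} -> L}).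
Local Notation q := #|Fq|.
Local Notation S := (twisted gamma).
Local Notation jL := (gamma \o polyC).
Local Notation fr := (frq jL).
Local Notation sg := (map_poly fr).
Local Notation tau := (Defs.tau gamma).

(** Constants of all of [L] act from the left; the scaling built into [twisted gamma] is by [Fq]
    only. *)
Definition sc (c : L) (f : S) : S := (c *: (f : {poly L})).

Lemma scM c (f g : S) : sc c f * g = sc c (f * g).
Proof. exact: twist_mulZl. Qed.
Lemma scD c (f g : S) : sc c (f + g) = sc c f + sc c g.
Proof. exact: (@scalerDr L {poly L} c f g). Qed.
Lemma sc_add c d (f : S) : sc (c + d) f = sc c f + sc d f.
Proof. exact: (@scalerDl L {poly L} f c d). Qed.
Lemma scA c d (f : S) : sc c (sc d f) = sc (c * d) f.
Proof. exact: (@scalerA L {poly L} c d f). Qed.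
Lemma sc1 (f : S) : sc 1 f = f.
Proof. exact: (@scale1r L {poly L} f). Qed.
Lemma sc0 (f : S) : sc 0 f = 0.
Proof. exact: (@scale0r L {poly L} f). Qed.
Lemma scN c (f : S) : sc (- c) f = - sc c f.
Proof. exact: (@scaleNr L {poly L} c f). Qed.
Lemma sc_sum (I : Type) (r : seq I) (P : pred I) c (F : I -> S) :
  sc c (\sum_(i <- r | P i) F i) = \sum_(i <- r | P i) sc c (F i).
Proof. exact: (@scaler_sumr L {poly L} c I r P F). Qed.

Lemma tauE (f : S) : tau * f = twist_tau Fq f.
Proof. by have := @twist_mulXl Fq L 1 f; rewrite expr1. Qed.

Lemma tau_sc c (f : S) : tau * sc c f = sc (fr c) (tau * f).
Proof. by rewrite !tauE /sc; apply: twist_tauZ. Qed.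

Lemma coef_tau (f : S) i : (tau * f : {poly L})`_i = if i is j.+1 then fr (f : {poly L})`_j else 0.
Proof.
by rewrite tauE; case: i => [|i]; [apply: coef_twist_tau0|apply: coef_twist_tau].
Qed.

Lemma coef_tauX n (f : S) i :
  (tau ^+ n * f : {poly L})`_i = if (i < n)%N then 0 else iter n fr (f : {poly L})`_(i - n).
Proof.
elim: n i => [|n IH] i; first by rewrite expr0 mul1r subn0.
rewrite exprS -mulrA coef_tau; case: i => [|i] //; rewrite IH ltnS subSS.
by case: ltnP => // _; rewrite ?rmorph0.
Qed.

Lemma tauX n : (tau ^+ n : {poly L}) = 'X^n.
Proof.
elim: n => [|n IH]; first by rewrite !expr0.
by rewrite exprS tauE IH; apply: twist_tauXn.
Qed.

Lemma twisted_sum (f : S) : f = \sum_(i < size (f : {poly L})) sc (f : {poly L})`_i (tau ^+ i).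
Proof.
rewrite -[LHS]/(f : {poly L}) -[f in LHS](coefK (f : {poly L})) poly_def.
by apply: eq_bigr => i _; rewrite /sc tauX.
Qed.

Lemma coef_mulS m n (f g : S) : (size (f : {poly L}) <= m.+1)%N -> (size (g : {poly L}) <= n.+1)%N ->
  (size ((f * g)%R : {poly L}) <= (m + n).+1)%N /\
  (f * g : {poly L})`_(m + n) = (f : {poly L})`_m * iter m fr (g : {poly L})`_n.
Proof.
move=> sf sg.
have E : f * g = \sum_(i < m.+1) sc (f : {poly L})`_i (tau ^+ i * g).
  have -> : f * g = twist_mul Fq f g by [].
  have it j : iter j (@twist_tau Fq L) (g : {poly L}) = tau ^+ j * g.
    by elim: j => [|j IH]; rewrite ?mul1r // exprS -mulrA tauE /= IH.
  rewrite (twist_mul_wide Fq g sf); apply: eq_bigr => i _; by rewrite it.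
have cE i : (f * g : {poly L})`_i = \sum_(j < m.+1) (f : {poly L})`_j * (tau ^+ j * g : {poly L})`_i.
  by rewrite E (coef_sum _ _ _ i); apply: eq_bigr => j _; rewrite /sc coefZ.
have it0 j : iter j fr 0 = 0 by elim: j => //= j ->; rewrite rmorph0.
have g0 i : (n < i)%N -> (g : {poly L})`_i = 0 by move=> ni; rewrite nth_default // (leq_trans sg).
split.
  apply/leq_sizeP => i mi; rewrite cE big1 // => j _; rewrite coef_tauX.
  case: ltnP => // ji; rewrite ?mulr0 // g0 ?it0 ?mulr0 //; have := ltn_ord j; lia.
rewrite cE big_ord_recr /= [X in X + _]big1 ?add0r => [|j _].
  by rewrite coef_tauX ltnNge leq_addr /= addKn.
rewrite coef_tauX; case: ltnP => // ji; rewrite ?mulr0 // g0 ?it0 ?mulr0 //=.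
have := ltn_ord j; lia.
Qed.

Variable Psi : S.
Local Notation c0 := ((Psi : {poly L})`_0).
Local Notation c1 := ((Psi : {poly L})`_1).
Local Notation c2 := ((Psi : {poly L})`_2).
Hypothesis Psi_size : size (Psi : {poly L}) = 3%N.

Lemma c2_neq0 : c2 != 0.
Proof.
have : lead_coef (Psi : {poly L}) != 0 by rewrite lead_coef_eq0 -size_poly_eq0 Psi_size.
by rewrite /lead_coef Psi_size.
Qed.

Lemma tau2 : tau ^+ 2 = sc c2^-1 (Psi - sc c0 1 - sc c1 tau).
Proof.
have e : Psi = sc c0 1 + sc c1 tau + sc c2 (tau ^+ 2).
  rewrite {1}[Psi]twisted_sum Psi_size !big_ord_recr big_ord0 /= add0r expr0 expr1 //.
have -> : Psi - sc c0 1 - sc c1 tau = sc c2 (tau ^+ 2).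
  by rewrite {1}e -addrA -opprD [sc c0 _ + _ + _]addrC addrK.
by rewrite scA mulVf ?c2_neq0 // sc1.
Qed.

(** The action of [P(T)] on [s], where [T] acts as right multiplication by [Psi]. *)
Definition ev1 (P : {poly L}) (s : S) : S := \sum_(j < size P) sc P`_j (s * Psi ^+ j).

Lemma ev1_wide n (P : {poly L}) s : (size P <= n)%N -> ev1 P s = \sum_(j < n) sc P`_j (s * Psi ^+ j).
Proof.
move=> sP; rewrite /ev1 -(subnK sP) addnC big_split_ord /= [X in _ + X]big1 ?addr0 // => j _.
by rewrite nth_default ?sc0 //= leq_addr.
Qed.

Lemma ev1D P P' s : ev1 (P + P') s = ev1 P s + ev1 P' s.
Proof.
pose n := maxn (size P) (size P').
rewrite !(@ev1_wide n) ?leq_maxl ?leq_maxr ?size_polyD // -big_split.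
by apply: eq_bigr => j _; rewrite coefD sc_add.
Qed.

Lemma ev1Z c P s : ev1 (c *: P) s = sc c (ev1 P s).
Proof.
rewrite (@ev1_wide (size P)) ?size_scale_leq // sc_sum.
by apply: eq_bigr => j _; rewrite coefZ scA.
Qed.

Lemma ev10 s : ev1 0 s = 0.
Proof. by rewrite /ev1 size_poly0 big_ord0. Qed.

Lemma ev1_D P s s' : ev1 P (s + s') = ev1 P s + ev1 P s'.
Proof. by rewrite -big_split; apply: eq_bigr => j _; rewrite mulrDl scD. Qed.

Lemma ev1_sc P c s : ev1 P (sc c s) = ev1 (c *: P) s.
Proof.
by rewrite ev1Z /ev1 sc_sum; apply: eq_bigr => j _; rewrite scM !scA mulrC.
Qed.

Lemma ev1C c s : ev1 c%:P s = sc c s.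
Proof. by rewrite (@ev1_wide 1) ?size_polyC_leq1 // big_ord1 coefC expr0 mulr1. Qed.

Lemma ev1X P s : ev1 ('X * P) s = ev1 P s * Psi.
Proof.
rewrite (@ev1_wide (size P).+1); last by rewrite (leq_trans (size_polyMleq _ _)) // size_polyX.
rewrite big_ord_recl coefXM sc0 add0r mulr_suml; apply: eq_bigr => j _.
by rewrite lift0 coefXM /= scM -mulrA -exprSr.
Qed.

Lemma ev1Xn i s : ev1 'X^i s = s * Psi ^+ i.
Proof.
elim: i => [|i IH]; first by rewrite expr0 -polyC1 ev1C sc1 mulr1.
by rewrite exprS ev1X IH -mulrA -exprSr.
Qed.

Lemma ev1_Psi P s : ev1 P (s * Psi) = ev1 ('X * P) s.
Proof. by rewrite ev1X mulr_suml; apply: eq_bigr => j _; rewrite scM -!mulrA -exprS -exprSr. Qed.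

Lemma tau_ev1 P s : tau * ev1 P s = ev1 (sg P) (tau * s).
Proof.
rewrite mulr_sumr /ev1 size_map_poly; apply: eq_bigr => j _.
by rewrite tau_sc coef_map mulrA.
Qed.

Definition E (v : 'rV[{poly L}]_2) : S := ev1 (v 0 0) 1 + ev1 (v 0 1) tau.

Lemma ED v v' : E (v + v') = E v + E v'.
Proof. by rewrite /E !mxE !ev1D addrACA. Qed.

Lemma EZ c v : E (c%:P *: v) = sc c (E v).
Proof. by rewrite /E !mxE !mul_polyC !ev1Z scD. Qed.

Lemma EX v : E ('X *: v) = E v * Psi.
Proof. by rewrite /E !mxE !ev1X mulrDl. Qed.

(** The rows are the coordinates of [tau] and [tau^2], the latter obtained by solving
    [Psi = c0 + c1 tau + c2 tau^2]. *)
Definition PhiL : 'M[{poly L}]_2 := mx2 0 1 (c2^-1 *: ('X - c0%:P)) (- (c2^-1 * c1)%:P).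

Lemma tau_E v : tau * E v = E (map_mx sg v *m PhiL).
Proof.
rewrite /E mulrDr !tau_ev1 mulr1 -expr2 tau2 ev1_sc !ev1_D.
rewrite !mul_row2 !mxE /= mulr0 add0r mulr1 -[X in ev1 _ X + _]mul1r ev1_Psi.
rewrite -!scN !ev1_sc -[X in _ + (X + _)]ev1D addrCA -[X in _ + X]ev1D.
by congr (ev1 _ _ + ev1 _ _); rewrite -!mul_polyC ?polyCN ?polyCM; ring.
Qed.

(** The [L]-basis of elements [T^i] and [T^i tau], ordered so that [mu n] has degree [n] in [tau].
    This triangularity makes [E] bijective. *)
Definition mu n : S := if odd n then tau * Psi ^+ n./2 else Psi ^+ n./2.

Lemma Psi_pow n : size (Psi ^+ n : {poly L}) = (n.*2).+1.
Proof.
elim: n => [|n IH]; first by rewrite expr0 size_poly1.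
have [s1 c] : (size ((Psi * Psi ^+ n)%R : {poly L}) <= (2 + n.*2).+1)%N /\
    (Psi * Psi ^+ n : {poly L})`_(2 + n.*2) = c2 * iter 2 fr (Psi ^+ n : {poly L})`_(n.*2).
  by apply: coef_mulS; rewrite ?Psi_size ?IH.
apply/eqP; rewrite eqn_leq doubleS -add2n exprS s1 /= ltnNge; apply/negP => s2.
have := c; rewrite nth_default //= => /esym/eqP; rewrite mulf_eq0 (negPf c2_neq0) /= !fmorph_eq0.
have : lead_coef (Psi ^+ n : {poly L}) != 0 by rewrite lead_coef_eq0 -size_poly_eq0 IH.
by rewrite /lead_coef IH /= => /negPf ->.
Qed.

Lemma mu_size n : size (mu n : {poly L}) = n.+1.
Proof.
rewrite /mu -[in RHS](odd_double_half n); case: ifP => _; last by rewrite Psi_pow.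
have s0 : size (Psi ^+ n./2 : {poly L}) = (n./2.*2).+1 by rewrite Psi_pow.
have -> : (tau * Psi ^+ n./2 : {poly L}) = sg (Psi ^+ n./2 : {poly L}) * 'X by rewrite tauE.
by rewrite size_mulX ?size_map_poly ?s0 // map_poly_eq0 -size_poly_eq0 s0.
Qed.

Lemma E_mu n (v : 'rV[{poly L}]_2) : (size (v 0%R 0%R) <= n)%N -> (size (v 0%R 1%R) <= n)%N ->
  E v = \sum_(i < n.*2) sc (if odd i then (v 0 1)`_(i./2) else (v 0 0)`_(i./2)) (mu i).
Proof.
move=> s0 s1; rewrite /E !(@ev1_wide n) //.
elim: n {s0 s1} => [|n IH]; first by rewrite !big_ord0 addr0.
rewrite doubleS !big_ord_recr /= addrACA IH odd_double uphalf_double doubleK /= -addrA.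
by rewrite /mu /= odd_double uphalf_double doubleK mul1r.
Qed.

Lemma E_surj (f : S) : exists v, f = E v.
Proof.
have [n] := ubnP (size (f : {poly L})); elim: n f => // n IH f; rewrite ltnS => sf.
have [f0|f0] := eqVneq (size (f : {poly L})) 0%N.
  by exists 0; rewrite /E !mxE !ev10 addr0; apply/eqP; rewrite -size_poly_eq0 f0.
pose d := (size (f : {poly L})).-1.
have sfd : size (f : {poly L}) = d.+1 by rewrite prednK // lt0n.
pose c := (f : {poly L})`_d / (mu d : {poly L})`_d.
have mu0 : (mu d : {poly L})`_d != 0.
  have : lead_coef (mu d : {poly L}) != 0 by rewrite lead_coef_eq0 -size_poly_eq0 mu_size.
  by rewrite /lead_coef mu_size.
have [|v vE] := IH (f - sc c (mu d)).
  rewrite (leq_trans _ sf) // sfd ltnS; apply/leq_sizeP => j; rewrite leq_eqVlt.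
  rewrite (coefB (f : {poly L})) /sc coefZ => /orP[/eqP <-|dj]; first by rewrite divfK // subrr.
  by rewrite !nth_default ?mulr0 ?subr0 // ?mu_size ?sfd.
have [w wE] : exists w, mu d = E w.
  rewrite /mu; exists (\row_j if (j == 1) == odd d then 'X^(d./2) else 0).
  rewrite /E !mxE /=; case: (odd d); rewrite /= ev10 ?add0r ?addr0.
    by rewrite ev1Xn.
  by rewrite ev1Xn mul1r.
by exists (v + c%:P *: w); rewrite ED EZ -wE -vE subrK.
Qed.

Lemma E_inj v : E v = 0 -> v = 0.
Proof.
move=> Ev; pose n := maxn (size (v 0 0)) (size (v 0 1)).
have := @E_mu n v (leq_maxl _ _) (leq_maxr _ _); rewrite Ev => e.
pose w i := if odd i then (v 0 1)`_(i./2) else (v 0 0)`_(i./2).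
have w0 : forall N, 0 = \sum_(i < N) sc (w i) (mu i) -> forall i, (i < N)%N -> w i = 0.
  elim=> [|N IH] // e'; have wN : w N = 0.
    have := congr1 (fun f : S => (f : {poly L})`_N) e'; rewrite big_ord_recr /=.
    rewrite (coefD (\sum_(i < N) _ : {poly L})) (coef_sum _ _ _ N) big1 => [|i _]; last first.
      by rewrite /sc coefZ nth_default ?mulr0 // mu_size.
    rewrite add0r /sc coefZ coef0 => /esym/eqP; rewrite mulf_eq0 => /orP[/eqP //|].
    have : lead_coef (mu N : {poly L}) != 0 by rewrite lead_coef_eq0 -size_poly_eq0 mu_size.
    by rewrite /lead_coef mu_size => /negPf ->.
  move=> i; rewrite ltnS leq_eqVlt => /orP[/eqP -> //|iN]; apply: IH => //.
  by move: e'; rewrite big_ord_recr /= wN sc0 addr0.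
have {}w0 := w0 _ e.
apply/rowP => j; rewrite mxE; apply/polyP => i; rewrite coef0.
have [ni|in_] := leqP n i.
  rewrite nth_default // (leq_trans _ ni) // /n leq_max.
  by elim/ord2_ind: j; rewrite leqnn ?orbT.
have h0 := w0 i.*2; have h1 := w0 i.*2.+1.
rewrite /w /= odd_double doubleK /= in h0; rewrite /w /= odd_double /= uphalf_double in h1.
by elim/ord2_ind: j; [apply: h0|apply: h1]; rewrite ?ltn_Sdouble ?ltn_double.
Qed.

Lemma E_inj2 v w : E v = E w -> v = w.
Proof.
move=> e; apply/eqP; rewrite -subr_eq0; apply/eqP/E_inj.
have -> : v - w = v + (-1)%:P *: w by rewrite polyCN scaleNr scale1r.
by rewrite ED EZ e scN sc1 subrr.
Qed.

Lemma E_row (P : {poly L}) v : E (P *: v) = \sum_(j < size P) sc P`_j (E v * Psi ^+ j).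
Proof.
elim/poly_ind: P => [|P c IH]; first by rewrite size_poly0 big_ord0 scale0r /E !mxE !ev10 addr0.
rewrite scalerDl ED mulrC -scalerA EX EZ IH -[RHS]/(ev1 _ _) ev1D ev1C; congr (_ + _).
by rewrite ev1X.
Qed.

Lemma E_split v : E v = \sum_(j < size (v 0 0)) sc (v 0 0)`_j (Psi ^+ j) +
  \sum_(j < size (v 0 1)) sc (v 0 1)`_j (tau * Psi ^+ j).
Proof. by congr (_ + _); apply: eq_bigr => j _; rewrite mul1r. Qed.

Definition E_of (f : S) := projT1 (cid (E_surj f)).
Lemma E_ofK f : E (E_of f) = f.
Proof. by rewrite /E_of; case: cid. Qed.
(** When [u] commutes with [Psi], right multiplication by [u] is [L[T]]-linear, and its matrix has
    the coordinates of [u] and [tau u] as rows. *)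
Definition U_of (u : S) : 'M[{poly L}]_2 := \matrix_(i, j) (if i == 0 then E_of u 0 j else E_of (tau * u) 0 j).

Lemma U_ofP (u : S) : u * Psi = Psi * u -> forall v, E v * u = E (v *m U_of u).
Proof.
move=> uP v; have uPj j : u * Psi ^+ j = Psi ^+ j * u.
  by elim: j => [|j IH]; rewrite ?mulr1 ?mul1r // exprSr mulrA IH -mulrA uP mulrA.
have -> : v *m U_of u = v 0 0 *: E_of u + v 0 1 *: E_of (tau * u).
  by apply/rowP => j; rewrite mul_row2 !mxE.
rewrite ED !E_row !E_ofK E_split mulrDl !mulr_suml; congr (_ + _); apply: eq_bigr => j _.
  by rewrite scM uPj.
by rewrite scM -!mulrA uPj.
Qed.

Lemma mx_E (A B : 'M[{poly L}]_2) : (forall v : 'rV_2, E (v *m A) = E (v *m B)) -> A = B.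
Proof. by move=> AB; apply/row_matrixP => i; rewrite !rowE; apply: E_inj2. Qed.

(** Right multiplication by [u] commutes with left multiplication by [tau]. *)
Lemma U_of_frob (u : S) : u * Psi = Psi * u -> map_mx sg (U_of u) *m PhiL = PhiL *m U_of u.
Proof.
move=> uP; apply/row_matrixP => i; rewrite !rowE; apply: E_inj2.
set e : 'rV[{poly L}]_2 := delta_mx 0 i.
have ee : map_mx sg e = e by rewrite map_delta_mx.
by rewrite !mulmxA -{1}ee -map_mxM -tau_E -(U_ofP uP) mulrA tau_E ee U_ofP.
Qed.

(** Conversely, a matrix commuting with Frobenius is right multiplication by its first row. The
    claim passes from [1] to sums, to [tau f] and to multiples by constants, which exhaust
    [L{tau}]. *)
Lemma E_comm (U : 'M[{poly L}]_2) : map_mx sg U *m PhiL = PhiL *m U ->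
  forall v, E v * E (row 0 U) = E (v *m U).
Proof.
move=> hU; pose e0 : 'rV[{poly L}]_2 := delta_mx 0 0.
have e0E : E e0 = 1 by rewrite /E !mxE /= ev10 addr0 ev1C sc1.
pose G f := forall v, E v = f -> f * E (row 0 U) = E (v *m U).
have G1 : G 1 by move=> v; rewrite -e0E => /E_inj2 ->; rewrite e0E mul1r rowE.
have GD f g : G f -> G g -> G (f + g).
  move=> Gf Gg v vE; rewrite mulrDl (Gf _ (E_ofK f)) (Gg _ (E_ofK g)) -ED -mulmxDl.
  by congr (E (_ *m _)); apply: E_inj2; rewrite ED !E_ofK.
have Gt f : G f -> G (tau * f).
  move=> Gf v vE; rewrite -mulrA (Gf _ (E_ofK f)) tau_E map_mxM -mulmxA hU mulmxA.
  by congr (E (_ *m _)); apply: E_inj2; rewrite -tau_E E_ofK.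
have Gs c f : G f -> G (sc c f).
  move=> Gf v vE; rewrite scM (Gf _ (E_ofK f)) -EZ scalemxAl.
  by congr (E (_ *m _)); apply: E_inj2; rewrite EZ E_ofK.
have G0 : G 0 by move=> v; rewrite -[0](sc0 1) => vE; apply: (Gs 0 1 G1).
have GT n : G (tau ^+ n) by elim: n => [|n IH]; rewrite ?expr0 // exprS; apply: Gt.
have GA f : G f by rewrite [f]twisted_sum; apply: (big_ind G) => // i _; apply: Gs.
by move=> v; apply: GA.
Qed.

Lemma E_commutes (U : 'M[{poly L}]_2) : map_mx sg U *m PhiL = PhiL *m U ->
  E (row 0 U) * Psi = Psi * E (row 0 U).
Proof.
move=> hU; pose e0 : 'rV[{poly L}]_2 := delta_mx 0 0.
have e0E : E e0 = 1 by rewrite /E !mxE /= ev10 addr0 ev1C sc1.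
have -> : Psi * E (row 0 U) = E ('X *: e0) * E (row 0 U) by rewrite EX e0E mul1r.
by rewrite (E_comm hU) -scalemxAl -rowE EX.
Qed.

Lemma U_of_mul u u' : u * Psi = Psi * u -> u' * Psi = Psi * u' -> U_of (u * u') = U_of u *m U_of u'.
Proof.
move=> hu hu'; apply: mx_E => v; rewrite mulmxA -!U_ofP ?mulrA //.
by rewrite -mulrA hu' mulrA hu -mulrA.
Qed.

Lemma U_of_row u : E (row 0 (U_of u)) = u.
Proof. by rewrite -[RHS](E_ofK u); congr E; apply/rowP => j; rewrite !mxE. Qed.

Lemma U_of_E (U : 'M[{poly L}]_2) : map_mx sg U *m PhiL = PhiL *m U -> U_of (E (row 0 U)) = U.
Proof.
by move=> hU; apply: mx_E => v; rewrite -(U_ofP (E_commutes hU)) (E_comm hU).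
Qed.
End TwistedModule.

(** * Adjugates, and semilinear maps on a subspace *)

Section Adj2.
Variable R : comNzRingType.
Implicit Types A B : 'M[R]_2.
Definition adj2 A : 'M[R]_2 := mx2 (A 1 1) (- A 0 1) (- A 1 0) (A 0 0).
Definition det2 A : R := A 0 0 * A 1 1 - A 0 1 * A 1 0.
Lemma adj2M A B : adj2 (A *m B) = adj2 B *m adj2 A.
Proof. by apply: mx2P; rewrite /adj2 !mulmx2 !mulmx2E !mxE /= ; ring. Qed.
Lemma mul_adj2 A : A *m adj2 A = (det2 A)%:M.
Proof. by rewrite [A in A *m _]mx2E mulmx2 scalar_mx2 /det2; congr mx2; ring. Qed.
Lemma det2M A B : det2 (A *m B) = det2 A * det2 B.
Proof. by rewrite /det2 !mulmx2E; ring. Qed.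
End Adj2.

Lemma map_adj2 (R R' : comNzRingType) (f : {rmorphism R -> R'}) (A : 'M[R]_2) :
  map_mx f (adj2 A) = adj2 (map_mx f A).
Proof. by rewrite /adj2 map_mx2 !mxE !rmorphN. Qed.

Section SemilinearSubspace.
Variables (Fq : finFieldType) (k : closedFieldType) (ik : {rmorphism Fq -> k}).
Local Notation fr := (frq ik).

(** [T] maps the subspace injectively into its Frobenius twist. In a basis it becomes an invertible
    matrix, and [semilinear_fixed] yields the vector. *)
Lemma semilinear_subspace r n (B : 'M[k]_(r, n)) (T : 'rV[k]_n -> 'rV[k]_n) :
  row_free B -> (0 < r)%N -> (forall c u v, T (c *: u + v) = c *: T u + T v) ->
  (forall v, (v <= B)%MS -> T v = 0 -> v = 0) ->
  (forall v, (v <= B)%MS -> exists2 w : 'rV_n, (w <= B)%MS & map_mx fr w = T v) ->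
  exists v : 'rV_n, [/\ v != 0, (v <= B)%MS & map_mx fr v = T v].
Proof.
case: r B => // r B fB _ Tlin Tinj TS.
have TD u v : T (u + v) = T u + T v by have := Tlin 1 u v; rewrite !scale1r.
have T0 : T 0 = 0 by have := Tlin (-1) 0 0; rewrite scaler0 addr0 scaleN1r addNr.
have /choice[w wP] : forall i, exists w : 'rV_n, (w <= B)%MS /\ map_mx fr w = T (row i B).
  by move=> i; have [w] := TS _ (row_sub i B); exists w.
have /choice[c cE] : forall i, exists c : 'rV_r.+1, w i = c *m B.
  by move=> i; have /submxP := (wP i).1.
pose C := \matrix_(i, j) c i 0 j.
have TE (y : 'rV_r.+1) : T (y *m B) = (y *m map_mx fr C) *m map_mx fr B.
  have -> : y *m B = \sum_i y 0 i *: row i B by rewrite mulmx_sum_row.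
  have -> : T (\sum_i y 0 i *: row i B) = \sum_i y 0 i *: T (row i B).
    rewrite (big_morph T TD T0); apply: eq_bigr => i _.
    by rewrite -[_ *: row i B]addr0 Tlin T0 addr0.
  rewrite -mulmxA mulmx_sum_row; apply: eq_bigr => i _; congr (_ *: _).
  rewrite -(wP i).2 cE map_mxM row_mul; congr (_ *m _).
  by apply/rowP => j; rewrite !mxE.
have Cu : (map_mx fr C)^T \in unitmx.
  rewrite unitmx_tr; apply: contraT => nu.
  have /det0P[y y0 yC] : \det (map_mx fr C) == 0.
    by move: nu; rewrite unitmxE unitfE negbK.
  have yB : y *m B = 0.
    by apply: Tinj; [exact: submxMl|rewrite TE yC mul0mx].
  by case/negP: y0; rewrite -(mulmx_free_eq0 y fB) yB.
have [y y0 yE] := semilinear_fixed ik Cu.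
exists (y^T *m B); split.
- by rewrite mulmx_free_eq0 // -(inj_eq trmx_inj) trmxK trmx0.
- exact: submxMl.
- have yTE : map_mx fr y^T = y^T *m map_mx fr C by rewrite -map_trmx yE trmx_mul trmxK.
  by rewrite TE map_mxM yTE.
Qed.
End SemilinearSubspace.

(** * A determinant that detects matrices of small degree commuting with Frobenius *)

Definition tz (R : comNzRingType) (a b c : R) : 'M[R]_2 := mx2 a b c (- a).

Section Exceptional.
Variables (Fq : finFieldType) (k : closedFieldType) (ik : {rmorphism Fq -> k}).
Variables (G0 G1 G2 : {poly Fq}).
Local Notation q := #|Fq|.
Local Notation eid := (@idfun k : {rmorphism k -> k}).
Local Notation ev x := (evA ik eid x).
Local Notation fr := (frq ik).
Local Notation sg := (map_poly fr).
Local Notation Ph x := (PhiK ik G0 G1 G2 eid x).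
Local Notation PPx := (PP ik G0 G1 G2).
Implicit Types a b c : {poly k}.

(** If [U^(q) Phi = Phi U] and [N = PP x i], then [N U N^-1] is the [i]-th twist of [U], whose lower
    left entry vanishes at [T = x^(q^i)]. This yields conditions that are linear in [U], without
    twists; the adjugate replaces the inverse. *)
Definition rho x i (U : 'M[{poly k}]_2) : k :=
  ((PPx x i *m U *m adj2 (PPx x i)) 1 0).[x ^+ (q ^ i)].

Lemma map_Ph x : map_mx sg (Ph x) = Ph (x ^+ q).
Proof.
have e P : ev (x ^+ q) P = fr (ev x P).
  by rewrite -{1}(expn1 q) evA_frob expn1.
by rewrite /PhiK map_mx2 !e rmorph0 rmorphM rmorphB rmorphN /= map_polyX !map_polyC.
Qed.

Lemma map_PP x n : map_mx sg (PPx x n) = PPx (x ^+ q) n.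
Proof.
elim: n => [|n IH]; first by rewrite map_mx1.
rewrite -[PPx x n.+1]/(Ph _ *m PPx x n) -[PPx _ n.+1]/(Ph _ *m PPx _ n).
by rewrite map_mxM IH map_Ph -!exprM mulnC.
Qed.

Lemma PP_right x n : PPx x n.+1 = PPx (x ^+ q) n *m Ph x.
Proof.
elim: n x => [|n IH] x; first by rewrite /= expn0 expr1 mulmx1 mul1mx.
by rewrite -[PPx x n.+2]/(Ph _ *m PPx x n.+1) IH mulmxA /= -exprM expnS.
Qed.

Lemma PP_comm x U n : map_mx sg U *m Ph x = Ph x *m U ->
  PPx x n *m U = iter n (map_mx sg) U *m PPx x n.
Proof.
move=> hU; elim: n => [|n IH]; first by rewrite mul1mx mulmx1.
rewrite -[PPx x n.+1]/(Ph _ *m PPx x n) -mulmxA IH mulmxA.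
have -> : Ph (x ^+ (q ^ n)) *m iter n (map_mx sg) U = iter n.+1 (map_mx sg) U *m Ph (x ^+ (q ^ n)).
  elim: n {IH} => [|n IH]; first by rewrite expr1 /= hU.
  rewrite expnSr exprM -map_Ph -[iter n.+1 _ U]/(map_mx sg _) -map_mxM IH map_mxM //.
by rewrite mulmxA.
Qed.

(** The entry [(0, 0)] of the commutation relation is [(T - x) G0 b^(q) = G2 c], so [c] vanishes at
    [x]; its twists vanish at the twists of [x]. *)
Lemma rho_eq0 x a b c i : ev x G2 != 0 -> map_mx sg (tz a b c) *m Ph x = Ph x *m tz a b c ->
  rho x i (tz a b c) = 0.
Proof.
move=> g2 hU; rewrite /rho PP_comm // -mulmxA mul_adj2 mul_mx_scalar mxE hornerM.
suff -> : (iter i (map_mx sg) (tz a b c) 1 0).[x ^+ (q ^ i)] = 0 by rewrite mulr0.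
have h : map_mx sg (iter i (map_mx sg) (tz a b c)) *m Ph (x ^+ (q ^ i)) =
    Ph (x ^+ (q ^ i)) *m iter i (map_mx sg) (tz a b c).
  elim: i => [|i IH]; first by rewrite expr1.
  by rewrite expnSr exprM -map_Ph -[iter i.+1 _ _]/(map_mx sg _) -map_mxM IH map_mxM.
have /matrixP/(_ 0 0) := h; rewrite !mulmx2E !mxE /= mulr0 mul0r !add0r.
move/(congr1 (fun P : {poly k} => P.[x ^+ (q ^ i)])); rewrite !hornerM !hornerC hornerXsubC subrr mul0r mulr0.
move=> /esym/eqP; rewrite mulf_eq0 evA_frob expf_eq0 (negPf g2) andbF /= => /eqP.
by [].
Qed.

Variable K : nat.
Local Notation n0 := (K.+1 + (K.+1 + K.+2))%N.

(** The coordinates allow degree [K] for [a] and [b] but [K + 1] for [c], in accordance with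
    [G2 c = (T - x) G0 b^(q)]. There are [3 K + 4] of them. *)
Definition pa (y : 'rV[k]_n0) : {poly k} := rVpoly (lsubmx y).
Definition pb (y : 'rV[k]_n0) : {poly k} := rVpoly (lsubmx (rsubmx y)).
Definition pc (y : 'rV[k]_n0) : {poly k} := rVpoly (rsubmx (rsubmx y)).
Definition Uy y := tz (pa y) (pb y) (pc y).
Definition yv a b c : 'rV[k]_n0 := row_mx (poly_rV a) (row_mx (poly_rV b) (poly_rV c)).

Lemma yvK a b c : (size a <= K.+1)%N -> (size b <= K.+1)%N -> (size c <= K.+2)%N ->
  [/\ pa (yv a b c) = a, pb (yv a b c) = b & pc (yv a b c) = c].
Proof. by move=> sa sb sc; rewrite /pa /pb /pc !(row_mxKl, row_mxKr) !poly_rV_K. Qed.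

Lemma yv_pabc y : yv (pa y) (pb y) (pc y) = y.
Proof. by rewrite /yv /pa /pb /pc !rVpolyK !hsubmxK. Qed.

(* The factors of the product defining [PP], with [T] specialised to [x ^+ (q ^ i)] and [x] generic. *)
Definition NG i j : 'M[{poly Fq}]_2 :=
  mx2 0 (G2 ^+ (q ^ j)) (('X^(q ^ i) - 'X^(q ^ j)) * G0 ^+ (q ^ j)) (- G1 ^+ (q ^ j)).
Fixpoint NN i n : 'M[{poly Fq}]_2 := if n is n'.+1 then NG i n' *m NN i n' else 1%:M.

Lemma NN_ev x i n : map_mx (ev x) (NN i n) = map_mx (horner_eval (x ^+ (q ^ i))) (PPx x n).
Proof.
elim: n => [|n IH]; first by rewrite !map_mx1.
rewrite [NN _ _]/= [PPx _ _]/= !map_mxM IH; congr (_ *m _).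
apply: mx2P; rewrite mxE [RHS]mxE mxE /= mxE /= /horner_eval.
- by rewrite rmorph0 horner0.
- by rewrite rmorphXn hornerC evA_frob.
- have -> : ev x (('X^(q ^ i) - 'X^(q ^ n)) * G0 ^+ (q ^ n)) = (x ^+ (q ^ i) - x ^+ (q ^ n)) * ev x G0 ^+ (q ^ n).
    by rewrite rmorphM rmorphB !rmorphXn /= evAX.
  by rewrite hornerM hornerXsubC hornerC evA_frob.
- by rewrite rmorphN rmorphXn hornerN hornerC evA_frob.
Qed.

(** Row [i] expresses [rho x i] in the coordinates of [U], with entries polynomial in [x]. There are
    as many conditions as unknowns, so a nonzero commuting [U] makes the determinant vanish at
    [x]. *)
Definition RG : 'M[{poly Fq}]_n0 := \matrix_(i < n0, j < n0)
  row_mx (\row_(l < K.+1) (2%:R * NN i i 1 0 * NN i i 1 1 * 'X^(q ^ i * l)))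
   (row_mx (\row_(l < K.+1) (- NN i i 1 0 ^+ 2 * 'X^(q ^ i * l)))
           (\row_(l < K.+2) (NN i i 1 1 ^+ 2 * 'X^(q ^ i * l)))) 0 j.

Lemma rho_RG x (i : 'I_n0) y : rho x i (Uy y) = (y *m (map_mx (ev x) RG)^T) 0 i.
Proof.
set N := PPx x i; set t := x ^+ (q ^ i).
have NE (a b : 'I_2) : ev x (NN i i a b) = (N a b).[t].
  by have /matrixP/(_ a b) := NN_ev x i i; rewrite !mxE.
have -> : rho x i (Uy y) = 2%:R * (N 1 0).[t] * (N 1 1).[t] * (pa y).[t] -
    (N 1 0).[t] ^+ 2 * (pb y).[t] + (N 1 1).[t] ^+ 2 * (pc y).[t].
  rewrite /rho -/N -/t; have -> : (N *m Uy y *m adj2 N) 1 0 =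
      2%:R * N 1 0 * N 1 1 * pa y - N 1 0 ^+ 2 * pb y + N 1 1 ^+ 2 * pc y.
    by rewrite !mulmx2E !mxE /=; ring.
  by rewrite !hornerE.
rewrite mxE.
have tl l : ev x 'X^(q ^ i * l) = t ^+ l by rewrite rmorphXn /= evAX exprM.
under eq_bigr do rewrite mxE mxE mxE.
rewrite big_split_ord /= big_split_ord /= addrA.
have hP n (z : 'rV[k]_n) : (rVpoly z).[t] = \sum_l z 0 l * t ^+ l.
  rewrite (horner_coef_wide _ (size_poly _ _)); apply: eq_bigr => l _.
  by rewrite coef_rVpoly_ord.
rewrite /pa /pb /pc !hP !mulr_sumr -sumrN; congr (_ + _ + _); apply: eq_bigr => l _.
- by rewrite row_mxEl !mxE !rmorphM rmorph_nat /= tl !NE; ring.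
- by rewrite row_mxEr row_mxEl !mxE rmorphM rmorphN rmorphXn /= tl !NE; ring.
- by rewrite row_mxEr row_mxEr !mxE rmorphM rmorphXn /= tl !NE; ring.
Qed.

Definition Lb := (n0 * ((2 * n0 * (gsz G0 G1 G2).+1 + K.+1) * q ^ n0))%N.

Lemma NN_size i n (a b : 'I_2) : (n <= i)%N ->
  (size (NN i n a b) <= (n * ((gsz G0 G1 G2).+1 * q ^ i)).+1)%N.
Proof.
set g := gsz G0 G1 G2; elim: n a b => [|n IH] a b ni.
  by rewrite mxE; case: eqP => _; rewrite ?size_poly1 ?mulr0n ?size_poly0.
have qji : (q ^ n <= q ^ i)%N by rewrite leq_exp2l ?q_gt1 // ltnW.
have gE (P : {poly Fq}) : (size P <= g)%N -> (size (P ^+ (q ^ n)) <= (g.+1 * q ^ i).+1)%N.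
  move=> sP; apply: leq_trans (size_exp_leq _ _) _; rewrite ltnS leq_mul //; lia.
have NGs u v : (size (NG i n u v) <= (g.+1 * q ^ i).+1)%N.
  elim/ord2_ind: u; elim/ord2_ind: v; rewrite mxE /=.
  - by rewrite size_poly0.
  - by apply: gE; rewrite /g /gsz; lia.
  - apply: leq_trans (size_polyMleq _ _) _.
    have s1 : (size ('X^(q ^ i) - 'X^(q ^ n) : {poly Fq})%R <= (q ^ i).+1)%N.
      by rewrite (leq_trans (size_polyD _ _)) // size_polyN !size_polyXn geq_max leqnn ltnS.
    have s2 : (size (G0 ^+ (q ^ n)) <= (g * q ^ i).+1)%N.
      by apply: leq_trans (size_exp_leq _ _) _; rewrite ltnS leq_mul // /g /gsz; lia.
    by rewrite -subn1 leq_subLR mulSn; apply: leq_trans (leq_add s1 s2) _; rewrite addSn addnS add1n.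
  - by rewrite size_polyN; apply: gE; rewrite /g /gsz; lia.
rewrite [NN _ _]/= mulmx2E; apply: leq_trans (size_polyD _ _) _.
have one u : (size (NG i n a u * NN i n u b)%R <= (n.+1 * (g.+1 * q ^ i)).+1)%N.
  apply: leq_trans (size_polyMleq _ _) _.
  by move: (NGs a u) (IH u b (ltnW ni)); rewrite mulSn; move: (size _) (size _) => s1 s2; lia.
by rewrite geq_max !one.
Qed.

Lemma detRG_size : (size (\det RG) <= Lb.+1)%N.
Proof.
apply: size_det_leq => i j; rewrite mxE; set g := gsz G0 G1 G2.
have qi : (q ^ i <= q ^ n0)%N by rewrite leq_exp2l ?q_gt1 // ltnW.
have ii := ltn_ord i; set B := (n0 * (g.+1 * q ^ n0))%N.
have nn u v : (size (NN i i u v) <= B.+1)%N.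
  apply: leq_trans (NN_size u v (leqnn i)) _; rewrite ltnS /B leq_mul //; first exact: ltnW.
  by rewrite leq_mul.
have prod (P Q R : {poly Fq}) l : (l <= K.+1)%N -> (size P <= B.+1)%N -> (size Q <= B.+1)%N ->
    (size R <= 1)%N -> (size (R * P * Q * 'X^(q ^ i * l))%R <= ((2 * n0 * g.+1 + K.+1) * q ^ n0).+1)%N.
  move=> lK sP sQ sR.
  have h0 := size_polyMleq R P; have h1 := size_polyMleq (R * P) Q.
  have h2 := size_polyMleq (R * P * Q) 'X^(q ^ i * l); rewrite size_polyXn in h2.
  have h3 : (q ^ i * l <= K.+1 * q ^ n0)%N by rewrite mulnC leq_mul.
  have -> : ((2 * n0 * g.+1 + K.+1) * q ^ n0 = B + B + K.+1 * q ^ n0)%N by rewrite /B; lia.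
  move: h0 h1 h2 h3 sP sQ sR; move: (size _) (size _) (size _) (size _) (size _) (size _) => *; lia.
case: (split_ordP j) => j' ->.
  rewrite row_mxEl mxE; apply: prod => //; first exact: ltnW.
  by rewrite -[2%:R]/(2%:R : {poly Fq}) -polyC_natr size_polyC_leq1.
rewrite row_mxEr; case: (split_ordP j') => j'' ->.
  rewrite row_mxEl mxE -mulN1r expr2 mulrA; apply: prod => //; first exact: ltnW.
  by rewrite size_polyN size_poly1.
rewrite row_mxEr mxE -[_ ^+ 2]mul1r expr2 mulrA; apply: prod => //; first by rewrite -ltnS.
by rewrite size_poly1.
Qed.

Lemma exceptional_count (T : seq k) : \det RG != 0 -> uniq T ->
  (forall x, x \in T -> ev x G2 != 0 /\ exists a b c,
     [/\ (size a <= K.+1)%N, (size b <= K.+1)%N, (size c <= K.+2)%N, tz a b c != 0 &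
         map_mx sg (tz a b c) *m Ph x = Ph x *m tz a b c]) ->
  (size T <= Lb)%N.
Proof.
move=> d0 uT hT; rewrite -ltnS; apply: leq_trans detRG_size.
rewrite -(size_map_poly ik (\det RG)); apply: max_poly_roots => //; first by rewrite map_poly_eq0.
apply/allP => x /hT[g2 [a [b [c [sa sb sc U0 hU]]]]].
have [ea eb ec] := yvK sa sb sc.
have UyE : Uy (yv a b c) = tz a b c by rewrite /Uy ea eb ec.
have : \det (map_mx (ev x) RG)^T == 0.
  apply/det0P; exists (yv a b c).
    by apply: contraNneq U0 => y0; rewrite -UyE y0 /Uy /pa /pb /pc !linear0 /tz oppr0; apply/eqP/mx2P; rewrite !mxE.
  by apply/rowP => i; rewrite -rho_RG UyE rho_eq0 // mxE.
rewrite det_tr det_map_mx /evA /= /horner_eval rootE.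
by rewrite (eq_map_poly (g := ik)).
Qed.

Section Generic.
Variable th : k.
Hypothesis th_gen : forall P, ev th P = 0 -> P = 0.
Hypothesis G0_neq0 : G0 != 0.
Hypothesis G2_neq0 : G2 != 0.
Hypothesis no_endo : forall a b c, map_mx sg (tz a b c) *m Ph th = Ph th *m tz a b c ->
  [/\ a = 0, b = 0 & c = 0].

Local Notation e0 := (ev th G0).
Local Notation e1 := (ev th G1).
Local Notation e2 := (ev th G2).
Let e00 : e0 != 0. Proof. by apply: contra_neq G0_neq0; apply: th_gen. Qed.
Let e20 : e2 != 0. Proof. by apply: contra_neq G2_neq0; apply: th_gen. Qed.

(** [T] is [U -> Phi U Phi^-1], polynomial when [c] vanishes at [th]. Euclidean division discards
    the remainder and so makes [T] linear on the whole space. *)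
Let cq (c : {poly k}) := c %/ ('X - th%:P).
Let Tb c := (e2 / e0) *: cq c.
Let Ta a c := (e1 / e0) *: cq c - a.
Let Tc a b c := e2^-1 *: ((e0 *: ('X - th%:P)) * b + (2%:R * e1) *: a - (e1 ^+ 2 / e0) *: cq c).
Let T y := yv (Ta (pa y) (pc y)) (Tb (pc y)) (Tc (pa y) (pb y) (pc y)).

Let tz_T a b c : root c th ->
  tz (Ta a c) (Tb c) (Tc a b c) *m Ph th = Ph th *m tz a b c.
Proof.
move=> rc; have cE : c = cq c * ('X - th%:P) by rewrite divpK // dvdp_XsubCl.
rewrite /PhiK !mulmx2 /Tb /Ta /Tc; move: cE; move: (cq c) => c' ->.
have f5 : (2%:R * e1)%:P = 2%:R * e1%:P by rewrite polyCM polyC_natr.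
have f0 : (e2 / e0)%:P * e0%:P = e2%:P by rewrite -polyCM divfK.
have f1 : (e1 / e0)%:P * e0%:P = e1%:P by rewrite -polyCM divfK.
have f2 : e2^-1%:P * e2%:P = 1 by rewrite -polyCM mulVf.
have f3 : (e1 / e0)%:P * e2%:P = (e2 / e0)%:P * e1%:P by rewrite -!polyCM; congr _%:P; ring.
have f4 : (e1 ^+ 2 / e0)%:P = (e1 / e0)%:P * e1%:P by rewrite -!polyCM; congr _%:P; ring.
rewrite -!mul_polyC f5; congr mx2.
- by rewrite mulr0 add0r mul0r add0r -f0; ring.
- by rewrite mul0r add0r mulrDl [_ * c' * e2%:P]mulrAC f3; ring.
- by rewrite mulr0 add0r -[in RHS]f1; ring.
- transitivity ((e2^-1)%:P * e2%:P * (e0%:P * ('X - th%:P) * b + 2%:R * e1%:P * a - (e1 ^+ 2 / e0)%:P * c') -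
    ((e1 / e0)%:P * c' - a) * - e1%:P); first by ring.
  by rewrite f2 f4; ring.
Qed.

Let pXb a c : (size a <= K.+1)%N -> (size c <= K.+2)%N -> (size (Ta a c) <= K.+1)%N.
Proof.
move=> sa sc; apply: leq_trans (size_polyD _ _) _; rewrite size_polyN geq_max sa andbT.
by apply: leq_trans (size_scale_leq _ _) _; rewrite size_divp ?polyXsubC_eq0 // size_XsubC leq_subLR add1n.
Qed.

Let cq_size c : (size c <= K.+2)%N -> (size (cq c) <= K.+1)%N.
Proof. by move=> sc; rewrite size_divp ?polyXsubC_eq0 // size_XsubC leq_subLR add1n. Qed.

Let pXc c : (size c <= K.+2)%N -> (size (Tb c) <= K.+1)%N.
Proof. by move=> sc; apply: leq_trans (size_scale_leq _ _) (cq_size sc). Qed.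

Let pXd a b c : (size a <= K.+1)%N -> (size b <= K.+1)%N -> (size c <= K.+2)%N ->
  (size (Tc a b c) <= K.+2)%N.
Proof.
move=> sa sb sc; apply: leq_trans (size_scale_leq _ _) _.
apply: leq_trans (size_polyD _ _) _; rewrite size_polyN geq_max; apply/andP; split; last first.
  by apply: leq_trans (size_scale_leq _ _) (leq_trans (cq_size sc) _).
apply: leq_trans (size_polyD _ _) _; rewrite geq_max; apply/andP; split; last first.
  by apply: leq_trans (size_scale_leq _ _) (leq_trans sa _).
rewrite -scalerAl; apply: leq_trans (size_scale_leq _ _) _.
by apply: leq_trans (size_polyMleq _ _) _; rewrite size_XsubC.
Qed.

Let sz y : [/\ (size (pa y) <= K.+1)%N, (size (pb y) <= K.+1)%N & (size (pc y) <= K.+2)%N].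
Proof. by split; apply: size_poly. Qed.

Let T_poly y : [/\ pa (T y) = Ta (pa y) (pc y), pb (T y) = Tb (pc y) & pc (T y) = Tc (pa y) (pb y) (pc y)].
Proof. by have [sa sb sc] := sz y; apply: yvK; [exact: pXb|exact: pXc|exact: pXd]. Qed.

Let T_lin (c : k) (u v : 'rV[k]_n0) : T (c *: u + v) = c *: T u + T v.
Proof.
have cq' (w w' : {poly k}) : cq (c *: w + w') = c *: cq w + cq w' by rewrite /cq divpD divpZl.
have pD n (p r : {poly k}) : c *: poly_rV p + poly_rV r = poly_rV (c *: p + r) :> 'rV_n by rewrite linearP.
have aL : pa (c *: u + v) = c *: pa u + pa v by rewrite /pa !linearP.
have bL : pb (c *: u + v) = c *: pb u + pb v by rewrite /pb !linearP.
have cL : pc (c *: u + v) = c *: pc u + pc v by rewrite /pc !linearP.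
rewrite /T /yv scale_row_mx add_row_mx scale_row_mx add_row_mx !pD aL bL cL /Ta /Tb /Tc !cq'.
by congr (row_mx (poly_rV _) (row_mx (poly_rV _) (poly_rV _))); rewrite -!mul_polyC; ring.
Qed.

Let map_pa (w : 'rV[k]_n0) : map_mx sg (Uy w) = Uy (map_mx fr w).
Proof.
have e n (z : 'rV[k]_n) : sg (rVpoly z) = rVpoly (map_mx fr z).
  apply/polyP => j; rewrite coef_map; have [jn|nj] := ltnP j n.
    by rewrite !(coef_rVpoly_ord _ (Ordinal jn)) mxE.
  have h1 : (size (rVpoly z) <= j)%N by exact: leq_trans (size_poly _ _) nj.
  have h2 : (size (rVpoly (map_mx fr z)) <= j)%N by exact: leq_trans (size_poly _ _) nj.
  by rewrite !nth_default // raddf0.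
have ea : sg (pa w) = pa (map_mx fr w) by rewrite /pa e map_lsubmx.
have eb : sg (pb w) = pb (map_mx fr w) by rewrite /pb e map_lsubmx map_rsubmx.
have ec : sg (pc w) = pc (map_mx fr w) by rewrite /pc e !map_rsubmx.
by rewrite /Uy /tz map_mx2 rmorphN /= ea eb ec.
Qed.

(** Passing from [v] to [w] with [w^(q) = Phi v Phi^-1] lowers the index by one. The factor
    [det Phi] at [th^(q^(i+1))] is nonzero because [th] is transcendental over [Fq]. *)
Let rho_shift (v w : 'rV[k]_n0) i : map_mx sg (Uy w) *m Ph th = Ph th *m Uy v ->
  rho th i.+1 (Uy v) = 0 -> rho th i (Uy w) = 0.
Proof.
move=> hU; rewrite /rho PP_right -mulmxA mulmxA -[_ *m Ph th *m Uy v]mulmxA -hU.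
rewrite adj2M -!mulmxA [Ph th *m (adj2 _ *m _)]mulmxA mul_adj2 mul_scalar_mx -scalemxAr -scalemxAr.
rewrite mxE hornerM.
have dE : (det2 (Ph th)).[th ^+ (q ^ i.+1)] != 0.
  rewrite /det2 /PhiK !mxE /= mul0r sub0r !hornerE oppr_eq0 !mulf_neq0 //.
  rewrite subr_eq0; apply/eqP => e.
  have /th_gen : ev th ('X^(q ^ i.+1) - 'X) = 0.
    by rewrite rmorphB rmorphXn /= evAX; apply/eqP; rewrite subr_eq0; apply/eqP.
  move/(congr1 (fun P : {poly Fq} => P`_1)); rewrite coefB coefXn poly.coefX coef0 eqxx.
  have -> : (1 == q ^ i.+1)%N = false.
    by apply: ltn_eqF; rewrite -{1}(expn0 q) ltn_exp2l ?q_gt1.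
  by move/eqP; rewrite sub0r oppr_eq0 oner_eq0.
move/eqP; rewrite mulf_eq0 (negPf dE) /= => e.
apply: (frq_inj (i := ik)); rewrite rmorph0 -[RHS](eqP e).
rewrite -horner_map /= -map_PP -map_adj2 /frq -exprM -expnSr.
have -> : (map_mx sg (PPx th i) *m (map_mx sg (Uy w) *m map_mx sg (adj2 (PPx th i)))) =
    map_mx sg (PPx th i *m Uy w *m adj2 (PPx th i)) by rewrite !map_mxM mulmxA.
by rewrite [in RHS]mxE mulmxA.
Qed.

(** If the rows are dependent, some [rho th s] is a combination of the earlier ones, so it vanishes
    on the space where these do. Conjugation by [Phi] shifts the conditions by one, hence maps this
    space into its Frobenius twist. A vector whose twist is its image under [T] is then a nonzero
    matrix commuting with Frobenius, against [no_endo]. *)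
Lemma detRG_neq0 : \det RG != 0.
Proof.
apply: contraT; rewrite negbK => /eqP d0.
set RR := map_mx (ev th) RG.
have dR : \det RR == 0 by rewrite det_map_mx d0 rmorph0.
have /det0P[z z0 zR] := dR.
(* The last row that occurs in the dependency [z]. *)
have [s zs smax] : exists2 s : 'I_n0, z 0 s != 0 & forall i : 'I_n0, (s < i)%N -> z 0 i = 0.
  have [i0 zi0] : exists i, z 0 i != 0.
    apply: contrapT => H; case/negP: z0; apply/eqP/rowP => i; rewrite mxE; apply/eqP.
    by apply: contraT => zi; case: H; exists i.
  case: (@arg_maxnP _ i0 (fun i => z 0 i != 0) (fun i => nat_of_ord i) zi0) => s zs smax.
  exists s => // i si; apply/eqP; apply: contraLR si => zi; rewrite -leqNgt; exact: smax.
pose A : 'M[k]_n0 := \matrix_(j, i) (if (i < s)%N then RR i j else 0).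
have inS (v : 'rV[k]_n0) : (v <= row_base (kermx A))%MS <-> (forall i : 'I_n0, (i < s)%N -> rho th i (Uy v) = 0).
  rewrite eq_row_base sub_kermx; split => [/eqP /rowP vA i si|h].
    have := vA i; rewrite mxE [RHS]mxE => <-; rewrite rho_RG mxE; apply: eq_bigr => j _.
    by congr (_ * _); rewrite [LHS]mxE [RHS]mxE si.
  apply/eqP/rowP => i; rewrite mxE [RHS]mxE; case: (ltnP i s) => is_.
    rewrite -[RHS](h i is_) rho_RG mxE; apply: eq_bigr => j _.
    by congr (_ * _); rewrite [LHS]mxE [RHS]mxE is_.
  by rewrite big1 // => j _; rewrite mxE ltnNge is_ mulr0.
have inS2 (v : 'rV[k]_n0) : (v <= row_base (kermx A))%MS -> forall i, (i <= s)%N -> rho th i (Uy v) = 0.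
  move=> /inS vS i; rewrite leq_eqVlt => /orP[/eqP ->|is_]; last first.
    have il : (i < n0)%N by apply: ltn_trans is_ (ltn_ord s).
    exact: (vS (Ordinal il)).
  apply: (mulfI zs); rewrite mulr0.
  have : \sum_i z 0 i * rho th i (Uy v) = 0.
    have : z *m (v *m RR^T)^T = 0 by rewrite trmx_mul trmxK mulmxA zR mul0mx.
    move=> /matrixP/(_ 0 0) h; have h2 : (z *m (v *m RR^T)^T) 0 0 = 0 by rewrite h mxE.
    by rewrite mxE in h2; rewrite -[RHS]h2; apply: eq_bigr => i' _; rewrite rho_RG [in RHS]mxE.
  rewrite (bigD1 s) //= big1 ?addr0 // => i' is'.
  have [i's|si'|/val_inj e] := ltngtP i' s; first by rewrite vS ?mulr0.
    by rewrite smax ?mul0r.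
  by rewrite e eqxx in is'.
have rt v : (v <= row_base (kermx A))%MS -> root (pc v) th.
  move=> /inS2/(_ 0%N (leq0n _)); rewrite /rho /= expn0 expr1 mul1mx.
  have -> : adj2 (1%:M : 'M[{poly k}]_2) = 1%:M by rewrite /adj2 scalar_mx2; apply: mx2P; rewrite !mxE /= ?oppr0.
  by rewrite mulmx1 mxE /= => /eqP.
have TE v : (v <= row_base (kermx A))%MS -> Uy (T v) *m Ph th = Ph th *m Uy v.
  by move=> vS; have [ea eb ec] := T_poly v; rewrite /Uy ea eb ec tz_T // rt.
have cE v : (v <= row_base (kermx A))%MS -> pc v = cq (pc v) * ('X - th%:P).
  by move=> vS; rewrite divpK // dvdp_XsubCl rt.
have r0 : (0 < \rank (kermx A))%N.
  have /det0P[y y0 yR] : \det RR^T == 0 by rewrite det_tr.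
  have : (y <= row_base (kermx A))%MS.
    apply/inS => i _; rewrite rho_RG yR mxE //.
  by rewrite lt0n mxrank_eq0 eq_row_base; apply: contraTneq => ->; rewrite submx0.
have Tinj v : (v <= row_base (kermx A))%MS -> T v = 0 -> v = 0.
  move=> vS Tv0; have [ea eb ec] := T_poly v.
  have z1 : pa (0 : 'rV[k]_n0) = 0 by rewrite /pa !linear0.
  have z2 : pb (0 : 'rV[k]_n0) = 0 by rewrite /pb !linear0.
  have z3 : pc (0 : 'rV[k]_n0) = 0 by rewrite /pc !linear0.
  rewrite Tv0 z1 in ea; rewrite Tv0 z2 in eb; rewrite Tv0 z3 in ec.
  have c'0 : cq (pc v) = 0.
    have := esym eb => /eqP; rewrite scaler_eq0 mulf_eq0 invr_eq0 (negPf e00) (negPf e20) => /eqP //.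
  have c0 : pc v = 0 by rewrite cE // c'0 mul0r.
  have a0 : pa v = 0 by have /eqP := esym ea; rewrite /Ta c'0 scaler0 sub0r oppr_eq0 => /eqP.
  have b0 : pb v = 0.
    have /eqP := esym ec; rewrite /Tc c'0 a0 !scaler0 subr0 addr0 scaler_eq0 invr_eq0 (negPf e20) /=.
    by rewrite mulf_eq0 scaler_eq0 (negPf e00) polyXsubC_eq0 /= => /eqP.
  by rewrite -(yv_pabc v) a0 b0 c0 /yv !linear0 !row_mx0.
(* The Frobenius preimage of [T v] satisfies the condition of index [i < s] because [v] satisfies
   that of index [i + 1 <= s]; the case [i + 1 = s] is where the dependency is used. *)
have TS v : (v <= row_base (kermx A))%MS -> exists2 w : 'rV_n0, (w <= row_base (kermx A))%MS & map_mx fr w = T v.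
  move=> vS; have /choice[rt_ rtE] := fun u : k => q_root ik u.
  pose w : 'rV[k]_n0 := \row_j rt_ (T v 0 j).
  have wE : map_mx fr w = T v by apply/rowP => j; rewrite !mxE rtE.
  exists w => //; apply/inS => i is_; apply: (@rho_shift v w i).
    by rewrite map_pa wE TE.
  by apply: inS2.
have [v [v0 vS vE]] := semilinear_subspace (row_base_free (kermx A)) r0 T_lin Tinj TS.
have hU : map_mx sg (Uy v) *m Ph th = Ph th *m Uy v by rewrite map_pa vE TE.
have [a0 b0 c0] := no_endo hU.
by case/negP: v0; rewrite -(yv_pabc v) a0 b0 c0 /yv !linear0 !row_mx0.
Qed.
End Generic.
End Exceptional.

(** * Auxiliary inequalities and 2x2 identities *)

Lemma uphalf_le n : (uphalf n <= n./2.+1)%N.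
Proof. by rewrite uphalf_half; case: odd; rewrite ?add1n. Qed.

Lemma half_le n : (n./2 <= n)%N.
Proof. by rewrite -{2}(odd_double_half n) -addnn addnA leq_addl. Qed.

Lemma size_polyB_le (R : nzRingType) N (P Q : {poly R}) : (size P <= N)%N -> (size Q <= N)%N ->
  (size (P - Q)%R <= N)%N.
Proof. by move=> sP sQ; rewrite (leq_trans (size_polyD _ _)) // size_polyN geq_max sP. Qed.

Lemma separable_scale (F : fieldType) (c : F) (P : {poly F}) : c != 0 ->
  separable_poly (c *: P) = separable_poly P.
Proof. by move=> c0; rewrite !separable_poly.unlock derivZ coprimepZl // coprimepZr. Qed.

Lemma leq_subS a b d : (a <= b.+1 -> a - d <= (b - d).+1)%N.
Proof. lia. Qed.

Lemma mul_adj2l (R : comNzRingType) (A : 'M[R]_2) : adj2 A *m A = (det2 A)%:M.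
Proof. by rewrite [A in _ *m A]mx2E mulmx2 scalar_mx2 /det2; congr mx2; ring. Qed.

Lemma trace2_conj (R : idomainType) (A B C : 'M[R]_2) : det2 C != 0 -> A *m C = C *m B ->
  A 0 0 + A 1 1 = B 0 0 + B 1 1.
Proof.
move=> C0 e; have t2 (D : 'M[R]_2) : \tr D = D 0 0 + D 1 1.
  by rewrite /mxtrace big_ord_recl big_ord1; congr (_ + D _ _); exact: val_inj.
rewrite -!t2; apply: (mulfI C0); rewrite -!mxtraceZ -mul_scalar_mx -mul_adj2 mxtrace_mulC mulmxA e.
by rewrite mxtrace_mulC mulmxA mul_adj2l mul_scalar_mx.
Qed.

Lemma det2_conj (R : idomainType) (A B C : 'M[R]_2) : det2 C != 0 -> A *m C = C *m B ->
  det2 A = det2 B.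
Proof. by move=> C0 /(congr1 (@det2 R)); rewrite !det2M mulrC => /(mulfI C0). Qed.

Lemma scalemx_inj (R : idomainType) m n (c : R) (A B : 'M[R]_(m, n)) : c != 0 ->
  c *: A = c *: B -> A = B.
Proof. by move=> c0 /matrixP e; apply/matrixP => i j; apply: (mulfI c0); have := e i j; rewrite !mxE. Qed.

(** * Elements of exact degree [n] over [Fq] *)

Section ExactDegree.
Variables (Fq : finFieldType) (k : closedFieldType) (ik : {rmorphism Fq -> k}).
Local Notation q := #|Fq|.
Local Notation eid := (@idfun k : {rmorphism k -> k}).
Local Notation ev x := (evA ik eid x).

(* [x] generates the extension of degree [n] of [Fq]. *)
Definition exactd n (x : k) := (x ^+ (q ^ n) == x) && [forall i : 'I_n, (0 < i)%N ==> (x ^+ (q ^ i) != x)].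

Lemma exactdP n x : reflect (x ^+ (q ^ n) = x /\ forall i, (0 < i < n)%N -> x ^+ (q ^ i) != x) (exactd n x).
Proof.
apply: (iffP andP) => -[/eqP xn h]; split=> //; last first.
  by apply/forallP => i; apply/implyP => i0; apply: h; rewrite i0 ltn_ord.
by move=> i /andP[i0 i_n]; have /forallP/(_ (Ordinal i_n)) /= := h; rewrite i0.
Qed.

Lemma frob_pow_mul (x : k) i c : x ^+ (q ^ i) = x -> x ^+ (q ^ (c * i)) = x.
Proof. by move=> xi; elim: c => [|c IH]; rewrite ?mul0n ?expn0 ?expr1 // mulSn expnD exprM xi. Qed.

Lemma frob_pow_gcd (x : k) i n : (0 < i)%N -> x ^+ (q ^ i) = x -> x ^+ (q ^ n) = x ->
  x ^+ (q ^ gcdn i n) = x.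
Proof.
move=> i0 xi xn; case: (egcdnP n i0) => u v e _.
by have := frob_pow_mul u xi; rewrite e expnD exprM frob_pow_mul.
Qed.

Lemma frob_pow_inj i : injective (fun x : k => x ^+ (q ^ i)).
Proof.
move=> x y; rewrite -!(iter_frq ik); elim: i => //= i IH /frq_inj; exact: IH.
Qed.

(** The derivative of [X^(q^n) - X] is [-1], so the roots are distinct. *)
Lemma fixed_roots n : (0 < n)%N ->
  exists s : seq k, [/\ uniq s, size s = (q ^ n)%N & forall x, (x \in s) = (x ^+ (q ^ n) == x)].
Proof.
move=> n0; have qn : (1 < q ^ n)%N by rewrite -{1}(expn0 q) ltn_exp2l ?q_gt1.
pose P : {poly k} := 'X^(q ^ n) - 'X.
have sP : size P = (q ^ n).+1 by rewrite size_polyDl ?size_polyXn // size_polyN size_polyX.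
have [s sE] := closed_field_poly_normal P; exists s.
have l0 : lead_coef P != 0 by rewrite lead_coef_eq0 -size_poly_eq0 sP.
have mem x : (x \in s) = (x ^+ (q ^ n) == x).
  have -> : (x ^+ (q ^ n) == x) = root P x by rewrite rootE !hornerE subr_eq0.
  by rewrite sE rootZ // root_prod_XsubC.
split=> //; last first.
  have := congr1 (fun Q : {poly k} => size Q) sE; rewrite /= size_scale // size_prod_XsubC sP.
  by move/eqP; rewrite eqSS => /eqP.
rewrite -separable_prod_XsubC.
suff : separable_poly P by rewrite sE separable_scale.
rewrite separable_poly.unlock derivB derivXn derivX.
have [p [e [pp e0 qE pk]]] := q_char_power ik.
have -> : 'X^((q ^ n).-1) *+ (q ^ n) = 0 :> {poly k}.
  apply/eqP; rewrite -mulr_natr -polyC_natr natrX qE natrX.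
  by rewrite (pcharf0 pk) expr0n (gtn_eqF e0) mulr0n expr0n (gtn_eqF n0) mulr0n mulr0.
by rewrite sub0r -scaleN1r coprimepZr ?coprimep1 // oppr_eq0 oner_neq0.
Qed.

(** An element fixed by the [n]-th Frobenius but of smaller degree is fixed by the [g]-th one for a
    proper divisor [g] of [n], and [g <= n/2]. *)
Lemma exact_seq n : (0 < n)%N -> exists T : seq k,
  [/\ uniq T, forall x, (x \in T) = exactd n x & (q ^ n <= size T + n * q ^ n./2)%N].
Proof.
move=> n0; have [s [us ss ms]] := fixed_roots n0.
exists [seq x <- s | exactd n x]; split; first exact: filter_uniq.
  by move=> x; rewrite mem_filter ms /exactd; case: eqP => //=; rewrite andbT.
rewrite size_filter -ss -(count_predC (exactd n) s) leq_add2l -size_filter.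
have /choice[r rP] : forall i, exists t : seq k, (size t <= q ^ i)%N /\
    forall x, (0 < i)%N -> x ^+ (q ^ i) = x -> x \in t.
  case=> [|i]; first by exists [::].
  have [t [_ st mt]] := fixed_roots (ltn0Sn i); exists t; rewrite st; split=> // x _ /eqP.
  by rewrite mt.
have sub : {subset [seq x <- s | predC (exactd n) x] <= flatten [seq r i | i <- iota 1 n./2]}.
  move=> x; rewrite mem_filter ms => /andP[/= ne /eqP xn].
  have [i i0 xi] : exists2 i, (0 < i < n)%N & x ^+ (q ^ i) = x.
    apply: contrapT => H; case/negP: ne; apply/exactdP; split=> // i i0; apply/eqP => xi.
    by apply: H; exists i.
  have /andP[i0' i_n] := i0.
  have xg := frob_pow_gcd i0' xi xn; set g := gcdn i n in xg.
  have g0 : (0 < g)%N by rewrite gcdn_gt0 i0'.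
  have gi : (g <= i)%N by rewrite dvdn_leq // dvdn_gcdl.
  have /dvdnP[c nE] : (g %| n)%N by apply: dvdn_gcdr.
  apply/flattenP; exists (r g); last exact: (rP g).2.
  apply: map_f; rewrite mem_iota g0 add1n ltnS.
  have c2 : (2 <= c)%N.
    by case: (c) nE => [|[|//]]; rewrite ?mul0n ?mul1n => e; lia.
  by rewrite -[g](doubleK g) half_leq // -muln2 nE mulnC leq_mul2r c2 orbT.
apply: leq_trans (uniq_leq_size (filter_uniq _ us) sub) _.
rewrite size_flatten /shape -map_comp sumnE big_map.
apply: (@leq_trans (\sum_(i <- iota 1 n./2) q ^ n./2)%N).
  rewrite big_seq [X in (_ <= X)%N]big_seq; apply: leq_sum => i; rewrite mem_iota add1n ltnS => /andP[_ i_n].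
  by apply: leq_trans (rP i).1 _; rewrite leq_exp2l ?q_gt1.
rewrite big_const_seq count_predT size_iota iter_addn_0 mulnC leq_mul2r; apply/orP; right.
exact: half_le.
Qed.

Lemma exact_conj n x : exactd n x -> uniq [seq x ^+ (q ^ i) | i <- iota 0 n].
Proof.
move=> /exactdP[xn h]; apply/(uniqP 0) => i j; rewrite !inE size_map size_iota => i_n j_n.
rewrite !(nth_map 0%N) ?size_iota // !nth_iota // !add0n.
have main a b : (a < b)%N -> (b < n)%N -> x ^+ (q ^ a) <> x ^+ (q ^ b).
  move=> ab bn e; have /negP := h (b - a)%N ltac:(lia); case.
  by apply/eqP/(@frob_pow_inj a); rewrite -exprM -expnD subnK // ltnW.
move=> e; have [ij|ji|//] := ltngtP i j; first by case: (main _ _ ij j_n).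
by case: (main _ _ ji i_n).
Qed.

(** All [n] conjugates of [x] would be roots of [P], whose degree is below [n]. *)
Lemma exact_ev n x (P : {poly Fq}) : exactd n x -> P != 0 -> (size P <= n)%N -> ev x P != 0.
Proof.
move=> xn P0 sP; apply: contraL sP => /eqP e; rewrite -ltnNge.
rewrite -(size_map_poly ik P) -(size_iota 0 n) -(size_map (fun i => x ^+ (q ^ i))).
apply: max_poly_roots; rewrite ?map_poly_eq0 ?exact_conj //.
apply/allP => _ /mapP[i _ ->]; rewrite rootE.
have := evA_frob ik i x P; rewrite e expr0n expn_eq0 eqn0Ngt q_gt0 /= mulr0n => <-.
rewrite /evA /= /horner_eval; apply/eqP; congr _.[_]; exact: eq_map_poly.
Qed.
End ExactDegree.

(** * Monic polynomials of given degree *)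

Section MonicPolynomials.
Variable Fq : finFieldType.
Local Notation q := #|Fq|.

Definition monp d (v : 'rV[Fq]_d) : {poly Fq} := 'X^d + rVpoly v.

Lemma mon_size d (v : 'rV_d) : size (monp v) = d.+1.
Proof. by rewrite /monp size_polyDl ?size_polyXn // ltnS size_poly. Qed.

Lemma mon_monic d (v : 'rV_d) : monp v \is monic.
Proof.
by rewrite monicE lead_coefDl ?lead_coefXn // size_polyXn ltnS size_poly.
Qed.

Lemma mon_inj d : injective (@monp d).
Proof. by move=> u v /addrI /(congr1 (@poly_rV _ d)); rewrite !rVpolyK. Qed.

Lemma monP d (m : {poly Fq}) : m \is monic -> size m = d.+1 -> exists v, m = @monp d v.
Proof.
move=> mm sm; exists (poly_rV (m - 'X^d)); rewrite /monp poly_rV_K ?subrKC //; last first.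
apply/leq_sizeP => j dj; rewrite coefB coefXn.
case: eqP => [->|/eqP jd]; last by rewrite nth_default ?subr0 // sm ltn_neqAle eq_sym jd.
by move/monicP: mm; rewrite /lead_coef sm => ->; rewrite subrr.
Qed.

Lemma divisor_count d D (b : {poly Fq}) : b \is monic -> size b = D.+1 ->
  (#|[set v : 'rV[Fq]_d | (monp v %| b)%R]| <= if (d <= D)%N then q ^ (D - d) else 0)%N.
Proof.
move=> bm sb; have [dD|dD] := leqP d D; last first.
  rewrite leqn0 cards_eq0; apply/eqP/setP => v; rewrite !inE; apply: contraTF dD => /dvdp_leq.
  by rewrite monic_neq0 // mon_size sb -leqNgt => /(_ isT).
have qE v : monp v %| b -> exists w, b = @monp (D - d) w * @monp d v.
  move=> vb; have [w wE] : exists w, b %/ monp v = @monp (D - d) w.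
    apply: monP; last by rewrite size_divp ?monic_neq0 ?mon_monic // sb mon_size /= subSn.
    by rewrite -(monicMr _ (mon_monic v)) divpK.
  by exists w; rewrite -wE divpK.
have /choice[f fP] : forall v, exists w, monp v %| b -> b = @monp (D - d) w * @monp d v.
  by move=> v; case: (boolP (monp v %| b)) => [/qE[w wE]|_]; [exists w|exists 0].
have -> : (q ^ (D - d) = #|{: 'rV[Fq]_(D - d)}|)%N by rewrite card_mx mul1n.
apply: (leq_card_in f) => u v; rewrite !inE => ub vb e; apply: mon_inj.
apply: (mulfI (monic_neq0 (mon_monic (f u)))).
by rewrite -(fP u ub) e -(fP v vb).
Qed.
End MonicPolynomials.

(** * The moduli for which a given [x] is scalar *)

Section ScalarModuli.
Variables (Fq : finFieldType) (k : closedFieldType) (ik : {rmorphism Fq -> k}).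
Variables (G0 G1 G2 : {poly Fq}).
Local Notation q := #|Fq|.
Local Notation eid := (@idfun k : {rmorphism k -> k}).
Local Notation ev x := (evA ik eid x).
Local Notation fr := (frq ik).
Local Notation sg := (map_poly fr).
Local Notation Ph x := (PhiK ik G0 G1 G2 eid x).
Local Notation PPx := (PP ik G0 G1 G2).
Local Notation scal m n x := (scalp ik G0 G1 G2 m n x).

(** Only one entry of [Phi] has degree 1, so degrees grow by one every second step. *)
Lemma PP_size x n : [/\ (size (PPx x n 0%R 0%R) <= n./2.+1)%N, (size (PPx x n 0%R 1%R) <= uphalf n)%N,
  (size (PPx x n 1%R 0%R) <= (uphalf n).+1)%N & (size (PPx x n 1%R 1%R) <= n./2.+1)%N].
Proof.
elim: n => [|n [h00 h01 h10 h11]]; first by rewrite /= !mxE /= size_poly1 size_poly0.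
have uh : ((n./2 <= uphalf n) /\ (uphalf n <= n./2.+1))%N.
  by split; [rewrite uphalf_half leq_addl|exact: uphalf_le].
have cz c (P : {poly k}) : (size (c%:P * P)%R <= size P)%N by rewrite mul_polyC size_scale_leq.
have lz y c (P : {poly k}) : (size (('X - y%:P) * c%:P * P)%R <= (size P).+1)%N.
  rewrite -mulrA; apply: leq_trans (size_polyMleq _ _) _; rewrite size_XsubC addSn /=.
  by rewrite add1n ltnS cz.
rewrite [PPx x n.+1]/(Ph _ *m PPx x n) /PhiK !mulmx2E !mxE /= !mul0r !add0r -[- (evA _ _ _ G1)%:P]polyCN.
split; try by apply: leq_trans (cz _ _) _.
- apply: leq_trans (size_polyD _ _) _; rewrite geq_max; apply/andP; split.
    by apply: leq_trans (lz _ _ _) _; rewrite ltnS.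
  by apply: leq_trans (cz _ _) _; apply: leq_trans h10 _; lia.
- apply: leq_trans (size_polyD _ _) _; rewrite geq_max; apply/andP; split.
    by apply: leq_trans (lz _ _ _) _; rewrite ltnS.
  by apply: leq_trans (cz _ _) _; apply: leq_trans h11 _; lia.
Qed.

Lemma PP_det x n : ev x G0 != 0 -> ev x G2 != 0 -> exists2 c : k, c != 0 &
  det2 (PPx x n) = c *: \prod_(y <- [seq x ^+ (q ^ i) | i <- iota 0 n]) ('X - y%:P).
Proof.
move=> e0 e2; elim: n => [|n [c c0 IH]].
  by exists 1; rewrite ?oner_neq0 // big_nil scale1r /det2 !mxE /= mulr0 subr0 mulr1.
rewrite [PPx x n.+1]/(Ph _ *m PPx x n) det2M IH -addn1 iotaD map_cat big_cat big_seq1 /= add0n.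
exists (- (ev x G0 * ev x G2) ^+ (q ^ n) * c); first by rewrite mulf_neq0 // oppr_eq0 expf_neq0 // mulf_neq0.
rewrite /det2 /PhiK !mxE /= mul0r sub0r !evA_frob -!mul_polyC polyCM polyCN exprMn polyCM.
by ring.
Qed.

(** A scalar matrix has a square as determinant, but here the determinant is separable of degree
    [n]. *)
Lemma PP_nonscalar x n : exactd Fq n x -> (0 < n)%N -> ev x G0 != 0 -> ev x G2 != 0 ->
  ~ [/\ PPx x n 0 1 = 0, PPx x n 1 0 = 0 & PPx x n 0 0 - PPx x n 1 1 = 0].
Proof.
move=> xn n0 e0 e2 [z1 z2 /eqP]; rewrite subr_eq0 => /eqP z3.
have [c c0 dE] := PP_det n e0 e2; rewrite /det2 z1 mul0r subr0 z3 in dE.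
have := exact_conj ik xn; rewrite -separable_prod_XsubC => sep.
have : separable_poly (PPx x n 1 1 * PPx x n 1 1).
  by rewrite dE separable_scale.
rewrite separable_mul => /and3P[_ _]; rewrite coprimepp => s1.
have := congr1 (fun Q : {poly k} => size Q) dE; rewrite /= size_scale // size_prod_XsubC.
rewrite size_map size_iota size_mul -?size_poly_eq0 (eqP s1) //; lia.
Qed.

Lemma scalar_lcm (b m : {poly Fq}) x n : b \is monic -> m \is monic -> scal b n x -> scal m n x ->
  exists l, [/\ l \is monic, scal l n x, b %| l & m %| l].
Proof.
move=> bm mm /asboolP[b1 b2 b3] /asboolP[m1 m2 m3]; set g := gcdp b m.
have g0 : g != 0 by rewrite gcdp_eq0 negb_and monic_neq0.
set b' := b %/ g; have bE : b = b' * g by rewrite divpK // dvdp_gcdl.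
set m' := m %/ g; have mE : m = m' * g by rewrite divpK // dvdp_gcdr.
have cop : coprimep m' b'.
  have := coprimep_div_gcd (p := b) (q := m); rewrite -/g -/b' -/m' coprimep_sym; apply.
  by rewrite monic_neq0.
have m'0 : m' != 0 by apply: contraTneq (monic_neq0 mm) => z; rewrite mE z mul0r eqxx.
have l0 : m' * b != 0 by exact: mulf_neq0 m'0 (monic_neq0 bm).
pose l := (lead_coef (m' * b))^-1 *: (m' * b).
have lc : (lead_coef (m' * b))^-1 != 0 by rewrite invr_eq0 lead_coef_eq0.
have main (Q : {poly k}) : map_poly ik b %| Q -> map_poly ik m %| Q -> map_poly ik l %| Q.
  rewrite linearZ /= dvdpZl ?fmorph_eq0 // {1}bE mE !rmorphM => /dvdpP[Q' QE]; rewrite QE.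
  rewrite mulrA dvdp_mul2r ?map_poly_eq0 // Gauss_dvdpl ?coprimep_map // => /dvdpP[Q'' ->].
  by rewrite bE rmorphM -!mulrA dvdp_mull.
exists l; split.
- by rewrite monicE /l lead_coefZ mulVf // lead_coef_eq0.
- by apply/asboolP; split; apply: main.
- by rewrite dvdpZr // dvdp_mull.
- by rewrite dvdpZr // [X in X %| _]mE bE mulrCA dvdp_mull.
Qed.

Lemma scalar_size x n (m : {poly Fq}) : exactd Fq n x -> (0 < n)%N -> ev x G0 != 0 -> ev x G2 != 0 ->
  scal m n x -> (size m <= n./2.+2)%N.
Proof.
move=> xn n0 e0 e2 /asboolP[m1 m2 m3]; rewrite -(size_map_poly ik m).
have [h00 h01 h10 h11] := PP_size x n.
have uh := uphalf_le n.
have [z1|z1] := eqVneq (PPx x n 0 1) 0; last first.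
  by apply: leq_trans (dvdp_leq z1 m1) _; apply: leq_trans h01 (leqW uh).
have [z2|z2] := eqVneq (PPx x n 1 0) 0; last first.
  by apply: leq_trans (dvdp_leq z2 m2) _; apply: leq_trans h10 _; rewrite ltnS.
have [z3|z3] := eqVneq (PPx x n 0 0 - PPx x n 1 1) 0; last first.
  by apply: leq_trans (dvdp_leq z3 m3) _; apply: leqW; apply: size_polyB_le.
by case: (PP_nonscalar xn n0 e0 e2).
Qed.

(** The moduli have bounded degree and are stable under least common multiples, so one of largest
    degree is a multiple of all. *)
Lemma scalar_max x n : exactd Fq n x -> (0 < n)%N -> ev x G0 != 0 -> ev x G2 != 0 ->
  exists b, [/\ b \is monic, scal b n x & forall m, m \is monic -> scal m n x -> m %| b].
Proof.
move=> xn n0 e0 e2.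
pose P s := `[< exists m, [/\ m \is monic, scal m n x & size m = s] >].
have ex : exists s, P s.
  exists 1%N; apply/asboolP; exists 1; rewrite monic1 size_poly1; split=> //.
  by apply/asboolP; rewrite rmorph1; split; apply: dvd1p.
have ub s : P s -> (s <= n./2.+2)%N by move=> /asboolP[m [_ sm <-]]; apply: scalar_size sm.
case: (ex_maxnP ex ub) => s /asboolP[b [bm sb bs]] smax.
exists b; split=> // m mm sm; have [l [lm sl bl ml]] := scalar_lcm bm mm sb sm.
have := smax (size l); rewrite -bs => /(_ _)/wrap[]; first by apply/asboolP; exists l.
move=> lb; have : b %= l by rewrite -dvdp_size_eqp // eqn_leq lb dvdp_leq ?monic_neq0.
by rewrite eqp_monic // => /eqP ->.
Qed.

Hypothesis q_odd : odd q.
Hypothesis detRG : forall K, \det (RG G0 G1 G2 K) != 0.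

(** If [P] is scalar modulo [m], the matrix [2 P - tr P] is divisible by [m]. The quotient is
    traceless, nonzero, of degree governed by [n/2 - d], and commutes with Frobenius because [P]
    does and [m] has coefficients in [Fq]. So [exceptional_count] applies with [K = n/2 - d]. *)
Lemma scalar_exceptional n d (T : seq k) : (0 < n)%N -> uniq T ->
  (forall x, x \in T -> [/\ exactd Fq n x, ev x G0 != 0, ev x G2 != 0 &
     exists m, [/\ m \is monic, (d < size m)%N & scal m n x]]) ->
  (size T <= Lb G0 G1 G2 (n./2 - d))%N.
Proof.
move=> n0 uT hT; apply: (exceptional_count (ik := ik) (detRG _) uT) => x /hT[xn e0 e2 [m [mm dm sm]]].
split=> //; have /asboolP[m1 m2 m3] := sm; set M := map_poly ik m in m1 m2 m3.
have sM : size M = size m by rewrite size_map_poly.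
have M0 : M != 0 by rewrite map_poly_eq0 monic_neq0.
have k2 : (2%:R : {poly k}) != 0.
  have [p [e [pp e0' qE pk]]] := q_char_power ik.
  have p2 : p != 2%N by apply: contraTneq q_odd => p2; rewrite qE p2 oddX (gtn_eqF e0').
  rewrite -polyC_natr polyC_eq0; apply/negP => /eqP two.
  have : 2%N \in [pchar k] by rewrite inE /= two eqxx.
  by rewrite (pcharf_eq pk) inE /= eq_sym (negPf p2).
have [h00 h01 h10 h11] := PP_size x n.
have uh := uphalf_le n.
set P := PPx x n in m1 m2 m3 h00 h01 h10 h11 *.
have sd (Q : {poly k}) : (size (Q %/ M)%R <= size Q - d)%N.
  by rewrite size_divp // sM leq_sub2l //; case: (size m) dm.
exists ((P 0 0 - P 1 1) %/ M), ((2%:R * P 0 1) %/ M), ((2%:R * P 1 0) %/ M).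
have s2 (Q : {poly k}) : (size (2%:R * Q)%R <= size Q)%N.
  by rewrite -polyC_natr mul_polyC size_scale_leq.
split.
- by apply: leq_trans (sd _) (leq_subS d _); apply: size_polyB_le.
- apply: leq_trans (sd _) (leq_subS d _); apply: leq_trans (s2 _) _; exact: leq_trans h01 uh.
- apply: leq_trans (sd _) _; apply: (@leq_trans (n./2.+2 - d)).
    by apply: leq_sub2r; apply: leq_trans (s2 _) _; apply: leq_trans h10 _; rewrite ltnS.
  by apply: leq_trans (leq_subS d (leqnn _)) _; rewrite ltnS leq_subS.
- apply/negP => /eqP U0; apply: (PP_nonscalar xn n0 e0 e2).
  have f (Q : {poly k}) : M %| Q -> Q %/ M = 0 -> Q = 0.
    by move=> dQ z; rewrite -(divpK dQ) z mul0r.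
  have a0 := congr1 (fun U : 'M_2 => U 0 0) U0; have b0 := congr1 (fun U : 'M_2 => U 0 1) U0.
  have c0 := congr1 (fun U : 'M_2 => U 1 0) U0; rewrite /= !mxE /= in a0 b0 c0.
  split; last by apply: f.
    by apply/eqP; rewrite -(mulrI_eq0 _ (mulfI k2)); apply/eqP/f => //; rewrite dvdp_mull.
  by apply/eqP; rewrite -(mulrI_eq0 _ (mulfI k2)); apply/eqP/f => //; rewrite dvdp_mull.
(* Since [x^(q^n) = x], adding a factor to the product on the left or on the right gives the same
   matrix. *)
have PP0 : map_mx sg P *m Ph x = Ph x *m P.
  have xn' := (elimT (exactdP _ n x) xn).1.
  by rewrite map_PP -PP_right /= xn'.
have W : M *: tz ((P 0 0 - P 1 1) %/ M) ((2%:R * P 0 1) %/ M) ((2%:R * P 1 0) %/ M) =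
    2%:R *: P - (P 0 0 + P 1 1)%:M.
  rewrite /tz scale_mx2 mulrN ![M * _]mulrC !divpK ?dvdp_mull // [P in _ *: P]mx2E scale_mx2 scalar_mx2.
  by apply: mx2P; rewrite !mxE /=; ring.
have trs : sg (P 0 0 + P 1 1) = P 0 0 + P 1 1.
  have := trace2_conj _ PP0; rewrite !mxE rmorphD; apply.
  by rewrite /det2 /PhiK !mxE /= mul0r sub0r oppr_eq0 !mulf_neq0 ?polyC_eq0 ?polyXsubC_eq0.
have Ms : sg M = M.
  apply/polyP => i; rewrite !coef_map /= frq_base //.
have s2' : sg 2%:R = 2%:R :> {poly k} by rewrite rmorph_nat.
set U := tz _ _ _ in W *; apply: (scalemx_inj M0); rewrite [RHS]scalemxAr W scalemxAl.
have -> : M *: map_mx sg U = map_mx sg (M *: U) by rewrite map_mxZ /= Ms.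
rewrite W map_mxB map_mxZ /= s2' map_scalar_mx /= trs mulmxBl mulmxBr -scalemxAl -scalemxAr PP0.
by rewrite -scalar_mxC.
Qed.

(** Absorbs the factors of [Lb] other than the power of [q], and a spare factor [n + 2] for a later
    sum over degrees. *)
Definition pol n := ((n + 2) * ((3 * n + 4) * (2 * (3 * n + 4) * (gsz G0 G1 G2).+1 + n.+1)))%N.

Lemma Lb_le n K : (K <= n)%N -> (Lb G0 G1 G2 K * (n + 2) <= pol n * q ^ (3 * K + 4))%N.
Proof.
move=> Kn; rewrite /Lb; have -> : (K.+1 + (K.+1 + K.+2) = 3 * K + 4)%N by lia.
rewrite mulnC /pol -!mulnA leq_mul2l; apply/orP; right.
rewrite !mulnA leq_mul2r; apply/orP; right.
have h : (3 * K + 4 <= 3 * n + 4)%N by lia.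
by rewrite leq_mul // leq_add // ?ltnS // !leq_mul.
Qed.

Lemma scalar_tail n d (T : seq k) : (0 < n)%N -> uniq T ->
  (forall x, x \in T -> [/\ exactd Fq n x, ev x G0 != 0, ev x G2 != 0 &
     exists m, [/\ m \is monic, (d < size m)%N & scal m n x]]) ->
  (size T <= pol n * q ^ (3 * (n./2 - d) + 4))%N.
Proof.
move=> n0 uT hT; apply: leq_trans (scalar_exceptional n0 uT hT) _.
have nh : (n./2 - d <= n)%N by rewrite (leq_trans (leq_subr _ _)) // half_le.
by apply: leq_trans (Lb_le nh); rewrite leq_pmulr // addn2.
Qed.

(** An [x] whose largest modulus has degree [D] is counted once for each divisor of degree [d], at
    most [q^(D - d)] times, while the number of such [x] decreases like [q^(3 (n/2 - D))]. *)
Lemma scalar_sum n d (T : seq k) : (0 < n)%N -> (d <= n./2)%N -> uniq T ->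
  (forall x, x \in T -> [/\ exactd Fq n x, ev x G0 != 0 & ev x G2 != 0]) ->
  (\sum_(v : 'rV[Fq]_d) size [seq x <- T | scal (monp v) n x] <= pol n * q ^ (3 * (n./2 - d) + 5))%N.
Proof.
move=> n0 dn uT hT.
have /choice[b bP] : forall x, exists b, x \in T -> [/\ b \is monic, scal b n x & forall m, m \is monic -> scal m n x -> m %| b].
  move=> x; have [xT|] := boolP (x \in T); last by exists 1.
  by have [xn e0 e2] := hT x xT; have [b bP] := scalar_max xn n0 e0 e2; exists b.
have -> : (\sum_(v : 'rV[Fq]_d) size [seq x <- T | scal (monp v) n x] =
    \sum_(x <- T) #|[set v : 'rV[Fq]_d | scal (monp v) n x]|)%N.
  transitivity (\sum_(v : 'rV[Fq]_d) \sum_(x <- T | scal (monp v) n x) 1)%N.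
    by apply: eq_bigr => v _; rewrite size_filter -sum1_count.
  rewrite (exchange_big_dep xpredT) //=; apply: eq_bigr => x _.
  by rewrite -sum1_card; apply: eq_bigl => v; rewrite inE.
have sb x : x \in T -> (0 < size (b x) <= n./2.+2)%N.
  move=> xT; have [xn e0 e2] := hT x xT; have [bm sbx _] := bP x xT.
  by rewrite (scalar_size xn n0 e0 e2 sbx) lt0n size_poly_eq0 monic_neq0.
apply: (@leq_trans (\sum_(x <- T) \sum_(j < (n./2.+2 - d)) if (d + j < size (b x))%N then q ^ j else 0)%N).
  rewrite big_seq [X in (_ <= X)%N]big_seq; apply: leq_sum => x xT.
  have [bm sbx bmax] := bP x xT; have /andP[s0 s1] := sb x xT.
  have := divisor_count d bm (esym (prednK s0)).
  move=> h; apply: (@leq_trans #|[set v : 'rV[Fq]_d | (monp v %| b x)%R]|).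
    by apply/subset_leq_card/fintype.subsetP => v; rewrite !finset.in_set => sv; apply: bmax; rewrite ?mon_monic.
  apply: leq_trans h _; have [ds|//] := leqP d (size (b x)).-1.
  have jl : ((size (b x)).-1 - d < n./2.+2 - d)%N by lia.
  by rewrite (bigD1 (Ordinal jl)) //= subnKC // prednK // leqnn leq_addr.
rewrite exchange_big /=.
have step (j : 'I_(n./2.+2 - d)) : (\sum_(x <- T) (if (d + j < size (b x))%N then q ^ j else 0) <=
     q ^ j * Lb G0 G1 G2 (n./2 - (d + j)))%N.
  rewrite -big_mkcond -big_filter big_const_seq count_predT iter_addn_0 leq_mul2l; apply/orP; right.
  apply: scalar_exceptional n0 (filter_uniq _ uT) _ => x.
  rewrite mem_filter => /andP[js xT]; have [xn e0 e2] := hT x xT; split=> //.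
  by have [bm sbx _] := bP x xT; exists (b x).
have n2 := half_le n.
have h2 (j : 'I_(n./2.+2 - d)) : ((\sum_(x <- T) (if (d + j < size (b x))%N then q ^ j else 0)) * (n + 2) <=
     pol n * q ^ (3 * (n./2 - d) + 5))%N.
  apply: (@leq_trans (q ^ j * Lb G0 G1 G2 (n./2 - (d + j)) * (n + 2))); first by rewrite leq_mul2r step orbT.
  rewrite -mulnA; apply: (@leq_trans (q ^ j * (pol n * q ^ (3 * (n./2 - (d + j)) + 4)))).
    by rewrite leq_mul2l Lb_le ?orbT //; lia.
  rewrite mulnCA leq_mul2l; apply/orP; right; rewrite -expnD leq_exp2l ?q_gt1 //.
  by have := ltn_ord j; lia.
rewrite -(@leq_pmul2r (n + 2)%N); last by rewrite addn2.
rewrite big_distrl /=.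
apply: leq_trans (leq_sum _ (fun j _ => h2 j)) _; rewrite sum_nat_const card_ord mulnC leq_mul2l.
by apply/orP; right; lia.
Qed.
End ScalarModuli.

(** * Polynomial growth against powers, and a geometric sum *)

Section PolynomialGrowth.
Local Open Scope nat_scope.

Definition polyb (g : nat -> nat) := exists C e, forall n, g n <= C * n.+1 ^ e.

Lemma polyb_const c : polyb (fun=> c).
Proof. by exists c, 0 => n; rewrite expn0 muln1. Qed.

Lemma polyb_id : polyb id.
Proof. by exists 1, 1 => n; rewrite mul1n. Qed.

Lemma polyb_add g h : polyb g -> polyb h -> polyb (fun n => g n + h n).
Proof.
move=> [C [e gP]] [C' [e' hP]]; exists (C + C'), (e + e') => n; rewrite mulnDl.
apply: leq_add; [apply: leq_trans (gP n) _|apply: leq_trans (hP n) _].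
  by rewrite leq_mul2l leq_pexp2l ?leq_addr ?orbT.
by rewrite leq_mul2l leq_pexp2l ?leq_addl ?orbT.
Qed.

Lemma polyb_mul g h : polyb g -> polyb h -> polyb (fun n => g n * h n).
Proof.
move=> [C [e gP]] [C' [e' hP]]; exists (C * C'), (e + e') => n.
by rewrite expnD mulnACA leq_mul.
Qed.

Lemma polyb_lin g a b : polyb g -> polyb (fun n => g (a * n + b)).
Proof.
move=> [C [e gP]]; exists (C * (a + b).+1 ^ e), e => n.
apply: leq_trans (gP _) _; rewrite -mulnA leq_mul2l -expnMn; apply/orP; right.
by have [->|e0] := posnP e; rewrite // leq_exp2r //; nia.
Qed.

(** From [n + 1 <= e (n/e + 1) <= e 2^(n/e)] powers of [n + 1] are at most a constant times [2^n].
    One exponent is kept in reserve to absorb the constants. *)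
Lemma polyb_lt g : polyb g -> exists n0, forall n, n0 <= n -> g n <= 2 ^ n.
Proof.
move=> [C [e gP]]; pose e' := e.+1; exists (C * e' ^ e') => n Cn.
have main : n.+1 ^ e' <= e' ^ e' * 2 ^ n.
  have h : n.+1 <= e' * (n %/ e').+1 by rewrite mulnC ltn_ceil.
  apply: leq_trans (_ : (e' * (n %/ e').+1) ^ e' <= _); first by rewrite leq_exp2r.
  rewrite expnMn leq_mul2l; apply/orP; right.
  apply: leq_trans (_ : (2 ^ (n %/ e')) ^ e' <= _); first by rewrite leq_exp2r // ltn_expl.
  by rewrite -expnM leq_exp2l // leq_trunc_div.
apply: leq_trans (gP n) _; rewrite -(@leq_pmul2r n.+1) // -mulnA -expnSr.
apply: leq_trans (_ : C * (e' ^ e' * 2 ^ n) <= _); first by rewrite leq_mul2l main orbT.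
by rewrite mulnA mulnC leq_mul2l ltnW ?orbT.
Qed.

(** The bound on [a i] improves by a factor 2 every 20 indices, so the sum is below
    [20 (1 + 1/2 + ...) Q]. The induction carries the remainder [40 Q] of this series. *)
Lemma geometric_sum (a : nat -> nat) Q J : (forall i, i < 20 * J -> 2 ^ (i %/ 20) * a i <= Q) ->
  \sum_(0 <= i < 20 * J) a i <= 40 * Q.
Proof.
move=> aP; suff : 2 ^ J * \sum_(0 <= i < 20 * J) a i + 40 * Q <= 2 ^ J * (40 * Q).
  by move/(leq_trans (leq_addr _ _)); rewrite leq_pmul2l // expn_gt0.
elim: J aP => [|J IH] aP; first by rewrite big_geq // muln0 add0n mul1n.
have /IH h : forall i, i < 20 * J -> 2 ^ (i %/ 20) * a i <= Q by move=> i iJ; apply: aP; lia.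
rewrite (@big_cat_nat _ _ _ (20 * J)) //=; last by rewrite leq_mul2l leqnSn.
have blk : 2 ^ J * \sum_(20 * J <= i < 20 * J.+1) a i <= 20 * Q.
  rewrite big_distrr /=; apply: (@leq_trans (\sum_(20 * J <= i < 20 * J.+1) Q)).
    rewrite big_nat [X in _ <= X]big_nat; apply: leq_sum => i /andP[i0 i1].
    by have := aP i i1; rewrite (_ : i %/ 20 = J) //; lia.
  by rewrite sum_nat_const_nat mulnS addnK.
move: h blk; rewrite expnS; set v := \sum_(0 <= i < _) _; set w := \sum_(_ <= i < _) _.
by move: (2 ^ J) v w => u v w; rewrite -!mulnA mulnDr; lia.
Qed.
End PolynomialGrowth.

Ltac leq_lia :=
  repeat match goal with H : is_true (leq _ _) |- _ => revert H end; clear; lia.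

(** * From a comparison in one degree to the density of exceptional [x] *)

Section Transfer.
Variables (Fq : finFieldType) (k : closedFieldType) (ik : {rmorphism Fq -> k}).
Variables (G0 G1 G2 : {poly Fq}).
Hypothesis G0_neq0 : G0 != 0.
Hypothesis G2_neq0 : G2 != 0.
Local Notation q := #|Fq|.
Local Notation eid := (@idfun k : {rmorphism k -> k}).
Local Notation ev x := (evA ik eid x).
Local Notation scal m n x := (scalp ik G0 G1 G2 m n x).
Local Notation good m x := (goodm ik G0 G2 m x).
Local Notation wb := (wbd G0 G1 G2).
Local Notation gs := (gsz G0 G1 G2).
Hypothesis q_odd : odd q.
Hypothesis detRG : forall K, \det (RG G0 G1 G2 K) != 0.

Let q_gt2 : (2 < q)%N.
Proof. by have := q_gt1 Fq; case: (q) q_odd => [|[|[|]]]. Qed.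

Let qX a b : (a <= b)%N -> (q ^ a <= q ^ b)%N.
Proof. by move=> ab; rewrite leq_exp2l ?q_gt1. Qed.

Let q2X a b : (a <= b)%N -> (2 ^ a <= q ^ b)%N.
Proof.
move=> ab; apply: leq_trans (_ : (2 ^ b <= _)%N); first by rewrite leq_exp2l.
by have [->|b0] := posnP b; rewrite // leq_exp2r // ltnW.
Qed.

Definition upper d (v : 'rV[Fq]_d) r := forall n (T : seq k), (0 < n)%N -> uniq T ->
  (forall x, x \in T -> [/\ good (monp v) x, x ^+ (q ^ n) = x & scal (monp v) n x]) ->
  (r * size T <= 2 * q ^ n + 4 * q * r ^ 2 * wb d ^ 2)%N.

Definition lower f d (v : 'rV[Fq]_d) r := forall n bad (T : seq k), (0 < n)%N -> (f %| n)%N -> uniq T ->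
  (forall x, x \in T -> good (monp v) x /\ x ^+ (q ^ n) = x) ->
  (q ^ n <= size T + bad)%N -> (4 * r * bad <= q ^ n)%N ->
  (144 * q * r ^ 4 * wb d ^ 2 <= q ^ n)%N ->
  (q ^ n <= 2 * r * size [seq x <- T | scal (monp v) n x])%N.

Let pow_shift P a b c : (q ^ a * (P * q ^ (b + c)) = q ^ b * (q ^ (a + c) * P))%N.
Proof. by rewrite !expnD; ring. Qed.

Let degree_shift a b c : (b < a -> a <= b + c -> a.-1 - b < 0 + c /\ b + (a.-1 - b) = a.-1)%N.
Proof. lia. Qed.

Lemma wbdE d : wb d = ((q * (2 * gs + d + 3)) * (q.-1 * ((4 * d.+1) * (4 * d.+1)))).+1.
Proof. by rewrite /wbd /wm /hh /adI !card_prod !card_ord. Qed.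

Lemma wbd_le d d' : (d <= d')%N -> (wb d <= wb d')%N.
Proof.
move=> dd; rewrite !wbdE ltnS; apply: leq_mul; first by rewrite leq_mul2l; apply/orP; right; lia.
by rewrite leq_mul2l; apply/orP; right; rewrite leq_mul // leq_mul2l ltnS dd.
Qed.

Lemma wbd_polyb : polyb wb.
Proof.
have [C [e h]] : polyb (fun d => (q * (2 * gs + d + 3)) * (q.-1 * ((4 * (d + 1)) * (4 * (d + 1)))) + 1)%N.
  by do ?[apply: polyb_add|apply: polyb_mul|apply: polyb_const|apply: polyb_id].
by exists C, e => n; have := h n; rewrite wbdE !addn1.
Qed.

Local Notation pl := (pol G0 G1 G2).

Lemma pol_polyb : polyb pl.
Proof.
have [C [e h]] : polyb (fun n => (n + 2) * ((3 * n + 4) * (2 * (3 * n + 4) * gs.+1 + (n + 1))))%N.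
  by do ?[apply: polyb_add|apply: polyb_mul|apply: polyb_const|apply: polyb_id].
by exists C, e => n; have := h n; rewrite /pol !addn1.
Qed.

Lemma pol_le n n' : (n <= n')%N -> (pl n <= pl n')%N.
Proof.
move=> nn; have h3 : (3 * n + 4 <= 3 * n' + 4)%N by lia.
rewrite /pol; apply: leq_mul; first by rewrite leq_add2r.
by apply: leq_mul => //; apply: leq_add; rewrite ?ltnS // leq_mul // leq_mul.
Qed.

Lemma exact_good n d (v : 'rV[Fq]_d) x : exactd Fq n x -> (gs + d < n)%N -> good (monp v) x.
Proof.
move=> xn dn; apply: (exact_ev ik xn).
  by rewrite /DD !mulf_neq0 // monic_neq0 // mon_monic.
apply: leq_trans dn; rewrite /DD; apply: leq_trans (size_polyMleq _ _) _; rewrite mon_size addnS /=.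
rewrite -addSn leq_add2r; apply: leq_trans (size_polyMleq _ _) _; rewrite /gsz.
by move: (size G0) (size G1) (size G2) => *; lia.
Qed.

Lemma exact_ev02 n x : exactd Fq n x -> (gs < n)%N -> ev x G0 != 0 /\ ev x G2 != 0.
Proof.
move=> xn gn; split; apply: (exact_ev ik xn) => //; apply: leq_trans (ltnW gn); rewrite /gsz.
  by rewrite -addnA leq_addr.
by rewrite leq_addl.
Qed.

Lemma modulus_rank : exists2 f, (0 < f)%N & forall d, (0 < d)%N -> exists r : 'rV[Fq]_d -> nat,
  forall v, [/\ (0 < r v)%N, (r v <= q ^ (4 * d))%N, upper v (r v) & lower f v (r v)].
Proof.
have [f f0 H] := scalar_count ik G1 G0_neq0 G2_neq0 q_gt2; exists f => // -[//|d] _.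
have /choice[r rP] : forall v : 'rV[Fq]_d.+1, exists r,
    [/\ (0 < r)%N, (r <= q ^ (4 * d.+1))%N, upper v r & lower f v r]; last by exists r.
move=> v; have [r [r0 rq up lo]] := H d (monp v) (mon_monic v) (mon_size v).
have w2 : (wb d ^ 2 <= wb d.+1 ^ 2)%N by rewrite leq_sqr wbd_le.
exists r; split=> //.
  move=> n T n0 uT hT; apply: leq_trans (up n T n0 uT hT) _.
  by rewrite leq_add2l leq_mul2l w2 orbT.
move=> n bad T n0 fn uT hT h1 h2 h3; apply: (lo n bad T n0 fn uT hT h1 h2).
by apply: leq_trans h3; rewrite leq_mul2l w2 orbT.
Qed.

(** In essence, the sum of [1 / r v] is at most [q^-s / 2]; to stay within integers, [B v] stands
    for [2 Q / r v]. Moduli with [r v <= q^(22 s)] are treated by comparing the lower bound with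
    [scalar_sum], the others by their mere number. *)
Lemma degree_sum : exists s1, forall s d, (s1 <= s)%N -> (20 * s <= d)%N -> (d < 20 * s + 20)%N ->
  exists r : 'rV[Fq]_d -> nat, (forall v, [/\ (0 < r v)%N, (r v <= q ^ (4 * d))%N & upper v (r v)]) /\
    forall Q (B : 'rV[Fq]_d -> nat), (forall v, r v * B v <= 2 * Q)%N -> (q ^ s * \sum_v B v <= Q)%N.
Proof.
have [f f0 H] := modulus_rank.
have [s2 s2P] : exists s2, forall s, (s2 <= s)%N -> (8 * q ^ 5 * pl (98 * s + 0) <= 2 ^ s)%N.
  by apply: polyb_lt; apply: polyb_mul; [apply: polyb_const|apply: polyb_lin; apply: pol_polyb].
have [s3 s3P] : exists s3, forall s, (s3 <= s)%N -> (4 * (98 * s) <= 2 ^ s)%N.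
  by apply: polyb_lt; do ?[apply: polyb_mul|apply: polyb_const|apply: polyb_id].
have [s4 s4P] : exists s4, forall s, (s4 <= s)%N -> (144 * q * (wb (20 * s + 20) * wb (20 * s + 20)) <= 2 ^ s)%N.
  apply: polyb_lt; apply: polyb_mul; first exact: polyb_const.
  by apply: polyb_mul; apply: polyb_lin; apply: wbd_polyb.
exists (s2 + s3 + s4 + f + gs + 22)%N => s d ss d1 d2.
have [|r rP] := H d; first by lia.
exists r; split=> [v|Q B BP]; first by have [] := rP v.
(* A multiple of [f] between [90 s] and [98 s]. It is large enough for the lower bound, where
   [r^4 <= q^(88 s)], and small enough for [3 (h - d) <= 2 h - 11 s], as [h <= 49 s] and
   [d >= 20 s]. *)
pose n := (98 * s %/ f * f)%N; pose h := n./2.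
have n98 : (n <= 98 * s)%N by apply: leq_trunc_div.
have n90 : (90 * s <= n)%N.
  have := ltn_ceil (98 * s) f0; rewrite mulSn -/n; lia.
have n0 : (0 < n)%N by lia.
have hn : (h.*2 <= n)%N by rewrite -[X in (_ <= X)%N](odd_double_half n) leq_addl.
have h45 : (45 * s <= h)%N.
  by have := half_leq n90; rewrite (_ : 90 * s = (45 * s).*2)%N ?doubleK // -muln2; lia.
have h49 : (h <= 49 * s)%N by lia.
have [T [uT Tex Tsz]] := exact_seq ik n0.
have Tg x : x \in T -> [/\ exactd Fq n x, ev x G0 != 0 & ev x G2 != 0].
  by rewrite Tex => xn; have [|? ?] := exact_ev02 xn; first by lia.
have small v : (r v <= q ^ (22 * s))%N -> (q ^ n <= 2 * r v * size [seq x <- T | scal (monp v) n x])%N.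
  move=> rv; have [_ _ _ lo] := rP v; apply: (lo n (n * q ^ h)%N) => //.
  - by rewrite dvdn_mull.
  - move=> x; rewrite Tex => xn; split; last by have /exactdP[] := xn.
    by apply: exact_good xn _; lia.
  - apply: leq_trans (_ : (4 * q ^ (22 * s) * (n * q ^ h) <= _)%N); first by rewrite leq_mul // leq_mul.
    apply: leq_trans (_ : (q ^ h * q ^ h <= _)%N); last by rewrite -expnD addnn qX.
    rewrite mulnA leq_mul2r; apply/orP; right.
    apply: leq_trans (_ : (q ^ (22 * s) * (4 * (98 * s)) <= _)%N).
      by rewrite mulnAC [(4 * n * _)%N]mulnC leq_mul2l; apply/orP; right; lia.
    apply: leq_trans (_ : (q ^ (22 * s) * q ^ s <= _)%N).
      by rewrite leq_mul2l; apply/orP; right; apply: leq_trans (s3P s _) (q2X (leqnn s)); lia.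
    by rewrite -expnD qX //; lia.
  - apply: leq_trans (_ : (q ^ (88 * s) * (144 * q * (wb (20 * s + 20) * wb (20 * s + 20))) <= _)%N).
      rewrite -(mulnA (144 * q)%N) mulnCA; apply: leq_mul.
        apply: leq_trans (_ : ((q ^ (22 * s)) ^ 4 <= _)%N); first by rewrite leq_exp2r.
        by rewrite -expnM qX //; lia.
      by rewrite leq_mul2l -mulnn leq_mul ?orbT // wbd_le // ltnW.
    apply: leq_trans (_ : (q ^ (88 * s) * q ^ s <= _)%N).
      by rewrite leq_mul2l; apply/orP; right; apply: leq_trans (s4P s _) (q2X (leqnn s)); lia.
    by rewrite -expnD qX //; lia.
have q1 a : (0 < q ^ a)%N by rewrite expn_gt0 q_gt0.
rewrite (bigID (fun v => r v <= q ^ (22 * s))%N) /=; set X := (\sum_(i | _) _)%N; set Y := (\sum_(i | _) _)%N.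
(* At most [q^d] moduli occur here, with [d < 20 s + 20], and for each of them
   [q^(22 s) B v <= 2 Q]. *)
have hY : (2 * (q ^ s * Y) <= Q)%N.
  have h1 : (q ^ (22 * s) * Y <= q ^ d * (2 * Q))%N.
    rewrite big_distrr /=; apply: leq_trans (_ : (\sum_(v : 'rV[Fq]_d) 2 * Q <= _)%N); last first.
      by rewrite sum_nat_const card_mx mul1n.
    rewrite big_mkcond; apply: leq_sum => v _; case: ifP => //; rewrite -ltnNge => rv.
    by apply: leq_trans (BP v); rewrite leq_mul2r ltnW ?orbT.
  have h2 : (q ^ (20 * s + 20) * (q ^ (2 * s - 20) * Y) <= q ^ (20 * s + 20) * (2 * Q))%N.
    rewrite mulnA -expnD (_ : 20 * s + 20 + _ = 22 * s)%N; last by lia.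
    apply: leq_trans h1 _; rewrite leq_mul2r; apply/orP; right; apply: qX; lia.
  move: h2; rewrite leq_pmul2l // => h2.
  have h3 : (4 * (q ^ s * Y) <= 2 * Q)%N.
    apply: leq_trans h2; rewrite mulnA leq_mul2r; apply/orP; right.
    rewrite (_ : 2 * s - 20 = (s - 20) + s)%N; last by lia.
    by rewrite expnD leq_mul2r; apply/orP; right; apply: (@q2X 2); lia.
  lia.
(* By the lower bound [q^n B v] is at most [4 Q] times the number of [x] that are scalar modulo [v],
   and [scalar_sum] bounds the total. *)
have hX : (2 * (q ^ s * X) <= Q)%N.
  have h1 : (q ^ n * X <= 4 * Q * (pl n * q ^ (3 * (h - d) + 5)))%N.
    apply: leq_trans (_ : (4 * Q * \sum_(v : 'rV[Fq]_d) size [seq x <- T | scal (monp v) n x] <= _)%N); last first.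
      by rewrite leq_mul2l scalar_sum ?orbT //; lia.
    rewrite !big_distrr /= big_mkcond; apply: leq_sum => v _; case: ifP => // rv.
    apply: leq_trans (_ : (2 * r v * size [seq x <- T | scal (monp v) n x] * B v <= _)%N).
      by rewrite leq_mul2r small ?orbT.
    by rewrite mulnAC leq_mul2r; have := BP v; rewrite -mulnA; lia.
  have h2 : (q ^ (2 * h + 5) * (q ^ (11 * s) * X) <= q ^ (2 * h + 5) * (4 * Q * (pl (98 * s + 0) * q ^ 5)))%N.
    apply: leq_trans (_ : (q ^ (11 * s + 5) * (q ^ n * X) <= _)%N).
      rewrite !mulnA leq_mul2r; apply/orP; right; rewrite -!expnD; apply: qX; lia.
    apply: leq_trans (_ : (q ^ (11 * s + 5) * (4 * Q * (pl (98 * s + 0) * q ^ (3 * (h - d) + 5))) <= _)%N).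
      rewrite leq_mul2l; apply/orP; right; apply: leq_trans h1 _; rewrite leq_mul2l; apply/orP; right.
      by rewrite leq_mul2r pol_le ?orbT // addn0.
    rewrite mulnCA [X in (_ <= X)%N]mulnCA leq_mul2l; apply/orP; right.
    rewrite mulnCA [X in (_ <= X)%N]mulnCA leq_mul2l; apply/orP; right.
    by rewrite -!expnD; apply: qX; lia.
  move: h2; rewrite leq_pmul2l // => h2.
  have p0 : (0 < pl (98 * s + 0) * q ^ 5)%N.
    by rewrite muln_gt0 q1 andbT /pol !muln_gt0 !addnS.
  rewrite -(@leq_pmul2r (pl (98 * s + 0) * q ^ 5)) //.
  suff : (8 * (q ^ s * X * (pl (98 * s + 0) * q ^ 5)) <= 4 * Q * (pl (98 * s + 0) * q ^ 5))%N.
    by move: (q ^ s * X)%N (pl _ * _)%N => *; nia.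
  apply: leq_trans h2.
  have e10 : (8 * q ^ 5 * pl (98 * s + 0) <= q ^ (10 * s))%N.
    by apply: leq_trans (s2P s _) (q2X _); lia.
  rewrite (_ : 11 * s = 10 * s + s)%N; last by lia.
  have -> : (q ^ (10 * s + s) * X = q ^ (10 * s) * (q ^ s * X))%N by rewrite expnD mulnA.
  apply: leq_trans (_ : (8 * q ^ 5 * pl (98 * s + 0) * (q ^ s * X) <= _)%N); last by rewrite leq_mul2r e10 orbT.
  by move: (q ^ s * X)%N (pl _)%N (q ^ 5)%N => a b c; apply: eq_leq; ring.
rewrite mulnDr; move: hX hY; clear; move: (q ^ s * X)%N (q ^ s * Y)%N => a b; lia.
Qed.

(** Moduli of degree below [D], about [0.18 n], are treated by the upper bound for each modulus, the
    others by [scalar_tail]. With [n] near [1200 y] and [D] near [220 y], the errors of the former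
    are governed by [5 * 220 < 1200], and the exponent of the latter by [3 (600 - 220) < 1200]. *)
Theorem scalar_density : exists s1, forall s, (s1 <= s)%N -> exists x0, forall n (T : seq k),
  (x0 <= n)%N -> uniq T ->
  (forall x, x \in T -> exactd Fq n x /\ exists m, [/\ m \is monic, (20 * s < size m)%N & scal m n x]) ->
  (q ^ s * size T <= 100 * q ^ n)%N.
Proof.
have [s1 H] := degree_sum; exists s1 => s s1s.
pose w y := wb (220 * y + 20 * s).
have [y1 y1P] : exists y1, forall y, (y1 <= y)%N -> (q ^ (s + 1804) * pl (1200 * y + 1200) <= 2 ^ y)%N.
  by apply: polyb_lt; apply: polyb_mul; [apply: polyb_const|apply: polyb_lin; apply: pol_polyb].
have [y2 y2P] : exists y2, forall y, (y2 <= y)%N ->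
    (q ^ (101 * s) * (4 * q) * ((220 * y) * (w y * w y)) <= 2 ^ y)%N.
  apply: polyb_lt; apply: polyb_mul; first exact: polyb_const.
  apply: polyb_mul; first by apply: polyb_mul; [apply: polyb_const|apply: polyb_id].
  by apply: polyb_mul; apply: polyb_lin; apply: wbd_polyb.
exists (1200 * (y1 + y2 + gs + 20 * s + 1))%N => n T nx uT hT.
pose y := (n %/ 1200)%N; have y_n : (1200 * y <= n)%N by rewrite mulnC leq_trunc_div.
have n_y : (n < 1200 * y + 1200)%N by have := ltn_ceil n (isT : 0 < 1200)%N; rewrite -/y; leq_lia.
have yx : (y1 + y2 + gs + 20 * s + 1 <= y)%N by leq_lia.
pose D := (20 * s + 20 * (11 * y))%N.
have n0 : (0 < n)%N by leq_lia.
have q1 a : (0 < q ^ a)%N by rewrite expn_gt0 q_gt0.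
pose big x := `[< exists m, [/\ m \is monic, (D < size m)%N & scal m n x] >].
have e02 x : x \in T -> [/\ exactd Fq n x, ev x G0 != 0 & ev x G2 != 0].
  by move=> /hT[xn _]; have [|? ?] := exact_ev02 xn; first by leq_lia.
have hbig : (q ^ s * size [seq x <- T | big x] <= q ^ n)%N.
  have := @scalar_tail _ _ ik G0 G1 G2 q_odd detRG n D [seq x <- T | big x] n0 (filter_uniq _ uT).
  move=> /(_ _)/wrap[]; first by move=> x; rewrite mem_filter => /andP[/asboolP bx /e02[]].
  move=> h; apply: leq_trans (_ : (q ^ s * (pl (1200 * y + 1200) * q ^ (1140 * y + 1804)) <= _)%N).
    rewrite leq_mul2l; apply/orP; right; apply: leq_trans h _; apply: leq_mul.
      by apply: pol_le; exact: ltnW.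
    apply: qX; have := half_leq (ltnW n_y).
    by rewrite (_ : 1200 * y + 1200 = (600 * y + 600).*2)%N ?doubleK -?muln2 /D; leq_lia.
  rewrite pow_shift.
  apply: leq_trans (_ : (q ^ (1140 * y) * q ^ y <= _)%N); last by rewrite -expnD qX //; leq_lia.
  by rewrite leq_mul2l; apply/orP; right; apply: leq_trans (y1P y _) (q2X (leqnn y)); leq_lia.
pose S d := (\sum_(v : 'rV[Fq]_d) size [seq x <- T | scal (monp v) n x])%N.
have hsmall : (size [seq x <- T | predC big x] <= \sum_(0 <= i < 20 * (11 * y)) S (20 * s + i)%N)%N.
  pose L d := flatten [seq [seq x <- T | scal (monp v) n x] | v <- enum {: 'rV[Fq]_d}].
  have SL d : size (L d) = S d.
    by rewrite size_flatten /shape -map_comp sumnE big_map big_enum.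
  have -> : (\sum_(0 <= i < 20 * (11 * y)) S (20 * s + i) =
      size (flatten [seq L (20 * s + i)%N | i <- iota 0 (20 * (11 * y))]))%N.
    rewrite size_flatten /shape -map_comp sumnE big_map /index_iota subn0.
    by apply: eq_bigr => i _; rewrite /= SL.
  apply: uniq_leq_size; first exact: filter_uniq.
  move=> x; rewrite mem_filter => /andP[/negP/= nb xT]; have [xn [m [mm sm scm]]] := hT x xT.
  have mD : (size m <= D)%N.
    by rewrite leqNgt; apply/negP => Dm; apply: nb; apply/asboolP; exists m.
  apply/flattenP; exists (L (size m).-1).
    apply/mapP; exists ((size m).-1 - 20 * s)%N; first by rewrite mem_iota; have [] := degree_shift sm mD.
    by have [_ ->] := degree_shift sm mD.
  have [v vE] := @monP _ (size m).-1 m mm (esym (prednK (leq_ltn_trans (leq0n _) sm))).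
  apply/flattenP; exists [seq x <- T | scal (monp v) n x].
    by apply/mapP; exists v; rewrite ?mem_enum.
  by rewrite mem_filter xT -vE scm.
(* The main terms [2 q^n / r v] are summed by [degree_sum], in the block of degrees that starts at
   [20 (s + i/20)]. The error terms are summed trivially, over [q^d] moduli with
   [r v <= q^(4 d)]. *)
have hS i : (i < 20 * (11 * y))%N -> exists B, (q ^ (s + i %/ 20) * B <= q ^ n)%N /\
    (S (20 * s + i) <= B + q ^ (1100 * y + 100 * s) * (4 * q) * (w y * w y))%N.
  move=> iy; set d := (20 * s + i)%N.
  have [|||r [rP rS]] := H (s + i %/ 20)%N d; rewrite /d; [leq_lia|leq_lia|leq_lia|].
  rewrite -/d in r rP rS *.
  pose E := (4 * q * q ^ (4 * d) * wb d ^ 2)%N.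
  pose B (v : 'rV[Fq]_d) := (size [seq x <- T | scal (monp v) n x] - E)%N.
  exists (\sum_v B v)%N; split.
    apply: rS => v; have [r0 rq up] := rP v; rewrite /B mulnBr leq_subLR addnC.
    apply: leq_trans (up n _ n0 (filter_uniq _ uT) _) _.
      move=> x; rewrite mem_filter => /andP[sx /e02[xn _ _]]; split=> //; last by have /exactdP[] := xn.
      by apply: exact_good xn _; rewrite /d; leq_lia.
    rewrite leq_add2l /E -mulnn [X in (_ <= X)%N]mulnCA.
    rewrite (mulnA (4 * q)%N (r v)) -(mulnA _ (r v) (_ ^ _)%N).
    by rewrite leq_mul // leq_mul2l rq orbT.
  apply: leq_trans (_ : (\sum_v (B v + E) <= _)%N).
    by apply: leq_sum => v _; rewrite /B addnC -leq_subLR.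
  rewrite big_split leq_add2l /= sum_nat_const card_mx mul1n /E.
  apply: leq_trans (_ : (q ^ (5 * d) * (4 * q) * (wb d * wb d) <= _)%N).
    by rewrite (_ : 5 * d = d + 4 * d)%N ?expnD; [nia|leq_lia].
  by rewrite !leq_mul // ?wbd_le // /w /d; try apply: qX; leq_lia.
have /choice[B BP] : forall i, exists b, (i < 20 * (11 * y))%N -> (q ^ (s + i %/ 20) * b <= q ^ n)%N /\
    (S (20 * s + i) <= b + q ^ (1100 * y + 100 * s) * (4 * q) * (w y * w y))%N.
  by move=> i; case: (boolP (i < 20 * (11 * y))%N) => [/hS[b bP]|_]; [exists b|exists 0%N].
have hgeo : (\sum_(0 <= i < 20 * (11 * y)) q ^ s * B i <= 40 * q ^ n)%N.
  apply: geometric_sum => i iy; apply: leq_trans (BP i iy).1.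
  by rewrite expnD mulnA leq_mul2r mulnC leq_mul2l q2X ?orbT.
have herr : (q ^ s * \sum_(0 <= i < 20 * (11 * y)) (q ^ (1100 * y + 100 * s) * (4 * q) * (w y * w y)) <= q ^ n)%N.
  rewrite sum_nat_const_nat subn0 (_ : 20 * (11 * y) = 220 * y)%N; last by leq_lia.
  rewrite (_ : q ^ s * _ = q ^ (1100 * y) * (q ^ (s + 100 * s) * (4 * q) * (220 * y * (w y * w y))))%N; last first.
    move: (100 * s)%N (1100 * y)%N (220 * y)%N (4 * q)%N (w y * w y)%N => a b c e z.
    by rewrite !expnD; ring.
  rewrite (_ : s + 100 * s = 101 * s)%N; last by leq_lia.
  apply: leq_trans (_ : (q ^ (1100 * y) * q ^ y <= _)%N); last by rewrite -expnD qX //; leq_lia.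
  by rewrite leq_mul2l; apply/orP; right; apply: leq_trans (y2P y _) (q2X (leqnn y)); leq_lia.
have hmid : (q ^ s * size [seq x <- T | predC big x] <= 41 * q ^ n)%N.
  apply: leq_trans (_ : (q ^ s * \sum_(0 <= i < 20 * (11 * y)) (B i + q ^ (1100 * y + 100 * s) * (4 * q) * (w y * w y)) <= _)%N).
    rewrite leq_mul2l; apply/orP; right; apply: leq_trans hsmall _.
    rewrite big_nat [X in (_ <= X)%N]big_nat; apply: leq_sum => i /andP[_ iy]; exact: (BP i iy).2.
  rewrite big_split mulnDr /= mulSn addnC leq_add //.
  by rewrite big_distrr.
rewrite -(count_predC big T) -!size_filter mulnDr.
apply: leq_trans (leq_add hbig hmid) _; rewrite -mulSn leq_mul2r.
by apply/orP; right.
Qed.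
End Transfer.

(** * Nonvanishing of the determinant from the hypothesis on endomorphisms *)

Lemma two_neq0 (Fq : finFieldType) (K : fieldType) (i : {rmorphism Fq -> K}) : odd #|Fq| -> (2%:R : K) != 0.
Proof.
move=> q_odd; have [p [e [pp e0 qE pk]]] := q_char_power i.
apply/negP => two; have : 2%N \in [pchar K] by rewrite inE /= two.
rewrite (pcharf_eq pk) inE /= => /eqP p2.
by move: q_odd; rewrite qE -p2 oddX (gtn_eqF e0).
Qed.

Lemma map_twist_mul (Fq : finFieldType) (L L' : fieldType) (h : {rmorphism L -> L'}) (f g : {poly L}) :
  map_poly h (twist_mul Fq f g) = twist_mul Fq (map_poly h f) (map_poly h g).
Proof.
rewrite /twist_mul size_map_poly rmorph_sum; apply: eq_bigr => i _.
rewrite /= linearZ /= coef_map; congr (_ *: _); elim: (nat_of_ord i) => //= n <-.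
rewrite /twist_tau rmorphM /= map_polyX -!map_poly_comp_id0 ?rmorph0 ?expr0n ?(gtn_eqF (q_gt0 Fq)) //.
by congr (_ * _); apply/polyP => j; rewrite !coef_map_id0 /= ?rmorph0 ?expr0n ?(gtn_eqF (q_gt0 Fq)) ?rmorphXn //= rmorph0.
Qed.

Section Generic.
Variables (Fq : finFieldType) (psi : {lrmorphism {poly Fq} -> twisted (@tofrac {poly Fq})}).
Hypothesis psi_rank2 : is_drinfeld 2 psi.
Local Notation F := {fraction {poly Fq}}.
Local Notation q := #|Fq|.
Local Notation g i := ((psi 'X : {poly F})`_i).

Lemma common_denominator : exists G0 G1 G2 : {poly Fq},
  [/\ G0 != 0, G2 != 0, g 1 * tofrac G0 = tofrac G1 & g 2 * tofrac G0 = tofrac G2].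
Proof.
have [a1 [b1 [b10 e1]]] := fracE (g 1); have [a2 [b2 [b20 e2]]] := fracE (g 2).
have [_ s3 _] := psi_rank2.
have g20 : g 2 != 0 by apply: (@c2_neq0 _ _ _ (psi 'X)).
exists (b1 * b2), (a1 * b2), (a2 * b1); split.
- exact: mulf_neq0.
- rewrite mulf_neq0 //; apply: contraNneq g20 => a20; by rewrite e2 a20 rmorph0 mul0r.
- by rewrite e1 !rmorphM /= mulrA divfK ?tofrac_eq0.
- by rewrite e2 !rmorphM /= mulrCA divfK ?tofrac_eq0 // mulrC.
Qed.

Variables (Falg : closedFieldType) (iota : {rmorphism {fraction {poly Fq}} -> Falg}).
Hypothesis psi_generic : endo_ring (base_change iota psi) = range (base_change iota psi).
Hypothesis q_odd : odd q.
Variables (G0 G1 G2 : {poly Fq}).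
Hypothesis G0_neq0 : G0 != 0.
Hypothesis G2_neq0 : G2 != 0.
Hypothesis G1E : g 1 * tofrac G0 = tofrac G1.
Hypothesis G2E : g 2 * tofrac G0 = tofrac G2.

Definition gammaA : {rmorphism {poly Fq} -> Falg} := iota \o @tofrac {poly Fq}.
Local Notation ik := (gammaA \o polyC).
Local Notation th := (gammaA 'X).
Local Notation eid := (@idfun Falg : {rmorphism Falg -> Falg}).
Local Notation ev x := (evA ik eid x).
Local Notation sg := (map_poly (frq ik)).
Local Notation bc := (base_change iota psi).
Let Psi : twisted gammaA := bc 'X.

Let Psi_size : size (Psi : {poly Falg}) = 3%N.
Proof. by rewrite /Psi /base_change size_map_poly; have [] := psi_rank2. Qed.

Let evE P : ev th P = gammaA P.
Proof.
rewrite /evA /= /horner_eval -[RHS](_ : (map_poly gammaA (map_poly polyC P)).[th] = _).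
  by rewrite -map_poly_comp.
by rewrite horner_map /= -/(P \Po 'X) comp_polyXr.
Qed.

Let gammaA_inj P : gammaA P = 0 -> P = 0.
Proof. by move/eqP; rewrite /gammaA /= fmorph_eq0 tofrac_eq0 => /eqP. Qed.

Let bcD a b : bc (a + b) = bc a + bc b :> twisted gammaA.
Proof. by rewrite /base_change raddfD; apply: (@raddfD _ _ (map_poly iota)). Qed.

Let bcM a b : bc (a * b) = (bc a : twisted gammaA) * bc b.
Proof. by rewrite /base_change rmorphM; apply: map_twist_mul. Qed.

Let bcC c : bc c%:P = c *: (1 : twisted gammaA).
Proof.
rewrite /base_change -[c%:P]mulr1 mul_polyC linearZ rmorph1 /= /GRing.scale /= /twist_scale.
by rewrite linearZ /= rmorph1.
Qed.

Let bcE a : bc a = ev1 Psi (map_poly ik a) 1.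
Proof.
elim/poly_ind: a => [|a c IH].
  by rewrite rmorph0 /ev1 size_poly0 big_ord0 /base_change raddf0 rmorph0.
rewrite bcD bcM bcC IH rmorphD rmorphM /= map_polyX map_polyC ev1D ev1C mulrC ev1X //=.
Qed.

(** A traceless matrix commuting with Frobenius gives an endomorphism over [Falg], hence an element
    [m] of [A], and its first row is [(m, 0)]. So [b = 0], then [c = 0], and [a = m] is fixed by
    Frobenius while the relation also gives [a^(q) = - a]; for odd [q] this means [a = 0]. *)
Lemma generic_det K : \det (RG G0 G1 G2 K) != 0.
Proof.
have e00 : gammaA G0 != 0 by apply: contra_neq G0_neq0 => /gammaA_inj.
have e20 : gammaA G2 != 0 by apply: contra_neq G2_neq0 => /gammaA_inj.
have c0E : (Psi : {poly Falg})`_0 = th.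
  by rewrite /Psi /base_change coef_map; have [_ _ ->] := psi_rank2.
have c1E : (Psi : {poly Falg})`_1 = gammaA G1 / gammaA G0.
  by apply: (mulIf e00); rewrite divfK // /Psi /base_change coef_map /= -rmorphM G1E.
have c2E : (Psi : {poly Falg})`_2 = gammaA G2 / gammaA G0.
  by apply: (mulIf e00); rewrite divfK // /Psi /base_change coef_map /= -rmorphM G2E.
apply: (@detRG_neq0 _ _ ik _ _ _ K th) => //; first by move=> P; rewrite evE; apply: gammaA_inj.
move=> a b c hU.
have PhE : PhiK ik G0 G1 G2 eid th = (gammaA G2)%:P *: PhiL Psi.
  rewrite /PhiK /PhiL !evE c0E c1E c2E scale_mx2; congr mx2; rewrite ?mulr0 ?mulr1 //.
    by rewrite -mul_polyC mulrA -polyCM invf_div mulrCA divff // mulr1 mulrC.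
  by rewrite mulrN -polyCM; congr (- _%:P); field; rewrite e00 e20.
have hU' : map_mx sg (tz a b c) *m PhiL Psi = PhiL Psi *m tz a b c.
  apply: (@scalemx_inj _ _ _ (gammaA G2)%:P); first by rewrite polyC_eq0.
  by rewrite [LHS]scalemxAr [RHS]scalemxAl -PhE.
have : endo_ring bc (E Psi (row 0 (tz a b c)) : twisted gammaA).
  move=> P /=; elim/poly_ind: P => [|P d IH]; first by rewrite /base_change raddf0 rmorph0 [LHS]mulr0 [RHS]mul0r.
  pose u : twisted gammaA := E Psi (row 0 (tz a b c)); pose w : twisted gammaA := bc P.
  have uw : u * w = w * u by exact: IH.
  have uP : u * Psi = Psi * u by exact: (E_commutes Psi_size hU').
  have -> : bc (P * 'X + d%:P) = w * Psi + d *: 1 by rewrite bcD bcM bcC.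
  transitivity (u * (w * Psi + d *: 1)) => //.
  rewrite mulrDr mulrA uw -mulrA uP mulrA -scalerAr mulr1.
  by transitivity ((w * Psi + d *: 1) * u); rewrite // mulrDl -scalerAl mul1r.
rewrite psi_generic => -[m _ mE].
have rE : row 0 (tz a b c) = \row_j (if j == 0 then map_poly ik m else 0).
  apply: (E_inj2 Psi_size); rewrite -mE bcE /E !mxE /=.
  by rewrite ev10 addr0.
have aE : a = map_poly ik m by have /rowP/(_ 0) := rE; rewrite !mxE.
have b0 : b = 0 by have /rowP/(_ 1) := rE; rewrite !mxE.
have c0 : c = 0.
  have /matrixP/(_ 0 0) := hU'; rewrite !mulmx2E !mxE /= b0 rmorph0.
  by rewrite mulr0 !mul0r addr0 add0r mul1r.
have a_s : sg a = a by rewrite aE; apply/polyP => j; rewrite !coef_map /= frq_base.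
have : sg a = - a.
  by have /matrixP/(_ 0 1) := hU'; rewrite !mulmx2E !mxE /= b0 rmorph0 !mul0r mulr1 addr0 add0r mul1r.
rewrite a_s => /eqP; rewrite -addr_eq0 -mulr2n -mulr_natl mulf_eq0 -polyC_natr polyC_eq0.
by rewrite (negPf (two_neq0 ik q_odd)) => /eqP.
Qed.
End Generic.

(** * Traces and discriminants in quadratic algebras *)

Lemma det_mx2 (R : comNzRingType) (A : 'M[R]_2) : \det A = det2 A.
Proof.
rewrite (expand_det_row _ 0) big_ord_recl big_ord1 /cofactor !det_mx11 !mxE /= /det2.
rewrite expr0 mul1r expr1 mulN1r mulrN.
by congr (_ * A _ _ - A _ _ * A _ _); apply: val_inj.
Qed.

Lemma cayley2 (R : comNzRingType) (A : 'M[R]_2) : A *m A - (A 0 0 + A 1 1) *: A + (det2 A)%:M = 0.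
Proof. by rewrite scalar_mx2 /det2; apply: mx2P; rewrite !(mulmx2E, mxE) /=; ring. Qed.

(** By Cayley-Hamilton [tr(N) N] is scalar, so a nonzero trace would make [N] scalar. *)
Lemma trace_sqrt_scalar (F : fieldType) n (N : 'M[F]_n) d : n = 2%N -> N *m N = d%:M ->
  (forall c, N <> c%:M) -> \tr N = 0.
Proof.
move=> n2; subst n => NN Nc.
have -> : \tr N = N 0 0 + N 1 1.
  by rewrite /mxtrace big_ord_recl big_ord1; congr (_ + N _ _); exact: val_inj.
apply/eqP; apply: contraT => t0; case: (Nc ((N 0 0 + N 1 1)^-1 * (d + det2 N))).
apply: (scalemx_inj t0); rewrite scale_scalar_mx mulrA divff // mul1r.
have := cayley2 N; rewrite NN addrAC -raddfD /= => /eqP; rewrite subr_eq0 => /eqP <- //.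
Qed.

Section QuadraticTrace.
Variables (F : fieldType) (h : {poly F}).
Hypothesis h_monic : h \is monic.
Hypothesis h_size : size h = 3%N.
Local Notation A := {poly %/ h}.
Local Notation B := (vbasis {: A}).
Local Notation lf x := (linfun ((x : A) \*o idfun)).
Definition mulq_mx (x : A) := passmx.mxof B B (lf x).
Definition trq (x : A) : F := \tr (mulq_mx x).

Let Bb : basis_of {: A} B := vbasisP _.

Lemma dim_qpoly2 : \dim {: A} = 2%N.
Proof.
have -> : \dim {: A} = (size (mk_monic h)).-1 by exact: dim_polyn.
by rewrite /mk_monic h_size h_monic /= h_size.
Qed.

Let lfM x y : lf x y = x * y. Proof. by rewrite lfunE. Qed.

Lemma mulq_mxP c x y : mulq_mx (c *: x + y) = c *: mulq_mx x + mulq_mx y.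
Proof.
rewrite /mulq_mx -passmx.mxof_linear; congr (passmx.mxof _ _ _); apply/lfunP => z.
by rewrite add_lfunE scale_lfunE !lfM mulrDl scalerAl.
Qed.

Lemma mulq_mxD x y : mulq_mx (x + y) = mulq_mx x + mulq_mx y.
Proof. by rewrite -[x in LHS]scale1r mulq_mxP scale1r. Qed.

Lemma mulq_mxZ c x : mulq_mx (c *: x) = c *: mulq_mx x.
Proof.
have z0 : mulq_mx 0 = 0 by rewrite -(subrr (0 : A)) -scaleN1r addrC mulq_mxP scaleN1r addNr.
by rewrite -[X in mulq_mx X]addr0 mulq_mxP z0 addr0.
Qed.

Lemma mulq_mx1 : mulq_mx 1 = 1%:M.
Proof.
rewrite -(passmx.mxof1 (basis_free Bb)); congr (passmx.mxof _ _ _).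
by apply/lfunP => z; rewrite lfM id_lfunE mul1r.
Qed.

Lemma mulq_mxM x y : mulq_mx (x * y) = mulq_mx x *m mulq_mx y.
Proof.
rewrite /mulq_mx -passmx.mxof_comp //; congr (passmx.mxof _ _ _).
by apply/lfunP => z; rewrite comp_lfunE !lfM mulrCA mulrA.
Qed.

Lemma mulq_mx_scalar x c : mulq_mx x = c%:M -> x = c *: 1.
Proof.
move=> e; apply/eqP; rewrite -subr_eq0; set z := x - _.
have : mulq_mx z = 0.
  by rewrite /z -scaleN1r scalerA mulN1r mulq_mxD mulq_mxZ mulq_mx1 e scaleNr scalemx1 subrr.
move/eqP; rewrite passmx.mxof_eq0 // => /eqP e0.
by have := lfM z 1; rewrite e0 zero_lfunE mulr1 => <-.
Qed.

Lemma trqD x y : trq (x + y) = trq x + trq y.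
Proof. by rewrite /trq mulq_mxD mxtraceD. Qed.

Lemma trqZ c x : trq (c *: x) = c * trq x.
Proof. by rewrite /trq mulq_mxZ mxtraceZ. Qed.

Lemma trq1 : trq 1 = 2%:R.
Proof. by rewrite /trq mulq_mx1 mxtrace1 dim_qpoly2. Qed.

Lemma trq_sqrt x d : x * x = d *: 1 -> (forall c, x <> c *: 1) -> trq x = 0.
Proof.
move=> xx xc; apply: (@trace_sqrt_scalar _ _ _ d); first exact: dim_qpoly2.
  by rewrite -mulq_mxM xx mulq_mxZ mulq_mx1 scalemx1.
by move=> c /mulq_mx_scalar; apply: xc.
Qed.

Lemma disc_quadratic (x : 'I_2 -> A) (xi : A) (d : F) (g : 'I_2 -> 'I_2 -> F) :
  xi * xi = d *: 1 -> (forall c, xi <> c *: 1) -> (forall i, x i = g i 0 *: 1 + g i 1 *: xi) ->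
  \det (\matrix_(i, j) trq (x i * x j)) = 4%:R * d * (g 0 0 * g 1 1 - g 0 1 * g 1 0) ^+ 2.
Proof.
move=> xx xc xE; have t0 := trq_sqrt xx xc.
have tE i j : trq (x i * x j) = (g i 0 * g j 0 + g i 1 * g j 1 * d) * 2%:R.
  have -> : x i * x j = (g i 0 * g j 0 + g i 1 * g j 1 * d) *: 1 + (g i 0 * g j 1 + g i 1 * g j 0) *: xi.
    rewrite !xE mulrDl !mulrDr -!scalerAl -!scalerAr !mul1r !mulr1 xx !scalerA !scalerDl.
    by rewrite [X in _ + X = _]addrC addrACA.
  by rewrite trqD !trqZ t0 mulr0 addr0 trq1.
rewrite det_mx2 /det2 !mxE !tE; ring.
Qed.
End QuadraticTrace.

Section QuadraticOrder.
Variables (A : idomainType) (K : fieldType) (tf : {rmorphism A -> K}).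
Hypothesis tf_eq0 : forall a, (tf a == 0) = (a == 0).
Hypothesis two_neq0 : (2%:R : K) != 0.
Variables (t n b D : A).
Hypothesis b_neq0 : b != 0.
Hypothesis tD : t ^+ 2 - 4%:R * n = b ^+ 2 * D.
Variable h : {poly K}.
Local Notation M := ('X^2 + (- t) *: 'X + n%:P).
Local Notation mK := (map_poly tf).
Local Notation iq := (in_qpoly h).
Hypothesis hE : h = mK M.
Local Notation Lx := (2%:R *: 'X - t%:P : {poly A}).

Let M_monic_size : M \is monic /\ size M = 3%N.
Proof.
have s : (size ((- t) *: 'X + n%:P : {poly A})%R < 3)%N.
  rewrite (leq_ltn_trans (size_polyD _ _)) // gtn_max (leq_ltn_trans (size_scale_leq _ _)) ?size_polyX //=.
  by rewrite (leq_ltn_trans (size_polyC_leq1 _)).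
rewrite -addrA; split; last by rewrite size_polyDl size_polyXn.
by rewrite monicE lead_coefDl ?size_polyXn ?lead_coefXn.
Qed.

Lemma quadratic_monic : h \is monic.
Proof. by rewrite hE monic_map //; have [] := M_monic_size. Qed.

Lemma quadratic_size : size h = 3%N.
Proof.
have [mM sM] := M_monic_size; rewrite hE size_map_poly_id0 //.
by rewrite (monicP mM) rmorph1 oner_neq0.
Qed.

Let tb0 : tf b != 0. Proof. by rewrite tf_eq0. Qed.
Let mkh : mk_monic h = h. Proof. by rewrite /mk_monic quadratic_size quadratic_monic. Qed.

(** The class of [(2 X - t) / b], a square root of [D] by [tD]. *)
Definition xiq : {poly %/ h} := (tf b)^-1 *: iq (mK Lx).

Let iqC c : iq c%:P = c *: 1.
Proof. by rewrite -[c%:P]mulr1 mul_polyC in_qpolyZ in_qpoly1. Qed.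

Let iqM H : iq (mK (H * M)) = 0.
Proof.
have -> : mK (H * M) = mK H * h by rewrite hE; exact: rmorphM.
rewrite in_qpolyM (_ : iq h = 0) ?mulr0 //; apply: val_inj.
by rewrite /= mkh -Pdiv.IdomainMonic.modpE ?quadratic_monic // modpp.
Qed.

Let iqB u v : iq (u - v) = iq u - iq v. Proof. exact: raddfB. Qed.

Lemma xiqE : iq (mK Lx) = tf b *: xiq.
Proof. by rewrite /xiq scalerA divff // scale1r. Qed.

Lemma xiq_sqr : xiq * xiq = tf D *: 1.
Proof.
apply: (scalerI (mulf_neq0 tb0 tb0)).
have sq (x : {poly %/ h}) c : (c * c) *: (x * x) = (c *: x) * (c *: x).
  by rewrite -scalerAl -scalerAr scalerA.
rewrite sq.
rewrite -xiqE -in_qpolyM -rmorphM scalerA -!rmorphM -expr2 -tD.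
have -> : Lx ^+ 2 = (4%:R)%:P * M + (t ^+ 2 - 4%:R * n)%:P.
  by rewrite -!mul_polyC !(polyCB, polyCM, polyCN, polyC_exp, polyC_natr); ring.
by rewrite rmorphD in_qpolyD iqM add0r /= map_polyC iqC.
Qed.

Lemma xiq_nonscalar c : xiq <> c *: 1.
Proof.
move=> e; set Q := mK Lx - (tf b * c)%:P; have Q0 : iq Q = 0.
  by rewrite /Q iqB iqC xiqE e scalerA subrr.
have sQ : (size Q < 3)%N.
  rewrite ltnS; apply: size_polyB_le; last by rewrite (leq_trans (size_polyC_leq1 _)).
  apply: leq_trans (size_poly _ _) _; apply: size_polyB_le; last by rewrite (leq_trans (size_polyC_leq1 _)).
  by rewrite (leq_trans (size_scale_leq _ _)) // size_polyX.
have Qz : Q = 0 by rewrite -(@in_qpoly_small _ h Q) ?mkh ?quadratic_size ?Q0.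
have /eqP := congr1 (fun P : {poly K} => P`_1) Qz.
rewrite /Q coefB coef_map coefC /= subr0 coefB coefZ poly.coefX coefC /= mulr1 subr0 rmorph_nat coef0.
exact/negP.
Qed.

(** A polynomial identity modulo [M], with denominators cleared, is what computations with
    endomorphisms can provide. *)
Lemma quadratic_coords z c Q c0 c1 H : c != 0 -> tf c *: z = iq (mK Q) ->
  b%:P * Q - ((c * b * c0)%:P + (c * c1) *: Lx) = H * M -> z = tf c0 *: 1 + tf c1 *: xiq.
Proof.
move=> c_neq0 zQ HE; have : iq (mK (H * M)) = 0 by exact: iqM.
have tc0 : tf c != 0 by rewrite tf_eq0.
have -> : mK (H * M) = (tf b)%:P * mK Q - ((tf (c * b * c0))%:P + tf (c * c1) *: mK Lx).
  rewrite -HE [LHS]rmorphB; congr (_ - _); first by rewrite rmorphM /= map_polyC.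
  by rewrite [LHS]rmorphD /= map_polyC map_polyZ.
rewrite mul_polyC iqB in_qpolyZ in_qpolyD iqC in_qpolyZ xiqE -zQ => /eqP.
rewrite subr_eq0 !scalerA !rmorphM => /eqP e5.
apply: (scalerI (mulf_neq0 tb0 tc0)); rewrite e5 scalerDr !scalerA.
by congr (_ *: _ + _ *: _); ring.
Qed.
End QuadraticOrder.

Local Open Scope quotient_scope.

(** * Fractions in lowest terms *)

Section LowestTerms.
Variable Fq : finFieldType.
Implicit Types (x : {fraction {poly Fq}}) (a b p : {poly Fq}).

Lemma fraction_repr x : x * tofrac (frac (repr x)).2 = tofrac (frac (repr x)).1.
Proof.
rewrite -{1}(reprK x); set r := repr x.
have d0 : \d_r != 0 by exact: denom_ratioP.
unlock tofrac; rewrite -[LHS]FracField.pi_mul; apply/eqmodP; rewrite /= FracField.equivfE.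
rewrite /FracField.mulf !numden_Ratio ?mulf_neq0 ?oner_eq0 ?denom_ratioP //.
by rewrite !mulr1 mulrC.
Qed.

Lemma fnum_fden x : [/\ fden x != 0, coprimep (fnum x) (fden x) & x * tofrac (fden x) = tofrac (fnum x)].
Proof.
have d0 : (frac (repr x)).2 != 0 by exact: denom_ratioP.
rewrite /fnum /fden; set n := _.1 in d0 *; set d := _.2 in d0 *.
have g0 : gcdp n d != 0 by rewrite gcdp_eq0 negb_and d0 orbT.
split; first by rewrite dvdp_div_eq0 ?dvdp_gcdr.
  by rewrite coprimep_div_gcd // d0 orbT.
have g0' : tofrac (gcdp n d) != 0 by rewrite tofrac_eq0.
apply: (mulIf g0'); rewrite -mulrA -!rmorphM /= !divpK ?dvdp_gcdr ?dvdp_gcdl //.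
exact: fraction_repr.
Qed.

Lemma lowest_terms x a b : b != 0 -> x * tofrac b = tofrac a ->
  [/\ fden x %| b, a != 0 -> fnum x %| a & fnum x * b = fden x * a].
Proof.
move=> b0 e; have [d0 cop e'] := fnum_fden x.
have main : fnum x * b = fden x * a.
  apply/eqP; rewrite -tofrac_eq !rmorphM /= -e -e'; apply/eqP; ring.
split=> //; first by rewrite -(Gauss_dvdpr _ (_ : coprimep (fden x) (fnum x))) ?main ?dvdp_mulr // coprimep_sym.
by move=> _; rewrite -(Gauss_dvdpr _ cop) -main dvdp_mulr.
Qed.

Lemma poly_ord0 p a : ~~ (p %| a) -> poly_ord p a = 0%N.
Proof.
move=> pa; apply/eqP; rewrite -leqn0; apply/bigmax_leqP => -[[|k] ka] //= pk.
by case/negP: pa; apply: dvdp_trans pk; rewrite exprS dvdp_mulr.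
Qed.
End LowestTerms.

Lemma double_traceless (R : comNzRingType) (A : 'M[R]_2) :
  2%:R *: A = (A 0 0 + A 1 1)%:M + tz (A 0 0 - A 1 1) (2%:R * A 0 1) (2%:R * A 1 0).
Proof. by rewrite scalar_mx2; apply: mx2P; rewrite !mxE /=; ring. Qed.

Lemma traceless_comm (R : comNzRingType) (A : 'M[R]_2) v0 v1 v2 : A *m tz v0 v1 v2 = tz v0 v1 v2 *m A ->
  let u0 := A 0 0 - A 1 1 in let u1 := 2%:R * A 0 1 in let u2 := 2%:R * A 1 0 in
  [/\ u0 * v1 = u1 * v0, u0 * v2 = u2 * v0 & u1 * v2 = u2 * v1].
Proof.
move=> e u0 u1 u2; have f i j := congr1 (fun B : 'M_2 => B i j) e.
have f00 := f 0 0; have f01 := f 0 1; have f10 := f 1 0; rewrite !mulmx2E !mxE /= in f00 f01 f10.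
split.
- have -> : u0 * v1 = (A 0 0 * v1 + A 0 1 * - v0) - (v0 * A 0 1 + v1 * A 1 1) + u1 * v0 by rewrite /u0 /u1; ring.
  by rewrite f01 subrr add0r.
- have -> : u0 * v2 = (v2 * A 0 0 + - v0 * A 1 0) - (A 1 0 * v0 + A 1 1 * v2) + u2 * v0 by rewrite /u0 /u2; ring.
  by rewrite f10 subrr add0r.
- have -> : u1 * v2 = 2%:R * ((A 0 0 * v0 + A 0 1 * v2) - (v0 * A 0 0 + v1 * A 1 0)) + u2 * v1 by rewrite /u1 /u2; ring.
  by rewrite f00 subrr mulr0 add0r.
Qed.

Lemma scalep_mx (R : comNzRingType) (c : R) (P : {poly R}) m n (A : 'M[{poly R}]_(m, n)) :
  (c *: P) *: A = c%:P *: (P *: A).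
Proof. by rewrite -mul_polyC scalerA. Qed.

Lemma comb_cancel (R : comNzRingType) (b c c0 c1 : R) n (A : 'M[R]_n) :
  b%:M *m (c *: (c0%:M + c1 *: A)) - ((c * b * c0)%:M + (c * c1) *: (b *: A)) = 0.
Proof.
rewrite mul_scalar_mx !scalerDr !scalerA !scale_scalar_mx; apply/eqP; rewrite subr_eq0; apply/eqP.
by congr (_%:M + _ *: _); ring.
Qed.

(** * The reduction at a prime, its Frobenius and its endomorphism ring *)

Section Residue.
Variables (Fq : finFieldType) (p : {poly Fq}) (p_prime : monic_irreducible_poly p).
Local Notation Fp := {poly %/ p with p_prime}.
Local Notation gp := (gammap p_prime).

Lemma gammap_eq0 a : (gp a == 0) = (p %| a).
Proof.
have gE : mk_monic p = p by rewrite /mk_monic p_prime.2 p_prime.1.1.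
apply/eqP/idP => [/(congr1 val)/=|pa].
  by rewrite gE => e; apply/modp_eq0P; rewrite Pdiv.IdomainMonic.modpE ?p_prime.2.
apply: val_inj; rewrite /= gE.
by have := modp_eq0P _ _ pa; rewrite Pdiv.IdomainMonic.modpE ?p_prime.2.
Qed.

Lemma gammap_surj (x : Fp) : exists a, x = gp a.
Proof.
exists (val x); apply: val_inj; rewrite /= Pdiv.CommonRing.rmodp_small //; exact: size_mk_monic.
Qed.

Lemma residueE x a b : ~~ (p %| b) -> x * tofrac b = tofrac a -> residue p_prime x = gp a / gp b.
Proof.
move=> pb e; have b0 : b != 0 by apply: contraNneq pb => ->; rewrite dvdp0.
have [db _ main] := lowest_terms b0 e; have [d0 _ _] := fnum_fden x.
have pd : gp (fden x) != 0 by rewrite gammap_eq0; apply: contraNN pb => /dvdp_trans; apply.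
by rewrite /residue; apply/eqP; rewrite eqr_div // ?gammap_eq0 // -!rmorphM main mulrC.
Qed.

Lemma residue0 : residue p_prime 0 = 0.
Proof.
rewrite (@residueE 0 0 1) ?rmorph0 ?mul0r //.
by rewrite dvdp1; apply: contraL (p_prime.1.1) => /eqP ->.
Qed.

Lemma ord_good x a b : ~~ (p %| b) -> x * tofrac b = tofrac a -> (0 <= ord p x)%R /\
  (~~ (p %| a) -> ord p x = 0).
Proof.
move=> pb e; have b0 : b != 0 by apply: contraNneq pb => ->; rewrite dvdp0.
have [db na main] := lowest_terms b0 e.
have pd : ~~ (p %| fden x) by apply: contraNN pb => /dvdp_trans; apply.
rewrite /ord (poly_ord0 pd) subr0; split=> // pa.
have a0 : a != 0 by apply: contraNneq pa => ->; rewrite dvdp0.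
by rewrite poly_ord0 //; apply: contraNN pa => /dvdp_trans; apply; apply: na.
Qed.

Variable psi : {lrmorphism {poly Fq} -> twisted (@tofrac {poly Fq})}.
Hypothesis psi_rank2 : is_drinfeld 2 psi.
Local Notation F := {fraction {poly Fq}}.
Local Notation g i := ((psi 'X : {poly F})`_i).
Variables (G0 G1 G2 : {poly Fq}).
Hypothesis pG0 : ~~ (p %| G0).
Hypothesis pG2 : ~~ (p %| G2).
Hypothesis G1E : g 1 * tofrac G0 = tofrac G1.
Hypothesis G2E : g 2 * tofrac G0 = tofrac G2.

Lemma good_reduction_of : good_reduction psi p.
Proof.
have [h1 _] := ord_good pG0 G1E; have [h2 h2'] := ord_good pG0 G2E.
split; first by right.
split; last exact: h2'.
have [_ s3 _] := psi_rank2; apply/eqP; exact: (@c2_neq0 _ _ _ (psi 'X)).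
Qed.

Definition Psip : twisted gp := map_poly (residue p_prime) (psi 'X : {poly F}).

Lemma Psip_coef i : (Psip : {poly Fp})`_i = residue p_prime (g i).
Proof. by rewrite /Psip coef_map_id0 // residue0. Qed.

Lemma Psip_c0 : (Psip : {poly Fp})`_0 = gp 'X.
Proof.
rewrite Psip_coef; have [_ _ ->] := psi_rank2; rewrite (@residueE _ 'X 1) ?rmorph1 ?divr1 ?mulr1 //.
by rewrite dvdp1; apply: contraL (p_prime.1.1) => /eqP ->.
Qed.

Lemma Psip_c1 : (Psip : {poly Fp})`_1 = gp G1 / gp G0.
Proof. by rewrite Psip_coef (residueE pG0 G1E). Qed.

Lemma Psip_c2 : (Psip : {poly Fp})`_2 = gp G2 / gp G0.
Proof. by rewrite Psip_coef (residueE pG0 G2E). Qed.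

Lemma Psip_size : size (Psip : {poly Fp}) = 3%N.
Proof.
apply/eqP; rewrite eqn_leq; have [_ s3 _] := psi_rank2; rewrite (leq_trans (size_poly _ _)) ?s3 //=.
rewrite ltnNge; apply/negP => /leq_sizeP/(_ 2%N (leqnn _))/eqP.
by rewrite Psip_c2 mulf_eq0 invr_eq0 !gammap_eq0 (negPf pG0) (negPf pG2).
Qed.

Local Notation red := (reduction psi p_prime).
Local Notation jp := (gp \o polyC).
Local Notation tr2 U := (U 0 0 + U 1 1).

Lemma redX : red 'X = Psip.
Proof. by rewrite /reduction horner_algX. Qed.

Local Notation endo := (@frob_endo Fq psi p p_prime).

Lemma endoP u : endo u <-> u * Psip = Psip * u.
Proof.
split=> [/(_ 'X)|h a]; first by rewrite redX.
rewrite /reduction -/Psip; elim/poly_ind: a => [|a c IH]; first by rewrite rmorph0 mulr0 mul0r.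
rewrite rmorphD rmorphM /= horner_algX horner_algC mulrDr mulrDl mulrA IH -!mulrA h.
by rewrite -scalerAl -scalerAr mulr1 mul1r.
Qed.

Lemma Fp_fixed (c : Fp) : c ^+ (#|Fq| ^ deg p) = c.
Proof. by rewrite -{2}(expf_card c) card_qfpoly. Qed.

Local Notation x := (deg p).
Local Notation fr := (frq jp).
Local Notation sg := (map_poly fr).
Local Notation Ph := (PhiL Psip).

(** The matrix of [tau^n] on the motive of the reduction. *)
Fixpoint PL n : 'M[{poly Fp}]_2 := if n is n'.+1 then iter n' (map_mx sg) Ph *m PL n' else 1%:M.

Lemma tauX_E n v : tau gp ^+ n * E Psip v = E Psip (iter n (map_mx sg) v *m PL n).
Proof.
elim: n v => [|n IH] v; first by rewrite mul1r mulmx1.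
rewrite exprSr -mulrA (tau_E Psip_size) IH mulmxA; congr (E _ (_ *m _)).
by rewrite iterSr; elim: (n) => //= m ->; rewrite map_mxM.
Qed.

Lemma sgx (P : {poly Fp}) : iter x sg P = P.
Proof.
apply/polyP => i; rewrite -[in RHS](Fp_fixed P`_i) -(iter_frq jp).
by elim: (x) => //= n <-; rewrite coef_map.
Qed.

Lemma frob_central u : frob p_prime * u = u * frob p_prime.
Proof.
rewrite /frob; apply/polyP => i.
rewrite coef_tauX.
rewrite [u in RHS]twisted_sum mulr_suml.
rewrite (@big_morph _ _ (fun f : twisted gp => (f : {poly Fp})`_i) 0 +%R 0 +%R) //; last first.
- by rewrite coef0.
- by move=> f f'; apply: coefD.
have -> : \sum_(j < size (u : {poly Fp})) (sc (u : {poly Fp})`_j (tau gp ^+ j) * tau gp ^+ x : {poly Fp})`_i =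
   \sum_(j < size (u : {poly Fp})) ((u : {poly Fp})`_j *+ (i == j + x)%N).
  apply: eq_bigr => j _; rewrite scM -exprD /sc tauX coefZ coefXn.
  by rewrite mulr_natr.
case: ltnP => [ix|xi].
  by rewrite big1 // => j _; rewrite ltn_eqF // ltn_addl.
rewrite iter_frq Fp_fixed; have [s|s] := ltnP (i - x) (size (u : {poly Fp})).
  rewrite (bigD1 (Ordinal s)) //= subnK // eqxx big1 ?addr0 // => j jn.
  rewrite (_ : i == _ = false) //; apply: contraNF jn => /eqP ij; apply/eqP/val_inj; rewrite /= ij addnK //.
rewrite nth_default // big1 // => j _; rewrite (_ : i == _ = false) //; apply/eqP => ij.
by move: s; rewrite ij addnK leqNgt ltn_ord.
Qed.

Lemma frob_in : endo (frob p_prime).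
Proof. by apply/endoP; rewrite frob_central. Qed.

Local Notation U_ := (U_of Psip_size).
Local Notation P := (PL x).

(** [pi_p] is central, so right multiplication by it equals left multiplication by [tau^(deg p)],
    whose matrix is [PL]. *)
Lemma U_frob : U_ (frob p_prime) = P.
Proof.
apply: (mx_E Psip_size) => v; rewrite -U_ofP; last exact/endoP/frob_in.
rewrite -frob_central /frob tauX_E; congr (E _ (_ *m _)).
apply/rowP => j; rewrite -[RHS]sgx; elim: (x) => //= n <-; by rewrite mxE.
Qed.

Local Notation aK := (map_poly jp).

Lemma aK_inj : injective aK.
Proof. exact: map_poly_inj. Qed.

Lemma aK_sg a : sg (aK a) = aK a.
Proof. by apply/polyP => i; rewrite !coef_map /= frq_base. Qed.

Lemma sg_fixed (Q : {poly Fp}) : sg Q = Q -> exists a, Q = aK a.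
Proof.
move=> sQ; have /choice[f fE] : forall i, exists c : Fq, Q`_i = jp c.
  by move=> i; apply: frq_fixed; rewrite -[RHS]/(Q`_i) -{2}sQ coef_map.
exists (\poly_(i < size Q) f i); apply/polyP => i; rewrite coef_map coef_poly.
case: ltnP => si; first exact: fE.
by rewrite raddf0 nth_default.
Qed.

Lemma det_Ph : det2 Ph = - (((Psip : {poly Fp})`_2)^-1 *: ('X - ((Psip : {poly Fp})`_0)%:P)).
Proof. by rewrite /det2 /PhiL !mxE /= mul0r sub0r mul1r. Qed.

Lemma det_Ph_root : 'X - (gp 'X)%:P %| det2 Ph.
Proof. by rewrite det_Ph Psip_c0 -mul_polyC -mulNr dvdp_mull. Qed.

Lemma det_Ph_size : size (det2 Ph) = 2%N.
Proof. by rewrite det_Ph size_polyN size_scale ?size_XsubC // invr_eq0 (c2_neq0 Psip_size). Qed.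

Lemma det_Ph_neq0 : det2 Ph != 0.
Proof. by rewrite -size_poly_eq0 det_Ph_size. Qed.

Lemma U_sg u : endo u -> map_mx sg (U_ u) *m Ph = Ph *m U_ u.
Proof. by move/endoP; apply: U_of_frob. Qed.

(** The twist of [U] is conjugate to [U] by [Ph], so the trace is fixed by Frobenius and has
    coefficients in [Fq]. *)
Lemma trace_fixed (U : 'M_2) : map_mx sg U *m Ph = Ph *m U -> exists a, tr2 U = aK a.
Proof.
move=> h; apply: sg_fixed; rewrite -[RHS](trace2_conj det_Ph_neq0 h) !mxE.
exact: rmorphD.
Qed.

Lemma det_fixed (U : 'M_2) : map_mx sg U *m Ph = Ph *m U -> exists a, det2 U = aK a.
Proof.
move=> h; apply: sg_fixed; rewrite -[RHS](det2_conj det_Ph_neq0 h) /det2 !mxE.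
by rewrite rmorphB !rmorphM.
Qed.

Lemma det_PL n : size (det2 (PL n)) = n.+1 /\ ((0 < n)%N -> det2 Ph %| det2 (PL n)).
Proof.
elim: n => [|n [sn dn]].
  by rewrite /det2 !mxE /= mulr0 subr0 mulr1 size_poly1.
have it m : det2 (iter m (map_mx sg) Ph) = iter m sg (det2 Ph).
  by elim: m => //= m <-; rewrite /det2 !mxE rmorphB !rmorphM.
rewrite [PL _]/(_ *m _) det2M it; split.
  have s m : size (iter m sg (det2 Ph)) = 2%N by elim: m => /= [|m IH]; rewrite ?det_Ph_size // size_map_poly.
  rewrite size_mul ?s ?sn // -size_poly_eq0 ?s ?sn //.
by case: n dn {sn} => [|n] dn _; [rewrite dvdp_mulr|rewrite dvdp_mull // dn].
Qed.

Lemma degp_gt0 : (0 < x)%N.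
Proof. by rewrite /deg -ltnS prednK ?p_prime.1.1 // ltnW // p_prime.1.1. Qed.

Lemma frob_trace : exists t, tr2 P = aK t.
Proof. by apply: trace_fixed; rewrite -U_frob; apply/U_sg/frob_in. Qed.

(** The determinant has coefficients in [Fq] and the degree of [p], and it vanishes at the image of
    [T] because [det Ph] divides it. So it is a constant multiple of [p]. *)
Lemma frob_det : exists2 mu : Fq, mu != 0 & det2 P = aK (mu *: p).
Proof.
have [d dE] : exists d, det2 P = aK d by apply: det_fixed; rewrite -U_frob; apply/U_sg/frob_in.
have [sP dP] := det_PL x; have {}dP := dP degp_gt0.
have sd : size d = size p.
  rewrite -(size_map_poly jp) -dE sP /deg prednK //; exact: ltnW p_prime.1.1.
have pd : p %| d.
  rewrite -gammap_eq0 -[d]comp_polyXr -horner_map /= -map_poly_comp -dE -rootE -dvdp_XsubCl.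
  exact: dvdp_trans det_Ph_root dP.
have /eqpP[[c1 c2] /andP[/= c10 c20] e] : p %= d by rewrite -dvdp_size_eqp // sd.
exists (c1 / c2); first by rewrite mulf_neq0 ?invr_eq0.
by rewrite dE; congr aK; apply: (scalerI c20); rewrite scalerA mulrCA divff // mulr1 e.
Qed.

(** The same function as [reduction], with its structure of ring morphism. *)
Definition redm : {rmorphism {poly Fq} -> twisted gp} := horner_alg Psip.
Definition mR : {rmorphism {poly Fq} -> 'M[{poly Fp}]_2} := @scalar_mx _ 2 \o aK.

Lemma redm_endo a : endo (redm a).
Proof.
move=> b; rewrite -[reduction psi _ b]/(redm b) -!rmorphM mulrC //.
Qed.

Lemma E_red a v : E Psip v * redm a = E Psip (aK a *: v).
Proof.
elim/poly_ind: a v => [|a c IH] v.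
  by rewrite !rmorph0 scale0r mulr0 /E !mxE !ev10 addr0.
rewrite /redm rmorphD rmorphM /= horner_algX horner_algC -/(redm a) rmorphD rmorphM /= map_polyX map_polyC.
rewrite mulrDr mulrA IH scalerDl ED mulrC -scalerA EX EZ -scalerAr mulr1 //.
Qed.

Lemma U_red a : U_ (redm a) = mR a.
Proof.
apply: (mx_E Psip_size) => v; rewrite -U_ofP; last exact/endoP/redm_endo.
by rewrite E_red /mR /= mul_mx_scalar.
Qed.

Lemma U_add u u' : endo u -> endo u' -> U_ (u + u') = U_ u + U_ u'.
Proof.
move=> /endoP hu /endoP hu'; apply: (mx_E Psip_size) => v.
have huu : (u + u') * Psip = Psip * (u + u') by rewrite mulrDl mulrDr hu hu'.
by rewrite mulmxDr ED -(U_ofP Psip_size huu) -(U_ofP Psip_size hu) -(U_ofP Psip_size hu') mulrDr.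
Qed.

Lemma U_mul u u' : endo u -> endo u' -> U_ (u * u') = U_ u *m U_ u'.
Proof. by move=> /endoP hu /endoP hu'; apply: U_of_mul. Qed.

Lemma endo_add u u' : endo u -> endo u' -> endo (u + u').
Proof. by move=> hu hu' a; rewrite mulrDl mulrDr hu hu'. Qed.

Lemma endo_mul u u' : endo u -> endo u' -> endo (u * u').
Proof. by move=> hu hu' a; rewrite -mulrA hu' mulrA hu mulrA. Qed.

Lemma U_inj u u' : U_ u = U_ u' -> u = u'.
Proof. by move=> e; rewrite -(U_of_row Psip_size u) e U_of_row. Qed.

Lemma U_horner Q : endo (map_poly redm Q).[frob p_prime] /\
  U_ (map_poly redm Q).[frob p_prime] = (map_poly mR Q).[P].
Proof.
elim/poly_ind: Q => [|Q c [h1 h2]].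
  rewrite !rmorph0 !horner0; split; first by rewrite -(rmorph0 redm); apply: redm_endo.
  by rewrite -(rmorph0 redm) U_red rmorph0.
have e1 : (map_poly redm (Q * 'X + c%:P)).[frob p_prime] = (map_poly redm Q).[frob p_prime] * frob p_prime + redm c.
  by rewrite rmorphD rmorphM /= map_polyX map_polyC hornerD hornerMX hornerC.
have e2 : (map_poly mR (Q * 'X + c%:P)).[P] = (map_poly mR Q).[P] *m P + mR c.
  by rewrite rmorphD rmorphM /= map_polyX map_polyC hornerD hornerMX hornerC.
rewrite e1 e2.
have hf := endo_mul h1 frob_in.
split; first exact/endo_add/redm_endo.
by rewrite U_add ?U_mul ?U_red ?h2 ?U_frob //; [exact: frob_in|exact: redm_endo].
Qed.

Hypothesis P_nonscalar : ~ [/\ P 0 1 = 0, P 1 0 = 0 & P 0 0 - P 1 1 = 0].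

Lemma ann_small (Q : {poly {poly Fq}}) : (size Q <= 2)%N -> (map_poly mR Q).[P] = 0 -> Q = 0.
Proof.
move=> sQ; have QE : Q = Q`_1 *: 'X + (Q`_0)%:P.
  apply/polyP => i; rewrite coefD coefZ poly.coefX coefC; case: i => [|[|i]].
  - by rewrite mulr0 add0r.
  - by rewrite mulr1 addr0.
  - by rewrite nth_default ?(leq_trans sQ) //= mulr0 addr0.
rewrite QE; move: (Q`_1) (Q`_0) => c1 c0.
rewrite rmorphD /= map_polyZ map_polyX map_polyC hornerD hornerZ hornerX hornerC /= => e.
have eE i j : aK c1 * P i j + aK c0 *+ (i == j) = 0.
  by have /matrixP/(_ i j) := e; rewrite mxE -[_ * P]/(_ *m P) mul_scalar_mx !mxE.
have c10 : aK c1 = 0.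
  have [//|n0] := eqVneq (aK c1) 0; case: P_nonscalar.
  have cz u : aK c1 * u = 0 -> u = 0 by move/eqP; rewrite mulf_eq0 (negPf n0) => /eqP.
  split; apply: cz.
  - by have := eE 0 1; rewrite mulr0n addr0.
  - by have := eE 1 0; rewrite mulr0n addr0.
  - by rewrite mulrBr; have := eE 0 0; have := eE 1 1 => /eqP; rewrite addr_eq0 => /eqP -> /eqP; rewrite addr_eq0 => /eqP ->; rewrite subrr.
have c00 : aK c0 = 0 by have := eE 0 0; rewrite c10 mul0r add0r.
have z a : aK a = 0 -> a = 0 by move=> h; apply: aK_inj; rewrite rmorph0.
by rewrite (z _ c10) (z _ c00) scale0r add0r.
Qed.

Lemma frob_poly_monic a mu : frob_poly p a mu \is monic /\ size (frob_poly p a mu) = 3%N.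
Proof.
have s : (size (a *: 'X + (mu *: p)%:P)%R < 3)%N.
  rewrite (leq_ltn_trans (size_polyD _ _)) // gtn_max (leq_ltn_trans (size_scale_leq _ _)) ?size_polyX //=.
  by rewrite (leq_ltn_trans (size_polyC_leq1 _)).
rewrite /frob_poly -addrA; split; last by rewrite size_polyDl size_polyXn.
by rewrite monicE lead_coefDl ?size_polyXn ?lead_coefXn.
Qed.

Variables (t : {poly Fq}) (mu : Fq).
Hypothesis trP : tr2 P = aK t.
Hypothesis detP : det2 P = aK (mu *: p).
Hypothesis mu_neq0 : mu != 0.

Local Notation M := (frob_poly p (- t) mu).

Lemma frob_poly_eval a mu' : (map_poly mR (frob_poly p a mu')).[P] = P *m P + aK a *: P + (aK (mu' *: p))%:M.
Proof.
rewrite /frob_poly !rmorphD rmorphXn /= map_polyZ /= map_polyX map_polyC !hornerD hornerXn hornerZ hornerX hornerC.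
by rewrite -[mR a * P]/(_ *m P) mul_scalar_mx expr2.
Qed.

Lemma M_ann : (map_poly mR M).[P] = 0.
Proof.
have aN : aK (- t) = - aK t by exact: rmorphN.
by rewrite frob_poly_eval aN scaleNr -trP -detP; apply: cayley2.
Qed.

(** Division by the monic [M] leaves an annihilating remainder of degree at most one, which is zero
    because [P] is not scalar. *)
Lemma ann_dvd Q : (map_poly mR Q).[P] = 0 -> exists H, Q = H * M.
Proof.
have [mM sM] := frob_poly_monic (- t) mu.
move=> QP; exists (Pdiv.CommonRing.rdivp Q M).
have qE := Pdiv.RingMonic.rdivp_eq mM Q.
suff r0 : Pdiv.CommonRing.rmodp Q M = 0 by rewrite {1}qE r0 addr0.
apply: ann_small.
  by rewrite -ltnS -sM Pdiv.CommonRing.ltn_rmodp monic_neq0.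
move: QP; rewrite {1}qE rmorphD rmorphM /= hornerD hornerM_comm ?M_ann ?mulr0 ?add0r //.
by rewrite /comm_poly M_ann mulr0 mul0r.
Qed.

Lemma horner_eq0 Q : (map_poly redm Q).[frob p_prime] = 0 <-> (map_poly mR Q).[P] = 0.
Proof.
have [_ <-] := U_horner Q; have U0 : U_ 0 = 0 by rewrite -(rmorph0 redm) U_red rmorph0.
by split=> [->//|e]; apply: U_inj; rewrite U0.
Qed.

Lemma is_minpoly_M : is_minpoly (reduction psi p_prime) (frob p_prime) M.
Proof.
have [mM sM] := frob_poly_monic (- t) mu; split=> //; first exact/horner_eq0/M_ann.
move=> Q Q0 /horner_eq0 QP; rewrite sM ltnNge; apply: contraNN Q0 => sQ.
by apply/eqP; apply: ann_small.
Qed.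

(** The pair is chosen by [xget]; two candidates differ by an annihilator of degree at most one,
    hence coincide. *)
Lemma frob_coefsE : frob_a psi p_prime = - t /\ frob_mu psi p_prime = mu.
Proof.
have ex : exists c, [set c : {poly Fq} * Fq | c.2 != 0 /\
    is_minpoly (reduction psi p_prime) (frob p_prime) (frob_poly p c.1 c.2)]%classic c.
  by exists (- t, mu); split=> //; apply: is_minpoly_M.
have := xgetPex (0, 0) ex; rewrite -/(frob_coefs psi p_prime) /frob_a /frob_mu.
case: (frob_coefs _ _) => a mu' /= [mu'0 [_ /horner_eq0 e _]].
have : a *: 'X + (mu' *: p)%:P - ((- t) *: 'X + (mu *: p)%:P) = 0 :> {poly {poly Fq}}.
  apply: ann_small.
    apply: size_polyB_le; apply: leq_trans (size_polyD _ _) _; rewrite geq_max;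
      by rewrite (leq_trans (size_scale_leq _ _)) ?size_polyX //= (leq_trans (size_polyC_leq1 _)).
  have -> : a *: 'X + (mu' *: p)%:P - ((- t) *: 'X + (mu *: p)%:P) = frob_poly p a mu' - M.
    by rewrite /frob_poly; ring.
  set N := frob_poly p a mu' in e *; move: M_ann; move: (M) => M0 e0.
  have -> : map_poly mR (N - M0) = map_poly mR N - map_poly mR M0 by exact: rmorphB.
  by rewrite hornerD hornerN e e0 subrr.
move/eqP; rewrite subr_eq0 => /eqP e1.
have := congr1 (fun Q : {poly {poly Fq}} => Q`_1) e1; rewrite !coefD !coefZ !poly.coefX !coefC /= !mulr1 !addr0 => ->.
have := congr1 (fun Q : {poly {poly Fq}} => Q`_0) e1; rewrite !coefD !coefZ !poly.coefX !coefC /= !mulr0 !add0r => /eqP.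
rewrite -subr_eq0 -scalerBl scaler_eq0 subr_eq0 => /orP[/eqP ->|/eqP p0] //.
by have := p_prime.1.1; rewrite p0 size_poly0.
Qed.

Hypothesis q_odd : odd #|Fq|.

Let two_Fq : (2%:R : Fq) != 0. Proof. exact: (two_neq0 (@idfun Fq : {rmorphism Fq -> Fq})). Qed.
Let two_K : (2%:R : {poly Fp}) != 0.
Proof. by rewrite -polyC_natr polyC_eq0 (two_neq0 jp). Qed.
Let two_aK : aK (2%:R)%:P = 2%:R.
Proof. by rewrite polyC_natr rmorph_nat. Qed.

(** [b] is taken of largest degree among the monic polynomials over [Fq] dividing the entries of
    [2 P - t]. The last clause says that no further factor over [Fq] can be removed. *)
Lemma max_square_factor : exists b v0 v1 v2, [/\ b \is monic,
  2%:R *: P = (aK t)%:M + aK b *: tz v0 v1 v2,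
  [\/ v0 != 0, v1 != 0 | v2 != 0] &
  forall c, c \is monic -> aK c %| v0 -> aK c %| v1 -> aK c %| v2 -> c = 1].
Proof.
set w0 := P 0 0 - P 1 1; set w1 := 2%:R * P 0 1; set w2 := 2%:R * P 1 0.
have wn : [\/ w0 != 0, w1 != 0 | w2 != 0].
  apply: contrapT => H; apply: P_nonscalar.
  have z0 : w0 = 0 by apply/eqP; apply: contraT => n; case: H; apply: Or31.
  have z1 : w1 = 0 by apply/eqP; apply: contraT => n; case: H; apply: Or32.
  have z2 : w2 = 0 by apply/eqP; apply: contraT => n; case: H; apply: Or33.
  by split=> //; apply: (mulfI two_K); rewrite mulr0.
pose ok b := [/\ b \is monic, aK b %| w0, aK b %| w1 & aK b %| w2].
pose B := (size w0 + size w1 + size w2)%N.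
have bound b : ok b -> (size b <= B)%N.
  move=> [_ b0 b1 b2]; rewrite -(size_map_poly jp b) /B; case: wn => n.
  - by apply: leq_trans (dvdp_leq n b0) _; rewrite -addnA leq_addr.
  - by apply: leq_trans (dvdp_leq n b1) _; rewrite addnAC leq_addl.
  - by apply: leq_trans (dvdp_leq n b2) _; rewrite leq_addl.
pose S s := `[< exists b, ok b /\ size b = s >].
have ex : exists s, S s.
  by exists 1%N; apply/asboolP; exists 1; rewrite size_poly1; split=> //; split; rewrite ?monic1 // rmorph1 dvd1p.
have ub s : S s -> (s <= B)%N by move=> /asboolP[b [hb <-]]; apply: bound.
case: (ex_maxnP ex ub) => s /asboolP[b [[bm b0 b1 b2] bs]] smax.
have bK : aK b != 0 by rewrite map_poly_eq0 monic_neq0.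
exists b, (w0 %/ aK b), (w1 %/ aK b), (w2 %/ aK b); split=> //.
- by rewrite /tz scale_mx2 -trP mulrN ![aK b * _]mulrC !divpK //; apply: double_traceless.
- by case: wn => n; [apply: Or31|apply: Or32|apply: Or33]; rewrite divpN0 // dvdp_leq.
move=> c cm c0 c1 c2; have : (size (b * c)%R <= size b)%N.
  rewrite bs; apply: smax; apply/asboolP; exists (b * c); split=> //.
  have d w : aK b %| w -> aK c %| w %/ aK b -> aK (b * c) %| w.
    by move=> bw cw; rewrite rmorphM /= -[X in _ %| X](divpK bw) mulrC dvdp_mul.
  by split; rewrite ?monicMl //; apply: d.
rewrite size_monicM ?monic_neq0 // => sc.
have c1' : size c = 1%N.
  have : (0 < size c)%N by rewrite size_poly_gt0 monic_neq0.
  have : (0 < size b)%N by rewrite size_poly_gt0 monic_neq0.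
  by move: sc; clear; move: (size c) (size b) => i j; lia.
have /eqP/size_poly1P[k' _ cE] := c1'.
by move: cm; rewrite cE monicE lead_coefC => /eqP ->.
Qed.

Variables (b : {poly Fq}) (v0 v1 v2 : {poly Fp}).
Hypothesis b_monic : b \is monic.
Hypothesis PV : 2%:R *: P = (aK t)%:M + aK b *: tz v0 v1 v2.
Hypothesis V_neq0 : [\/ v0 != 0, v1 != 0 | v2 != 0].
Hypothesis b_max : forall c, c \is monic -> aK c %| v0 -> aK c %| v1 -> aK c %| v2 -> c = 1.
Local Notation V := (tz v0 v1 v2).

Let bK : aK b != 0. Proof. by rewrite map_poly_eq0 monic_neq0. Qed.

Lemma V_sg : map_mx sg V *m Ph = Ph *m V.
Proof.
apply: (scalemx_inj bK); rewrite [LHS]scalemxAl [RHS]scalemxAr.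
have -> : aK b *: V = 2%:R *: P - (aK t)%:M by rewrite PV addrC addKr.
have -> : aK b *: map_mx sg V = 2%:R *: map_mx sg P - (aK t)%:M.
  rewrite -(aK_sg b) -(aK_sg t) -map_scalar_mx -[2%:R](rmorph_nat sg 2) -!map_mxZ -map_mxB PV.
  by rewrite addrC addKr.
rewrite mulmxBl mulmxBr -scalemxAl -scalemxAr -U_frob (U_sg frob_in).
by rewrite scalar_mxC.
Qed.

Lemma disc_factor : exists2 D, det2 V = - aK D & t ^+ 2 - 4%:R * (mu *: p) = b ^+ 2 * D.
Proof.
have [d dE] := det_fixed V_sg; exists (- d); first by rewrite rmorphN opprK.
apply: aK_inj; rewrite rmorphB (rmorphM _ 4%:R) (rmorphM _ (b ^+ 2)) !rmorphXn /= rmorph_nat -detP -trP rmorphN /= -dE.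
have e i j := congr1 (fun A : 'M_2 => A i j) PV.
have e00 := e 0 0; have e01 := e 0 1; have e10 := e 1 0; have e11 := e 1 1.
rewrite -trP !mxE /= ?mulr1n ?mulr0n ?add0r in e00 e01 e10 e11.
have f0 : P 0 0 - P 1 1 = aK b * v0.
  apply: (mulfI two_K); rewrite mulrBr e00 e11; ring.
have f1 : 4%:R * (P 0 1 * P 1 0) = (aK b * v1) * (aK b * v2) by rewrite -e01 -e10; ring.
rewrite /det2 !mxE /=.
transitivity ((P 0 0 - P 1 1) ^+ 2 + 4%:R * (P 0 1 * P 1 0)); first by ring.
by rewrite f0 f1; ring.
Qed.

(** The endomorphism [(2 pi_p - t) / b]; it exists because [V] commutes with Frobenius. *)
Definition y_endo : twisted gp := E Psip (row 0 V).

Lemma y_in : endo y_endo.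
Proof. by apply/endoP; apply: (E_commutes Psip_size V_sg). Qed.

Lemma U_y : U_ y_endo = V.
Proof. exact: U_of_E V_sg. Qed.

Lemma V_cancel (c d : {poly Fp}) : c *: V = d *: V -> c = d.
Proof.
move=> e; have f i j := congr1 (fun A : 'M_2 => A i j) e.
have f0 := f 0 0; have f1 := f 0 1; have f2 := f 1 0; rewrite !mxE /= in f0 f1 f2.
by case: V_neq0 => n; apply: (mulIf n).
Qed.

Lemma V_free c0 c1 : (aK c0)%:M + aK c1 *: V = 0 -> c0 = 0 /\ c1 = 0.
Proof.
move=> e; have f i j := congr1 (fun A : 'M_2 => A i j) e.
have f00 := f 0 0; have f01 := f 0 1; have f10 := f 1 0; have f11 := f 1 1.
rewrite !mxE /= ?mulr1n ?mulr0n ?add0r in f00 f01 f10 f11.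
have z a : aK a = 0 -> a = 0 by move=> h; apply: aK_inj; rewrite rmorph0.
have g00 : aK c1 * v0 = 0.
  apply: (mulfI two_K); rewrite mulr0; transitivity ((aK c0 + aK c1 * v0) - (aK c0 + aK c1 * - v0)); first by ring.
  by rewrite f00 f11 subrr.
have c10 : aK c1 = 0 by case: V_neq0 => n; apply: (mulIf n); rewrite mul0r.
by split; apply: z => //; move: f00; rewrite c10 mul0r addr0.
Qed.

Local Notation comb a c := ((aK a)%:M + aK c *: V).

Lemma combZ w a c : aK w *: comb a c = comb (w * a) (w * c).
Proof. by rewrite scalerDr scale_scalar_mx scalerA -!rmorphM. Qed.

Lemma combD a c a' c' : comb a c + comb a' c' = comb (a + a') (c + c').
Proof.
have e u v : aK (u + v) = aK u + aK v by exact: rmorphD.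
by rewrite !e addrACA -scalerDl -raddfD.
Qed.

Lemma comb_inj a c a' c' : comb a c = comb a' c' -> a = a' /\ c = c'.
Proof.
move=> e; have [] := @V_free (a - a') (c - c').
  have := combD (a - a') (c - c') a' c'; rewrite !subrK e => /eqP.
  by rewrite -subr_eq0 addrK => /eqP.
by move=> /eqP; rewrite subr_eq0 => /eqP -> /eqP; rewrite subr_eq0 => /eqP ->.
Qed.

(** An endomorphism commutes with [pi_p], so its traceless part is proportional to [V]:
    [s' (2 U - a) = r' V] with [s'] monic and prime to [r']. Comparison with the Frobenius twist
    shows that [s'] and [r'] have coefficients in [Fq]. Then [s'] divides the entries of [V], and
    [b_max] gives [s' = 1]. Division by 2 is possible as [q] is odd. *)
Lemma commutant u : endo u -> exists c0 c1, U_ u = (aK c0)%:M + aK c1 *: V.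
Proof.
move=> hu; set U := U_ u; have Us : map_mx sg U *m Ph = Ph *m U by apply: U_sg.
have [a aE] := trace_fixed Us.
have UP : U *m P = P *m U.
  by rewrite -U_frob -!U_mul ?frob_central //; exact: frob_in.
clearbody U; have UV : U *m V = V *m U.
  apply: (scalemx_inj bK); rewrite [LHS]scalemxAr [RHS]scalemxAl.
  have -> : aK b *: V = 2%:R *: P - (aK t)%:M by rewrite PV addrC addKr.
  by rewrite mulmxBl mulmxBr -scalemxAl -scalemxAr UP scalar_mxC.
set u0 := U 0 0 - U 1 1; set u1 := 2%:R * U 0 1; set u2 := 2%:R * U 1 0.
have UE : 2%:R *: U = (aK a)%:M + tz u0 u1 u2.
  by rewrite -aE; apply: double_traceless.
have /= [x01 x02 x12] := traceless_comm UV; rewrite -/u0 -/u1 -/u2 in x01 x02 x12.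
have [s [r [s0 rs]]] : exists s r, s != 0 /\ s *: tz u0 u1 u2 = r *: V.
  case: V_neq0 => n; [exists v0, u0|exists v1, u1|exists v2, u2]; split=> //; rewrite /tz !scale_mx2; congr mx2; rewrite ?mulrN.
  - exact: mulrC.
  - by rewrite x01 mulrC.
  - by rewrite x02 mulrC.
  - by congr (- _); exact: mulrC.
  - by rewrite mulrC x01.
  - exact: mulrC.
  - by rewrite x12 mulrC.
  - by congr (- _); rewrite mulrC x01.
  - by rewrite mulrC x02.
  - by rewrite mulrC -x12.
  - exact: mulrC.
  - by congr (- _); rewrite mulrC x02.
have [s' [r' [s'm cop rs']]] : exists s' r', [/\ s' \is monic, coprimep s' r' & s' *: tz u0 u1 u2 = r' *: V].
  set g := gcdp s r; have g0 : g != 0 by rewrite gcdp_eq0 negb_and s0.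
  have sE : s = s %/ g * g by rewrite divpK // dvdp_gcdl.
  have rE : r = r %/ g * g by rewrite divpK // dvdp_gcdr.
  have sg0 : s %/ g != 0 by apply: contraNneq s0 => z; rewrite sE z mul0r.
  have l0 : (lead_coef (s %/ g))^-1 != 0 by rewrite invr_eq0 lead_coef_eq0.
  exists ((lead_coef (s %/ g))^-1 *: (s %/ g)), ((lead_coef (s %/ g))^-1 *: (r %/ g)); split.
  - by rewrite monicE lead_coefZ mulVf // lead_coef_eq0.
  - by rewrite coprimepZl // coprimepZr // coprimep_div_gcd // s0.
  - apply: (scalemx_inj g0); rewrite !scalerA -!scalerAr ![g * _]mulrC -sE -rE.
    by rewrite !scalep_mx rs.
have Ps : s' != 0 by exact: monic_neq0.
have sU : map_mx sg (tz u0 u1 u2) *m Ph = Ph *m tz u0 u1 u2.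
  have -> : tz u0 u1 u2 = 2%:R *: U - (aK a)%:M by rewrite UE addrC addKr.
  rewrite map_mxB map_mxZ /= rmorph_nat map_scalar_mx /= aK_sg mulmxBl mulmxBr -scalemxAl -scalemxAr Us.
  by rewrite scalar_mxC.
have Phc (A B : 'M_2) : Ph *m A = Ph *m B -> A = B.
  move=> /(congr1 (mulmx (adj2 Ph))); rewrite !mulmxA mul_adj2l !mul_scalar_mx.
  exact/scalemx_inj/det_Ph_neq0.
have srs : sg s' *: tz u0 u1 u2 = sg r' *: V.
  apply: Phc; rewrite -[LHS]scalemxAr -[RHS]scalemxAr -sU -V_sg [LHS]scalemxAl [RHS]scalemxAl.
  by rewrite -[sg s' *: _](map_mxZ sg) -[sg r' *: _](map_mxZ sg) rs'.
(* By coprimality [s'] divides its twist; both are monic of the same degree, so they are equal. *)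
have cross : s' * sg r' = sg s' * r'.
  by apply: V_cancel; rewrite -[LHS]scalerA -srs scalerA mulrC -scalerA rs' scalerA.
have s's : sg s' = s'.
  have sd : s' %| sg s' by rewrite -(Gauss_dvdpl _ cop) -cross dvdp_mulr.
  apply/esym/eqP; rewrite -eqp_monic ?map_monic //.
  by rewrite -dvdp_size_eqp // size_map_poly.
have r's : sg r' = r'.
  by apply: (mulfI Ps); rewrite cross s's.
have [s1 s1E] := sg_fixed s's; have [r1 r1E] := sg_fixed r's.
have s1m : s1 \is monic by rewrite -(map_monic jp) -s1E.
have dv w w' : s' * w' = r' * w -> s' %| w by move=> e; rewrite -(Gauss_dvdpr _ cop) -e dvdp_mulr.
have h i j := congr1 (fun A : 'M_2 => A i j) rs'.
have h0 := h 0 0; have h1 := h 0 1; have h2 := h 1 0; rewrite !mxE /= in h0 h1 h2.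
have s11 : s1 = 1 by apply: b_max => //; rewrite -s1E; [exact: dv h0|exact: dv h1|exact: dv h2].
have UV' : tz u0 u1 u2 = aK r1 *: V by rewrite -r1E -rs' s1E s11 rmorph1 scale1r.
exists ((2%:R^-1)%:P * a), ((2%:R^-1)%:P * r1).
have h2' : 2%:R * aK (2%:R^-1)%:P = 1.
  by rewrite -two_aK -rmorphM -polyCM divff // rmorph1.
have half a' : 2%:R * aK ((2%:R^-1)%:P * a') = aK a' by rewrite rmorphM /= mulrA h2' mul1r.
by apply: (scalemx_inj two_K); rewrite UE UV' scalerDr scalerA half scale_scalar_mx half.
Qed.

Variable D : {poly Fq}.
Hypothesis detV : det2 V = - aK D.
Hypothesis tD : t ^+ 2 - 4%:R * (mu *: p) = b ^+ 2 * D.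

Local Notation FF := {fraction {poly Fq}}.
Local Notation tf := (@tofrac {poly Fq}).
Local Notation h := (frob_minpolyF psi p_prime).
Local Notation iq := (in_qpoly h).
Local Notation mF := (map_poly tf).

Let hE : h = mF M. Proof. by have [a m] := frob_coefsE; rewrite /frob_minpolyF a m. Qed.
Let two_F : (2%:R : FF) != 0.
Proof. by rewrite -(rmorph_nat tf) tofrac_eq0 -polyC_natr polyC_eq0 two_Fq. Qed.
Let h_monic : h \is monic. Proof. exact: quadratic_monic hE. Qed.
Let h_size : size h = 3%N. Proof. exact: quadratic_size hE. Qed.
Let b_neq0 : b != 0. Proof. exact: monic_neq0. Qed.
Local Notation Lx := (2%:R *: 'X - t%:P : {poly {poly Fq}}).
Definition xi_elt : frob_field psi p_prime := xiq tf t b h.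

Let xi_sqr : xi_elt * xi_elt = tf D *: 1.
Proof. exact: (@xiq_sqr _ _ tf (@tofrac_eq0 _) t (mu *: p) b D b_neq0 tD h hE). Qed.

Let xi_nonscalar c : xi_elt <> c *: 1.
Proof. exact: (@xiq_nonscalar _ _ tf (@tofrac_eq0 _) two_F t (mu *: p) b b_neq0 h hE). Qed.

Let aKM u w : aK (u * w) = aK u * aK w. Proof. exact: rmorphM. Qed.
Let mRE u : mR u = (aK u)%:M. Proof. by []. Qed.

Let eval_Lx : (map_poly mR Lx).[P] = aK b *: V.
Proof.
rewrite rmorphB /= map_polyZ map_polyX map_polyC hornerD hornerN hornerZ hornerX hornerC /=.
by rewrite -[_ * P]/(_ *m P) mul_scalar_mx rmorph_nat PV addrC addKr.
Qed.

(** The fraction [Q(pi_p) / c] can be computed with matrices as well as in [F(pi_p)], because the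
    polynomials annihilating [P] are the multiples of [M]. *)
Lemma embed_coords u z c0 c1 : endo u -> U_ u = (aK c0)%:M + aK c1 *: V -> endo_embed u z ->
  z = tf c0 *: 1 + tf c1 *: xi_elt.
Proof.
move=> hu uE [c [Q [c0' uQ zQ]]].
have QP : (map_poly mR Q).[P] = aK c *: ((aK c0)%:M + aK c1 *: V).
  have [_ <-] := U_horner Q; rewrite -[map_poly redm Q]/(map_poly (reduction psi p_prime) Q) -uQ.
  rewrite -[reduction psi p_prime c]/(redm c) U_mul //; last exact: redm_endo.
  by rewrite U_red /mR /= mul_scalar_mx uE.
pose H := b%:P * Q - ((c * b * c0)%:P + (c * c1) *: Lx).
have HP : (map_poly mR H).[P] = 0.
  have e1 : (map_poly mR (b%:P * Q)).[P] = mR b *m (map_poly mR Q).[P].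
    by rewrite rmorphM /= map_polyC hornerCM.
  have e3 : (map_poly mR ((c * c1) *: Lx)).[P] = aK (c * c1) *: (aK b *: V).
    by rewrite map_polyZ hornerZ eval_Lx -[mR _ * _]/(_ *m _) mul_scalar_mx.
  have -> : (map_poly mR H).[P] = (map_poly mR (b%:P * Q)).[P] - (mR (c * b * c0) + (map_poly mR ((c * c1) *: Lx)).[P]).
    by rewrite /H rmorphB rmorphD /= map_polyC hornerD hornerN hornerD hornerC.
  by rewrite e1 e3 QP !mRE !aKM; apply: comb_cancel.
have [H1 HE] := ann_dvd HP.
exact: (quadratic_coords (@tofrac_eq0 _) b_neq0 hE c0' zQ HE).
Qed.

Let sum2 (W : zmodType) (f : 'I_2 -> W) : \sum_i f i = f 0 + f 1.
Proof. by rewrite big_ord_recl big_ord1; congr (_ + f _); exact: val_inj. Qed.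

Lemma U_comb (al : 'I_2 -> twisted gp) (c : 'I_2 -> {poly Fq}) : (forall i, endo (al i)) ->
  endo (\sum_i reduction psi p_prime (c i) * al i) /\
  U_ (\sum_i reduction psi p_prime (c i) * al i) = aK (c 0) *: U_ (al 0) + aK (c 1) *: U_ (al 1).
Proof.
move=> ha; rewrite sum2.
have hr i : endo (redm (c i) * al i) by apply: endo_mul => //; exact: redm_endo.
have ur i : U_ (redm (c i) * al i) = aK (c i) *: U_ (al i).
  by rewrite U_mul ?U_red ?mul_scalar_mx //; exact: redm_endo.
split; first exact: endo_add (hr 0) (hr 1).
by rewrite -(ur 0) -(ur 1); apply: U_add; [exact: hr 0|exact: hr 1].
Qed.

Let alpha (i : 'I_2) : twisted gp := if i == 0 then 1 else y_endo.

Let endo1 : endo 1. Proof. by move=> a; rewrite mul1r mulr1. Qed.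
Let U1 : U_ 1 = 1%:M. Proof. by rewrite -(rmorph1 redm) U_red rmorph1. Qed.
Let alpha_endo i : endo (alpha i).
Proof. by rewrite /alpha; case: eqP => _; [exact: endo1|exact: y_in]. Qed.

Let alpha_comb c : U_ (\sum_i reduction psi p_prime (c i) * alpha i) = (aK (c 0))%:M + aK (c 1) *: V.
Proof. by have [_ ->] := U_comb c alpha_endo; rewrite /alpha /= U1 U_y scalemx1. Qed.

Lemma alpha_basis : is_A_basis (reduction psi p_prime) (@frob_endo Fq psi p p_prime) alpha.
Proof.
split=> // u hu; have [c0 [c1 uE]] := commutant hu.
exists (fun i => if i == 0 then c0 else c1); split; first by apply: U_inj; rewrite alpha_comb.
move=> c' e; have := uE; rewrite e alpha_comb => /comb_inj[f0 f1].
by apply: functional_extensionality_dep => i; elim/ord2_ind: i; rewrite /= ?f0 ?f1.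
Qed.

Lemma disc_exists : is_disc psi p_prime (4%:R * D).
Proof.
pose z (i : 'I_2) : frob_field psi p_prime := if i == 0 then 1 else xi_elt.
exists alpha, z; split; first exact: alpha_basis.
  move=> i; elim/ord2_ind: i; rewrite /alpha /z /=.
    exists 1, 1; rewrite oner_neq0 -[reduction psi p_prime 1]/(redm 1) -[map_poly (reduction psi p_prime) 1]/(map_poly redm 1).
    by split=> //; rewrite !rmorph1 ?scale1r // mulr1 -polyC1 hornerC.
  exists b, Lx; split; first exact: monic_neq0.
    rewrite -[reduction psi p_prime b]/(redm b) -[map_poly (reduction psi p_prime) _]/(map_poly redm Lx).
    apply: U_inj; have [_ ->] := U_horner Lx; rewrite U_mul ?U_red ?U_y //; [|exact: redm_endo|exact: y_in].
    by rewrite eval_Lx mRE mul_scalar_mx.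
  by rewrite -(xiqE (@tofrac_eq0 _) t b_neq0).
have zE i : z i = tf (i == 0)%:R *: 1 + tf (i == 1)%:R *: xi_elt.
  by elim/ord2_ind: i; rewrite /z /= ?rmorph1 ?rmorph0 ?scale1r ?scale0r ?addr0 ?add0r.
have e := @disc_quadratic _ _ h_monic h_size z xi_elt (tf D) (fun i j => tf (i == j)%:R) xi_sqr xi_nonscalar zE.
transitivity (4%:R * tf D * (tf (0 == 0 :> 'I_2)%:R * tf (1 == 1 :> 'I_2)%:R - tf (0 == 1 :> 'I_2)%:R * tf (1 == 0 :> 'I_2)%:R) ^+ 2).
  by rewrite /= !rmorph1 !rmorph0 mulr0 subr0 mulr1 expr1n mulr1 rmorphM rmorph_nat.
exact: esym e.
Qed.

(** The basis behind the chosen discriminant is arbitrary. Its coordinate matrix [G] in terms of [1]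
    and [V] is invertible over [A], since [1] and [y_endo] are combinations of that basis, so the
    determinant of [G] is a constant. *)
Lemma disc_value : exists2 e : Fq, e != 0 & frob_disc psi p_prime = 4%:R * D * (e ^+ 2)%:P.
Proof.
have /(xgetPex 0) : exists d, [set d | is_disc psi p_prime d]%classic d by exists (4%:R * D); apply: disc_exists.
rewrite -/(frob_disc psi p_prime) => -[al [z [[al_in al_gen] emb dE]]].
have /choice[g gP] : forall i, exists c : {poly Fq} * {poly Fq}, U_ (al i) = (aK c.1)%:M + aK c.2 *: V.
  by move=> i; have [c0 [c1 e]] := commutant (al_in i); exists (c0, c1).
pose G : 'M[{poly Fq}]_2 := \matrix_(i, j) if j == 0 then (g i).1 else (g i).2.
have coords u c0 c1 : endo u -> U_ u = (aK c0)%:M + aK c1 *: V ->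
    exists w : 'I_2 -> {poly Fq}, c0 = \sum_i w i * G i 0 /\ c1 = \sum_i w i * G i 1.
  move=> /al_gen[w [uw _]] uE; exists w.
  have [_ e] := U_comb w al_in; rewrite -uw uE !gP in e.
  rewrite !combZ combD in e; have [-> ->] := comb_inj e.
  by rewrite !sum2 !mxE.
have [w0 [a00 a01]] : exists w : 'I_2 -> {poly Fq}, 1 = \sum_i w i * G i 0 /\ 0 = \sum_i w i * G i 1.
  have a1 : aK 1 = 1 by exact: rmorph1.
  have a0 : aK 0 = 0 by exact: rmorph0.
  by apply: (coords 1 _ _ endo1); rewrite U1 a1 a0 scale0r addr0.
have [w1 [a10 a11]] : exists w : 'I_2 -> {poly Fq}, 0 = \sum_i w i * G i 0 /\ 1 = \sum_i w i * G i 1.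
  by apply: (coords y_endo _ _ y_in); rewrite U_y rmorph1 rmorph0 scale1r raddf0 add0r.
pose Hm : 'M[{poly Fq}]_2 := \matrix_(i, j) if i == 0 then w0 j else w1 j.
have HG : Hm *m G = 1%:M.
  apply: mx2P; rewrite mulmx2E [Hm]lock !mxE -lock !mxE /=; rewrite ?mulr1n ?mulr0n.
  - by rewrite a00 sum2 !mxE.
  - by rewrite a01 sum2 !mxE.
  - by rewrite a10 sum2 !mxE.
  - by rewrite a11 sum2 !mxE.
have : det2 Hm * det2 G = 1 by rewrite -det2M HG /det2 !mxE /= mulr0 subr0 mulr1.
move=> hd; have : size (det2 G) == 1%N.
  have : det2 G \is a GRing.unit by apply/unitrP; exists (det2 Hm); rewrite [det2 G * _]mulrC hd.
  by rewrite poly_unitE => /andP[].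
case/size_poly1P => e e0 eE; exists e => //.
have zE i : z i = tf (G i 0) *: 1 + tf (G i 1) *: xi_elt.
  by rewrite !mxE /=; apply: embed_coords (al_in i) (gP i) (emb i).
have e1 := @disc_quadratic _ _ h_monic h_size z xi_elt (tf D) (fun i j => tf (G i j)) xi_sqr xi_nonscalar zE.
have e2 : tf (frob_disc psi p_prime) = 4%:R * tf D * (tf (G 0 0) * tf (G 1 1) - tf (G 0 1) * tf (G 1 0)) ^+ 2.
  by rewrite dE; exact: e1.
have -> : 4%:R * D * (e ^+ 2)%:P = 4%:R * D * det2 G ^+ 2 by rewrite eE -polyC_exp.
have e3 : tf (det2 G) = tf (G 0 0) * tf (G 1 1) - tf (G 0 1) * tf (G 1 0).
  have e4 u v : tf (u * v) = tf u * tf v by exact: rmorphM.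
  have e5 u v : tf (u - v) = tf u - tf v by exact: rmorphB.
  by rewrite /det2 e5 !e4.
have e6 : tf (4%:R * D * det2 G ^+ 2) = 4%:R * tf D * tf (det2 G) ^+ 2.
  by rewrite (rmorphM tf (4%:R * D)) (rmorphM tf 4%:R) rmorph_nat -(rmorphXn tf 2).
by apply/eqP; rewrite -tofrac_eq e2 e6 e3.
Qed.

(** Otherwise [t^2 = 4 mu p], so [p] divides [t], and cancelling one [p] leaves [p] dividing a
    nonzero constant. *)
Lemma D_neq0 : D != 0.
Proof.
apply/eqP => D0; move/eqP: tD; rewrite D0 mulr0 subr_eq0 => /eqP e.
have : gp t ^+ 2 == 0.
  by rewrite -rmorphXn gammap_eq0 /= e dvdp_mull // dvdpZr // dvdpp.
rewrite expf_eq0 /= gammap_eq0 => /dvdpP[s sE].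
have p0 : p != 0 by apply: monic_neq0; exact: p_prime.2.
have : s ^+ 2 * p = (4%:R * mu)%:P.
  by apply: (mulIf p0); rewrite -mulrA -expr2 -exprMn -sE e -mul_polyC polyCM polyC_natr mulrA.
move/(congr1 (fun Q => p %| Q)); rewrite dvdp_mull // => /esym /dvdp_leq.
rewrite polyC_eq0 mulf_neq0 //; last by rewrite (_ : 4%:R = 2%:R * 2%:R) ?mulf_neq0 // -natrM.
by move/(_ isT); rewrite leqNgt (leq_ltn_trans (size_polyC_leq1 _)) // p_prime.1.1.
Qed.

Lemma disc_core : [/\ frob_disc psi p_prime != 0,
  (deg (frob_disc psi p_prime) + 2 * deg b)%N =
    deg (frob_a psi p_prime ^+ 2 - (4%:R * frob_mu psi p_prime) *: p),
  frob_a psi p_prime ^+ 2 - (4%:R * frob_mu psi p_prime) *: p != 0 &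
  [/\ aK b %| P 0 1, aK b %| P 1 0 & aK b %| P 0 0 - P 1 1]].
Proof.
have [e e0 dE] := disc_value; have [aE mE] := frob_coefsE.
have D0 := D_neq0; have b0 : b != 0 by exact: monic_neq0.
have four0 : (4%:R : Fq) != 0 by rewrite (_ : 4%:R = 2%:R * 2%:R) ?mulf_neq0 // -natrM.
have discE : frob_disc psi p_prime = (4%:R * e ^+ 2) *: D.
  by rewrite dE mulrC mul_polyC mulr_natl -scaler_nat scalerA mulrC.
have tE : frob_a psi p_prime ^+ 2 - (4%:R * frob_mu psi p_prime) *: p = b ^+ 2 * D.
  by rewrite aE mE sqrrN -tD -scalerA scaler_nat mulr_natl.
have ce : 4%:R * e ^+ 2 != 0 by rewrite mulf_neq0 // expf_neq0.
rewrite discE tE; split.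
- by rewrite scaler_eq0 negb_or ce.
- rewrite /deg size_scale // size_mul ?expf_neq0 // expr2 size_mul //.
  have : (0 < size b)%N by rewrite size_poly_gt0.
  have : (0 < size D)%N by rewrite size_poly_gt0.
  by clear; move: (size b) (size D) => i j; lia.
- by rewrite mulf_neq0 // expf_neq0.
have f i j := congr1 (fun A : 'M_2 => A i j) PV.
have f00 := f 0 0; have f01 := f 0 1; have f10 := f 1 0; have f11 := f 1 1.
rewrite !mxE /= ?mulr1n ?mulr0n ?add0r in f00 f01 f10 f11.
have half Q Q' : 2%:R * Q = aK b * Q' -> aK b %| Q.
  move=> e1; have : aK b %| 2%:R * Q by rewrite e1 dvdp_mulr.
  by rewrite -polyC_natr mul_polyC dvdpZr // (two_neq0 jp).
split; [exact: half f01|exact: half f10|apply: (half _ (2%:R * v0))].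
by rewrite mulrBr f00 f11; ring.
Qed.

End Residue.
Local Close Scope quotient_scope.

(** * The reduction at [p] compared with the specialisation at a root of [p] *)

Section ResidueEmbedding.
Variables (Fq : finFieldType) (psi : {lrmorphism {poly Fq} -> twisted (@tofrac {poly Fq})}).
Hypothesis psi_rank2 : is_drinfeld 2 psi.
Local Notation q := #|Fq|.
Local Notation F := {fraction {poly Fq}}.
Local Notation g i := ((psi 'X : {poly F})`_i).
Variables (k : closedFieldType) (ik : {rmorphism Fq -> k}).
Variables (G0 G1 G2 : {poly Fq}).
Hypothesis G1E : g 1 * tofrac G0 = tofrac G1.
Hypothesis G2E : g 2 * tofrac G0 = tofrac G2.
Variables (p : {poly Fq}) (p_prime : monic_irreducible_poly p).
Hypothesis pG0 : ~~ (p %| G0).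
Hypothesis pG2 : ~~ (p %| G2).
Local Notation eid := (@idfun k : {rmorphism k -> k}).
Local Notation ev := (evA ik eid).
Variable y : k.
Hypothesis y_root : ev y p = 0.
Local Notation Fp := {poly %/ p with p_prime}.
Local Notation gp := (gammap p_prime).
Local Notation jp := (gp \o polyC).
Local Notation n := (deg p).

Lemma residue_embedding : exists rho : {rmorphism Fp -> k}, forall a, rho (gp a) = ev y a.
Proof.
apply: (@rmorph_factor _ _ _ gp (ev y)); first exact: gammap_surj.
by move=> a /eqP; rewrite gammap_eq0 => /dvdpP[c ->]; rewrite rmorphM /= y_root mulr0.
Qed.

(** A smaller power of Frobenius fixing [y] would fix the whole residue field, which has too many
    elements. *)
Lemma root_exact : exactd Fq n y.
Proof.
have [rho rhoE] := residue_embedding; have q1 := q_gt1 Fq.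
have yE : y = rho (gp 'X) by rewrite rhoE evAX.
apply/exactdP; split=> [|i /andP[i0 i_n]].
  by rewrite {1}yE -rmorphXn Fp_fixed -yE.
apply/eqP => yi; have all_fixed (c : Fp) : c ^+ (q ^ i) = c.
  have [a ->] := gammap_surj c; apply: (fmorph_inj rho).
  by rewrite rmorphXn /= rhoE -evA_frob yi.
have qi : (1 < q ^ i)%N by rewrite -{1}(expn0 q) ltn_exp2l.
pose P : {poly Fp} := 'X^(q ^ i) - 'X.
have sP : size P = (q ^ i).+1 by rewrite size_polyDl ?size_polyXn // size_polyN size_polyX.
have P0 : P != 0 by rewrite -size_poly_eq0 sP.
have := @max_poly_roots _ P (enum Fp) P0.
rewrite sP ltnS -cardE card_qfpoly enum_uniq => h.
have : (q ^ (size p).-1 <= q ^ i)%N.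
  by apply: h => //; apply/allP => c _; rewrite rootE !hornerE all_fixed subrr.
by rewrite leq_exp2l // leqNgt i_n.
Qed.

Variable rho : {rmorphism Fp -> k}.
Hypothesis rhoE : forall a, rho (gp a) = ev y a.
Local Notation Ph := (PhiK ik G0 G1 G2 eid).
Local Notation Psi := (Psip p_prime psi).
Local Notation sgk := (map_poly (frq ik)).
Local Notation sgp := (map_poly (frq jp)).
Local Notation mrho := (map_poly rho).

Let e0 : ev y G0 != 0. Proof. by rewrite -rhoE fmorph_eq0 gammap_eq0. Qed.
Let e2 : ev y G2 != 0. Proof. by rewrite -rhoE fmorph_eq0 gammap_eq0. Qed.

Let Ph_rho : Ph y = (ev y G2)%:P *: map_mx mrho (PhiL Psi).
Proof.
have c0 : rho (Psi : {poly Fp})`_0 = y by rewrite (Psip_c0 p_prime psi_rank2) rhoE evAX.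
have c1 : rho (Psi : {poly Fp})`_1 = ev y G1 / ev y G0.
  by rewrite (Psip_c1 p_prime pG0 G1E) fmorph_div /= !rhoE.
have c2 : rho (Psi : {poly Fp})`_2 = ev y G2 / ev y G0.
  by rewrite (Psip_c2 p_prime pG0 G2E) fmorph_div /= !rhoE.
have d0 : mrho (((Psi : {poly Fp})`_2)^-1 *: ('X - ((Psi : {poly Fp})`_0)%:P)) = (ev y G2 / ev y G0)^-1 *: ('X - y%:P).
  by rewrite map_polyZ rmorphB /= map_polyX map_polyC /= c0 fmorphV c2.
have d1 : mrho (- (((Psi : {poly Fp})`_2)^-1 * (Psi : {poly Fp})`_1)%:P) = - ((ev y G2 / ev y G0)^-1 * (ev y G1 / ev y G0))%:P.
  by rewrite rmorphN /= map_polyC /= rmorphM fmorphV /= c1 c2.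
rewrite /PhiL map_mx2 d0 d1 rmorph0 rmorph1 /PhiK scale_mx2 mulr0 mulr1; congr mx2.
  by rewrite -mul_polyC mulrA -polyCM invf_div mulrCA divff // mulr1 mulrC.
by rewrite mulrN -polyCM; congr (- _%:P); field; rewrite e0 e2.
Qed.

Let rho_sg (A : 'M[{poly Fp}]_2) : map_mx sgk (map_mx mrho A) = map_mx mrho (map_mx sgp A).
Proof.
apply/matrixP => i j; rewrite !mxE; apply/polyP => l.
by rewrite !coef_map /= /frq rmorphXn.
Qed.

Let Ph_iter m : Ph (y ^+ (q ^ m)) = (ev y G2 ^+ (q ^ m))%:P *: map_mx mrho (iter m (map_mx sgp) (PhiL Psi)).
Proof.
elim: m => [|m IH]; first by rewrite !expr1.
rewrite expnSr exprM -map_Ph IH map_mxZ /= map_polyC /= rho_sg.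
by rewrite exprM.
Qed.

(** [Phi] is a constant times the matrix of the reduction; constants affect neither being scalar nor
    divisibility. *)
Lemma PP_rho m : exists2 c : k, c != 0 &
  PP ik G0 G1 G2 y m = c%:P *: map_mx mrho (PL p_prime psi m).
Proof.
elim: m => [|m [c c0 IH]]; first by exists 1; rewrite ?oner_neq0 // polyC1 scale1r map_mx1.
exists (ev y G2 ^+ (q ^ m) * c); first by rewrite mulf_neq0 // expf_neq0.
have -> : PP ik G0 G1 G2 y m.+1 = Ph (y ^+ (q ^ m)) *m PP ik G0 G1 G2 y m by [].
have -> : PL p_prime psi m.+1 = iter m (map_mx sgp) (PhiL Psi) *m PL p_prime psi m by [].
by rewrite IH Ph_iter map_mxM -scalemxAl -scalemxAr scalerA -polyCM.
Qed.

Lemma PL_nonscalar : let P := PL p_prime psi n in ~ [/\ P 0 1 = 0, P 1 0 = 0 & P 0 0 - P 1 1 = 0].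
Proof.
move=> P [z1 z2 z3]; have [c c0 E] := PP_rho n.
have n0 : (0 < n)%N by exact: degp_gt0.
apply: (PP_nonscalar (G1 := G1) root_exact n0 e0 e2); rewrite E; split; rewrite !mxE.
- by rewrite -/P z1 rmorph0 mulr0.
- by rewrite -/P z2 rmorph0 mulr0.
- by rewrite -/P -mulrBr -rmorphB z3 rmorph0 mulr0.
Qed.

Lemma scalar_of_PL b : let P := PL p_prime psi n in
  [/\ map_poly jp b %| P 0 1, map_poly jp b %| P 1 0 & map_poly jp b %| P 0 0 - P 1 1] ->
  scalp ik G0 G1 G2 b n y.
Proof.
move=> P [h1 h2 h3]; have [c c0 E] := PP_rho n; apply/asboolP.
have bE : map_poly ik b = mrho (map_poly jp b).
  by rewrite -map_poly_comp; apply: eq_map_poly => a /=; rewrite rhoE evAC.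
have dv w : map_poly jp b %| w -> map_poly ik b %| mrho w.
  by move=> /dvdpP[w' ->]; rewrite bE rmorphM dvdp_mull.
split; rewrite E !mxE; [exact: dvdp_mull (dv _ h1)|exact: dvdp_mull (dv _ h2)|].
by rewrite -mulrBr dvdp_mull // -rmorphB; apply: dv.
Qed.
End ResidueEmbedding.

(** * The index of [A[pi_p]] in the endomorphism ring *)

Section DiscriminantIndex.
Variables (Fq : finFieldType) (psi : {lrmorphism {poly Fq} -> twisted (@tofrac {poly Fq})}).
Hypothesis psi_rank2 : is_drinfeld 2 psi.
Hypothesis q_odd : odd #|Fq|.
Local Notation F := {fraction {poly Fq}}.
Local Notation g i := ((psi 'X : {poly F})`_i).
Variables (k : closedFieldType) (ik : {rmorphism Fq -> k}).
Variables (G0 G1 G2 : {poly Fq}).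
Hypothesis G1E : g 1 * tofrac G0 = tofrac G1.
Hypothesis G2E : g 2 * tofrac G0 = tofrac G2.

Theorem discriminant_index p (p_prime : monic_irreducible_poly p) y :
  ~~ (p %| G0) -> ~~ (p %| G2) -> evA ik (@idfun k : {rmorphism k -> k}) y p = 0 ->
  let a2 := frob_a psi p_prime ^+ 2 - (4%:R * frob_mu psi p_prime) *: p in
  exists b, [/\ b \is monic, scalp ik G0 G1 G2 b (deg p) y,
    frob_disc psi p_prime != 0, a2 != 0 & (deg (frob_disc psi p_prime) + 2 * deg b)%N = deg a2].
Proof.
move=> pG0 pG2 yp a2; have [rho rhoE] := residue_embedding p_prime yp.
have Pn := PL_nonscalar psi_rank2 G1E G2E pG0 pG2 yp rhoE.
have [t tE] := frob_trace p_prime psi_rank2 pG0 pG2 G2E.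
have [mu mu0 dE] := frob_det p_prime psi_rank2 pG0 pG2 G2E.
have [b [v0 [v1 [v2 [bm PV V0 bmax]]]]] := max_square_factor Pn tE q_odd.
have [D _ tD] := disc_factor psi_rank2 pG0 pG2 G2E tE dE q_odd bm PV.
have [h1 h2 h3 h4] := disc_core psi_rank2 pG0 pG2 G2E Pn tE dE mu0 q_odd bm PV V0 bmax tD.
exists b; split=> //; exact: (scalar_of_PL psi_rank2 G1E G2E pG0 pG2 rhoE h4).
Qed.
End DiscriminantIndex.

(** * Counting primes through their roots *)

Section PrimeCount.
Variables (Fq : finFieldType) (k : closedFieldType) (ik : {rmorphism Fq -> k}).
Local Notation q := #|Fq|.
Local Notation eid := (@idfun k : {rmorphism k -> k}).
Local Notation ev := (evA ik eid).
Local Notation mip := (@monic_irreducible_poly Fq).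

Let evE x P : ev x P = (map_poly ik P).[x].
Proof. by rewrite /evA /= /horner_eval; congr _.[_]; apply: eq_map_poly. Qed.

Lemma prime_size p : mip p -> size p = (deg p).+1.
Proof. by move=> pP; rewrite /deg prednK // (ltn_trans _ pP.1.1). Qed.

Lemma primes_eq p p' x : mip p -> mip p' -> ev x p = 0 -> ev x p' = 0 -> p = p'.
Proof.
move=> pP p'P e e'; set g := gcdp p p'.
have [[u v] /= uv] := Bezoutp p p'.
have g0 : ev x g = 0.
  have /dvdpP[c cE] : u * p + v * p' %| g by have := uv; rewrite /eqp => /andP[].
  by rewrite cE rmorphM rmorphD !rmorphM /= e e' !mulr0 addr0 mulr0.
have g1 : size g != 1%N.
  by apply/eqP => /eqP/size_poly1P[c c0 cE]; move: g0; rewrite cE evAC => /eqP; rewrite !fmorph_eq0 (negPf c0).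
have h1 : g %= p by apply: pP.1.2 => //; apply: dvdp_gcdl.
have h2 : g %= p' by apply: p'P.1.2 => //; apply: dvdp_gcdr.
have : p %= p' by apply: eqp_trans h2; rewrite eqp_sym.
by rewrite eqp_monic ?pP.2 ?p'P.2 // => /eqP.
Qed.

Lemma prime_roots p : mip p -> exists B : seq k,
  [/\ uniq B, size B = deg p, forall x, (x \in B) = (ev x p == 0) & forall x, x \in B -> exactd Fq (deg p) x].
Proof.
move=> pP; have [|y] := @closed_root _ (map_poly ik p); first by rewrite size_map_poly pP.1.1.
rewrite rootE -evE => /eqP yp; have yx := root_exact pP yp.
pose B := [seq y ^+ (q ^ i) | i <- iota 0 (deg p)].
have uB : uniq B by have := exact_conj ik yx; congr uniq; apply: eq_map => i.
have sB : size B = deg p by rewrite size_map size_iota.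
have Bp x : x \in B -> ev x p = 0.
  by move=> /mapP[i _ ->]; rewrite evA_frob yp expr0n expn_eq0 eqn0Ngt q_gt0.
exists B; split=> // [x|x /Bp]; last exact: root_exact.
apply/idP/eqP => [/Bp //|xp]; apply: contraT => xB.
have : (size (x :: B) < size (map_poly ik p))%N.
  apply: max_poly_roots; first by rewrite map_poly_eq0 monic_neq0 // pP.2.
    by rewrite /= rootE -evE xp eqxx; apply/allP => z /Bp zp; rewrite rootE -evE zp.
  by rewrite /= xB.
by rewrite size_map_poly (prime_size pP) /= sB ltnn.
Qed.

Lemma roots_of_primes n (L : seq {poly Fq}) : uniq L -> (forall p, p \in L -> mip p /\ deg p = n) ->
  exists T : seq k, [/\ uniq T, size T = (n * size L)%N &
    forall x, x \in T <-> exists2 p, p \in L & ev x p = 0].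
Proof.
elim: L => [|p L IH] /=; first by exists [::]; rewrite muln0; split=> // x; split=> // -[].
move=> /andP[pL uL] hL; have [|T [uT sT memT]] := IH uL.
  by move=> p' p'L; apply: hL; rewrite inE p'L orbT.
have [pP dp] := hL p (mem_head _ _); have [B [uB sB memB _]] := prime_roots pP.
exists (B ++ T); split.
- rewrite cat_uniq uB uT andbT; apply/hasPn => x /memT[p' p'L xp']; rewrite /= memB.
  apply: contraNN pL => /eqP xp; have [p'P _] : mip p' /\ deg p' = n by apply: hL; rewrite inE p'L orbT.
  by rewrite (primes_eq pP p'P xp xp').
- by rewrite size_cat sB sT dp mulnS.
- move=> x; rewrite mem_cat memB; split=> [/orP[/eqP xp|/memT[p' p'L xp']]|[p']].
  + by exists p => //; apply: mem_head.
  + by exists p' => //; rewrite inE p'L orbT.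
  + rewrite inE => /orP[/eqP -> -> |p'L xp']; first by rewrite eqxx.
    by apply/orP; right; apply/memT; exists p'.
Qed.

Lemma prime_count_upper n L : uniq L -> (forall p, p \in L -> mip p /\ deg p = n) ->
  (n * size L <= q ^ n)%N.
Proof.
move=> uL hL; have [->//|n0] := posnP n.
have [T [uT <- memT]] := roots_of_primes uL hL; have [s [us ss ms]] := fixed_roots ik n0.
rewrite -ss; apply: uniq_leq_size uT _ => x /memT[p pL xp]; have [pP dp] := hL p pL.
by have := root_exact pP xp; rewrite dp => /exactdP[xn _]; rewrite ms xn.
Qed.

(** The product over the conjugates of [x] has coefficients fixed by Frobenius. In a proper
    factorisation one factor would vanish at [x] with degree below [n], against [exact_ev]. *)
Lemma prime_of_exact n x : (0 < n)%N -> exactd Fq n x -> exists p, [/\ mip p, deg p = n & ev x p = 0].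
Proof.
case: n => // n _ xn; have /exactdP[xE _] := xn.
pose m := \prod_(i < n.+1) ('X - (x ^+ (q ^ i))%:P) : {poly k}.
have ms : map_poly (frq ik) m = m.
  rewrite /m rmorph_prod big_ord_recr big_ord_recl /= mulrC; congr (_ * _).
    by rewrite rmorphB /= map_polyX map_polyC /= /frq -exprM -expnSr xE expn0 expr1.
  apply: eq_bigr => i _; rewrite rmorphB /= map_polyX map_polyC /= /frq -exprM -expnSr.
  by rewrite /bump leq0n add1n.
have /choice[c cE] : forall i, exists a : Fq, m`_i = ik a.
  by move=> i; apply: frq_fixed; rewrite -[RHS]/(m`_i) -{2}ms coef_map.
have sm : size m = n.+2.
  by rewrite /m (size_prod_XsubC (index_enum 'I_n.+1) (fun i => x ^+ (q ^ i))) /index_enum -enumT size_enum_ord.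
pose P := \poly_(i < n.+2) c i.
have PE : map_poly ik P = m.
  apply/polyP => i; rewrite coef_map coef_poly; case: ltnP => ni; first by rewrite cE.
  by rewrite nth_default ?sm //; apply: (rmorph0 ik).
have sP : size P = n.+2 by rewrite -(size_map_poly ik) PE.
have Pm : P \is monic by rewrite -(map_monic ik) PE monic_prod_XsubC.
have Px : ev x P = 0.
  by rewrite evE PE /m horner_prod big_ord_recl /= hornerXsubC expn0 expr1 subrr mul0r.
exists P; split=> //; last by rewrite /deg sP.
split=> //; split; first by rewrite sP.
move=> d d1 /dvdpP[d' dE].
have d0 : d != 0 by apply: contraTneq (monic_neq0 Pm) => d0; rewrite dE d0 mulr0 eqxx.
have d'0 : d' != 0 by apply: contraTneq (monic_neq0 Pm) => d'0; rewrite dE d'0 mul0r eqxx.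
have sdd : (size d' + size d = n.+3)%N.
  have e : n.+2 = (size d' + size d).-1.
    exact: etrans (esym sP) (etrans (congr1 (fun Q : {poly Fq} => size Q) dE) (size_mul d'0 d0)).
  by rewrite -[n.+3]/(n.+2.+1) e prednK // addn_gt0 !size_poly_gt0 d0 orbT.
have [dn|nd] := leqP (size d) n.+1; last first.
  rewrite -dvdp_size_eqp; first by rewrite sP eqn_leq nd andbT; have : (0 < size d')%N; [rewrite size_poly_gt0|lia].
  by rewrite dE dvdp_mull.
have d'n : (size d' <= n.+1)%N.
  by have : (1 < size d)%N; [rewrite ltn_neqAle eq_sym d1 size_poly_gt0|lia].
move: Px; rewrite dE rmorphM => /eqP; rewrite mulf_eq0.
by rewrite (negPf (exact_ev ik xn d0 dn)) (negPf (exact_ev ik xn d'0 d'n)).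
Qed.

Lemma prime_count_lower n L : (0 < n)%N -> uniq L -> (forall p, p \in L <-> mip p /\ deg p = n) ->
  (q ^ n <= n * size L + n * q ^ n./2)%N.
Proof.
move=> n0 uL hL; have [T [uT <- memT]] := roots_of_primes uL (fun p => (hL p).1).
have [S [uS memS sS]] := exact_seq ik n0; apply: leq_trans sS _; rewrite leq_add2r.
apply: uniq_leq_size uS _ => x; rewrite memS => xn; apply/memT.
by have [p [pP dp xp]] := prime_of_exact n0 xn; exists p => //; apply/hL.
Qed.

Lemma primes_seq n : exists L : seq {poly Fq}, uniq L /\ forall p, p \in L <-> mip p /\ deg p = n.
Proof.
exists [seq p <- [seq monp v | v <- enum {: 'rV[Fq]_n}] | `[< mip p >]]; split.
  by rewrite filter_uniq // map_inj_uniq ?enum_uniq //; apply: mon_inj.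
move=> p; rewrite mem_filter; split=> [/andP[/asboolP pP /mapP[v _ e]]|[pP dp]].
  by split=> //; rewrite /deg e mon_size.
apply/andP; split; first exact/asboolP.
by have [v ->] := @monP _ n p pP.2 (etrans (prime_size pP) (congr1 S dp)); apply: map_f; rewrite mem_enum.
Qed.

Variables (G0 G1 G2 : {poly Fq}).
Hypothesis G0_neq0 : G0 != 0.
Hypothesis G2_neq0 : G2 != 0.
Hypothesis q_odd : odd q.
Hypothesis detRG : forall K, \det (RG G0 G1 G2 K) != 0.

Lemma bad_prime_count : exists s1, forall s, (s1 <= s)%N -> exists x0, forall n (L : seq {poly Fq}),
  (x0 <= n)%N -> uniq L -> (forall p, p \in L -> [/\ mip p, deg p = n & forall y, ev y p = 0 ->
     exists m, [/\ m \is monic, (20 * s < size m)%N & scalp ik G0 G1 G2 m n y]]) ->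
  (q ^ s * (n * size L) <= 100 * q ^ n)%N.
Proof.
have [s1 H] := scalar_density ik G0_neq0 G2_neq0 q_odd detRG; exists s1 => s /H[x0 {}H]; exists x0 => n L xn uL hL.
have hL' p : p \in L -> mip p /\ deg p = n by move=> /hL[].
have [T [uT <- memT]] := roots_of_primes uL hL'.
apply: H xn uT _ => x /memT[p pL xp]; have [pP dp hp] := hL p pL.
by split; [have := root_exact pP xp; rewrite dp|apply: hp].
Qed.
End PrimeCount.

From mathcomp Require Import finmap all_classical all_reals all_analysis lra.
Import Order.TTheory GRing.Theory Num.Theory.
Import numFieldNormedType.Exports.
Local Open Scope classical_set_scope.
Local Open Scope ring_scope.

(** * The logarithm series with remainder *)

Lemma lt1_powR (R : realType) (a x y : R) : 1 < a -> x < y -> a `^ x < a `^ y.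
Proof.
move=> a1 xy; have a0 : 0 < a by exact: lt_trans a1.
by rewrite /powR gt_eqF // ltr_expR ltr_pM2r // ln_gt0.
Qed.

Section LogSeries.
Variable R : realType.
Implicit Types u x : R.

Let psum N (u : R) : R := \sum_(i < N) i.+1%:R^-1 * u ^+ i.+1.

Let psum_derive N x : is_derive x (1 : R) (psum N) (\sum_(i < N) x ^+ i).
Proof.
elim: N => [|N IH].
  rewrite big_ord0; have -> : psum 0 = cst 0 by apply/funext => u; rewrite /psum big_ord0.
  exact: is_derive_cst.
have -> : psum N.+1 = psum N + (N.+1%:R^-1 \*: (@id R : R -> R) ^+ N.+1).
  apply/funext => u; rewrite /psum big_ord_recr /=; congr (_ + _).
  by rewrite exprfctE.
rewrite big_ord_recr /=; apply: is_deriveD.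
have h : is_derive x (1 : R) ((@id R : R -> R) ^+ N.+1) ((N.+1%:R * x ^+ N) *: (1 : R)).
  exact: is_deriveX.
apply: is_derive_eq (is_deriveZ _ h) _.
by rewrite /GRing.scale /= mulr1 mulrA mulVf ?mul1r // pnatr_eq0.
Qed.

Let ln1B_derive x : x < 1 -> is_derive x (1 : R) (fun u => ln (1 - u)) (- (1 - x)^-1).
Proof.
move=> x1; have h : is_derive x (1 : R) (fun u => 1 - u) (0 - 1).
  by apply: is_deriveB.
have h2 : is_derive (1 - x) (1 : R) (@ln R) (1 - x)^-1 by apply: is_derive1_ln; lra.
have := @is_derive1_comp R (@ln R) (fun u => 1 - u) x _ _ h2 h; rewrite sub0r mulrN1.
by rewrite (_ : @ln R \o _ = fun u => ln (1 - u)).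
Qed.

(** The mean value theorem for [psum + ln (1 - x)], whose derivative is [- x^N / (1 - x)]. *)
Lemma ln_psum N u : 0 <= u < 1 ->
  psum N u <= - ln (1 - u) /\ - ln (1 - u) <= psum N u + u ^+ N / (1 - u).
Proof.
move=> /andP[u0 u1]; pose h x := psum N x + ln (1 - x).
pose dh x := \sum_(i < N) x ^+ i - (1 - x)^-1.
have hd x : x < 1 -> is_derive x (1 : R) h (dh x).
  by move=> x1; apply: is_deriveD; [exact: psum_derive|exact: ln1B_derive].
have [c cI hE] : exists2 c, c \in `[0, u] & h u - h 0 = dh c * (u - 0).
  apply: MVT_segment => //; first by move=> x; rewrite in_itv /= => /andP[_ xu]; apply: hd; lra.
  apply: derivable_within_continuous => x; rewrite in_itv /= => /andP[_ xu].
  by have [] := hd x (le_lt_trans xu u1).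
have h0 : h 0 = 0.
  rewrite /h subr0 ln1 addr0 /psum big1 // => i _; by rewrite expr0n mulr0.
move: cI; rewrite in_itv /= => /andP[c0 cu]; have c1 : 0 < 1 - c by lra.
have dhE : dh c = - (c ^+ N / (1 - c)).
  rewrite /dh; apply: (mulIf (lt0r_neq0 c1)); rewrite mulrBl mulVf ?lt0r_neq0 //.
  rewrite mulNr mulfVK ?lt0r_neq0 //.
  have := subrX1 c N; rewrite -[X in _ = X]mulrC => e.
  have -> : 1 - c = - (c - 1) by ring.
  by rewrite mulrN -e; ring.
have hN : h u = - (c ^+ N / (1 - c)) * u by rewrite -dhE; move: hE; rewrite h0 !subr0.
have cN : 0 <= c ^+ N / (1 - c) by apply: divr_ge0; [exact: exprn_ge0|exact: ltW].
have cN2 : c ^+ N / (1 - c) <= u ^+ N / (1 - u).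
  have a1 : c ^+ N <= u ^+ N by apply: lerXn2r; rewrite ?nnegrE.
  have a2 : (1 - c)^-1 <= (1 - u)^-1 by rewrite lef_pV2 ?posrE //; lra.
  by apply: ler_pM => //; [exact: exprn_ge0|rewrite invr_ge0; exact: ltW].
have p1 : 0 <= c ^+ N / (1 - c) * u by apply: mulr_ge0.
have p2 : c ^+ N / (1 - c) * u <= u ^+ N / (1 - u).
  apply: le_trans cN2; rewrite -[leRHS]mulr1; apply: ler_wpM2l => //; exact: ltW.
move: hN; rewrite /h mulNr => hN; split; lra.
Qed.

Lemma psum_cvg u e : 0 <= u < 1 -> 0 < e -> exists N0, forall N, (N0 <= N)%N -> - ln (1 - u) <= psum N u + e.
Proof.
move=> u01 e0; have /andP[u0 u1] := u01.
have : (fun n => u ^+ n) @ \oo --> (0 : R) by apply: cvg_expr; rewrite ger0_norm.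
move=> /cvgrPdist_lt/(_ (e * (1 - u)))[]; first by apply: mulr_gt0 => //; lra.
move=> N0 _ HN; exists N0 => N NN; have [_ h] := ln_psum N u01; apply: le_trans h _; rewrite lerD2l.
have := HN N NN; rewrite /= sub0r normrN ger0_norm ?exprn_ge0 // => /ltW.
by rewrite ler_pdivrMr //; lra.
Qed.
End LogSeries.

(** * From counts by degree to the ratio and to the Dirichlet density *)

Section DegreeCounts.
Variables (R : realType) (q : nat) (c P : nat -> nat).
Hypothesis q_gt1 : (1 < q)%N.
Hypothesis cP : forall n, (c n <= P n)%N.
Hypothesis P_upper : forall n, (n * P n <= q ^ n)%N.
Hypothesis c_lower : exists s1, forall s, (s1 <= s)%N -> exists N0, forall n, (N0 <= n)%N ->
    (q ^ s * q ^ n <= q ^ s * (n * c n) + 101 * q ^ n)%N.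
Local Notation Q := (q%:R : R).

Let Q_gt1 : 1 < Q. Proof. by rewrite ltr1n. Qed.
Let Q_gt0 : 0 < Q. Proof. exact: lt_trans Q_gt1. Qed.

Lemma c_lower_eps (e : R) : 0 < e -> exists N0, forall n, (N0 <= n)%N -> (1 - e) * Q ^+ n <= (n * c n)%:R.
Proof.
move=> e0; have [s1 H] := c_lower.
pose s := (s1 + Num.Def.archi_bound (101 / e))%N.
have [N0 {}H] := H s (leq_addr _ _); exists N0 => n /H; rewrite -(ler_nat R).
rewrite natrD !(natrM _ (q ^ _)) (natrM _ 101) !natrX => h.
have se : 101 <= e * Q ^+ s.
  rewrite mulrC -ler_pdivrMr //; apply: le_trans (ltW (archi_boundP _)) _; first by apply: divr_ge0 => //; exact: ltW.
  rewrite -natrX ler_nat; apply: leq_trans (ltnW (ltn_expl s q_gt1)); exact: leq_addl.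
have Qs : 0 < Q ^+ s by apply: exprn_gt0.
have Qn : 0 < Q ^+ n by apply: exprn_gt0.
rewrite -(ler_pM2l Qs); have : 101 * Q ^+ n <= e * Q ^+ s * Q ^+ n by rewrite ler_pM2r.
move: h; set A := Q ^+ s * (n * c n)%:R; set B := Q ^+ s; set C := Q ^+ n; lra.
Qed.

Lemma density_ratio : ((c x)%:R / (P x)%:R : R) @[x --> \oo] --> (1 : R).
Proof.
apply/cvgrPdist_le => e e0; pose e' := Num.min e 2^-1.
have e'0 : 0 < e' by rewrite lt_min e0 /= invr_gt0.
have e'e : e' <= e by rewrite ge_min lexx.
have e'2 : e' <= 2^-1 by rewrite ge_min lexx orbT.
have [N0 H] := c_lower_eps e'0; exists N0.+1 => // n /= Nn.
have n0 : (0 < n)%N by apply: leq_ltn_trans Nn.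
have h1 := H n (ltnW Nn).
have h2 : (n * P n)%:R <= Q ^+ n by rewrite -natrX ler_nat.
have nR : 0 < (n%:R : R) by rewrite ltr0n.
have h3 : (1 - e') * (P n)%:R <= (c n)%:R.
  rewrite -(ler_pM2l nR) -natrM; apply: le_trans h1; rewrite mulrCA -natrM.
  by apply: ler_wpM2l => //; lra.
have c0 : 0 < (c n)%:R :> R.
  rewrite -(pmulr_rgt0 _ nR) -natrM; apply: lt_le_trans h1; apply: mulr_gt0; [lra|exact: exprn_gt0].
have cPn : (c n)%:R <= (P n)%:R :> R by rewrite ler_nat.
have P0 : 0 < (P n)%:R :> R by apply: lt_le_trans cPn.
rewrite ger0_norm; last by rewrite subr_ge0 ler_pdivrMr // mul1r.
rewrite lerBlDr -lerBlDl ler_pdivlMr //; apply: le_trans h3; rewrite ler_pM2r //; lra.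
Qed.

Hypothesis c0 : c 0 = 0%N.
Let v (t : R) n := Q `^ (- t * n%:R).
Let L (t : R) := - ln (1 - Q `^ (1 - t)).

Let vE t n : v t n = (Q `^ (1 - t)) ^+ n / Q ^+ n.
Proof.
have QN : Q != 0 by exact: lt0r_neq0.
rewrite /v powRrM powR_mulrn ?powR_ge0 // -expr_div_n; congr (_ ^+ _).
by rewrite powRD ?QN ?implybT // powRr1 ?ltW // mulrAC mulfV // mul1r.
Qed.

Let u01 t : 1 < t -> 0 <= Q `^ (1 - t) < 1.
Proof.
move=> t1; rewrite powR_ge0 /= -[ltRHS](powRr0 Q).
by apply: lt1_powR => //; lra.
Qed.

Let term_le t n : 1 < t -> (c n.+1)%:R * v t n.+1 <= n.+1%:R^-1 * (Q `^ (1 - t)) ^+ n.+1.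
Proof.
move=> t1; rewrite vE; set u := Q `^ (1 - t).
have u0 : 0 <= u ^+ n.+1 by apply: exprn_ge0; exact: powR_ge0.
have Qn : 0 < Q ^+ n.+1 by apply: exprn_gt0.
rewrite mulrCA mulrC; apply: ler_wpM2r => //.
rewrite ler_pdivrMr // mulrC ler_pdivlMr // mulrC -natrM -natrX ler_nat.
by apply: leq_trans (P_upper n.+1); rewrite leq_mul2l cP.
Qed.

Lemma count_sum_le t N : 1 < t -> \sum_(n < N) (c n)%:R * v t n <= L t.
Proof.
move=> t1; case: N => [|N].
  have [h _] := ln_psum 0 (u01 t1); rewrite big_ord0; move: h; by rewrite big_ord0.
rewrite big_ord_recl c0 mul0r add0r; have [h _] := ln_psum N (u01 t1).
apply: le_trans h; apply: ler_sum => i _; exact: term_le.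
Qed.

(** Each of the first [N0] terms of the logarithm series is at most 1, whence a loss of [N0]; the
    remaining 1 is the tail of the series. *)
Lemma count_sum_ge t (e : R) N0 : 1 < t -> 0 < e < 1 ->
  (forall n, (N0 <= n)%N -> (1 - e) * Q ^+ n <= (n * c n)%:R) ->
  exists N, (1 - e) * (L t - N0.+1%:R) <= \sum_(n < N) (c n)%:R * v t n.
Proof.
move=> t1 /andP[e0 e1] H; have [N1 HN] := psum_cvg (u01 t1) ltr01.
have := HN (N0 + N1)%N (leq_addl _ _); set M := (N0 + N1)%N => hM; exists M.+1.
rewrite big_ord_recl c0 mul0r add0r.
have u0 := u01 t1; set u := Q `^ (1 - t) in hM u0.
have tm (i : nat) : (1 - e) * (i.+1%:R^-1 * u ^+ i.+1 - (i < N0)%:R) <= (c i.+1)%:R * v t i.+1.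
  have ui : 0 <= u ^+ i.+1 by apply: exprn_ge0; case/andP: u0.
  have ui1 : u ^+ i.+1 <= 1 by apply: exprn_ile1; [|apply: ltW]; case/andP: u0.
  have Qn : 0 < Q ^+ i.+1 by apply: exprn_gt0.
  have i0 : 0 < i.+1%:R^-1 :> R by rewrite invr_gt0.
  have [lt|ge] := ltnP i N0.
    apply: (@le_trans _ _ 0); last by apply: mulr_ge0 => //; exact: powR_ge0.
    apply: mulr_ge0_le0; first by lra.
    have : i.+1%:R^-1 * u ^+ i.+1 <= 1 by apply: mulr_ile1; rewrite ?invf_le1 ?ler1n ?invr_ge0.
    by rewrite subr_le0.
  rewrite subr0 vE -/u; have := H i.+1 (leqW ge); rewrite natrM => h.
  rewrite [leLHS]mulrA [leLHS]mulrC [leRHS]mulrCA; apply: ler_wpM2l => //.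
  by rewrite ler_pdivlMr // mulrAC ler_pdivrMr // [leRHS]mulrC.
apply: (@le_trans _ _ (\sum_(i < M) (1 - e) * (i.+1%:R^-1 * u ^+ i.+1 - (i < N0)%:R))); last first.
  by apply: ler_sum => i _; apply: tm.
rewrite -mulr_sumr; apply: ler_wpM2l; first by lra.
rewrite sumrB.
have hc : \sum_(i < M) ((i < N0)%N%:R : R) <= N0%:R.
  rewrite -natr_sum ler_nat; apply: leq_trans (geq_minr M N0).
  elim: (M) => [|K IH]; first by rewrite big_ord0.
  by rewrite big_ord_recr /=; move: IH; case: (ltnP K N0) => /=; lia.
move: hM; rewrite /L -natr1 -/u; lra.
Qed.

Lemma L_large M : exists2 d, 0 < d & forall t, 1 < t -> t < 1 + d -> M <= L t.
Proof.
have lQ : 0 < ln Q by apply: ln_gt0.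
exists (expR (- M) / ln Q); first by rewrite divr_gt0 ?expR_gt0.
move=> t t1 td; have /andP[u0 u1] := u01 t1.
have h : 1 - Q `^ (1 - t) <= expR (- M).
  rewrite /powR gt_eqF //; have := expR_ge1Dx ((1 - t) * ln Q).
  have : (t - 1) * ln Q <= expR (- M) by rewrite -ler_pdivlMr //; lra.
  by lra.
rewrite /L -[leLHS]opprK lerN2 -[leRHS]expRK ler_ln ?posrE ?expR_gt0 //; lra.
Qed.

Variables (T : choiceType) (S : set T) (dg : T -> nat) (l : nat -> seq T).
Hypothesis l_uniq : forall n, uniq (l n).
Hypothesis lE : forall n x, x \in l n <-> S x /\ dg x = n.
Hypothesis cE : forall n, c n = size (l n).

Let XN N := flatten [seq l n | n <- iota 0 N].

Let XN_mem N x : x \in XN N <-> S x /\ (dg x < N)%N.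
Proof.
split=> [/flattenP[s /mapP[n]]|[Sx dx]].
  by rewrite mem_iota => /= nN -> /lE[Sx ->].
by apply/flattenP; exists (l (dg x)); [apply: map_f; rewrite mem_iota|apply/lE].
Qed.

Let XN_uniq N : uniq (XN N).
Proof.
elim: N => // N IH; rewrite /XN -addn1 iotaD map_cat flatten_cat /= cats0 cat_uniq IH l_uniq andbT /=.
by apply/hasPn => x /lE[_ dx]; apply/negP => /XN_mem[_]; rewrite dx add0n ltnn.
Qed.

Let XN_sum t N : (\sum_(x \in [set` XN N]) (v t (dg x))%:E = (\sum_(n < N) (c n)%:R * v t n)%:E)%E.
Proof.
rewrite -(fsbig_seq _ _ (XN_uniq N)) sumEFin; congr (_%:E).
elim: N => [|N IH]; first by rewrite big_nil big_ord0.
rewrite /XN -addn1 iotaD map_cat flatten_cat /= cats0 big_cat /= IH addn1 big_ord_recr /=; congr (_ + _).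
rewrite cE -sum1_size natr_sum mulr_suml add0n; apply: eq_big_seq => x /lE[_ ->].
by rewrite mul1r.
Qed.

Lemma esum_by_degree_le t B : (forall N, \sum_(n < N) (c n)%:R * v t n <= B) ->
  (\esum_(x in S) (v t (dg x))%:E <= B%:E)%E.
Proof.
move=> h; apply: ge_ereal_sup => _ [X [finX XS] <-].
have [r rE] : exists r : seq T, X = [set` r] by apply/finite_seqP.
pose N := (\max_(x <- r) dg x).+1.
apply: (@le_trans _ _ (\sum_(x \in [set` XN N]) (v t (dg x))%:E)%E); last by rewrite XN_sum lee_fin.
apply: lee_fsum_nneg_subset => //.
  move=> x; rewrite !inE => Xx /=; apply/XN_mem; split; first exact: XS.
  rewrite /N ltnS; move: Xx; rewrite rE /= => xr.
  by rewrite (big_rem x) //= leq_maxl.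
by move=> x _; rewrite lee_fin powR_ge0.
Qed.

Lemma esum_by_degree_ge t N : ((\sum_(n < N) (c n)%:R * v t n)%:E <= \esum_(x in S) (v t (dg x))%:E)%E.
Proof.
apply: esum_ge; exists [set` XN N]; last by rewrite XN_sum.
by split; [exact: finite_seq|move=> x /= /XN_mem[]].
Qed.

(** The sum lies between [(1 - e') (L t - N0 - 1)] and [L t], and the bounded term disappears
    because [L t] tends to infinity. *)
Lemma dirichlet_limit :
  ((\esum_(x in S) (Q `^ (- t * (dg x)%:R))%:E) * ((- ln (1 - Q `^ (1 - t)))^-1)%:E)%E
    @[t --> (1 : R)^'+] --> (1 : R)%:E.
Proof.
have E1 t : 1 < t -> exists2 E : R, (\esum_(x in S) (v t (dg x))%:E = E%:E)%E & 0 <= E <= L t.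
  move=> t1; have hu := esum_by_degree_le (fun N => count_sum_le N t1).
  have h0 := esum_by_degree_ge t 0; rewrite big_ord0 in h0.
  have fin : \esum_(x in S) (v t (dg x))%:E \is a fin_num.
    by rewrite fin_numElt (lt_le_trans _ h0) ?ltNyr // (le_lt_trans hu) ?ltry.
  exists (fine (\esum_(x in S) (v t (dg x))%:E)%E); first by rewrite fineK.
  by rewrite -!lee_fin fineK // h0.
apply/fine_cvgP; split.
  near=> t; have t1 : 1 < t by near: t; exact: nbhs_right_gt.
  by have [E EE _] := E1 t t1; rewrite -/(v t _) EE.
(* Half of [e] pays for the factor [1 - e'], the other half for the bounded term once
   [L t >= (N0 + 1) / e']. *)
apply/cvgrPdist_le => e e0; pose e' := Num.min (e / 2) 2^-1.
have e'0 : 0 < e' by rewrite lt_min divr_gt0 //= invr_gt0.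
have e'e : e' <= e / 2 by rewrite ge_min lexx.
have e'2 : e' <= 2^-1 by rewrite ge_min lexx orbT.
have [N0 H] := c_lower_eps e'0; have [d d0 Hd] := L_large (N0.+1%:R / e').
near=> t; have t1 : 1 < t by near: t; exact: nbhs_right_gt.
have td : t < 1 + d by near: t; apply: nbhs_right_lt; lra.
have LM := Hd t t1 td; have [E EE /andP[E0 EL]] := E1 t t1.
have [|N hN] := count_sum_ge t1 _ H; first by apply/andP; split; lra.
have EN : (1 - e') * (L t - N0.+1%:R) <= E.
  by apply: le_trans hN _; rewrite -lee_fin -EE; exact: esum_by_degree_ge.
have L0 : 0 < L t by apply: lt_le_trans LM; rewrite divr_gt0.
have NL : N0.+1%:R <= e' * L t by rewrite -ler_pdivrMl // mulrC.
rewrite /= -/(v t _) EE /= -/(L t) ger0_norm; last by rewrite subr_ge0 ler_pdivrMr // mul1r.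
rewrite lerBlDr -lerBlDl ler_pdivlMr //; apply: le_trans EN.
have h1 : e' * L t <= e / 2 * L t by rewrite ler_pM2r.
have h2 : 0 <= e' * N0.+1%:R by apply: mulr_ge0 => //; exact: ltW.
move: NL h1 h2; set n1 := N0.+1%:R; set l1 := L t; nra.
Unshelve. all: by end_near. Qed.
End DegreeCounts.

(** * Primes with a small discriminant are rare *)

Lemma count_degE (Fq : finFieldType) (S : set {poly Fq}) n l : uniq l ->
  (forall p, p \in l <-> S p /\ deg p = n) -> count_deg S n = size l.
Proof.
move=> ul hl; have E : S `&` [set p | deg p = n] = [set` l].
  by apply/seteqP; split=> p /= /hl.
rewrite /count_deg E; apply: perm_size; apply: uniq_perm.
- exact: finmap.fset_uniq.
- by [].
move=> p; rewrite -[LHS]/(p \in fset_set _) in_fset_set; last exact: finite_seq.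
by rewrite mem_setE.
Qed.

Lemma degree_seqs (Fq : finFieldType) (S : set {poly Fq}) : S `<=` primes_A Fq ->
  exists l : nat -> seq {poly Fq}, forall n, [/\ uniq (l n),
    forall p, p \in l n <-> S p /\ deg p = n & count_deg S n = size (l n)].
Proof.
move=> SP; have h n : exists l, [/\ uniq l, forall p, p \in l <-> S p /\ deg p = n & count_deg S n = size l].
  have [L [uL hL]] := primes_seq Fq n; exists [seq p <- L | `[< S p >]].
  have ul : uniq [seq p <- L | `[< S p >]] by rewrite filter_uniq.
  have hl p : p \in [seq p <- L | `[< S p >]] <-> S p /\ deg p = n.
    rewrite mem_filter; split=> [/andP[/asboolP Sp /hL[]]//|[Sp dp]].
    by apply/andP; split; [apply/asboolP|apply/hL; split=> //; apply: SP].
  by split=> //; apply: count_degE.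
by have [l hl] := choice h; exists l.
Qed.

Section CountLargeDisc.
Variables (R : realType) (Fq : finFieldType).
Variable psi : {lrmorphism {poly Fq} -> twisted (@tofrac {poly Fq})}.
Hypothesis q_odd : odd #|Fq|.
Hypothesis psi_rank2 : is_drinfeld 2 psi.
Variables (Falg : closedFieldType) (iota : {rmorphism {fraction {poly Fq}} -> Falg}).
Hypothesis psi_generic : endo_ring (base_change iota psi) = range (base_change iota psi).
Variable f : R -> R.
Hypothesis f_infty : f x @[x --> +oo] --> +oo.
Local Notation q := #|Fq|.
Local Notation Q := (#|Fq|%:R : R).
Local Notation S := (large_disc_primes psi f).
Local Notation c := (count_deg S).
Local Notation mip := (@monic_irreducible_poly Fq).

Lemma large_prime : S `<=` primes_A Fq. Proof. by move=> p []. Qed.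

Lemma card_gt1 : (1 < q)%N. Proof. exact: finNzRing_gt1. Qed.

Lemma f_large s : exists N, forall n, (N <= n)%N -> (40 * s)%:R <= f n%:R.
Proof.
have /cvgryPge/(_ (40 * s)%:R)[M [Mr HM]] := f_infty.
exists (Num.Def.archi_bound `|M|) => n Nn; apply: HM.
apply: le_lt_trans (ler_norm M) _; apply: lt_le_trans (archi_boundP (normr_ge0 M)) _.
by rewrite ler_nat.
Qed.

(** The two degrees differ by [2 deg b], so failure of the inequality gives
    [2 deg b >= f (deg p) >= 40 s]. *)
Lemma disc_small p (b : {poly Fq}) (p_prime : mip p) s :
  ~ absA R (frob_disc psi p_prime) >
       absA R (frob_a psi p_prime ^+ 2 - (4%:R * frob_mu psi p_prime) *: p) / Q `^ f (deg p)%:R ->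
  frob_disc psi p_prime != 0 -> frob_a psi p_prime ^+ 2 - (4%:R * frob_mu psi p_prime) *: p != 0 ->
  (deg (frob_disc psi p_prime) + 2 * deg b)%N =
    deg (frob_a psi p_prime ^+ 2 - (4%:R * frob_mu psi p_prime) *: p) ->
  b \is monic -> (40 * s)%:R <= f (deg p)%:R -> (20 * s < size b)%N.
Proof.
move=> /negP; rewrite -leNgt /absA => h d0 a0 e bm fs.
have Q1 : 1 < Q by rewrite ltr1n card_gt1.
have Q0 : 0 < Q by apply: lt_trans Q1.
rewrite (negPf d0) (negPf a0) -e exprD in h.
rewrite ler_pdivlMr ?powR_gt0 // ler_pM2l ?exprn_gt0 // in h.
have fb : f (deg p)%:R <= (2 * deg b)%:R.
  rewrite leNgt; apply/negP => lt; move: h; rewrite leNgt => /negP; apply.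
  by rewrite -powR_mulrn ?ltW //; apply: lt1_powR.
have := le_trans fs fb; rewrite ler_nat => h40.
have sb : (0 < size b)%N by rewrite size_poly_gt0 monic_neq0.
by move: h40 sb; rewrite /deg; case: (size b) => // m; clear; rewrite /=; lia.
Qed.

(** A prime of large degree divides neither [G0] nor [G2], so its reduction is good; if it is not
    counted, each of its roots is scalar modulo some [b] of degree at least [20 s]. The constant 101
    is the 100 of [bad_prime_count] plus 1 for the error in the count of all primes. *)
Lemma count_large : [/\ forall n, (c n <= pi_F Fq n)%N, forall n, (n * pi_F Fq n <= q ^ n)%N &
  exists s1, forall s, (s1 <= s)%N -> exists N0, forall n, (N0 <= n)%N ->
    (q ^ s * q ^ n <= q ^ s * (n * c n) + 101 * q ^ n)%N].
Proof.
have [L hL] := degree_seqs (@subset_refl _ (primes_A Fq)).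
have [G0 [G1 [G2 [G00 G20 G1E G2E]]]] := common_denominator psi_rank2.
pose ik : {rmorphism Fq -> Falg} := gammaA iota \o polyC.
have detRG := generic_det psi_rank2 psi_generic q_odd G00 G20 G1E G2E.
have hL' n p : p \in L n <-> mip p /\ deg p = n by have [_ h _] := hL n; exact: h.
have cE n : c n = count (fun p => `[< S p >]) (L n).
  have [uL h _] := hL n; rewrite -size_filter; apply: count_degE; first by rewrite filter_uniq.
  move=> p; rewrite mem_filter; split=> [/andP[/asboolP Sp /h[]]//|[Sp dp]].
  by apply/andP; split; [apply/asboolP|apply/h; split=> //; apply: large_prime].
have piE n : pi_F Fq n = size (L n) by have [_ _] := hL n.
split=> [n|n|].
- by rewrite cE piE count_size.
- by rewrite piE; apply: (prime_count_upper ik); [have [] := hL n|move=> p /hL'].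
have [s1 H] := bad_prime_count ik G00 G20 q_odd detRG; exists s1 => s /H[x0 {}H].
have [N1 HN1] := f_large s.
(* Makes the error [n q^(n/2)] of [prime_count_lower] at most [q^n / q^s]. *)
have [n0 Hn0] : exists n0, forall m, (n0 <= m)%N -> (q ^ s * (3 * m) <= 2 ^ m)%N.
  by apply: polyb_lt; do ?[apply: polyb_mul|apply: polyb_const|apply: polyb_id].
exists (x0 + N1 + 2 * n0 + size G0 + size G2 + 2)%N => n Nn.
pose bad := [seq p <- L n | ~~ `[< S p >]].
have sz : (size (L n) = c n + size bad)%N by rewrite cE size_filter count_predC.
have hb : (q ^ s * (n * size bad) <= 100 * q ^ n)%N.
  apply: H; [by move: Nn; clear; lia|by rewrite filter_uniq //; have [] := hL n|].
  move=> p; rewrite mem_filter => /andP[/asboolPn nS /hL'[pP dp]]; split=> // y yp.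
  have ndv (G : {poly Fq}) : G != 0 -> (size G <= n)%N -> ~~ (p %| G).
    move=> Gn sG; apply/negP => /(dvdp_leq Gn); rewrite (prime_size pP) dp.
    by rewrite leqNgt ltnS sG.
  have pG0 : ~~ (p %| G0) by apply: ndv G00 _; move: Nn; clear; lia.
  have pG2 : ~~ (p %| G2) by apply: ndv G20 _; move: Nn; clear; lia.
  have [b [bm bs d0 a0 e]] := discriminant_index psi_rank2 q_odd G1E G2E pP pG0 pG2 yp.
  exists b; split=> //; last by rewrite -dp.
  apply: (disc_small (p_prime := pP) _ d0 a0 e bm); last first.
    by rewrite dp; apply: HN1; move: Nn; clear; lia.
  by move=> lt; apply: nS; exists pP; split=> //; exact: (good_reduction_of psi_rank2 pG0 pG2 G1E G2E).
have hl : (q ^ n <= n * size (L n) + n * q ^ n./2)%N.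
  apply: (prime_count_lower ik); [by move: Nn; clear; lia|by have [] := hL n|exact: hL'].
have hn : (q ^ s * (n * q ^ n./2) <= q ^ n)%N.
  have nm := odd_double_half n.
  have m0 : (n0 <= n./2)%N by move: Nn nm; clear; case: (odd n) => /=; lia.
  have m1 : (n <= 3 * n./2)%N by move: Nn nm; clear; case: (odd n) => /=; lia.
  have h1 : (q ^ s * n <= q ^ n./2)%N.
    apply: leq_trans (leq_mul (leqnn _) m1) _; apply: leq_trans (Hn0 _ m0) _.
    by rewrite leq_exp2r ?card_gt1 //; move: Nn nm; clear; case: (odd n) => /=; lia.
  rewrite mulnA; apply: leq_trans (leq_mul h1 (leqnn _)) _; rewrite -expnD leq_exp2l ?card_gt1 //.
  by move: nm; clear; lia.
rewrite sz in hl; move: hl hb hn; set A := (q ^ s)%N; set B := (q ^ n)%N; set C := (q ^ n./2)%N.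
set b := size bad; set d := c n; clearbody A B C b d; clear=> hl hb hn.
by apply: leq_trans (leq_mul (leqnn A) hl) _; nia.
Qed.
End CountLargeDisc.

Theorem theorem6 (R : realType) (Fq : finFieldType) (q_odd : odd #|Fq|)
  (psi : {lrmorphism {poly Fq} -> twisted (@tofrac {poly Fq})})
  (psi_rank2 : is_drinfeld 2 psi)
  (Falg : closedFieldType) (iota : {rmorphism {fraction {poly Fq}} -> Falg})
  (Falg_algebraic : forall z : Falg, algebraicOver iota z)
  (psi_generic : endo_ring (base_change iota psi) = range (base_change iota psi))
  (f : R -> R) (f_gt0 : forall x, 0 < x -> 0 < f x)
  (f_infty : f x @[x --> +oo%R] --> +oo%R) :
  ((count_deg (large_disc_primes psi f) x)%:R
     / (pi_F Fq x)%:R : R) @[x --> \oo] --> (1 : R)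
  /\ has_dirichlet_density (large_disc_primes psi f) (1 : R).
Proof.
have [h1 h2 h3] := count_large q_odd psi_rank2 psi_generic f_infty.
have q1 := card_gt1 Fq; split; first by have := @density_ratio R _ (count_deg (large_disc_primes psi f)) (pi_F Fq) q1 h1 h2 h3; exact.
have [l hl] := degree_seqs (@large_prime R Fq psi f).
have c0 : count_deg (large_disc_primes psi f) 0 = 0%N.
  have [_ h ->] := hl 0%N; case E : (l 0%N) => [//|p t].
  have /h[[pP _]] : p \in l 0%N by rewrite E mem_head.
  by have := pP.1.1; rewrite /deg; case: (size p) => [|[]].
apply: (dirichlet_limit q1 h1 h2 h3 c0 (l := l)) => n; first by have [] := hl n.
- by move=> p; have [_ h _] := hl n; apply: h.
- by have [_ _] := hl n.
Qed.
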